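(* Let $\Xi$ be a translation invariant random measure on $\mathbb{R}^d$ or $\mathbb{Z}^d$ whose structure function $S$ vanishes faster than any polynomial at the origin in the wave space. Then for any bounded domain $D$, the restricted random measure $[\Xi]_{|D}$ is almost surely determined by the restricted random measure $[\Xi]_{|D^{\complement}}$; that is, there is a measurable function $F_D$ such that $[\Xi]_{|D}=F_D\big([\Xi]_{|D^{\complement}}\big)$ almost surely. Consequently, $\Xi$ is completely determined by its tail sigma field; that is, $\Xi$ is measurable (up to null sets) with respect to the tail sigma field of $\Xi$.
   Context: A random measure on $\mathbb{R}^d$ (resp. $\mathbb{Z}^d$) is a random variable $\Xi$ taking values in the space of locally finite complex Borel measures on $\mathbb{R}^d$ (resp. $\mathbb{Z}^d$). This includes point processes (via counting measures) and locally $L_1$ random fields $\{X_u\}$ (via $X_u\,\mathrm{d}u$). It is assumed that the total variation satisfies $\mathbb{E}[|\Xi|(K)^2]<\infty$ for every bounded $K$. $\Xi$ is translation invariant if its law is invariant under all translations by elements of $\mathbb{R}^d$ (resp. $\mathbb{Z}^d$). $D^{\complement}$ denotes the complement of $D$, and on $\mathbb{Z}^d$ a bounded domain means a finite subset. The tail sigma field of $\Xi$ is $\bigcap_{n\ge1}\sigma\big([\Xi]_{|B(0;n)^{\complement}}\big)$, where $B(0;n)$ is the ball of radius $n$ centred at the origin. The covariance functional $\beta$ of $\Xi$ is defined by $$\mathrm{Cov}\Big[\int\varphi\,\mathrm{d}\Xi,\int\psi\,\mathrm{d}\Xi\Big]=\iint\varphi(s)\,\overline{\psi(t)}\,\beta(s-t)\,\mathrm{d}s\,\mathrm{d}t$$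 for test functions $\varphi,\psi$, where $\mathrm{Cov}[X,Y]=\mathbb{E}[(X-\mathbb{E}X)\overline{(Y-\mathbb{E}Y)}]$ (sums replace integrals on $\mathbb{Z}^d$; in general $\beta$ may be a measure or distribution). The structure function $S$ is the Fourier transform $\hat\beta$, with convention $\hat f(k)=\int f(x)e^{-i\langle k,x\rangle}\mathrm{d}x$, here assumed to be a (locally integrable) function; it lives on the wave space, which is $\mathbb{R}^d$ when the physical space is $\mathbb{R}^d$ and the torus $\mathbb{T}^d=\mathbb{R}^d/(2\pi\mathbb{Z})^d$ when the physical space is $\mathbb{Z}^d$. ''$S$ vanishes faster than any polynomial at the origin'' means: for every positive integer $m$ there are $C_m,\epsilon_m>0$ such that $|S(\xi)|\le C_m|\xi|^m$ for $|\xi|\le\epsilon_m$. *)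

(* Defs.v *)
From HB Require Import structures.
From mathcomp Require Import all_boot all_order all_algebra.
From mathcomp Require Import all_classical all_reals all_analysis.
From mathcomp Require Import complex.

Set Implicit Arguments.
Unset Strict Implicit.
Unset Printing Implicit Defensive.

Import Order.TTheory GRing.Theory Num.Theory.
Import numFieldNormedType.Exports.
Import Normc.

Local Open Scope classical_set_scope.
Local Open Scope ring_scope.
Local Open Scope complex_scope.

Local Notation Re := (@complex.Re _).
Local Notation Im := (@complex.Im _).

(* [shift v] is the translation by [v].  The group structure is not inherited
   from [zmodType] because no structure of the library joins it with
   [measurableType]; in the two instances below [shift v x] is [x + v]. *)
HB.mixin Record isPhysicalSpace (R : realType) (disp : measure_display) T
    & Measurable disp T := {
  snorm : T -> R;
  shift : T -> T -> T;
  measurable_snorm : measurable_fun [set: T] snorm;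
  measurable_shift : forall v : T, measurable_fun [set: T] (shift v);
  snorm_shift : forall v x : T, snorm x <= snorm (shift v x) + snorm v }.

#[short(type="physicalSpaceType")]
HB.structure Definition PhysicalSpace (R : realType) (disp : measure_display) :=
  { T of Measurable disp T & isPhysicalSpace R disp T }.

Definition enorm (R : realType) (d : nat) (x : 'rV[R]_d) : R :=
  Num.sqrt (\sum_(i < d) x 0 i ^+ 2).

Definition dotp (R : realType) (d : nat) (x y : 'rV[R]_d) : R :=
  \sum_(i < d) x 0 i * y 0 i.

Lemma enormD (R : realType) (d : nat) (x y : 'rV[R]_d) :
  enorm (x + y) <= enorm x + enorm y.
Proof.
have sq0 (z : 'rV[R]_d) : 0 <= \sum_(i < d) z 0 i ^+ 2.
  by apply: sumr_ge0 => i _; rewrite sqr_ge0.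
have e2 (z : 'rV[R]_d) : enorm z ^+ 2 = \sum_(i < d) z 0 i ^+ 2.
  by rewrite sqr_sqrtr.
have e0 (z : 'rV[R]_d) : 0 <= enorm z by rewrite sqrtr_ge0.
have enorm0 (z : 'rV[R]_d) : enorm z = 0 -> z = 0.
  move=> z0; apply/rowP => i; rewrite !mxE; apply/eqP; rewrite -sqrf_eq0.
  have /eqP := e2 z; rewrite z0 expr0n /= eq_sym psumr_eq0; last first.
    by move=> j _; rewrite sqr_ge0.
  by move=> /allP /(_ i); rewrite mem_index_enum => /(_ isT).
have cs : dotp x y <= enorm x * enorm y.
  have [x0|xN0] := eqVneq (enorm x) 0.
    rewrite x0 mul0r (enorm0 _ x0) /dotp big1 // => i _.
    by rewrite !mxE mul0r.
  have [y0|yN0] := eqVneq (enorm y) 0.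
    rewrite y0 mulr0 (enorm0 _ y0) /dotp big1 // => i _.
    by rewrite !mxE mulr0.
  have ab0 : 0 < enorm x * enorm y.
    by rewrite mulr_gt0 // lt_neqAle eq_sym ?xN0 ?yN0 e0.
  have : 0 <= \sum_(i < d) (enorm y * x 0 i - enorm x * y 0 i) ^+ 2.
    by apply: sumr_ge0 => i _; rewrite sqr_ge0.
  have -> : \sum_(i < d) (enorm y * x 0 i - enorm x * y 0 i) ^+ 2 =
      (enorm x * enorm y) * (enorm x * enorm y - dotp x y) *+ 2.
    transitivity (enorm y ^+ 2 * (\sum_(i < d) x 0 i ^+ 2) -
        (enorm x * enorm y * dotp x y) *+ 2 +
        enorm x ^+ 2 * (\sum_(i < d) y 0 i ^+ 2)).
      rewrite /dotp !mulr_sumr -sumrMnl -sumrN -!big_split /=.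
      apply: eq_bigr => i _; rewrite sqrrB !exprMn; congr (_ - _ *+ _ + _).
      by rewrite mulrACA [enorm y * _]mulrC.
    rewrite -!e2 mulrBr mulrnBl addrAC; congr (_ - _).
    by rewrite mulr2n -!expr2 exprMn [X in X + _]mulrC.
  by rewrite pmulrn_lge0 // pmulr_rge0 // subr_ge0.
rewrite -(@ler_pXn2r _ 2) ?nnegrE ?addr_ge0 //.
rewrite sqrrD !e2.
have -> : \sum_(i < d) (x + y) 0 i ^+ 2 = \sum_(i < d) x 0 i ^+ 2 +
    dotp x y *+ 2 + \sum_(i < d) y 0 i ^+ 2.
  rewrite /dotp -sumrMnl -!big_split /=.
  by apply: eq_bigr => i _; rewrite mxE sqrrD.
by rewrite lerD2r lerD2l lerMn2r cs orbT.
Qed.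

Lemma enorm_shift (R : realType) (d : nat) (v x : 'rV[R]_d) :
  enorm x <= enorm (x + v) + enorm v.
Proof.
have -> : enorm v = enorm (- v).
  by congr Num.sqrt; apply: eq_bigr => i _; rewrite mxE sqrrN.
by rewrite -{1}[x](addrK v) enormD.
Qed.

Lemma enorm_continuous (R : realType) (d : nat) :
  continuous (@enorm R d).
Proof.
move=> x; apply: (@continuous_comp _ _ _ _ Num.sqrt); last exact: sqrt_continuous.
apply: continuous_big => [|i _ y]; first exact: add_continuous.
apply: (@continuous_comp _ _ _ (fun y : 'rV[R]_d => y 0 i) (fun t => t ^+ 2)).
  exact: coord_continuous.
exact: exprn_continuous.
Qed.

Lemma translation_continuous (R : realType) (d : nat) (v : 'rV[R]_d) :
  continuous (fun x : 'rV[R]_d => x + v).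
Proof.
move=> x; have Fx : Filter (nbhs x) := nbhs_filter x.
apply: (@cvgD R 'rV[R]_d _ (nbhs x) Fx id (cst v) x v) => //.
exact: cvg_cst.
Qed.

Definition Rd (R : realType) (d : nat) : Type := 'rV[R]_d.

HB.instance Definition _ (R : realType) (d : nat) :=
  NormedModule.on (Rd R d).

HB.instance Definition _ (R : realType) (d : nat) :=
  @isMeasurable.Build (sigma_display (@open 'rV[R]_d)) (Rd R d) <<s @open 'rV[R]_d >>
    (@sigma_algebra0 _ setT (@open 'rV[R]_d))
    (@sigma_algebraC _ (@open 'rV[R]_d))
    (@sigma_algebra_bigcup _ setT (@open 'rV[R]_d)).

Lemma Rd_measurable_snorm (R : realType) (d : nat) :
  measurable_fun [set: Rd R d] (@enorm R d).
Proof.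
apply: (measurability _ (measurable_realfun.RGenOpens.measurableE R)).
move=> _ [_ [a [b ->]] <-]; rewrite setTI; apply: sub_sigma_algebra.
have /continuousP := @enorm_continuous R d; apply.
exact: interval_open.
Qed.

Lemma Rd_measurable_shift (R : realType) (d : nat) (v : Rd R d) :
  measurable_fun [set: Rd R d] (fun x : Rd R d => x + v : Rd R d).
Proof.
apply: (@measurability _ _ (Rd R d) (Rd R d) setT _ (@open 'rV[R]_d)) => //.
move=> _ [B oB <-]; rewrite setTI; apply: sub_sigma_algebra.
by have /continuousP := @translation_continuous R d v; exact.
Qed.

HB.instance Definition _ (R : realType) (d : nat) :=
  isPhysicalSpace.Build R (sigma_display (@open 'rV[R]_d)) (Rd R d)
    (@Rd_measurable_snorm R d) (@Rd_measurable_shift R d) (@enorm_shift R d).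

(* Z^d with its discrete sigma-algebra; the parameter [R] only fixes the type
   of the values of the norm. *)
Definition Zd (R : realType) (d : nat) : Type := 'rV[int]_d.

Definition Zd_Rd (R : realType) (d : nat) (x : Zd R d) : Rd R d :=
  map_mx intr (x : 'rV[int]_d).

HB.instance Definition _ (R : realType) (d : nat) :=
  GRing.Zmodule.on (Zd R d).
HB.instance Definition _ (R : realType) (d : nat) :=
  isPointed.Build (Zd R d) 0.
HB.instance Definition _ (R : realType) (d : nat) :=
  @isMeasurable.Build default_measure_display (Zd R d) [set: set (Zd R d)]
    I (fun _ _ => I) (fun _ _ => I).

Lemma Zd_snorm_shift (R : realType) (d : nat) (v x : Zd R d) :
  enorm (Zd_Rd x) <= enorm (Zd_Rd (x + v)) + enorm (Zd_Rd v).
Proof.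
have -> : Zd_Rd (x + v) = Zd_Rd x + Zd_Rd v.
  by apply/rowP => i; rewrite !mxE intrD.
exact: enorm_shift.
Qed.

Lemma Zd_measurable (R : realType) (d : nat) (A : set (Zd R d)) :
  measurable A.
Proof. by []. Qed.

HB.instance Definition _ (R : realType) (d : nat) :=
  isPhysicalSpace.Build R default_measure_display (Zd R d)
    (fun _ _ _ => Zd_measurable _) (fun _ _ _ _ => Zd_measurable _)
    (@Zd_snorm_shift R d).

Definition ccvg (R : realType) (u : nat -> R[i]) (l : R[i]) : Prop :=
  (Re (u n) @[n --> \oo] --> Re l) /\ (Im (u n) @[n --> \oo] --> Im l).

Section LocallyFiniteMeasure.
Context (R : realType) (disp : measure_display) (T : physicalSpaceType R disp).

Definition sbounded (A : set T) : Prop :=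
  exists r : R, forall x, A x -> snorm x <= r.

Definition bmeasurable (A : set T) : Prop := measurable A /\ sbounded A.

(* A complex measure takes finite values and has finite total variation, so
   local finiteness amounts to being defined and countably additive on the
   bounded Borel sets.  The value outside these is irrelevant and is set to 0,
   which makes equality of measures the equality of the set functions. *)
Record lfmeasure := LFMeasure {
  lfm :> set T -> R[i];
  lfm_default : forall A, ~ bmeasurable A -> lfm A = 0;
  lfm_sigma_additive : forall F : (set T)^nat,
    (forall n, measurable (F n)) -> trivIset setT F ->
    sbounded (\bigcup_n F n) ->
    ccvg (fun n => \sum_(k < n) lfm (F k)) (lfm (\bigcup_n F n)) }.

Lemma sbounded_sub (A B : set T) : A `<=` B -> sbounded B -> sbounded A.
Proof. by move=> AB [r Br]; exists r => x /AB /Br. Qed.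

Lemma sbounded_shift (v : T) (A : set T) :
  sbounded A -> sbounded (shift v @^-1` A).
Proof.
move=> [r Ar]; exists (r + snorm v) => x /= /Ar Ax.
by apply: le_trans (snorm_shift v x) _; rewrite lerD2r.
Qed.

Lemma lfm_comp_sigma_additive (mu : lfmeasure) (h : set T -> set T) :
  (forall A, measurable A -> measurable (h A)) ->
  (forall A, sbounded A -> sbounded (h A)) ->
  (forall A B, A `&` B = set0 -> h A `&` h B = set0) ->
  (forall F : (set T)^nat, h (\bigcup_n F n) = \bigcup_n h (F n)) ->
  forall F : (set T)^nat,
    (forall n, measurable (F n)) -> trivIset setT F ->
    sbounded (\bigcup_n F n) ->
    ccvg (fun n => \sum_(k < n)
        if `[< bmeasurable (F k) >] then mu (h (F k)) else 0)
      (if `[< bmeasurable (\bigcup_n F n) >] then mu (h (\bigcup_n F n)) else 0).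
Proof.
move=> mh bh dh Uh F mF tF bF.
have -> : `[< bmeasurable (\bigcup_n F n) >].
  by apply/asboolP; split=> //; exact: bigcupT_measurable.
rewrite Uh.
have -> : (fun n => \sum_(k < n)
    if `[< bmeasurable (F k) >] then mu (h (F k)) else 0) =
    (fun n => \sum_(k < n) mu (h (F k))).
  apply/funext => n; apply: eq_bigr => k _.
  suff -> : `[< bmeasurable (F k) >] by [].
  apply/asboolP; split=> //; apply: sbounded_sub bF.
  exact: bigcup_sup.
apply: lfm_sigma_additive => [n||]; first exact: mh.
  apply/trivIsetP => i j _ _ ij; apply: dh.
  by move/trivIsetP : tF; exact.
by rewrite -Uh; exact: bh.
Qed.

Program Definition lfm_zero : lfmeasure := @LFMeasure (fun=> 0) _ _.
Next Obligation. by []. Qed.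
Next Obligation.
move=> F _ _ _; split; under eq_fun do rewrite big1 //; exact: cvg_cst.
Qed.

(* [mu] restricted to [D], seen as a measure on the whole space. *)
Program Definition lfm_restrict (D : set T) (mD : measurable D) (mu : lfmeasure) :
    lfmeasure :=
  @LFMeasure (fun A => if `[< bmeasurable A >] then mu (A `&` D) else 0) _ _.
Next Obligation. by move=> D mD mu A /asboolPn/negbTE ->. Qed.
Next Obligation.
move=> D mD mu; apply: (@lfm_comp_sigma_additive mu (fun A => A `&` D)).
- by move=> A mA; exact: measurableI.
- by move=> A; exact: sbounded_sub.
- by move=> A B AB; rewrite setIACA AB set0I.
- by move=> F; rewrite setI_bigcupl.
Qed.

(* The image of [mu] under [shift v]. *)
Program Definition lfm_translate (v : T) (mu : lfmeasure) : lfmeasure :=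
  @LFMeasure
    (fun A => if `[< bmeasurable A >] then mu (shift v @^-1` A) else 0) _ _.
Next Obligation. by move=> v mu A /asboolPn/negbTE ->. Qed.
Next Obligation.
move=> v mu; apply: (@lfm_comp_sigma_additive mu (fun A => shift v @^-1` A)).
- by move=> A mA; rewrite -[X in measurable X]setTI; exact: measurable_shift.
- exact: sbounded_shift.
- by move=> A B AB; rewrite -preimage_setI AB preimage_set0.
- by move=> F; rewrite preimage_bigcup.
Qed.

HB.instance Definition _ := gen_eqMixin lfmeasure.
HB.instance Definition _ := gen_choiceMixin lfmeasure.
HB.instance Definition _ := isPointed.Build lfmeasure lfm_zero.

(* The sigma-algebra on the space of measures is generated by the evaluations
   at bounded Borel sets. *)
Definition evaluations : set (set lfmeasure) :=
  [set E | exists A (B : set R), [/\ bmeasurable A, measurable B &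
    E = [set mu : lfmeasure | B (Re (mu A))] \/ E = [set mu : lfmeasure | B (Im (mu A))]]].

HB.instance Definition _ :=
  @isMeasurable.Build (sigma_display evaluations) lfmeasure <<s evaluations >>
    (@sigma_algebra0 _ setT evaluations) (@sigma_algebraC _ evaluations)
    (@sigma_algebra_bigcup _ setT evaluations).

Definition lfm_total_variation (mu : lfmeasure) (A : set T) : \bar R :=
  ereal_sup [set (\sum_(0 <= n <oo) (normc (mu (F n)))%:E)%E | F in
    [set F : (set T)^nat | [/\ forall n, measurable (F n), trivIset setT F &
      \bigcup_n F n = A]]].

(* The positive part of the Jordan decomposition of a real measure. *)
Definition pos_variation (nu : set T -> R) (A : set T) : \bar R :=
  ereal_sup [set (nu B)%:E | B in [set B | bmeasurable B /\ B `<=` A]].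

Definition real_lfm_integral (nu : set T -> R) (f : T -> R) : R :=
  fine (\int[pos_variation nu]_x (f x)%:E) -
  fine (\int[pos_variation (fun A => (- nu A)%R)]_x (f x)%:E).

Definition lfm_integral (mu : lfmeasure) (f : T -> R[i]) : R[i] :=
  let re_mu A := Re (mu A) in let im_mu A := Im (mu A) in
  let re_f x := Re (f x) in let im_f x := Im (f x) in
  (real_lfm_integral re_mu re_f - real_lfm_integral im_mu im_f) +i*
  (real_lfm_integral re_mu im_f + real_lfm_integral im_mu re_f).

Lemma measurable_sball (r : R) : measurable [set x : T | snorm x <= r].
Proof.
rewrite [X in measurable X](_ : _ = snorm @^-1` `]-oo, r]%classic); last first.
  by rewrite preimage_itvNyc.
by rewrite -[X in measurable X]setTI; exact: measurable_snorm.
Qed.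

End LocallyFiniteMeasure.

Definition cintegral (R : realType) (disp : measure_display)
    (T : measurableType disp) (mu : set T -> \bar R) (D : set T)
    (f : T -> R[i]) : R[i] :=
  fine (\int[mu]_(x in D) (Re (f x))%:E) +i*
  fine (\int[mu]_(x in D) (Im (f x))%:E).

Section RandomMeasure.
Context (R : realType) (disp : measure_display) (T : physicalSpaceType R disp)
  (dO : measure_display) (Omega : measurableType dO) (P : probability Omega R)
  (Xi : {mfun Omega >-> lfmeasure T}).

Definition cexpectation (X : Omega -> R[i]) : R[i] := cintegral P setT X.

Definition ccovariance (X Y : Omega -> R[i]) : R[i] :=
  cexpectation (fun w =>
    (X w - cexpectation X) * conjc (Y w - cexpectation Y)).

Definition locally_square_integrable : Prop :=
  forall K : set T, bmeasurable K ->
    (\int[P]_w (lfm_total_variation (Xi w) K ^+ 2) < +oo)%E.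

Definition translation_invariant : Prop :=
  forall (v : T) (E : set (lfmeasure T)), measurable E ->
    P ((lfm_translate v \o Xi) @^-1` E) = P (Xi @^-1` E).

Definition determined_by_outside (D : set T) (mD : measurable D) : Prop :=
  exists F : {mfun lfmeasure T >-> lfmeasure T},
    {ae P, forall w, lfm_restrict mD (Xi w) =
                     F (lfm_restrict (measurableC mD) (Xi w))}.

Definition tail_sigma_field : set (set Omega) :=
  \bigcap_(n in [set n | (0 < n)%N])
    preimage_set_system setT
      (lfm_restrict (measurableC (@measurable_sball R disp T n%:R)) \o Xi)
      measurable.

Definition determined_by_tail : Prop :=
  forall E : set (lfmeasure T), measurable E ->
    exists2 A, tail_sigma_field A & P.-negligible ((Xi @^-1` E) `+` A).

End RandomMeasure.

Section Fourier.
Context (R : realType) (d : nat).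
Implicit Types (f g : Rd R d -> R[i]) (s : seq 'I_d).

(* Iterated partial derivatives, the head of [s] being differentiated last. *)
Definition pderiv s (h : Rd R d -> R) : Rd R d -> R :=
  foldr (fun (i : 'I_d) (u : Rd R d -> R) x => 'D_(delta_mx 0 i : Rd R d) u x)
    h s.

Definition smooth (h : Rd R d -> R) : Prop :=
  forall s, continuous (pderiv s h) /\
    forall (i : 'I_d) x, derivable (pderiv s h) x (delta_mx 0 i : Rd R d).

Definition csmooth f : Prop :=
  smooth (fun x => Re (f x)) /\ smooth (fun x => Im (f x)).

Definition cpderiv s f (x : Rd R d) : R[i] :=
  pderiv s (fun y => Re (f y)) x +i* pderiv s (fun y => Im (f y)) x.

Definition test_function f : Prop :=
  csmooth f /\ exists r : R, forall x, r < enorm x -> f x = 0.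

Definition schwartz_function f : Prop :=
  csmooth f /\ forall (N : nat) s, exists B : R,
    forall x, (1 + enorm x) ^+ N * normc (cpderiv s f x) <= B.

(* Only the values at Schwartz functions matter. *)
Definition tempered_distribution (beta : (Rd R d -> R[i]) -> R[i]) : Prop :=
  (forall (a : R[i]) f g, schwartz_function f -> schwartz_function g ->
     beta (fun x => a * f x + g x) = a * beta f + beta g) /\
  (exists (C : R) (N : nat), forall f (B : R), schwartz_function f ->
     (forall s x, (size s <= N)%N ->
        (1 + enorm x) ^+ N * normc (cpderiv s f x) <= B) ->
     normc (beta f) <= C * B).

Definition cis (t : R) : R[i] := cos t +i* sin t.

End Fourier.

(* Iterated sections, as in the product of [lebesgue_measure] with itself. *)
Fixpoint lebesgue_Rd (R : realType) (d : nat) : set 'rV[R]_d -> \bar R :=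
  match d with
  | 0 => fun A => (\1_A 0)%:E
  | d'.+1 => fun A => (\int[lebesgue_measure]_(x in [set: R])
      lebesgue_Rd [set y : 'rV[R]_d' | A (row_mx (x%:M : 'rV[R]_1) y)])%E
  end.

Section StructureFunction.
Context (R : realType) (d : nat).

Definition cint_Rd (D : set (Rd R d)) (f : Rd R d -> R[i]) : R[i] :=
  cintegral (@lebesgue_Rd R d : set (Rd R d) -> \bar R) D f.

Definition locally_integrable_Rd (S : Rd R d -> R[i]) : Prop :=
  [/\ measurable_fun setT (fun x => Re (S x)),
      measurable_fun setT (fun x => Im (S x)) &
      forall r : R, (\int[@lebesgue_Rd R d : set (Rd R d) -> \bar R]_(x in
        [set x : Rd R d | (enorm x <= r)%R]) (normc (S x))%:E < +oo)%E].

Definition vanishes_faster_than_polynomials (S : Rd R d -> R[i]) : Prop :=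
  forall m : nat, (0 < m)%N -> exists C eps : R, [/\ 0 < C, 0 < eps &
    forall xi : Rd R d, enorm xi <= eps -> normc (S xi) <= C * enorm xi ^+ m].

Context (dO : measure_display) (Omega : measurableType dO)
  (P : probability Omega R).

Definition fourier_Rd (f : Rd R d -> R[i]) (k : Rd R d) : R[i] :=
  cint_Rd setT (fun x => f x * cis (- dotp k x)).

(* With [x = s - t], the double integral
   \iint phi(s) (psi(t))^* beta(s - t) ds dt is the value of the distribution
   [beta] at the function x |-> \int phi(x + t) (psi(t))^* dt. *)
Definition covariance_functional_Rd (Xi : {mfun Omega >-> lfmeasure (Rd R d)})
    (beta : (Rd R d -> R[i]) -> R[i]) : Prop :=
  tempered_distribution beta /\
  forall phi psi : Rd R d -> R[i], test_function phi -> test_function psi ->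
    ccovariance P (fun w => lfm_integral (Xi w) phi)
                  (fun w => lfm_integral (Xi w) psi) =
    beta (fun x : Rd R d =>
      cint_Rd setT (fun t => phi (x + t : Rd R d) * conjc (psi t))).

(* [S] is the Fourier transform of the distribution [beta], that is
   <S, f> = <beta, \hat f>. *)
Definition structure_function_Rd (beta : (Rd R d -> R[i]) -> R[i])
    (S : Rd R d -> R[i]) : Prop :=
  locally_integrable_Rd S /\
  forall f : Rd R d -> R[i], test_function f ->
    beta (fourier_Rd f) = cint_Rd setT (fun xi => S xi * f xi).

(* Functions on the torus R^d / (2 pi Z)^d are periodic functions on R^d. *)
Definition torus_periodic (f : Rd R d -> R[i]) : Prop :=
  forall (x : Rd R d) (n : Zd R d), f (x + (2 * pi) *: Zd_Rd n) = f x.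

Definition torus_cell : set (Rd R d) :=
  [set x : Rd R d | forall i, - pi <= (x : 'rV[R]_d) 0 i < pi].

Definition fourier_torus (f : Rd R d -> R[i]) (x : Zd R d) : R[i] :=
  cint_Rd torus_cell (fun k => f k * cis (- dotp k (Zd_Rd x))).

Definition covariance_functional_Zd (Xi : {mfun Omega >-> lfmeasure (Zd R d)})
    (beta : Zd R d -> R[i]) : Prop :=
  forall phi psi : Zd R d -> R[i],
    finite_set [set s | phi s != 0] -> finite_set [set t | psi t != 0] ->
    ccovariance P (fun w => lfm_integral (Xi w) phi)
                  (fun w => lfm_integral (Xi w) psi) =
    \sum_(s \in [set: Zd R d]) \sum_(t \in [set: Zd R d])
      phi s * conjc (psi t) * beta (s - t : Zd R d).

(* As in [structure_function_Rd], <S, f> = <beta, \hat f> for smooth functions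
   [f] on the torus. *)
Definition structure_function_Zd (beta : Zd R d -> R[i])
    (S : Rd R d -> R[i]) : Prop :=
  [/\ torus_periodic S, locally_integrable_Rd S &
    forall f : Rd R d -> R[i], csmooth f -> torus_periodic f ->
      ccvg (fun n : nat => \sum_(x \in [set x : Zd R d | snorm x <= n%:R :> R])
              beta x * fourier_torus f x)
           (cint_Rd torus_cell (fun xi => S xi * f xi))].

End StructureFunction.

(* Main.v *)
Require Import Defs.
From HB Require Import structures.
From mathcomp Require Import all_boot all_order all_algebra.
From mathcomp Require Import all_classical all_reals all_analysis.
From mathcomp Require Import complex.
From mathcomp Require Import ring lra zify finmap measurable_realfun.

Set Implicit Arguments.
Unset Strict Implicit.
Unset Printing Implicit Defensive.

Import Order.TTheory GRing.Theory Num.Theory.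
Import numFieldNormedType.Exports.
Import Normc.

Local Open Scope classical_set_scope.
Local Open Scope ring_scope.
Local Open Scope complex_scope.

Local Notation Re := (@complex.Re _).
Local Notation Im := (@complex.Im _).

(** If test functions [f_n] converge boundedly on [D] to the indicator of [A] and the variance of [Xi(f_n)] is at
    most [2^-n], then almost surely [Xi(A `&` D)] is the limit of [E Xi(f_n) - Xi(f_n 1_{~` D})], a function of
    the restriction of [Xi] to the complement of [D].  Countably many sets [A], transported to the real line by
    a measurable encoding, then determine the restriction to [D], through distribution functions.

    Such [f_n] come from polynomials.  On R^d take [f(x) = prod_i p_i(y_i^2) kappa(delta y_i)], [y = x + shift], where
    [kappa] is the Fourier transform of a bump: [f] is the transform of a differential operator of order
    [sum_i 2 deg p_i] applied to a bump supported in the cube of side [2 delta], so its variance is the integral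
    of [S] against a density bounded by a power of [1 / delta] and supported near 0, which tends to 0 with
    [delta] because [S] vanishes to infinite order.  Since [f] is not compactly supported, it is truncated, and
    temperedness of [beta] makes the error negligible.  On Z^d the binomial weights [C(2n, n + j) / C(2n, n)],
    whose Fourier series is a power of [cos (k / 2)^2], play the role of [kappa].

    An event of [Xi] then has, for every [n], an almost sure version depending only on [Xi] outside the ball of radius
    [n]; the limit superior of these versions is tail measurable. *)

(** * Integrals against locally finite measures *)

Section MeasurableIntegral.
Context (R : realType) (disp : measure_display) (T : measurableType disp).
Implicit Types (D : set T) (f : T -> R).
Import HBNNSimple.

(** The freedom exploited is that [f_n] is prescribed on [D] only. A polynomial with any wanted
    behaviour on [D] may be huge elsewhere; multiplying it by a wide window barely changes it on [D]
    and pushes its spectrum towards 0. For each [n] the degree is fixed before the width, so one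
    order of vanishing of [S] is enough at that stage, but the degrees are unbounded in [n].
    Polynomials in [y_i ^ 2] are even, so that all transforms are real cosine transforms; the shift
    moves [D] to a region where squaring is injective, so that no set is lost. Products over the
    coordinates reach a pi-system, and a Dynkin argument reaches all Borel sets. The null set found
    for [A] depends on [A], whereas one measurable map must recover the whole restriction almost
    surely. The way around this is that the positive part of a signed measure is a supremum over a
    countable algebra: its distribution function at the rationals involves countably many almost
    sure identities only. *)

Lemma jordan_measures (m : {charge set T -> \bar R}) :
  exists p n : {finite_measure set T -> \bar R}, exists2 P : set T,
  measurable P & forall A, measurable A ->
  [/\ p A = m (A `&` P), n A = - m (A `&` ~` P) & m A = p A - n A]%E.
Proof.
have [P [N hPN]] := Hahn_decomposition m.
have [[mP posP] [mN negN] PNT PN0] := hPN.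
have NE : N = ~` P.
  apply/seteqP; split => x.
    move=> Nx Px; have : (P `&` N) x by [].
    by rewrite PN0.
  by move=> nPx; have [] : (P `|` N) x by rewrite PNT.
exists (jordan_pos hPN), (jordan_neg hPN), P => // A mA; split.
- by rewrite [LHS](jordan_posE hPN A)/= cjordan_posE/= /crestr0 mem_set.
- by rewrite [LHS](jordan_negE hPN A)/= cjordan_negE/= /crestr0 mem_set// /crestr NE.
- by rewrite [LHS](jordan_decomp hPN mA) /cadd/= /cscale mulN1e.
Qed.

Lemma eq_set_function_integral (m1 m2 : set T -> \bar R) K (f : T -> \bar R) :
  (forall A, measurable A -> A `<=` K -> m1 A = m2 A) ->
  (forall x, ~ K x -> f x = 0%E) ->
  (\int[m1]_x f x = \int[m2]_x f x)%E.
Proof.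
move=> m12 f0; rewrite /integral; apply: congr2; last congr (- _)%E; congr ereal_sup.
all: apply: eq_imagel => /= h; rewrite /= => hf; rewrite !sintegralET.
all: apply: eq_fsbigr => r _; have [->|r0] := eqVneq r 0; first by rewrite !mul0e.
all: congr *%E; apply: m12 => [|x /= hr]; first exact: measurable_funPTI.
all: apply: contrapT => nKx; move: (hf x).
all: rewrite ?funeposE ?funenegE patch_setT (f0 _ nKx) ?oppe0 maxxx lee_fin hr.
all: by move=> r0'; have := @fun_ge0 _ _ h x; rewrite [X in 0 <= X]hr => r0''; case/eqP: r0; apply/le_anti/andP.
Qed.


Lemma bounded_integrable (p : {finite_measure set T -> \bar R}) D f (B : R) :
  measurable D -> measurable_fun setT f -> (forall x, `|f x| <= B) ->
  p.-integrable D (EFin \o f).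
Proof.
move=> mD mf fB; apply: measurable_bounded_integrable => //.
- by rewrite -ge0_fin_numE// fin_num_measure.
- exact: measurable_funS mf.
- exists B; split; first exact: num_real.
  by move=> M BM x _ /=; rewrite (le_trans (fB x))// ltW.
Qed.

Lemma Rintegral_indicator (p : {finite_measure set T -> \bar R}) D f :
  measurable D -> measurable_fun setT f ->
  \int[p]_x (f x * \1_D x) = \int[p]_(x in D) f x.
Proof.
move=> mD mf; rewrite [RHS]Rintegral_mkcond; apply: eq_Rintegral => x _.
by rewrite patchE indicE; case: ifP; rewrite ?mulr1 ?mulr0.
Qed.

Lemma Rintegral_nnsfun (p : {finite_measure set T -> \bar R}) D
    (h : {nnsfun T >-> R}) : measurable D ->
  \int[p]_(x in D) h x =
  \sum_(r <- fset_set (range h)) r * fine (p (h @^-1` [set r] `&` D)).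
Proof.
move=> mD; rewrite /Rintegral.
have -> : (\int[p]_(x in D) (h x)%:E = \int[p]_(x in D)
    \sum_(r <- fset_set (range h)) (r%:E * (\1_(h @^-1` [set r]) x)%:E))%E.
  apply: eq_integral => x _; by rewrite [h x]fimfunE fsbig_finite//= -sumEFin.
rewrite integral_sum//; last first.
  move=> r; apply: integrableZl => //.
  apply: (@bounded_integrable _ _ _ 1) => //.
  by move=> x; rewrite indicE; case: (_ \in _); rewrite ?normr1 ?normr0.
under eq_bigr => r _.
  rewrite integralZl//; last first.
    apply: (@bounded_integrable _ _ _ 1) => //.
      by move=> x; rewrite indicE; case: (_ \in _); rewrite ?normr1 ?normr0.
  rewrite integral_indic//.
  over.
rewrite /= -sum_fine => [|r _]; last first.
  by rewrite fin_numM// fin_num_measure//; apply: measurableI => //; exact: measurable_funPTI.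
apply: eq_bigr => r _; rewrite fineM// fin_num_measure//.
by apply: measurableI => //; exact: measurable_funPTI.
Qed.

Lemma dominated_Rintegral_cvg (p : {finite_measure set T -> \bar R}) D
    (g : nat -> T -> R) f (B : R) :
  measurable D -> (forall n, measurable_fun setT (g n)) -> measurable_fun setT f ->
  (forall n x, `|g n x| <= B) -> (forall x, D x -> g n x @[n --> \oo] --> f x) ->
  \int[p]_(x in D) g n x @[n --> \oo] --> \int[p]_(x in D) f x.
Proof.
move=> mD mg mf gB gf.
pose gE n x := (g n x)%:E; pose fE x := (f x)%:E.
have mgE n : measurable_fun D (gE n).
  by apply/measurable_EFinP; exact: measurable_funS (mg n).
have mfE : measurable_fun D fE by apply/measurable_EFinP; exact: measurable_funS mf.
have cgE : {ae p, forall x, D x -> gE n x @[n --> \oo] --> fE x}.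
  by apply: aeW => x Dx; apply/cvg_EFin; [exact: nearW|exact: gf].
have iB : p.-integrable D (cst B%:E) by exact: finite_measure_integrable_cst.
have bgE : {ae p, forall x n, D x -> `|gE n x| <= cst B%:E x}%E.
  by apply: aeW => x n Dx; rewrite /= lee_fin.
have [_ _ H] := dominated_convergence mD mgE mfE cgE iB bgE.
apply: fine_cvg; rewrite fineK//.
have [i1 _] := dominated_convergence mD mgE mfE cgE iB bgE.
by move=> _; exact: integrable_fin_num i1.
Qed.

Lemma bounded_nnsfun_approx f : measurable_fun setT f -> (forall x, 0 <= f x) ->
  exists g : nat -> {nnsfun T >-> R},
    (forall n x, g n x <= f x) /\ (forall x, g n x @[n --> \oo] --> f x).
Proof.
move=> mf f0.
have mfE : measurable_fun setT (EFin \o f) by exact/measurable_EFinP.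
have f0E x : setT x -> (0 <= (EFin \o f) x)%E by move=> _; rewrite lee_fin.
exists (nnsfun_approx measurableT mfE); split=> [n x|x].
  by rewrite -lee_fin nnsfun_approxE; exact: le_approx.
by have /fine_cvg := @cvg_nnsfun_approx _ _ _ setT measurableT _ mfE f0E x Logic.I.
Qed.

End MeasurableIntegral.

Section JordanIntegral.
Import HBNNSimple.
Context (R : realType) (disp : measure_display) (T : physicalSpaceType R disp).
Implicit Types (nu : set T -> R) (K D A : set T) (f : T -> R).

Definition locally_sigma_additive nu : Prop := forall F : (set T)^nat,
  (forall n, measurable (F n)) -> trivIset setT F -> sbounded (\bigcup_n F n) ->
  (\sum_(k < n) nu (F k)) @[n --> \oo] --> nu (\bigcup_n F n).

(** For the constant sequence of empty sets, the partial sums and their shifts by one have the same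
    limit and differ by [nu set0]. *)
Lemma lsa_set0 nu : locally_sigma_additive nu -> nu set0 = 0.
Proof.
move=> /(_ (fun=> set0)) H.
have /H{}H : forall n : nat, measurable (set0 : set T) by [].
have b0 : sbounded (\bigcup_(n : nat) (set0 : set T)).
  by exists 0 => x [].
have {H}:= H (@trivIset_set0 _ _ _) b0.
rewrite bigcup0// => H.
have H1 : (\sum_(k < n.+1) nu set0) @[n --> \oo] --> nu set0.
  by move: H; rewrite -cvg_shiftS.
have H2 := cvgB H1 H.
rewrite subrr in H2.
have E : (fun n : nat => \sum_(k < n.+1) nu set0) - (fun n => \sum_(k < n) nu set0)
   = cst (nu set0).
  by apply/funext => n /=; rewrite fctE /= big_ord_recr/= addrAC subrr add0r.
rewrite E in H2.
have {}H2 := H2 eventually_filter.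
have H3 : cst (nu set0) x @[x --> \oo] --> nu set0 by exact: cvg_cst.
exact: (cvg_unique _ H3 H2).
Qed.

Lemma sbounded0 : @sbounded R disp T set0.
Proof. by exists 0. Qed.

(** Cutting by a bounded set makes the additivity global, so that the Hahn decomposition becomes
    available. *)
Lemma lsa_charge nu K : locally_sigma_additive nu -> bmeasurable K ->
  exists m : {charge set T -> \bar R}, forall A, m A = (nu (A `&` K))%:E.
Proof.
move=> nuP [mK bK].
pose m A := (nu (A `&` K))%:E.
have m0 : m set0 = 0%E by rewrite /m set0I lsa_set0.
have mfin : forall A, measurable A -> m A \is a fin_num by [].
have msa : semi_sigma_additive m.
  move=> F mF tF mU; rewrite /m.
  under eq_fun do rewrite sumEFin big_mkord.
  apply/fine_cvgP; split; first by apply: nearW.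
  rewrite /= setI_bigcupl.
  apply: nuP => //; last first.
    by rewrite -setI_bigcupl; apply: sbounded_sub bK.
    exact: trivIset_setIr.
  by move=> n; exact: measurableI.
pose M := isCharge.Build _ _ _ m m0 mfin msa.
by exists (HB.pack m M : {charge set T -> \bar R}).
Qed.

(** The supremum defining the positive variation of [A] is attained at the part of [A] in [P], the
    positive half of a Hahn decomposition. *)
Lemma pos_variationE nu K (p n : {finite_measure set T -> \bar R}) (P : set T) :
  bmeasurable K -> measurable P ->
  (forall A, measurable A -> p A = (nu (A `&` K `&` P))%:E) ->
  (forall A, measurable A -> (nu (A `&` K))%:E = (p A - n A)%E) ->
  forall A, measurable A -> A `<=` K -> pos_variation nu A = p A.
Proof.
move=> [mK bK] mP pE nuE A mA AK; apply/eqP; rewrite eq_le; apply/andP; split.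
  apply: ub_ereal_sup => _ [B [[mB bB] BA] <-].
  have BK : B `&` K = B by apply/setIidPl; exact: subset_trans BA AK.
  rewrite -BK nuE//; apply: (@le_trans _ _ (p B)).
    by rewrite leeBlDr ?fin_num_measure// leeDl.
  by apply: (@le_measure _ _ _ p) => //; exact/mem_set.
apply: ereal_sup_ubound; exists (A `&` P); last first.
  by rewrite pE//; congr (nu _)%:E; move/setIidPl : AK => ->.
split; first split; [exact: measurableI| |exact: subIsetl].
by apply: sbounded_sub bK => x [/AK].
Qed.

Lemma lsa_jordan nu K : locally_sigma_additive nu -> bmeasurable K ->
  exists p n : {finite_measure set T -> \bar R},
  [/\ forall A, measurable A -> A `<=` K -> pos_variation nu A = p A,
      forall A, measurable A -> A `<=` K ->
        pos_variation (fun B => - nu B) A = n A,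
      p setT = p K, n setT = n K &
      forall A, measurable A -> (nu (A `&` K))%:E = (p A - n A)%E].
Proof.
move=> nuP bK; have [m mE] := lsa_charge nuP bK.
have [p [n [P mP H]]] := jordan_measures m.
exists p, n; split.
- apply: (@pos_variationE nu K p n P) => // A mA.
    by have [-> _ _] := H _ mA; rewrite mE setIAC.
  by have [_ _ <-] := H _ mA; rewrite mE.
- apply: (@pos_variationE _ K n p (~` P)) => //.
  + exact: measurableC.
  + by move=> A mA; have [_ -> _] := H _ mA; rewrite mE setIAC EFinN.
  + move=> A mA; rewrite EFinN -mE; have [_ _ ->] := H _ mA.
    by rewrite fin_num_oppeB ?fin_num_measure// addeC.
- have mK : measurable K by case: bK.
  have [-> _ _] := H _ mK; have [-> _ _] := H _ measurableT.
  by rewrite !mE setTI setIAC setIid setIC.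
- have mK : measurable K by case: bK.
  have [_ -> _] := H _ mK; have [_ -> _] := H _ measurableT.
  by rewrite !mE setTI setIAC setIid setIC.
- by move=> A mA; have [_ _ <-] := H _ mA; rewrite mE.
Qed.

Definition supported f K := forall x, ~ K x -> f x = 0.

Lemma real_lfm_integral_jordan nu K :
  locally_sigma_additive nu -> bmeasurable K ->
  exists p n : {finite_measure set T -> \bar R},
  [/\ forall f, supported f K -> real_lfm_integral nu f =
        \int[p]_x f x - \int[n]_x f x,
      forall A, measurable A -> nu (A `&` K) = fine (p A) - fine (n A),
      p setT = pos_variation nu K &
      n setT = pos_variation (fun B => - nu B) K].
Proof.
move=> nuP bK; have [p [n [pE nE pT nT nuE]]] := lsa_jordan nuP bK.
have mK : measurable K by case: bK.
exists p, n; split.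
- move=> f f0; rewrite /real_lfm_integral /Rintegral.
  congr (fine _ - fine _).
    by apply: (eq_set_function_integral pE) => x /f0 ->.
  by apply: (eq_set_function_integral nE) => x /f0 ->.
- move=> A mA; apply: EFin_inj; rewrite nuE// EFinB !fineK ?fin_num_measure//.
- by rewrite pT pE.
- by rewrite nT nE.
Qed.

(** The simple functions and their level sets are chosen before [nu] and [D]. The integral is thus a
    limit of fixed finite combinations of values of [nu], which yields both its measurability in the
    measure and its compatibility with restriction. *)
Lemma real_lfm_integral_approx K f (B : R) : bmeasurable K ->
  measurable_fun setT f -> (forall x, 0 <= f x <= B) -> supported f K ->
  exists s : nat -> seq R, exists A : nat -> R -> set T,
  (forall n r, bmeasurable (A n r)) /\
  forall nu D, locally_sigma_additive nu -> measurable D ->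
    (\sum_(r <- s n) r * nu (A n r `&` D)) @[n --> \oo] -->
    real_lfm_integral nu (fun x => f x * \1_D x).
Proof.
move=> bK mf fB f0.
have fge0 x : 0 <= f x by case/andP: (fB x).
have [g [gf cvgg]] := @bounded_nnsfun_approx _ _ T f mf fge0.
have mK : measurable K by case: bK.
have mgr n r : measurable (g n @^-1` [set r]) by exact: measurable_funPTI.
exists (fun n => fset_set (range (g n))), (fun n r => g n @^-1` [set r] `&` K).
split=> [n r|nu D nuP mD].
  split; first exact: measurableI.
  by case: bK => _; apply: sbounded_sub.
have [p [m [JE nuE _ _]]] := real_lfm_integral_jordan nuP bK.
rewrite JE; last by move=> x /f0 ->; rewrite mul0r.
rewrite !Rintegral_indicator//.
rewrite (_ : (fun n => _) =
    (fun n => \int[p]_(x in D) g n x - \int[m]_(x in D) g n x)).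
  apply: cvgB; apply: (@dominated_Rintegral_cvg _ _ _ _ D _ _ B) => //.
  - by move=> n x; rewrite ger0_norm// (le_trans (gf n x))//; case/andP: (fB x).
  - by move=> n x; rewrite ger0_norm// (le_trans (gf n x))//; case/andP: (fB x).
apply/funext => n; rewrite !Rintegral_nnsfun// -sumrB.
apply: eq_bigr => r _; rewrite -mulrBr setIAC nuE//; exact: measurableI.
Qed.

Lemma real_lfm_integral_posneg nu K f (B : R) : locally_sigma_additive nu ->
  bmeasurable K -> measurable_fun setT f -> (forall x, `|f x| <= B) ->
  supported f K ->
  real_lfm_integral nu f =
  real_lfm_integral nu f^\+ - real_lfm_integral nu f^\-.
Proof.
move=> nuP bK mf fB f0.
have [p [m [JE nuE _ _]]] := real_lfm_integral_jordan nuP bK.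
have fE : f = (fun x => f^\+ x - f^\- x).
  by have := funrposBneg f => {1}<-.
have f0p : supported f^\+ K by move=> x /f0; rewrite /funrpos => ->; rewrite maxxx.
have f0n : supported f^\- K by move=> x /f0; rewrite /funrneg => ->; rewrite oppr0 maxxx.
have pB x : `|f^\+ x| <= B.
  rewrite /funrpos ger0_norm ?le_max ?lexx ?orbT// ge_max (le_trans (ler_norm _) (fB x)).
  exact: le_trans (fB x).
have nB x : `|f^\- x| <= B.
  rewrite /funrneg ger0_norm ?le_max ?lexx ?orbT// ge_max.
  by rewrite (le_trans (ler_norm _)) ?normrN//= (le_trans _ (fB x)).
have mp : measurable_fun setT f^\+ by exact: measurable_funrpos.
have mn : measurable_fun setT f^\- by exact: measurable_funrneg.
rewrite !JE// {1 2}fE !RintegralB//; try exact: bounded_integrable.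
by rewrite !opprB !addrA; lra.
Qed.

End JordanIntegral.

(** The boolean selects the real or the imaginary part, so that each statement about real set
    functions is proved once for both. *)
Definition part (R : realType) (b : bool) (z : R[i]) : R := if b then Re z else Im z.

Lemma part_sum (R : realType) b (I : Type) (s : seq I) (F : I -> R[i]) :
  part b (\sum_(i <- s) F i) = \sum_(i <- s) part b (F i).
Proof.
apply: (big_morph (part b)) => [[x1 x2] [y1 y2]|]; by case: b.
Qed.

Lemma partD (R : realType) b (z w : R[i]) : part b (z + w) = part b z + part b w.
Proof. by case: z w b => [? ?] [? ?] []. Qed.

Lemma part0 (R : realType) b : part b (0 : R[i]) = 0.
Proof. by case: b. Qed.

Lemma normr_part (R : realType) b (z : R[i]) : `|part b z| <= normc z.
Proof.
case: z => x y; rewrite /normc /part /=.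
by case: b => /=; rewrite -sqrtr_sqr ler_wsqrtr// ?lerDl ?lerDr sqr_ge0.
Qed.

Section LocallyFiniteMeasureIntegral.
Context (R : realType) (disp : measure_display) (T : physicalSpaceType R disp).
Implicit Types (mu : lfmeasure T) (K D A : set T) (f : T -> R) (b : bool).

Lemma lfm_lsa b mu : locally_sigma_additive (fun A => part b (mu A)).
Proof.
move=> F mF tF bF; have [reF imF] := @lfm_sigma_additive _ _ _ mu F mF tF bF.
under eq_fun do rewrite -part_sum.
by case: b.
Qed.

Definition lfm_int b mu f := real_lfm_integral (fun A => part b (mu A)) f.

Lemma lfm_integral_real mu f :
  lfm_integral mu (fun x => (f x)%:C) = lfm_int true mu f +i* lfm_int false mu f.
Proof.
have J0 b : lfm_int b mu (fun=> 0) = 0.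
  have b0 : bmeasurable (set0 : set T) by split; [exact: measurable0|exact: sbounded0].
  have [p [n [JE _ _ _]]] := real_lfm_integral_jordan (@lfm_lsa b mu) b0.
  by rewrite /lfm_int JE// /Rintegral !integral0 subrr.
by rewrite /lfm_integral /= -!/(lfm_int true mu _) -!/(lfm_int false mu _) !J0 subr0 add0r.
Qed.

Lemma lfm_restrictE D (mD : measurable D) mu A : bmeasurable A ->
  lfm_restrict mD mu A = mu (A `&` D).
Proof. by move=> bA; rewrite /lfm_restrict/=; case: asboolP. Qed.

Definition bounded_mfun K (B : R) f :=
  [/\ measurable_fun setT f, forall x, `|f x| <= B & supported f K].

(** Both integrals are limits of the same finite sums, by [real_lfm_integral_approx] used once with
    [D] and once with the whole space. *)
Lemma lfm_int_restrict b mu D (mD : measurable D) K (B : R) f :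
  bmeasurable K -> bounded_mfun K B f ->
  lfm_int b (lfm_restrict mD mu) f = lfm_int b mu (fun x => f x * \1_D x).
Proof.
move=> bK; wlog f0 : f / forall x, 0 <= f x => [hwlog [mf fB fK]|].
  have B0 : 0 <= B by rewrite (le_trans _ (fB point)).
  have Hp : bounded_mfun K B f^\+.
    split; first exact: measurable_funrpos.
      move=> x; rewrite ger0_norm ?funrpos_ge0//.
      by rewrite /funrpos ge_max B0 (le_trans (ler_norm _))//.
    by move=> x /fK; rewrite /funrpos => ->; rewrite maxxx.
  have Hn : bounded_mfun K B f^\-.
    split; first exact: measurable_funrneg.
      move=> x; rewrite ger0_norm ?funrneg_ge0//.
      by rewrite /funrneg ge_max B0 (le_trans (ler_norm _)) ?normrN.
    by move=> x /fK; rewrite /funrneg => ->; rewrite oppr0 maxxx.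
  have mfD : measurable_fun setT (fun x => f x * \1_D x).
    by apply: measurable_funM => //; exact: measurable_indic.
  rewrite /lfm_int (real_lfm_integral_posneg (@lfm_lsa b _) bK mf fB fK).
  rewrite [RHS](real_lfm_integral_posneg (@lfm_lsa b _) bK mfD (B := B)); last 2 first.
  - move=> x; rewrite normrM indicE; case: (_ \in _); rewrite ?normr1 ?mulr1//.
    by rewrite normr0 mulr0.
  - by move=> x /fK ->; rewrite mul0r.
  have -> : (fun x => f x * \1_D x)^\+ = (fun x => f^\+ x * \1_D x).
    apply/funext => x; rewrite /funrpos indicE; case: (_ \in _); rewrite ?mulr1//.
    by rewrite !mulr0 maxxx.
  have -> : (fun x => f x * \1_D x)^\- = (fun x => f^\- x * \1_D x).
    apply/funext => x; rewrite /funrneg indicE; case: (_ \in _); rewrite ?mulr1//.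
    by rewrite !mulr0 oppr0 maxxx.
  by congr (_ - _); apply: hwlog.
move=> [mf fB fK].
have fB' x : 0 <= f x <= B by rewrite f0/= (le_trans (ler_norm _)).
have [s [A [bA H]]] := real_lfm_integral_approx bK mf fB' fK.
have H1 := H _ _ (@lfm_lsa b mu) mD.
have H2 := H _ _ (@lfm_lsa b (lfm_restrict mD mu)) measurableT.
rewrite /lfm_int (_ : real_lfm_integral _ f = real_lfm_integral
  (fun A => part b (lfm_restrict mD mu A)) (fun x => f x * \1_setT x)); last first.
  by congr real_lfm_integral; apply/funext => x; rewrite indicT mulr1.
apply: (cvg_unique _ H2); first exact: Rhausdorff.
rewrite /mkset.
suff -> : (fun n => \sum_(r <- s n) r * part b (lfm_restrict mD mu (A n r `&` setT)))
  = (fun n => \sum_(r <- s n) r * part b (mu (A n r `&` D))) by [].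
by apply/funext => n; apply: eq_bigr => r _; rewrite setIT lfm_restrictE.
Qed.

Lemma lfm_intD b mu D (mD : measurable D) K (B : R) f :
  bmeasurable K -> bounded_mfun K B f ->
  lfm_int b mu f = lfm_int b mu (fun x => f x * \1_D x) +
                   lfm_int b (lfm_restrict (measurableC mD) mu) f.
Proof.
move=> bK fKB; rewrite (lfm_int_restrict b mu _ bK fKB); case: fKB => mf fB fK.
have [p [m [JE _ _ _]]] := real_lfm_integral_jordan (@lfm_lsa b mu) bK.
have fD A : supported (fun x => f x * \1_A x) K by move=> x /fK ->; rewrite mul0r.
rewrite /lfm_int !JE//.
have mC := measurableC mD.
have E (q : {finite_measure set T -> \bar R}) :
    \int[q]_x f x = \int[q]_x (f x * \1_D x) + \int[q]_x (f x * \1_(~` D) x).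
  have fB' A x : `|f x * \1_A x| <= B.
    rewrite normrM indicE; case: (_ \in _); rewrite ?normr1 ?mulr1//.
    by rewrite normr0 mulr0 (le_trans _ (fB x)).
  rewrite -RintegralD//; try (apply: (@bounded_integrable _ _ _ _ _ _ B) => //;
    by apply: measurable_funM => //; exact: measurable_indic).
  apply: eq_Rintegral => x _; rewrite -mulrDr !indicE in_setC.
  by case: (_ \in _); rewrite ?addr0 ?add0r mulr1.
by rewrite (E p) (E m) opprD addrACA.
Qed.

(** Dominated convergence inside [D]: outside [D] only measurability is asked of [f n], which may
    grow there without control. *)
Lemma lfm_int_indic_cvg b mu D (B : R) A (f : nat -> T -> R) :
  bmeasurable D -> measurable A ->
  (forall n, measurable_fun setT (f n)) ->
  (forall n x, D x -> `|f n x| <= B) ->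
  (forall x, D x -> f n x @[n --> \oo] --> (\1_A x : R)) ->
  lfm_int b mu (fun x => f n x * \1_D x) @[n --> \oo] --> part b (mu (A `&` D)).
Proof.
move=> bD mA mf fB fA; have [mD _] := bD.
have [p [m [JE nuE _ _]]] := real_lfm_integral_jordan (@lfm_lsa b mu) bD.
have fD (g : T -> R) : supported (fun x => g x * \1_D x) D.
  by move=> x nDx; rewrite indicE memNset// mulr0.
rewrite /lfm_int (_ : (fun n => _) = (fun n => \int[p]_x (f n x * \1_D x) -
    \int[m]_x (f n x * \1_D x))); last by apply/funext => n; rewrite JE.
have -> : A `&` D = A `&` D `&` D by rewrite -setIA setIid.
rewrite nuE; last exact: measurableI.
have E (q : {finite_measure set T -> \bar R}) :
    \int[q]_x (f n x * \1_D x) @[n --> \oo] --> fine (q (A `&` D)).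
  have -> : fine (q (A `&` D)) = \int[q]_x (\1_A x * \1_D x).
    by rewrite Rintegral_indicator// /Rintegral integral_indic.
  apply: (@dominated_Rintegral_cvg _ _ _ _ _ _ _ `|B|) => //.
  - by move=> n; apply: measurable_funM => //; exact: measurable_indic.
  - by apply: measurable_funM; exact: measurable_indic.
  - move=> n x; rewrite normrM indicE; case: (boolP (_ \in _)); rewrite ?normr1 ?mulr1.
      by move=> /set_mem/(fB n)/le_trans; apply; exact: ler_norm.
    by rewrite normr0 mulr0.
  - move=> x _; have [Dx|nDx] := pselect (D x).
      by apply: cvgM; [exact: fA|exact: cvg_cst].
    by rewrite !indicE (memNset nDx); under eq_fun do rewrite mulr0;
      rewrite mulr0; exact: cvg_cst.
exact: cvgB.
Qed.

Lemma pos_variation_le_total_variation b mu K : bmeasurable K ->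
  (pos_variation (fun A => part b (mu A)) K <= lfm_total_variation mu K)%E /\
  (pos_variation (fun A => (- part b (mu A))%R) K <= lfm_total_variation mu K)%E.
Proof.
move=> [mK bK].
have H B : bmeasurable B -> B `<=` K ->
    ((normc (mu B))%:E <= lfm_total_variation mu K)%E.
  move=> [mB bB] BK.
  (* [B] is completed to a partition of [K], so that the first term of the series already gives the
     bound. *)
  pose F n := if n == 0%N then B else if n == 1%N then K `\` B else set0.
  apply: (@le_trans _ _ (\sum_(0 <= n <oo) (normc (mu (F n)))%:E)%E).
    have := @nneseries_lim_ge R (fun n => (normc (mu (F n)))%:E) xpredT 0 1.
    by rewrite big_nat1; apply => n _ _; rewrite lee_fin (le_trans _ (normr_part true _)).
  apply: ereal_sup_ubound; exists F => //; split.
  - move=> n; rewrite /F; case: ifP => // _; case: ifP => // _.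
    exact: measurableD.
  - apply/trivIsetP => -[|[|i]] [|[|j]] // _ _ _; rewrite /F/= ?setI0 ?set0I//.
      by rewrite setDIK.
    by rewrite setIC setDIK.
  - apply/seteqP; split => [x [[|[|n]] _]//=|x Kx]; first exact: BK.
      by case.
    by have [Bx|nBx] := pselect (B x); [exists 0%N|exists 1%N].
split; apply: ub_ereal_sup => _ [B [bB BK] <-]; apply: le_trans (H _ bB BK).
all: rewrite lee_fin; apply: le_trans (normr_part b _); rewrite ?ler_norm//.
by rewrite -normrN ler_norm.
Qed.

Lemma total_variation_ge0 mu K : bmeasurable K -> (0 <= lfm_total_variation mu K)%E.
Proof.
move=> bK; have [pK _] := @pos_variation_le_total_variation true mu K bK.
have [p [m [_ _ pT _]]] := real_lfm_integral_jordan (@lfm_lsa true mu) bK.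
by apply: le_trans pK; rewrite -pT.
Qed.

(** The factor 2 counts the positive and the negative variation separately. *)
Lemma lfm_int_le_total_variation b mu K (B : R) f : bmeasurable K ->
  bounded_mfun K B f -> 
  (`|lfm_int b mu f|%:E <= (B *+ 2)%:E * lfm_total_variation mu K)%E.
Proof.
move=> bK [mf fB fK].
have [p [m [JE _ pT mT]]] := real_lfm_integral_jordan (@lfm_lsa b mu) bK.
have [pK nK] := @pos_variation_le_total_variation b mu K bK.
have B0 : 0 <= B by rewrite (le_trans _ (fB point)).
have E (q : {finite_measure set T -> \bar R}) :
    (q setT <= lfm_total_variation mu K ->
    (`|\int[q]_x f x|)%:E <= B%:E * lfm_total_variation mu K)%E.
  move=> qT; apply: le_trans (lee_wpmul2l _ qT); last by rewrite lee_fin.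
  rewrite -[q setT]fineK ?fin_num_measure// -EFinM lee_fin.
  apply: (@le_trans _ _ (\int[q]_x `|f x|)).
    by apply: le_normr_Rintegral => //; exact: (@bounded_integrable _ _ _ _ _ _ B).
  apply: (@le_trans _ _ (\int[q]_x B)).
    apply: le_Rintegral => //.
      apply: (@bounded_integrable _ _ _ _ _ _ B) => // [|x].
        exact: measurableT_comp.
      by rewrite normr_id.
    by apply: finite_measure_integrable_cst.
  by rewrite Rintegral_cst.
rewrite /lfm_int JE// mulr2n EFinD ge0_muleDl ?lee_fin//.
apply: le_trans (leeD (E p _) (E m _)); rewrite ?pT ?mT//.
by rewrite -EFinD lee_fin ler_normB.
Qed.

Lemma measurable_evaluation b A :
  measurable_fun setT (fun mu : lfmeasure T => part b (mu A)).
Proof.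
have [bA|nA] := pselect (bmeasurable A); last first.
  rewrite (_ : (fun _ => _) = cst 0); first exact: measurable_cst.
  by apply/funext => mu; rewrite lfm_default// part0.
move=> _ B mB; rewrite setTI; apply: sub_sigma_algebra.
by exists A, B; split => //; case: b; [left|right].
Qed.

Lemma measurable_fun_lfmeasure d' (X : measurableType d') (F : X -> lfmeasure T) :
  (forall b A, bmeasurable A -> measurable_fun setT (fun w => part b (F w A))) ->
  measurable_fun setT F.
Proof.
move=> H; apply: (@measurability _ _ X (lfmeasure T) setT F (evaluations (T := T))) => //.
move=> _ [_ [A [B [bA mB [->|->]]]] <-].
- exact: (H true A bA).
- exact: (H false A bA).
Qed.

Lemma measurable_lfm_restrict D (mD : measurable D) :
  measurable_fun setT (lfm_restrict mD : lfmeasure T -> lfmeasure T).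
Proof.
apply: measurable_fun_lfmeasure => b A bA.
under eq_fun do rewrite lfm_restrictE//.
exact: measurable_evaluation.
Qed.

Lemma measurable_lfm_int b K (B : R) f : bmeasurable K -> bounded_mfun K B f ->
  measurable_fun setT (fun mu : lfmeasure T => lfm_int b mu f).
Proof.
move=> bK; wlog f0 : f / forall x, 0 <= f x => [hwlog [mf fB fK]|[mf fB fK]].
  have B0 : 0 <= B by rewrite (le_trans _ (fB point)).
  rewrite /lfm_int; under eq_fun do
    rewrite (real_lfm_integral_posneg (@lfm_lsa b _) bK mf fB fK).
  apply: measurable_funB; apply: hwlog.
  - exact: funrpos_ge0.
  - split; first exact: measurable_funrpos.
      move=> x; rewrite ger0_norm ?funrpos_ge0//.
      by rewrite /funrpos ge_max B0 (le_trans (ler_norm _)).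
    by move=> x /fK; rewrite /funrpos => ->; rewrite maxxx.
  - exact: funrneg_ge0.
  - split; first exact: measurable_funrneg.
      move=> x; rewrite ger0_norm ?funrneg_ge0//.
      by rewrite /funrneg ge_max B0 (le_trans (ler_norm _)) ?normrN.
    by move=> x /fK; rewrite /funrneg => ->; rewrite oppr0 maxxx.
have fB' x : 0 <= f x <= B by rewrite f0/= (le_trans (ler_norm _)).
have [s [A [bA H]]] := real_lfm_integral_approx bK mf fB' fK.
apply: (@measurable_fun_cvg _ _ _ _
  (fun n mu => \sum_(r <- s n) r * part b (mu (A n r)))) => [n|mu _].
  apply: measurable_sum => r; apply: measurable_funM => //.
  exact: measurable_evaluation.
have := H _ _ (@lfm_lsa b mu) measurableT.
under eq_fun do under eq_bigr do rewrite setIT.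
rewrite (_ : (fun x => f x * \1_setT x) = f)//.
by apply/funext => x; rewrite indicT mulr1.
Qed.

End LocallyFiniteMeasureIntegral.

(** * Functionals of small variance *)

Section SquareIntegrable.
Context (R : realType) (dO : measure_display) (Omega : measurableType dO)
  (P : probability Omega R).
Implicit Types X Y : Omega -> R.

(* For functions that may fail to be measurable, such as the total variation of [Xi]: the integral is a supremum
   over the simple functions below the integrand. *)
Lemma le_integral_lower (f g : Omega -> \bar R) :
  (forall x, 0 <= f x)%E -> (forall x, f x <= g x)%E ->
  (\int[P]_x f x <= \int[P]_x g x)%E.
Proof.
move=> f0 fg; have g0 x : (0 <= g x)%E by exact: le_trans (fg x).
rewrite !ge0_integralTE//; apply: le_ereal_sup => _ [h hf <-].
by exists h => // x; exact: le_trans (hf x) (fg x).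
Qed.

Definition sq_integrable X :=
  measurable_fun setT X /\ (\int[P]_w ((X w) ^+ 2)%:E < +oo)%E.

Lemma sq_integrableB_cst X (c : R) : sq_integrable X ->
  sq_integrable (fun w => X w - c).
Proof.
move=> [mX iX]; split; first exact: measurable_funB.
have m2 : measurable_fun setT (fun w => ((X w) ^+ 2)%:E : \bar R).
  by apply/measurable_EFinP; exact: measurable_funX.
apply: (@le_lt_trans _ _ (\int[P]_w (2%:E * ((X w) ^+ 2)%:E + (2 * c ^+ 2)%:E)))%E.
  apply: le_integral_lower => w; first by rewrite lee_fin sqr_ge0.
  rewrite -EFinM -EFinD lee_fin.
  have := sqr_ge0 (X w + c); rewrite !expr2; lra.
rewrite ge0_integralD//=; last 3 first.
- by move=> w _; rewrite -EFinM lee_fin mulr_ge0// sqr_ge0.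
- exact: measurable_funeM.
- by move=> w _; rewrite lee_fin mulr_ge0// sqr_ge0.
rewrite ge0_integralZl//=; last by move=> w _; rewrite lee_fin sqr_ge0.
rewrite lte_add_pinfty//; first by rewrite lte_mul_pinfty// lee_fin.
by rewrite integral_cst// ltey_eq fin_numM// fin_num_measure.
Qed.

(** The expected sum of the squares is at most the sum of a geometric series, so the sum is almost
    surely finite and its terms tend to 0. *)
Lemma ae_cvg0 (Y : nat -> Omega -> R) :
  (forall n, measurable_fun setT (Y n)) ->
  (forall n, \int[P]_w ((Y n w) ^+ 2)%:E <= (2^-1 ^+ n)%:E)%E ->
  {ae P, forall w, Y n w @[n --> \oo] --> 0}.
Proof.
move=> mY iY.
have m2 n : measurable_fun setT (fun w => ((Y n w) ^+ 2)%:E : \bar R).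
  by apply/measurable_EFinP; exact: measurable_funX.
pose S w := (\sum_(0 <= n <oo) ((Y n w) ^+ 2)%:E)%E.
have mS : measurable_fun setT S.
  by apply: ge0_emeasurable_sum => // n w _ _; rewrite lee_fin sqr_ge0.
have S0 w : (0 <= S w)%E by apply: nneseries_ge0 => n _ _; rewrite lee_fin sqr_ge0.
have iS : (\int[P]_w S w < +oo)%E.
  rewrite /S integral_nneseries//; last by move=> n w _; rewrite lee_fin sqr_ge0.
  apply: (@le_lt_trans _ _ (\sum_(0 <= n <oo) (2^-1 ^+ n)%:E)%E).
    apply: lee_nneseries => n *; last exact: iY.
    by apply: integral_ge0 => w _; rewrite lee_fin sqr_ge0.
  have -> : (fun n : nat => \sum_(0 <= i < n) (2^-1 ^+ i : R)%:E)%E =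
     EFin \o series (geometric 1 (2^-1 : R)).
    apply/funext => n; rewrite /= sumEFin; congr EFin; apply: eq_bigr => i _.
    by rewrite /geometric/= mul1r.
  have h1 : `|2^-1 : R| < 1 by rewrite ger0_norm// invf_lt1// ltr1n.
  rewrite EFin_lim ?ltry//; apply/cvg_ex; eexists; exact: cvg_geometric_series h1.
have iS' : P.-integrable setT S.
  by apply/integrableP; split => //; under eq_integral do rewrite gee0_abs//.
have := integrable_ae measurableT iS'.
apply: filterS => w /(_ Logic.I) Sfin.
have S_fin : (\sum_(0 <= n <oo) ((Y n w) ^+ 2)%:E < +oo)%E.
  by rewrite -ge0_fin_numE//; exact: S0.
have c0 : (Y n w) ^+ 2 @[n --> \oo] --> 0.
  apply: cvg_series_cvg_0.
  apply: nondecreasing_is_cvgn.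
    by apply/nondecreasing_seqP => n; rewrite /series/= big_nat_recr//= lerDl sqr_ge0.
  exists (fine (S w)) => _ [n _ <-].
  rewrite -lee_fin /series/= -sumEFin fineK//.
  by apply: nneseries_lim_ge => k _ _; rewrite lee_fin sqr_ge0.
apply/cvgrPdist_lt => e e0.
have e2 : 0 < e ^+ 2 by rewrite exprn_gt0.
move/cvgrPdist_lt : c0 => /(_ _ e2); apply: filterS => n.
rewrite !sub0r !normrN ger0_norm ?sqr_ge0// => h.
by rewrite -(@ltr_pXn2r _ 2) ?nnegrE// ?ltW// -normrX ger0_norm// sqr_ge0.
Qed.

End SquareIntegrable.

Section RandomMeasureCovariance.
Context (R : realType) (disp : measure_display) (T : physicalSpaceType R disp)
  (dO : measure_display) (Omega : measurableType dO) (P : probability Omega R)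
  (Xi : {mfun Omega >-> lfmeasure T}).
Hypothesis Xi2 : locally_square_integrable P Xi.
Implicit Types (f : T -> R) (b : bool).

Lemma lfm_int_sq_integrable b K (B : R) f : bmeasurable K -> bounded_mfun K B f ->
  sq_integrable P (fun w => lfm_int b (Xi w) f).
Proof.
move=> bK fKB.
have mX : measurable_fun setT (fun w => lfm_int b (Xi w) f).
  apply: (measurableT_comp (measurable_lfm_int b bK fKB)).
  exact: measurable_funPT.
split=> //.
have [mf fB _] := fKB.
have B0 : 0 <= B by rewrite (le_trans _ (fB point)).
(* The [+ 1] keeps [C] positive even when [B] is 0, so that division by it is meaningful; the
   quotient is then bounded by the total variation. *)
pose C := (B *+ 2 + 1).
have C0 : 0 < C by rewrite ltr_wpDl// mulrn_wge0.
have H : (\int[P]_w ((lfm_int b (Xi w) f / C) ^+ 2)%:E < +oo)%E.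
  apply: le_lt_trans (Xi2 bK).
  apply: le_integral_lower => w; first by rewrite lee_fin sqr_ge0.
  have TV0 : (0 <= lfm_total_variation (Xi w) K)%E by exact: total_variation_ge0.
  have := lfm_int_le_total_variation b (Xi w) bK fKB.
  case: (lfm_total_variation _ _) TV0 => [r|_|//]; last first.
    by move=> _; rewrite expe2 mulyy leey.
  rewrite lee_fin => r0; rewrite -EFinM lee_fin => h.
  rewrite -EFin_expe lee_fin -[leLHS]ger0_norm ?sqr_ge0// normrX.
  rewrite lerXn2r ?nnegrE// normrM normfV (gtr0_norm C0) ler_pdivrMr//.
  by rewrite (le_trans h)// mulrC ler_wpM2l// lerDl.
rewrite (_ : (\int[P]_w _)%E = ((C ^+ 2)%:E *
    \int[P]_w ((lfm_int b (Xi w) f / C) ^+ 2)%:E)%E).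
  by rewrite lte_mul_pinfty// lee_fin sqr_ge0.
rewrite -ge0_integralZl//.
- apply: eq_integral => w _; rewrite -EFinM; congr EFin.
  by rewrite exprMn mulrCA exprVn mulfV ?mulr1// expf_neq0// gt_eqF.
- apply/measurable_EFinP; apply: measurable_funX; apply: measurable_funM => //.
- by move=> w _; rewrite lee_fin sqr_ge0.
- by rewrite lee_fin sqr_ge0.
Qed.

Definition variance_of f : R :=
  Re (ccovariance P (fun w => lfm_integral (Xi w) (fun x => (f x)%:C))
                    (fun w => lfm_integral (Xi w) (fun x => (f x)%:C))).

(** The squared modulus of the centred complex integral is the sum of the squares of its two parts,
    so the complex variance dominates that of each part; [m] is the corresponding part of the
    expectation. *)
Lemma variance_of_bound b K (B : R) f : bmeasurable K -> bounded_mfun K B f ->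
  exists m : R,
  (\int[P]_w ((lfm_int b (Xi w) f - m) ^+ 2)%:E <= (variance_of f)%:E)%E.
Proof.
move=> bK fKB.
pose X w := lfm_integral (Xi w) (fun x => (f x)%:C).
pose c := cexpectation P X.
exists (part b c).
have sq b' := sq_integrableB_cst (part b' c) (lfm_int_sq_integrable b' bK fKB).
have m2 b' : measurable_fun setT
    (fun w => ((lfm_int b' (Xi w) f - part b' c) ^+ 2)%:E : \bar R).
  by apply/measurable_EFinP; apply: measurable_funX; case: (sq b').
pose I b' := (\int[P]_w ((lfm_int b' (Xi w) f - part b' c) ^+ 2)%:E)%E.
have E : (\int[P]_w (Re ((X w - c) * conjc (X w - c)))%:E = I true + I false)%E.
  rewrite -ge0_integralD//; last 2 first.
  - by move=> w _; rewrite lee_fin sqr_ge0.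
  - by move=> w _; rewrite lee_fin sqr_ge0.
  apply: eq_integral => w _; rewrite -EFinD; congr EFin.
  have cE : c = part true c +i* part false c by rewrite /part; case: (c).
  rewrite /X lfm_integral_real [in LHS]cE/=.
  by rewrite !expr2; ring.
rewrite /variance_of /ccovariance /cexpectation /cintegral/= -/X -/c E -/(I b).
have i0 b' : (0 <= I b')%E.
  by apply: integral_ge0 => w _; rewrite lee_fin sqr_ge0.
have iI b' : I b' \is a fin_num by rewrite ge0_fin_numE//; case: (sq b').
clearbody I; rewrite fineK ?fin_numD ?iI//.
by case: b; rewrite ?leeDl ?leeDr.
Qed.

End RandomMeasureCovariance.

(** The upper limit is defined and measurable everywhere, so a limit that is known to exist only
    almost surely acquires a version on the whole space. *)
Lemma measurable_limit d (X : measurableType d) (R : realType) (h : nat -> X -> R) :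
  (forall n, measurable_fun setT (h n)) ->
  exists2 G : X -> R, measurable_fun setT G &
    forall x l, h n x @[n --> \oo] --> l -> G x = l.
Proof.
move=> mh; exists (fun x => fine (limn_esup (fun n => (h n x)%:E))).
  apply: (measurableT_comp (@fine_measurable R setT measurableT)) => //.
  by apply: measurable_fun_limn_esup => n; exact/measurable_EFinP.
move=> x l hl; have {}hl : (h n x)%:E @[n --> \oo] --> l%:E.
  by apply: cvg_EFin => //; exact: nearW.
by have [_ ->] := cvg_limn_einf_sup hl.
Qed.

(** * Sets whose measure is determined from outside *)

Section Determined.
Context (R : realType) (disp : measure_display) (T : physicalSpaceType R disp)
  (dO : measure_display) (Omega : measurableType dO) (P : probability Omega R)
  (Xi : {mfun Omega >-> lfmeasure T}).
Hypothesis Xi2 : locally_square_integrable P Xi.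
Variables (D : set T) (mD : measurable D).
Hypothesis bD : bmeasurable D.
Implicit Types (b : bool) (A : set T).

Definition outside (w : Omega) : lfmeasure T :=
  lfm_restrict (measurableC mD) (Xi w).

Definition set_determined b A : Prop :=
  exists2 G : lfmeasure T -> R, measurable_fun setT G &
    {ae P, forall w, part b (Xi w (A `&` D)) = G (outside w)}.

Lemma set_determined_approx b A (f : nat -> T -> R) (B : R) :
  measurable A ->
  (forall n, exists K, exists2 B' : R, bmeasurable K & bounded_mfun K B' (f n)) ->
  (forall n x, D x -> `|f n x| <= B) ->
  (forall x, D x -> f n x @[n --> \oo] --> (\1_A x : R)) ->
  (forall n, variance_of P Xi (f n) <= 2^-1 ^+ n) ->
  set_determined b A.
Proof.
move=> mA fK fB fA fV.
have mf n : measurable_fun setT (f n) by have [K [B' _ []]] := fK n.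
have /choice[m Hm] : forall n, exists m : R,
    (\int[P]_w ((lfm_int b (Xi w) (f n) - m) ^+ 2)%:E <= (2^-1 ^+ n)%:E)%E.
  move=> n; have [K [B' bK fKB]] := fK n.
  have [m Hm] := variance_of_bound Xi2 b bK fKB.
  by exists m; rewrite (le_trans Hm)// lee_fin.
have mY n : measurable_fun setT (fun w => lfm_int b (Xi w) (f n) - m n).
  have [K [B' bK fKB]] := fK n; apply: measurable_funB => //.
  by case: (lfm_int_sq_integrable Xi2 b bK fKB).
have aeY := ae_cvg0 mY Hm.
have [|G mG HG] := @measurable_limit _ (lfmeasure T) R
    (fun n nu => m n - lfm_int b nu (f n)).
  move=> n; have [K [B' bK fKB]] := fK n; apply: measurable_funB => //.
  exact: measurable_lfm_int bK fKB.
exists G => //; apply: filterS aeY => w cvgY; apply/esym/HG.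
have cD := @lfm_int_indic_cvg _ _ _ b (Xi w) _ _ _ _ bD mA mf fB fA.
have E : (fun n => lfm_int b (Xi w) (fun x => f n x * \1_D x)) -
    (fun n => lfm_int b (Xi w) (f n) - m n) =
    (fun n => m n - lfm_int b (outside w) (f n)).
  apply/funext => n; rewrite [LHS]/=; have [K [B' bK fKB]] := fK n.
  by rewrite !fctE /outside [X in _ - (X - _) = _](lfm_intD b (Xi w) mD bK fKB); lra.
by rewrite -E -[X in _ --> X]subr0; exact: (cvgB cD cvgY).
Qed.

Lemma set_determinedC b A : measurable A ->
  set_determined b setT -> set_determined b A -> set_determined b (~` A).
Proof.
move=> mA [G1 mG1 H1] [G2 mG2 H2]; exists (fun nu => G1 nu - G2 nu).
  exact: measurable_funB.
apply: filterS2 H1 H2 => w <- <-.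
have [m mE] := lsa_charge (@lfm_lsa _ _ _ b (Xi w)) bD.
apply/eqP; rewrite eq_sym subr_eq; apply/eqP/EFin_inj.
rewrite EFinD -!mE -chargeU//; first by rewrite setUC setUv.
- exact: measurableC.
- by rewrite setICl.
Qed.

(** A Dynkin argument: a countable disjoint union needs countably many almost sure identities at
    once. The exceptional null set obtained still depends on [A]. *)
Lemma all_set_determined b (G : set (set T)) :
  @measurable _ T = <<s G >> -> setI_closed G ->
  set_determined b setT -> (forall A, G A -> set_determined b A) ->
  forall A, measurable A -> set_determined b A.
Proof.
move=> mG GI detT detG.
move=> A mA; move: (mA); rewrite mG => sA.
apply: (@dynkin_induction _ T G (set_determined b) mG) => // {A mA sA}.
- by move=> A mA; exact: set_determinedC.
- move=> F mF tF detF.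
  have /choice[g Hg] : forall n, exists g : lfmeasure T -> R,
      measurable_fun setT g /\
      {ae P, forall w, part b (Xi w (F n `&` D)) = g (outside w)}.
    by move=> n; have [g] := detF n; exists g.
  have [|h mh Hh] := @measurable_limit _ (lfmeasure T) R
      (fun n nu => \sum_(k < n) g k nu).
    by move=> n; apply: measurable_sum => k; case: (Hg k).
  exists h => //.
  have : {ae P, forall w, forall n, part b (Xi w (F n `&` D)) = g n (outside w)}.
    by apply/ae_foralln => n; case: (Hg n).
  apply: filterS => w Hw; apply/esym/Hh.
  under eq_fun do under eq_bigr do rewrite -Hw.
  rewrite setI_bigcupl; apply: (@lfm_lsa _ _ _ b (Xi w) (fun n => F n `&` D)).
  + by move=> n; exact: measurableI.
  + exact: trivIset_setIr.
  + by rewrite -setI_bigcupl; case: bD => _; apply: sbounded_sub.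
Qed.

End Determined.

Lemma measure_mono d (R : realFieldType) (T : semiRingOfSetsType d)
    (mu : {content set T -> \bar R}) (A B : set T) :
  measurable A -> measurable B -> A `<=` B -> (mu A <= mu B)%E.
Proof. by move=> mA mB; apply: le_measure; exact/mem_set. Qed.

(** * Reconstruction of a measure from countably many values *)

Section CountableAlgebra.
Context (R : realType) (d : measure_display) (T : measurableType d) (C : (set T)^nat).

Definition code (x : T) (n : nat) : seq bool := [seq `[<C i x>] | i <- iota 0 n].

Lemma size_code x n : size (code x n) = n.
Proof. by rewrite size_map size_iota. Qed.

Lemma code_recr x n : code x n.+1 = rcons (code x n) `[<C n x>].
Proof. by rewrite /code -addn1 iotaD map_cat/= cats1. Qed.

Lemma take_code x m n : (m <= n)%N -> take m (code x n) = code x m.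
Proof. by move=> mn; rewrite /code -map_take take_iota (minn_idPl mn). Qed.

(* The sets [cylinder c], for [c] in a countable type, form the algebra of sets
   generated by the family [C]. *)
Definition cylinder (c : nat * seq (seq bool)) : set T :=
  [set x | code x c.1 \in c.2].

Lemma cylinder_exists n (Q : pred (seq bool)) :
  exists c, cylinder c = [set x | Q (code x n)].
Proof.
exists (n, [seq s <- map (@tval n bool) (enum {: n.-tuple bool}) | Q s]).
apply/seteqP; split => x; rewrite /cylinder/= mem_filter; first by case/andP.
move=> ->/=; apply/mapP; exists (Tuple (introT eqP (size_code x n))) => //.
by rewrite mem_enum.
Qed.

Hypothesis mC : forall n, measurable (C n).

Lemma measurable_code n (Q : pred (seq bool)) : measurable [set x | Q (code x n)].
Proof.
elim: n Q => [|n IH] Q.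
  rewrite (_ : [set x | _] = [set x | Q [::]])//.
  have [q|q] := boolP (Q [::]).
    by rewrite (_ : [set _ | _] = setT)//; apply/seteqP; split.
  by rewrite (_ : [set _ | _] = set0)//; apply/seteqP; split.
rewrite (_ : [set x | _] =
   (C n `&` [set x | Q (rcons (code x n) true)]) `|`
   (~` C n `&` [set x | Q (rcons (code x n) false)])).
  apply: measurableU; apply: measurableI => //; try exact: measurableC.
    exact: (IH (fun s => Q (rcons s true))).
  exact: (IH (fun s => Q (rcons s false))).
apply/seteqP; split => x /=; rewrite code_recr.
  by case: asboolP => Cx; [left|right].
by case: asboolP => Cx [] [].
Qed.

Lemma measurable_cylinder c : measurable (cylinder c).
Proof. exact: (@measurable_code c.1 (fun s => s \in c.2)). Qed.

(** The sets that the algebra approximates in [mu] form a sigma-algebra; for a countable union,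
    continuity from above first reduces to a finite one. *)
Lemma cylinder_approx (mu : {measure set T -> \bar R}) :
  (forall A, measurable A -> mu A \is a fin_num) ->
  <<s range C >> `<=` [set B | measurable B /\ forall e : R, 0 < e ->
    exists c, (mu (B `\` cylinder c) + mu (cylinder c `\` B) < e%:E)%E].
Proof.
(* Arbitrary predicates on membership patterns make complements and unions immediate; two lengths
   are reconciled by reading the longer pattern through [take]. The countable encoding is recovered
   at the end by [cylinder_exists]. *)
move=> mufin; pose S B := forall e : R, 0 < e -> exists n, exists Q : pred (seq bool),
  (mu (B `\` [set x | Q (code x n)]) + mu ([set x | Q (code x n)] `\` B) < e%:E)%E.
suff: <<s range C >> `<=` [set B | measurable B /\ S B].
  move=> H B /H[mB SB]; split => // e /SB [n [Q nQ]].
  by have [c cE] := cylinder_exists n Q; exists c; rewrite cE.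
have SU A B : measurable A -> measurable B -> S A -> S B -> S (A `|` B).
  move=> mA mB SA SB e e0; have e20 : 0 < e / 2 by rewrite divr_gt0.
  have [n [Q nQ]] := SA _ e20; have [m [Q' mQ]] := SB _ e20.
  exists (maxn n m), (fun s => Q (take n s) || Q' (take m s)).
  set E := [set x | Q (code x n)]; set E' := [set x | Q' (code x m)].
  have -> : [set x | Q (take n (code x (maxn n m))) || Q' (take m (code x (maxn n m)))]
      = E `|` E'.
    apply/seteqP; split => x /=; rewrite !take_code ?leq_maxl ?leq_maxr//.
      by move/orP.
    by move=> h; apply/orP.
  have mE : measurable E by exact: measurable_code.
  have mE' : measurable E' by exact: measurable_code.
  rewrite (splitr e) EFinD; apply: le_lt_trans (lteD nQ mQ).
  rewrite addeACA; apply: leeD.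
    rewrite -/E -/E'; apply: (@le_trans _ _ (mu ((A `\` E) `|` (B `\` E')))).
      apply: measure_mono; [|apply: measurableU|].
      - by apply: measurableD; apply: measurableU.
      - exact: measurableD.
      - exact: measurableD.
      - by move=> x [[Ax|Bx] nE]; [left|right]; split => // ?; apply: nE; [left|right].
    by apply: measureU2; exact: measurableD.
  apply: (@le_trans _ _ (mu ((E `\` A) `|` (E' `\` B)))).
    apply: measure_mono; [|apply: measurableU|].
    - by apply: measurableD; apply: measurableU.
    - exact: measurableD.
    - exact: measurableD.
    - by move=> x [[Ax|Bx] nE]; [left|right]; split => // ?; apply: nE; [left|right].
  by apply: measureU2; exact: measurableD.
have S0 : S set0.
  move=> e e0; exists 0%N, pred0.
  rewrite (_ : [set _ | _] = set0); last by apply/seteqP; split.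
  by rewrite set0D measure0 adde0 lte_fin.
apply: smallest_sub; last first.
  move=> _ [i _ <-]; split => // e e0; exists i.+1, (fun s => nth false s i).
  rewrite (_ : [set _ | _] = C i); first by rewrite setDv measure0 adde0 lte_fin.
  apply/seteqP; split => x /=; rewrite code_recr nth_rcons size_code ltnn eqxx.
    by move/asboolP.
  by move=> ?; apply/asboolP.
split.
- by split => //.
- move=> A [mA SA]; rewrite setTD; split; first exact: measurableC.
  move=> e /SA[n [Q nQ]]; exists n, (predC Q).
  rewrite (_ : [set _ | _] = ~` [set x | Q (code x n)]); last first.
    by apply/seteqP; split => x /=; move/negP.
  rewrite !setDE !setCK setIC (setIC _ A) -!setDE addeC.
  exact: nQ.
- move=> F mSF; have mF n : measurable (F n) by case: (mSF n).
  split; first exact: bigcupT_measurable.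
  move=> e e0; have e20 : 0 < e / 2 by rewrite divr_gt0.
  pose U n := \big[setU/set0]_(k < n) F k.
  have mU n : measurable (U n) by exact: bigsetU_measurable.
  have SUn n : S (U n).
    elim: n => [|n IH]; first by rewrite /U big_ord0.
    have -> : U n.+1 = U n `|` F n by rewrite /U big_ord_recr.
    by apply: SU => //; case: (mSF n).
  have mbU : measurable (\bigcup_k F k) by exact: bigcupT_measurable.
  have [N HN] : exists N, (mu (\bigcup_k F k `\` U N) < (e / 2)%:E)%E.
    have H : mu (\bigcup_k F k `\` U n) @[n --> \oo] --> 0%E.
      rewrite -(measure0 mu).
      rewrite (_ : set0 = \bigcap_n (\bigcup_k F k `\` U n)).
        apply: nonincreasing_cvg_mu.
        - by rewrite ltey_eq mufin//; exact: measurableD.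
        - by move=> n; exact: measurableD.
        - by apply: bigcap_measurable => // n _; exact: measurableD.
        - move=> m n mn; apply/subsetPset => x [Fx nU]; split => // Ux; apply: nU.
          by apply: (@subset_bigsetU _ F _ _ mn).
      apply/seteqP; split => // x Hx.
      have [[k _ Fkx] _] := Hx 0%N Logic.I.
      have [_] := Hx k.+1 Logic.I; apply.
      by rewrite /U big_ord_recr/=; right.
    have := H => /fine_cvgP[_]; move/cvgrPdist_lt => /(_ _ e20)[N _ HN].
    exists N; have := HN _ (leqnn N); rewrite /= sub0r normrN ger0_norm ?fine_ge0// => h.
    by rewrite -[X in (X < _)%E]fineK ?lte_fin// mufin//; exact: measurableD.
  have [n [Q nQ]] := SUn N _ e20; exists n, Q.
  set E := [set x | _] in nQ *; have mE : measurable E by exact: measurable_code.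
  rewrite (splitr e) EFinD; apply: le_lt_trans (lteD HN nQ).
  rewrite addeA; apply: leeD.
    apply: (@le_trans _ _ (mu ((\bigcup_k F k `\` U N) `|` (U N `\` E)))).
      apply: measure_mono; [exact: measurableD| |].
        by apply: measurableU; exact: measurableD.
      by move=> x [Fx nE]; have [Ux|nU] := pselect (U N x); [right|left].
    by apply: measureU2; exact: measurableD.
  apply: measure_mono; [exact: measurableD|exact: measurableD|].
  move=> x [Ex nF]; split => // Ux; apply: nF.
  by apply: (@bigsetU_bigcup _ F N).
Qed.

(** The supremum of [m] over the subsets of [A] is attained at the part of [A] in [P], and [P] need
    not belong to the algebra. An algebra set [E] that is close to [P] for [p + n] loses at most
    [p (P minus E) + n (E minus P)], so the countable algebra gives the same supremum. *)
Lemma jordan_pos_sup (p n : {finite_measure set T -> \bar R}) (m : set T -> R)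
    (P A : set T) : measurable = <<s range C >> -> measurable P -> measurable A ->
  (forall B, measurable B -> p B = (m (B `&` P))%:E) ->
  (forall B, measurable B -> n B = (- m (B `&` ~` P))%:E) ->
  (forall B, measurable B -> (m B)%:E = (p B - n B)%E) ->
  (forall c, m (A `&` cylinder c) <= fine (p A)) /\
  (forall e : R, 0 < e -> exists c, fine (p A) - e < m (A `&` cylinder c)).
Proof.
move=> mE mP mA pE nE pnE; split=> [c|e e0].
  have mAc : measurable (A `&` cylinder c).
    by apply: measurableI => //; exact: measurable_cylinder.
  rewrite -lee_fin pnE// fineK ?fin_num_measure//.
  apply: (@le_trans _ _ (p (A `&` cylinder c))); last exact: measure_mono.
  by rewrite leeBlDr ?fin_num_measure// leeDl.
have pnfin B : measurable B -> measure_add p n B \is a fin_num.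
  by move=> mB; rewrite measure_addE fin_numD !fin_num_measure.
have [|_ /(_ e e0)[c hE0]] := cylinder_approx pnfin (t := P); first by rewrite -mE.
have : (measure_add p n (P `\` cylinder c) +
        measure_add p n (cylinder c `\` P) < e%:E)%E := hE0.
rewrite !measure_addE; set E := cylinder c => hE; exists c.
have mE' : measurable E by exact: measurable_cylinder.
have mAE : measurable (A `&` E) by exact: measurableI.
rewrite -lte_fin EFinB fineK ?fin_num_measure// pnE// lteBlDr ?fin_num_measure//.
have pA : (p A <= p (A `&` E) + p (P `\` E))%E.
  have -> : p A = p (A `&` P).
    by rewrite !pE//; [rewrite -setIA setIid|exact: measurableI].
  apply: (@le_trans _ _ (p ((A `&` E) `|` (P `\` E)))).
    apply: measure_mono; first exact: measurableI.
      by apply: measurableU => //; exact: measurableD.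
    by move=> x [Ax Px]; have [Ex|nEx] := pselect (E x); [left|right].
  by apply: measureU2 => //; exact: measurableD.
have nA : (n (A `&` E) <= n (E `\` P))%E.
  have -> : n (A `&` E) = n (A `&` E `&` ~` P).
    rewrite !nE//; last by apply: measurableI => //; exact: measurableC.
    by rewrite -[in RHS](setIA _ (~` P)) setIid.
  apply: measure_mono; [apply: measurableI => //; exact: measurableC|exact: measurableD|].
  by move=> x [[_ Ex] nP].
have mPE : measurable (P `\` E) by exact: measurableD.
have mEP : measurable (E `\` P) by exact: measurableD.
have key : (p (P `\` E) + n (E `\` P) < e%:E)%E.
  apply: le_lt_trans hE; apply: leeD; first exact: leeDl.
  exact: leeDr.
move: pA nA key; rewrite -[p A]fineK ?fin_num_measure//.
rewrite -[p (A `&` E)]fineK ?fin_num_measure// -[n (A `&` E)]fineK ?fin_num_measure//.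
rewrite -[p (P `\` E)]fineK ?fin_num_measure// -[n (E `\` P)]fineK ?fin_num_measure//.
by rewrite -!EFinD !lee_fin !lte_fin; lra.
Qed.

End CountableAlgebra.

Lemma cvge_le_lim (R : realType) (u : nat -> \bar R) (l M : \bar R) :
  u @ \oo --> l -> (forall n, (u n <= M)%E) -> (l <= M)%E.
Proof.
move=> ul uM; rewrite -(cvg_lim _ ul)//; apply: lime_le; last exact: nearW.
by apply/cvg_ex; exists l.
Qed.

Lemma cvge_ge_lim (R : realType) (u : nat -> \bar R) (l M : \bar R) :
  u @ \oo --> l -> (forall n, (M <= u n)%E) -> (M <= l)%E.
Proof.
move=> ul uM; rewrite -(cvg_lim _ ul)//; apply: lime_ge; last exact: nearW.
by apply/cvg_ex; exists l.
Qed.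

(** * Measurable families of finite measures on the line *)

Section RightRegularization.
Context (R : realType).
Local Notation TR := (measurableTypeR R).
Implicit Types (g : rat -> R).

Definition rat_cumulative g : Prop :=
  (forall q r, q <= r -> g q <= g r) /\ exists M, forall q, 0 <= g q <= M.

(* The values at the rationals are almost sure versions, so right continuity has to be restored. *)
Definition right_reg g (y : R) : R := inf [set g q | q in [set q : rat | y < ratr q]].

Lemma rat_gt (y : R) (e : R) : 0 < e -> exists q : rat, y < ratr q < y + e.
Proof.
move=> e0; have ye : y < y + e by rewrite ltrDl.
by have [q] := rat_in_itvoo ye; rewrite in_itv/=; exists q.
Qed.

Lemma right_reg_has_inf g (y : R) : rat_cumulative g ->
  has_inf [set g q | q in [set q : rat | y < ratr q]].
Proof.
move=> [_ [M gM]]; split.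
  by have [q /andP[yq _]] := rat_gt y ltr01; exists (g q); exists q.
by exists 0 => _ [q _ <-]; case/andP: (gM q).
Qed.

Lemma right_reg_le g (y : R) q : rat_cumulative g -> y < ratr q -> right_reg g y <= g q.
Proof.
move=> gc yq; apply: ge_inf; last by exists q.
by case: (right_reg_has_inf y gc).
Qed.

Lemma right_reg_adherent g (y : R) (e : R) : rat_cumulative g -> 0 < e ->
  exists2 q, y < ratr q & g q < right_reg g y + e.
Proof.
move=> gc e0; have [_ [q yq <-] h] := inf_adherent e0 (right_reg_has_inf y gc).
by exists q.
Qed.

Lemma right_reg_nd g : rat_cumulative g -> nondecreasing (right_reg g).
Proof.
move=> gc x y xy; apply: lb_le_inf; first by case: (right_reg_has_inf y gc).
by move=> _ [q yq <-]; apply: right_reg_le => //; exact: le_lt_trans yq.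
Qed.

Lemma right_reg_rc g : rat_cumulative g -> right_continuous (right_reg g).
Proof.
move=> gc x; apply/cvgrPdist_lt => e e0.
have [q xq gq] := right_reg_adherent x gc e0.
near=> y; have xy : x < y by near: y; exact: nbhs_right_gt.
have yq : y < ratr q by near: y; exact: nbhs_right_lt.
rewrite distrC ger0_norm ?subr_ge0; last by apply: right_reg_nd => //; exact: ltW.
by rewrite ltrBlDl (le_lt_trans (right_reg_le gc yq)).
Unshelve. all: by end_near. Qed.

Lemma right_reg_bound g (M : R) (y : R) : rat_cumulative g -> (forall q, 0 <= g q <= M) ->
  0 <= right_reg g y <= M.
Proof.
move=> gc gM; apply/andP; split.
  apply: lb_le_inf; first by case: (right_reg_has_inf y gc).
  by move=> _ [q _ <-]; case/andP: (gM q).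
have [q /andP[yq _]] := rat_gt y ltr01.
by apply: le_trans (right_reg_le gc yq) _; case/andP: (gM q).
Qed.

Lemma right_reg_cvg g (y : R) (q : nat -> rat) : rat_cumulative g ->
  (forall n, y < ratr (q n)) -> (ratr (q n) : R) @[n --> \oo] --> y ->
  g (q n) @[n --> \oo] --> right_reg g y.
Proof.
move=> gc yq qy; apply/cvgrPdist_lt => e e0.
have [r yr gr] := right_reg_adherent y gc e0.
near=> n; have qr : (ratr (q n) : R) < ratr r.
  near: n; apply: (cvgr_lt _ qy) => //.
rewrite distrC ger0_norm ?subr_ge0 ?right_reg_le// ltrBlDl.
by rewrite (le_lt_trans _ gr)//; apply gc.1; rewrite -(@ler_rat R) ltW.
Unshelve. all: by end_near. Qed.

Lemma cumulative_measure g : rat_cumulative g ->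
  exists mu : {finite_measure set TR -> \bar R}, forall a b, a <= b ->
    mu `]a, b]%classic = (right_reg g b - right_reg g a)%:E.
Proof.
move=> gc.
pose H := isCumulative.Build R _ R (right_reg g) (right_reg_nd gc) (right_reg_rc gc).
pose h : cumulative R R := HB.pack (right_reg g) H.
pose mu := lebesgue_stieltjes_measure h.
have muE a b : a <= b -> mu `]a, b]%classic = (right_reg g b - right_reg g a)%:E.
  move=> ab; rewrite /mu/lebesgue_stieltjes_measure/measure_extension.
  rewrite measurable_mu_extE; last exact: is_ocitv.
  exact: (@wlength_itv_bnd _ h a b false false ab).
have [_ [M gM]] := gc.
have mufin : fin_num_fun mu.
  move=> A mA; rewrite ge0_fin_numE//.
  apply: (@le_lt_trans _ _ M%:E); last exact: ltry.
  apply: (@le_trans _ _ (mu setT)).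
    by apply: measure_mono.
  pose I (n : nat) : set TR := `]- n%:R, n%:R]%classic.
  have IT : \bigcup_n I n = setT.
    apply/seteqP; split => // x _; exists (Num.bound `|x|) => //.
    rewrite /I/= in_itv/=; have := archi_boundP (normr_ge0 x).
    by rewrite ltr_norml => /andP[-> /ltW ->].
  have mI n : measurable (I n) by apply: sub_sigma_algebra; exact: is_ocitv.
  have ndI : nondecreasing_seq I.
    move=> m n mn; apply/subsetPset => x; rewrite /I/= !in_itv/= => /andP[h1 h2].
    rewrite (le_lt_trans _ h1) ?lerN2 ?ler_nat//=.
    by rewrite (le_trans h2)// ler_nat.
  have := nondecreasing_cvg_mu mI _ ndI (mu := mu).
  rewrite IT => /(_ measurableT) cvgI.
  suff : (mu (setT : set TR) <= M%:E)%E by [].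
  apply: (cvge_le_lim cvgI) => n.
  have nn : - n%:R <= n%:R :> R by rewrite (@le_trans _ _ 0)// oppr_le0.
  suff : ((right_reg g n%:R - right_reg g (- n%:R))%:E <= M%:E)%E by rewrite -(muE _ _ nn).
  rewrite lee_fin; have /andP[_] := right_reg_bound n%:R gc gM.
  by have /andP[] := right_reg_bound (- n%:R) gc gM; lra.
pose F := Measure_isFinite.Build _ _ _ mu mufin.
exists (HB.pack mu F : {finite_measure set TR -> \bar R}).
exact: muE.
Qed.

End RightRegularization.

Lemma countable_bigcap_measurable d (T : measurableType d) (I : countType)
    (F : I -> set T) : (forall i, measurable (F i)) -> measurable (\bigcap_i F i).
Proof.
move=> mF; rewrite (_ : \bigcap_i F i =
    \bigcap_(n : nat) (if choice.unpickle n is Some i then F i else setT)).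
  by apply: bigcapT_measurable => n; case: choice.unpickle.
apply/seteqP; split => x Fx i _.
  by case: choice.unpickle => // j; exact: Fx.
by have := Fx (choice.pickle i) Logic.I; rewrite choice.pickleK.
Qed.

(** The value [-oo] is allowed in [h] so that an index can be switched off at a given point. [G] is
    chosen before [l]: it is the supremum read as a real number, which carries no information where
    the supremum is infinite. *)
Lemma measurable_ereal_supremum d (V : measurableType d) (R : realType) (I : countType)
    (h : I -> V -> \bar R) : (forall i, measurable_fun setT (h i)) ->
  exists2 G : V -> R, measurable_fun setT G &
    forall v l, (forall i, h i v <= l%:E)%E ->
      (forall e : R, 0 < e -> exists i, ((l - e)%:E < h i v)%E) -> G v = l.
Proof.
move=> mh; pose hh (n : nat) v : \bar R := if choice.unpickle n is Some i then h i v else -oo%E.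
have mhh n : measurable_fun setT (hh n).
  by rewrite /hh; case: choice.unpickle => [i|]; [exact: mh|exact: measurable_cst].
exists (fun v => fine (esups (hh^~ v) 0%N)).
  apply: (measurableT_comp (@fine_measurable R setT measurableT)) => //.
  exact: measurable_fun_esups.
move=> v l hl le; suff -> : esups (hh^~ v) 0%N = l%:E by [].
apply/eqP; rewrite eq_le; apply/andP; split.
  apply: ub_ereal_sup => _ [n _ <-]; rewrite /hh.
  by case: choice.unpickle => [i|]; rewrite ?leNye.
apply/lee_addgt0Pr => e e0; have [i hi] := le e e0.
rewrite -leeBlDr//; apply: (@le_trans _ _ (hh (choice.pickle i) v)).
  by rewrite /hh choice.pickleK -EFinB ltW.
by apply: ereal_sup_ubound; exists (choice.pickle i).
Qed.

Lemma measurable_fin_supremum d (V : measurableType d) (R : realType) (I : countType)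
    (h : I -> V -> R) : (forall i, measurable_fun setT (h i)) ->
  exists2 G : V -> R, measurable_fun setT G &
    forall v l, (forall i, h i v <= l) ->
      (forall e : R, 0 < e -> exists i, l - e < h i v) -> G v = l.
Proof.
move=> mh; have [|G mG HG] := @measurable_ereal_supremum _ V R I (fun i v => (h i v)%:E).
  by move=> i; exact/measurable_EFinP.
by exists G => // v l hl le; apply: HG.
Qed.

Section FiniteMeasureFamily.
Context (R : realType) (d : measure_display) (V : measurableType d).
Local Notation TR := (measurableTypeR R).

Definition centered (n : nat) : set TR := `]- n%:R, n%:R]%classic.

Lemma centered_cover : \bigcup_n centered n = setT.
Proof.
apply/seteqP; split => // x _; exists (Num.bound `|x|) => //.
rewrite /centered/= in_itv/=; have := archi_boundP (normr_ge0 x).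
by rewrite ltr_norml => /andP[-> /ltW ->].
Qed.

Lemma nd_centered : nondecreasing_seq centered.
Proof.
move=> m n mn; apply/subsetPset => x; rewrite /centered/= !in_itv/= => /andP[h1 h2].
rewrite (le_lt_trans _ h1) ?lerN2 ?ler_nat//=.
by rewrite (le_trans h2)// ler_nat.
Qed.

Lemma measurable_oc (a b : R) : measurable (`]a, b]%classic : set TR).
Proof. by apply: sub_sigma_algebra; exact: is_ocitv. Qed.

Lemma measurable_centered n : measurable (centered n).
Proof. exact: measurable_oc. Qed.

Lemma TR_generated : @measurable _ TR = <<s @ocitv R >>.
Proof. by []. Qed.

(** A Dynkin argument from the half-open intervals; the total mass, which complements require, is
    the limit over [centered n]. *)
Lemma measurable_finite_measure_family (mu : V -> {finite_measure set TR -> \bar R}) :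
  (forall a b, a <= b ->
    measurable_fun setT (fun v => fine (mu v `]a, b]%classic))) ->
  forall B, measurable B -> measurable_fun setT (fun v => fine (mu v B)).
Proof.
move=> mab B mB; move: (mB); rewrite TR_generated => sB.
have muf v A : measurable A -> mu v A \is a fin_num by move=> mA; rewrite fin_num_measure.
apply: (@dynkin_induction _ TR (@ocitv R)
  (fun B => measurable_fun setT (fun v => fine (mu v B))) TR_generated) => //.
- exact: ocitvI.
- apply: (@measurable_fun_cvg _ _ _ _ (fun n v => fine (mu v (centered n)))).
    by move=> n; apply: mab; rewrite (@le_trans _ _ 0)// oppr_le0.
  move=> v _; apply: fine_cvg; rewrite fineK ?muf// -centered_cover.
  apply: nondecreasing_cvg_mu; [exact: measurable_centered| |exact: nd_centered].
  by rewrite centered_cover.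
- move=> A /ocitvP[->|[x x12 ->]]; last by apply: mab; exact: ltW.
  by under eq_fun do rewrite measure0; exact: measurable_cst.
- move=> S mS IH.
  rewrite (_ : (fun _ => _) = (fun v => fine (mu v setT) - fine (mu v S))).
    apply: measurable_funB => //.
    apply: (@measurable_fun_cvg _ _ _ _ (fun n v => fine (mu v (centered n)))).
      by move=> n; apply: mab; rewrite (@le_trans _ _ 0)// oppr_le0.
    move=> v _; apply: fine_cvg; rewrite fineK ?muf// -centered_cover.
    apply: nondecreasing_cvg_mu; [exact: measurable_centered| |exact: nd_centered].
    by rewrite centered_cover.
  apply/funext => v; rewrite -(setUv S) measureU// ?setICr//; last exact: measurableC.
  by rewrite fineD ?muf//; [rewrite addrAC subrr add0r|exact: measurableC].
- move=> F mF tF IH.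
  apply: (@measurable_fun_cvg _ _ _ _ (fun n v => \sum_(k < n) fine (mu v (F k)))).
    by move=> n; exact: measurable_sum.
  move=> v _; have mU : measurable (\bigcup_k F k) by exact: bigcupT_measurable.
  have H := measure_semi_sigma_additive F mF tF mU (s := mu v).
  have {}H : fine (\sum_(0 <= i < n) mu v (F i))%E @[n --> \oo] -->
      fine (mu v (\bigcup_k F k)).
    by apply: fine_cvg; rewrite fineK ?muf.
  rewrite (_ : (fun n => _) = (fun n => fine (\sum_(0 <= i < n) mu v (F i))%E))//.
  apply/funext => n; rewrite big_mkord -sum_fine// => i _; exact: muf.
Qed.

(** The distribution function of a finite measure is already right continuous, so regularising its
    values at the rationals gives it back. *)
Lemma right_reg_measure (p : {finite_measure set TR -> \bar R}) (g : rat -> R) :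
  (forall q, (g q)%:E = p `]-oo, ratr q]%classic) ->
  rat_cumulative g /\
  forall y, (right_reg g y)%:E = p `]-oo, y]%classic.
Proof.
move=> gp.
have mI (y : R) : measurable (`]-oo, y]%classic : set TR).
  by have := @measurable_itv R `]-oo, y].
have pf A : measurable A -> p A \is a fin_num by move=> mA; rewrite fin_num_measure.
have pm (y z : R) : y <= z -> (p `]-oo, y]%classic <= p `]-oo, z]%classic)%E.
  move=> yz; apply: measure_mono; [exact: mI|exact: mI|].
  by move=> x; rewrite /= !in_itv/= => /le_trans; apply.
have gc : rat_cumulative g.
  split=> [q r qr|]; first by rewrite -lee_fin !gp; apply: pm; rewrite ler_rat.
  exists (fine (p setT)) => q; rewrite -!lee_fin gp fineK ?pf//; apply/andP; split => //.
  by apply: measure_mono => //; exact: mI.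
split=> // y; apply/eqP; rewrite eq_le; apply/andP; split; last first.
  have pfI z := pf _ (mI z); rewrite -[leLHS]fineK//.
  rewrite lee_fin; apply: lb_le_inf; first by case: (right_reg_has_inf y gc).
  move=> _ [q yq <-]; rewrite -lee_fin gp fineK//.
  by apply: pm; exact: ltW.
pose I (n : nat) : set TR := `]-oo, y + n.+1%:R^-1]%classic.
have II : \bigcap_n I n = `]-oo, y]%classic.
  apply/seteqP; split => x /=; rewrite in_itv/=.
    move=> H; apply/ler_addgt0Pr => e e0.
    have [n ne] : exists n : nat, n.+1%:R^-1 < e.
      have [N _ HN] := near_infty_natSinv_lt (PosNum e0).
      by exists N; exact: (HN N (leqnn _)).
    have := H n Logic.I; rewrite /I/= in_itv/= => /le_trans; apply.
    by rewrite lerD2l ltW.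
  by move=> xy n _; rewrite /I/= in_itv/= (le_trans xy)// lerDl.
have cI : p (I n) @[n --> \oo] --> p `]-oo, y]%classic.
  rewrite -II; apply: nonincreasing_cvg_mu.
  - by rewrite ltey_eq pf//; exact: mI.
  - by move=> n; exact: mI.
  - by rewrite II; exact: mI.
  - move=> m n mn; apply/subsetPset => x; rewrite /I/= !in_itv/= => /le_trans; apply.
    by rewrite lerD2l lef_pV2 ?posrE// ler_nat.
apply: (cvge_ge_lim cI) => n.
have [q /andP[h1 h2]] : exists q : rat, y < ratr q < y + n.+1%:R^-1 by exact: rat_gt.
apply: (@le_trans _ _ (g q)%:E); first by rewrite lee_fin; exact: right_reg_le.
by rewrite gp; apply: pm; exact: ltW.
Qed.

Lemma finite_measure_family (g : rat -> V -> R) :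
  (forall q, measurable_fun setT (g q)) ->
  exists2 mu : V -> {finite_measure set TR -> \bar R},
    (forall B, measurable B -> measurable_fun setT (fun v => fine (mu v B))) &
    forall v (p : {finite_measure set TR -> \bar R}),
      (forall q, (g q v)%:E = p `]-oo, ratr q]%classic) ->
      forall B, measurable B -> mu v B = p B.
Proof.
move=> mg.
(* Off the set [K] of admissible families the values are replaced by 0, so that every [v] receives a
   measure. Monotonicity and boundedness amount to countably many conditions once the bound is an
   integer, whence the measurability of [K]. *)
pose K := [set v | rat_cumulative (g^~ v)].
have mK : measurable K.
  rewrite (_ : K = (\bigcap_(qr : rat * rat) [set v | qr.1 <= qr.2 -> g qr.1 v <= g qr.2 v])
    `&` \bigcup_(M : nat) \bigcap_(q : rat) [set v | 0 <= g q v <= M%:R]).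
    apply: measurableI.
      apply: countable_bigcap_measurable => -[q r]/=.
      have [qr|qr] := boolP (q <= r); last first.
        by rewrite (_ : [set _ | _] = setT)//; apply/seteqP; split.
      rewrite (_ : [set _ | _] = (fun v => g r v - g q v) @^-1` `[0, +oo[); last first.
        by apply/seteqP; split => v /=; rewrite in_itv/= andbT subr_ge0 => //; apply.
      by rewrite -[X in measurable X]setTI; apply: measurable_funB.
    apply: bigcupT_measurable => M; apply: countable_bigcap_measurable => q.
    rewrite (_ : [set _ | _] = g q @^-1` `[0, M%:R]); last first.
      by apply/seteqP; split => v /=; rewrite in_itv.
    by rewrite -[X in measurable X]setTI; apply: mg.
  apply/seteqP; split => v.
    move=> [nd [M gM]]; split => [[q r] _ /=|]; first exact: nd.
    exists (Num.bound `|M|) => // q _; have /andP[g0 gM'] := gM q.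
    rewrite /= g0/= (le_trans gM')// (le_trans (ler_norm _))// ltW//.
    exact: archi_boundP.
  move=> [nd [M _ gM]]; split; last by exists M%:R => q; exact: gM.
  by move=> q r; exact: (nd (q, r) Logic.I).
pose gg v q := if v \in K then g q v else 0.
have gc v : rat_cumulative (gg v).
  rewrite /gg; have [vK|vK] := boolP (v \in K); first exact: (set_mem vK).
  by split=> [//|]; exists 0 => q; rewrite lexx.
have mgg q : measurable_fun setT (gg^~ q).
  rewrite (_ : gg^~ q = (fun v => g q v * \1_K v)).
    by apply: measurable_funM => //; exact: measurable_indic.
  apply/funext => v; rewrite /gg indicE; case: (v \in K); by rewrite ?mulr1 ?mulr0.
have mreg (y : R) : measurable_fun setT (fun v => right_reg (gg v) y).
  have /choice[q Hq] : forall n : nat, exists q : rat, y < ratr q < y + n.+1%:R^-1.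
    by move=> n; exact: rat_gt.
  have qy : (ratr (q n) : R) @[n --> \oo] --> y.
    apply/cvgrPdist_lt => e e0; near=> n; have /andP[h1 h2] := Hq n.
    rewrite distrC ger0_norm ?subr_ge0 ?ltW// ltrBlDl (lt_le_trans h2)// lerD2l ltW//.
    by near: n; exact: (near_infty_natSinv_lt (PosNum e0)).
  apply: (@measurable_fun_cvg _ _ _ _ (fun n v => gg v (q n))) => // v _.
  by apply: right_reg_cvg => // n; case/andP: (Hq n).
have /choice[mu Hmu] := fun v => cumulative_measure (gc v).
exists mu.
  apply: measurable_finite_measure_family => a b ab.
  under eq_fun do rewrite Hmu//=.
  exact: measurable_funB.
move=> v p gp; have [vc regp] := right_reg_measure gp.
have ggv : gg v = g^~ v by apply/funext => q; rewrite /gg mem_set.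
have mI (y : R) : measurable (`]-oo, y]%classic : set TR).
  by have := @measurable_itv R `]-oo, y].
apply: (@measure_unique _ _ TR (@ocitv R) centered) => //.
- exact: ocitvI.
- by move=> n; exact: is_ocitv.
- exact: centered_cover.
- move=> A /ocitvP[->|[x x12 ->]]; first by rewrite !measure0.
  apply: (etrans (Hmu v _ _ (ltW x12))); rewrite ggv EFinB !regp.
  rewrite (_ : `]-oo, x.2]%classic = `]-oo, x.1]%classic `|` `]x.1, x.2]%classic :> set TR).
    rewrite (measureU p (mI x.1) (measurable_oc x.1 x.2)).
      have pfI : p `]-oo, x.1]%classic \is a fin_num by exact: fin_num_measure.
      by rewrite addeAC subee// add0e.
    apply/seteqP; split => // y [] /=; rewrite !in_itv/= => h1 /andP[h2 _].
    by move: h1; rewrite leNgt h2.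
  by rewrite -itv_bndbnd_setU// bnd_simp ltW.
- by move=> n; rewrite ltey_eq fin_num_measure//; exact: measurable_centered.
Unshelve. all: by end_near. Qed.

End FiniteMeasureFamily.

Lemma lfmeasure_eq (R : realType) (disp : measure_display)
    (T : physicalSpaceType R disp) (mu nu : lfmeasure T) :
  (forall A, mu A = nu A) -> mu = nu.
Proof.
case: mu nu => [m m0 mS] [n n0 nS] /= /funext mn; move: m0 mS; rewrite mn => m0 mS.
by congr LFMeasure; exact: Prop_irrelevance.
Qed.

Section RationalRays.
Context (R : realType).
Local Notation TR := (measurableTypeR R).

Definition rational_ray (n : nat) : set TR :=
  if choice.unpickle n is Some q then `]-oo, ratr (q : rat)]%classic else set0.

Lemma measurable_ray (y : R) : measurable (`]-oo, y]%classic : set TR).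
Proof. by have := @measurable_itv R `]-oo, y]. Qed.

Lemma measurable_rational_ray n : measurable (rational_ray n).
Proof. by rewrite /rational_ray; case: choice.unpickle => // q; exact: measurable_ray. Qed.

Lemma rational_ray_generates : @measurable _ TR = <<s range rational_ray >>.
Proof.
apply/seteqP; split; last first.
  apply: smallest_sub; first exact: sigma_algebra_measurable.
  by move=> _ [n _ <-]; exact: measurable_rational_ray.
have sG := @smallest_sigma_algebra TR setT (range rational_ray).
have [s0 sC sU] := sG.
have sI (F : (set TR)^nat) : (forall n, <<s range rational_ray >> (F n)) ->
    <<s range rational_ray >> (\bigcap_n F n).
  move=> sF; rewrite -[X in _ X]setCK setC_bigcap -setTD; apply: (sC).
  by apply: (sU) => n; rewrite -setTD; apply: (sC).
have ray (y : R) : <<s range rational_ray >> (`]-oo, y]%classic : set TR).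
  have /choice[q Hq] : forall n : nat, exists q : rat, y < ratr q < y + n.+1%:R^-1.
    by move=> n; exact: rat_gt.
  rewrite (_ : `]-oo, y]%classic = \bigcap_n rational_ray (choice.pickle (q n))).
    by apply: (sI) => n; apply: sub_sigma_algebra; exists (choice.pickle (q n)).
  apply/seteqP; split => x /=; rewrite in_itv/=.
    move=> xy n _; rewrite /rational_ray choice.pickleK/= in_itv/= (le_trans xy)//.
    by case/andP: (Hq n) => /ltW.
  move=> H; apply/ler_addgt0Pr => e e0.
  have [N _ HN] := near_infty_natSinv_lt (PosNum e0).
  have := H N Logic.I; rewrite /rational_ray choice.pickleK/= in_itv/= => xq.
  have /andP[_ qN] := Hq N; apply: (le_trans xq); apply: (le_trans (ltW qN)).
  by rewrite lerD2l; apply: ltW; exact: (HN N (leqnn _)).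
apply: smallest_sub => // _ [[a b] _ <-]/=.
rewrite (_ : `]a, b]%classic = ~` (`]-oo, a]%classic `|` ~` `]-oo, b]%classic)).
  rewrite -setTD; apply: (sC); rewrite -bigcup2E; apply: (sU) => -[|[|n]]/=.
  - exact: ray.
  - by rewrite -setTD; apply: (sC); exact: ray.
  - exact: s0.
apply/seteqP; split => x /=; rewrite !in_itv/=.
  by move=> /andP[ax xb] []; [rewrite leNgt ax|].
move=> /not_orP[/negP]; rewrite -ltNge => -> /contrapT -> //.
Qed.

End RationalRays.

(** * Almost sure reconstruction of the restriction to [D] *)

Section Reconstruction.
Context (R : realType) (disp : measure_display) (T : physicalSpaceType R disp)
  (dO : measure_display) (Omega : measurableType dO) (P : probability Omega R)
  (Xi : {mfun Omega >-> lfmeasure T}).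
Local Notation TR := (measurableTypeR R).
Variables (D : set T) (mD : measurable D).
Hypothesis bD : bmeasurable D.
Variables (iota : T -> TR) (j : TR -> T).
Hypotheses (miota : measurable_fun setT iota) (mj : measurable_fun setT j)
  (iotaK : cancel iota j).
Hypothesis det : forall b A, measurable A -> set_determined P Xi mD b A.

Let sgn (s : bool) : R := if s then 1 else -1.

Let mpre (B : set TR) : measurable B -> measurable (iota @^-1` B).
Proof. by move=> mB; rewrite -[X in measurable X]setTI; exact: miota. Qed.

Let image_jordan b w : exists p n : {finite_measure set TR -> \bar R},
  exists2 Q : set TR, measurable Q &
  let m B := part b (Xi w (iota @^-1` B `&` D)) in
  forall B, measurable B ->
  [/\ p B = (m (B `&` Q))%:E, n B = (- m (B `&` ~` Q))%:E & (m B)%:E = (p B - n B)%E].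
Proof.
have [m mE] := lsa_charge (@lfm_lsa _ _ _ b (Xi w)) bD.
pose c0 (B : set TR) : \bar R := m (iota @^-1` B).
have mfin : fin_num_fun c0.
  by move=> B mB; apply: fin_num_measure; exact: mpre.
have msa : semi_sigma_additive c0.
  move=> F mF tF mU; rewrite /c0 preimage_bigcup; apply: charge_semi_sigma_additive.
  - by move=> n; exact: (mpre (mF n)).
  - apply/trivIsetP => /= i k _ _ ik; rewrite -preimage_setI.
    by move/trivIsetP : tF => /(_ _ _ _ _ ik) ->//; rewrite preimage_set0.
  - by rewrite -preimage_bigcup; exact: (mpre mU).
have m0 : c0 set0 = 0%E by rewrite /c0 preimage_set0 charge0.
pose C := isCharge.Build _ _ _ c0 m0 mfin msa.
pose c : {charge set TR -> \bar R} := HB.pack c0 C.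
have [p [n [Q mQ H]]] := jordan_measures c.
exists p, n, Q => // m1 B mB; rewrite /m1; have [E1 E2 E3] := H B mB.
by split; [rewrite E1|rewrite E2|rewrite -E3]; rewrite /c/= /c0 mE.
Qed.

(** By [jordan_pos_sup], the supremum over [c] of the transported measure on these sets is the mass
    that its positive part gives to the ray ending at [q]. *)
Let ray_sets (q : rat) (c : nat * seq (seq bool)) : set TR :=
  `]-oo, ratr q]%classic `&` cylinder (@rational_ray R) c.

Let measurable_ray_sets q c : measurable (ray_sets q c).
Proof.
apply: measurableI; first exact: measurable_ray.
by apply: measurable_cylinder; exact: measurable_rational_ray.
Qed.

(** The sign [s] selects the positive or the negative part. The Jordan decomposition is quantified
    inside the almost sure event: it is chosen separately for each [w], and only the countably many
    identities for the pairs [(q, c)] have to hold simultaneously. *)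
Let reconstructed_part b (s : bool) :
  exists2 mu : lfmeasure T -> {finite_measure set TR -> \bar R},
    (forall B, measurable B -> measurable_fun setT (fun v => fine (mu v B))) &
    {ae P, forall w, forall p n : {finite_measure set TR -> \bar R}, forall Q : set TR,
      let m B := sgn s * part b (Xi w (iota @^-1` B `&` D)) in
      measurable Q -> (forall B, measurable B ->
        [/\ p B = (m (B `&` Q))%:E, n B = (- m (B `&` ~` Q))%:E &
            (m B)%:E = (p B - n B)%E]) ->
      forall B, measurable B -> mu (outside Xi mD w) B = p B}.
Proof.
have /choice[G HG] : forall qc : rat * (nat * seq (seq bool)),
    exists G : lfmeasure T -> R, measurable_fun setT G /\
    {ae P, forall w, part b (Xi w (iota @^-1` (ray_sets qc.1 qc.2) `&` D)) =
      G (outside Xi mD w)}.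
  move=> [q c]; have [G mG HG] := det b (mpre (measurable_ray_sets q c)).
  by exists G.
have /choice[g Hg] : forall q : rat, exists g : lfmeasure T -> R,
    measurable_fun setT g /\
    forall v l, (forall c, sgn s * G (q, c) v <= l) ->
      (forall e, 0 < e -> exists c, l - e < sgn s * G (q, c) v) -> g v = l.
  move=> q; have [|g mg Hg] := @measurable_fin_supremum _ (lfmeasure T) R
      (nat * seq (seq bool))%type (fun c v => sgn s * G (q, c) v).
    by move=> c; apply: measurable_funM => //; case: (HG (q, c)).
  by exists g.
have [|mu mmu Hmu] := @finite_measure_family R _ (lfmeasure T) g.
  by move=> q; case: (Hg q).
exists mu => //.
have : {ae P, forall w, forall n, if choice.unpickle n is Some qc then
    part b (Xi w (iota @^-1` (ray_sets qc.1 qc.2) `&` D)) = G qc (outside Xi mD w)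
    else True}.
  apply/ae_foralln => n; case: choice.unpickle => [qc|]; last exact: aeW.
  by case: (HG qc).
apply: filterS => w Hw p n Q mQ H.
pose m B := sgn s * part b (Xi w (iota @^-1` B `&` D)).
apply: Hmu => q.
have pE B : measurable B -> p B = (m (B `&` Q))%:E by move=> /H[].
have nE B : measurable B -> n B = (- m (B `&` ~` Q))%:E by move=> /H[].
have pnE B : measurable B -> (m B)%:E = (p B - n B)%E by move=> /H[].
have [ub adh] := jordan_pos_sup (@measurable_rational_ray R)
  (rational_ray_generates R) mQ (measurable_ray (ratr q)) pE nE pnE.
rewrite -[RHS]fineK; last by rewrite fin_num_measure//; exact: measurable_ray.
have GE c : sgn s * G (q, c) (outside Xi mD w) = m (ray_sets q c).
  by have := Hw (choice.pickle (q, c)); rewrite choice.pickleK => <-.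
congr EFin; have [_] := Hg q; apply.
  by move=> c; rewrite GE; exact: ub.
by move=> e e0; have [c hc] := adh e e0; exists c; rewrite GE.
Qed.

Lemma reconstruction : determined_by_outside P Xi mD.
Proof.
have /choice[mu Hmu] : forall bs : bool * bool,
    exists mu : lfmeasure T -> {finite_measure set TR -> \bar R},
    (forall B, measurable B -> measurable_fun setT (fun v => fine (mu v B))) /\
    {ae P, forall w, forall p n : {finite_measure set TR -> \bar R}, forall Q : set TR,
      let m B := sgn bs.2 * part bs.1 (Xi w (iota @^-1` B `&` D)) in
      measurable Q -> (forall B, measurable B ->
        [/\ p B = (m (B `&` Q))%:E, n B = (- m (B `&` ~` Q))%:E &
            (m B)%:E = (p B - n B)%E]) ->
      forall B, measurable B -> mu (outside Xi mD w) B = p B}.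
  by move=> [b s]; have [mu mmu H] := reconstructed_part b s; exists mu.
have mjpre (A : set T) : measurable A -> measurable (j @^-1` A).
  by move=> mA; rewrite -[X in measurable X]setTI; exact: mj.
(* The recovered measures live on the line. Pulling back by [j] returns to the original space
   because, by [iotaK], the preimage under [iota] of the preimage of [A] under [j] is [A]. *)
pose val b v A : R := fine (mu (b, true) v (j @^-1` A)) - fine (mu (b, false) v (j @^-1` A)).
pose f v A : R[i] := if `[< bmeasurable A >] then val true v A +i* val false v A else 0.
have fpart b v A : bmeasurable A -> part b (f v A) = val b v A.
  by move=> bA; rewrite /f; case: asboolP => // _; case: b.
have f0 v A : ~ bmeasurable A -> f v A = 0 by rewrite /f; case: asboolP.
have fS v (F : (set T)^nat) : (forall n, measurable (F n)) -> trivIset setT F ->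
    sbounded (\bigcup_n F n) -> ccvg (fun n => \sum_(k < n) f v (F k)) (f v (\bigcup_n F n)).
  move=> mF tF bF.
  have bFn n : bmeasurable (F n).
    by split => //; apply: sbounded_sub bF; exact: bigcup_sup.
  have bU : bmeasurable (\bigcup_n F n) by split => //; exact: bigcupT_measurable.
  suff H b : part b (\sum_(k < n) f v (F k)) @[n --> \oo] --> part b (f v (\bigcup_n F n)).
    by split; [exact: (H true)|exact: (H false)].
  rewrite fpart// (_ : (fun n => _) = (fun n =>
      \sum_(k < n) fine (mu (b, true) v (j @^-1` F k)) -
      \sum_(k < n) fine (mu (b, false) v (j @^-1` F k)))); last first.
    apply/funext => n; rewrite part_sum -sumrB.
    by apply: eq_bigr => k _; rewrite fpart.
  have K (p : {finite_measure set TR -> \bar R}) :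
      (\sum_(k < n) fine (p (j @^-1` F k))) @[n --> \oo] -->
      fine (p (j @^-1` \bigcup_n F n)).
    have mU : measurable (\bigcup_n (j @^-1` F n)).
      by apply: bigcupT_measurable => n; exact: mjpre.
    have tj : trivIset setT (fun n => j @^-1` F n).
      apply/trivIsetP => /= i k _ _ ik; rewrite -preimage_setI.
      by move/trivIsetP : tF => /(_ _ _ _ _ ik) ->//; rewrite preimage_set0.
    have := @measure_semi_sigma_additive _ _ _ p (fun n => j @^-1` F n)
      (fun n => mjpre _ (mF n)) tj mU.
    move=> H; have {}H : fine (\sum_(0 <= i < n) p (j @^-1` F i))%E @[n --> \oo] -->
        fine (p (\bigcup_n (j @^-1` F n))).
      by apply: fine_cvg; rewrite fineK ?fin_num_measure.
    rewrite preimage_bigcup (_ : (fun n => _) =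
      (fun n => fine (\sum_(0 <= i < n) p (j @^-1` F i))%E))//.
    apply/funext => n; rewrite big_mkord -sum_fine// => i _.
    by rewrite fin_num_measure//; exact: mjpre.
  by apply: cvgB; exact: K.
pose F v : lfmeasure T := LFMeasure (f0 v) (fS v).
have mF : measurable_fun setT F.
  apply: measurable_fun_lfmeasure => b A bA; rewrite /F/=.
  under eq_fun do rewrite fpart//.
  have [mA _] := bA.
  by apply: measurable_funB; [case: (Hmu (b, true))|case: (Hmu (b, false))] => H _;
    apply: H; exact: mjpre.
pose MF := isMeasurableFun.Build _ _ _ _ F mF.
exists (HB.pack F MF : {mfun lfmeasure T >-> lfmeasure T}).
have : {ae P, forall w, forall b A, bmeasurable A ->
    part b (Xi w (A `&` D)) = val b (outside Xi mD w) A}.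
  have Hb b : {ae P, forall w, forall A, bmeasurable A ->
      part b (Xi w (A `&` D)) = val b (outside Xi mD w) A}.
    have [_ H1] := Hmu (b, true); have [_ H2] := Hmu (b, false).
    apply: filterS2 H1 H2 => w H1 H2 A [mA bA].
    have [p [n [Q mQ H]]] := image_jordan b w.
    rewrite /val (H1 p n Q)//; last 2 first.
    - by move=> B mB; rewrite /= !mul1r; exact: H.
    - exact: mjpre.
    (* For the opposite sign the two parts exchange their roles, and the positive set is the
       complement of [Q]. *)
    rewrite (H2 n p (~` Q))//; last 3 first.
    - exact: measurableC.
    - move=> B mB; rewrite /= !mulN1r setCK !opprK; have [-> -> E] := H B mB.
      split => //; rewrite EFinN E.
      have [-> -> _] := H B mB.
      by rewrite -EFinB -!EFinN -EFinD; congr EFin; lra.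
    - exact: mjpre.
    have [_ _ E] := H _ (mjpre _ mA).
    apply: EFin_inj; rewrite EFinB !fineK ?fin_num_measure//; try exact: mjpre.
    rewrite -E; congr (part b (Xi w _))%:E; congr (_ `&` _).
    by apply/seteqP; split => x /=; rewrite iotaK.
  by apply: filterS2 (Hb true) (Hb false) => w h1 h2 [].
apply: filterS => w Hw; apply: lfmeasure_eq => A; rewrite /=/f -/(outside Xi mD w).
case: asboolP => // bA.
have := Hw true A bA; have := Hw false A bA; rewrite /part.
by case: (Xi w (A `&` D)) => x y /= -> ->.
Qed.

End Reconstruction.

(** * From complements of balls to the tail sigma field *)

Section Tail.
Context (R : realType) (disp : measure_display) (T : physicalSpaceType R disp).
Implicit Types (mu nu : lfmeasure T) (D : set T).

Lemma lfm_add_default mu nu A : ~ bmeasurable A -> mu A + nu A = 0.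
Proof. by move=> nA; rewrite !lfm_default// addr0. Qed.

Lemma lfm_add_sigma_additive mu nu (F : (set T)^nat) :
  (forall n, measurable (F n)) -> trivIset setT F -> sbounded (\bigcup_n F n) ->
  ccvg (fun n => \sum_(k < n) (mu (F k) + nu (F k)))
    (mu (\bigcup_n F n) + nu (\bigcup_n F n)).
Proof.
move=> mF tF bF.
suff H b : part b (\sum_(k < n) (mu (F k) + nu (F k))) @[n --> \oo] -->
    part b (mu (\bigcup_n F n) + nu (\bigcup_n F n)).
  by split; [exact: (H true)|exact: (H false)].
rewrite partD (_ : (fun n => _) = (fun n => \sum_(k < n) part b (mu (F k)) +
    \sum_(k < n) part b (nu (F k)))).
  by apply: cvgD; exact: lfm_lsa.
by apply/funext => n; rewrite part_sum -big_split/=; apply: eq_bigr => k _; rewrite partD.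
Qed.

Definition lfm_add mu nu : lfmeasure T :=
  LFMeasure (@lfm_add_default mu nu) (@lfm_add_sigma_additive mu nu).

Lemma lfm_restrict_split D (mD : measurable D) mu :
  mu = lfm_add (lfm_restrict mD mu) (lfm_restrict (measurableC mD) mu).
Proof.
apply: lfmeasure_eq => A; rewrite /lfm_add/=; case: asboolP => bA; last first.
  by rewrite lfm_default// addr0.
suff H b : part b (mu A) = part b (mu (A `&` D) + mu (A `&` ~` D)).
  have := H true; have := H false; rewrite /part.
  by case: (mu A) (_ + _) => x y [x' y'] /= -> ->.
have [m mE] := lsa_charge (@lfm_lsa _ _ _ b mu) bA.
rewrite partD; apply: EFin_inj; rewrite EFinD.
have := mE setT; rewrite setTI => <-.
rewrite (setIC A D) (setIC A (~` D)) -!mE -chargeU// ?setUv//.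
- exact: measurableC.
- by rewrite setICr.
Qed.

Lemma lfm_restrict_comp D D' (mD : measurable D) (mD' : measurable D') mu :
  D `<=` D' -> lfm_restrict mD (lfm_restrict mD' mu) = lfm_restrict mD mu.
Proof.
move=> DD'; apply: lfmeasure_eq => A; rewrite /=; case: asboolP => // bA.
have bAD : bmeasurable (A `&` D).
  by case: bA => mA sA; split; [exact: measurableI|apply: sbounded_sub sA].
by case: asboolP => // _; rewrite -setIA; move/setIidPl : DD' => ->.
Qed.

Context (dO : measure_display) (Omega : measurableType dO) (P : probability Omega R)
  (Xi : {mfun Omega >-> lfmeasure T}).

Local Notation ball n := (@measurable_sball R disp T n%:R).

Lemma determined_by_outside_tail :
  (forall n, determined_by_outside P Xi (ball n)) -> determined_by_tail P Xi.
Proof.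
move=> det E mE.
have /choice[F HF] := det.
pose rho n := lfm_restrict (measurableC (ball n)) : lfmeasure T -> lfmeasure T.
pose H n nu := lfm_add (F n nu) nu.
have mH n : measurable_fun setT (H n).
  apply: measurable_fun_lfmeasure => b A bA; rewrite /H/=.
  under eq_fun do rewrite partD.
  apply: measurable_funD; last exact: measurable_evaluation.
  apply: (measurableT_comp (measurable_evaluation b A)).
  exact: measurable_funPT.
pose B n := H n @^-1` E.
have mB n : measurable (B n) by rewrite -[X in measurable X]setTI; exact: mH.
pose A : set Omega := \bigcap_m \bigcup_(n in [set n | (m <= n)%N]) ((rho n \o Xi) @^-1` (B n)).
exists A.
  move=> k /= k0.
  (* Dropping the indices below [k] does not change the upper limit, and for [n >= k] the
     restriction outside radius [n] factors through the restriction outside radius [k]. *)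
  exists (\bigcap_m \bigcup_(n in [set n | (maxn k m <= n)%N]) (rho n @^-1` (B n))).
    apply: bigcapT_measurable => m; apply: bigcup_measurable => n _.
    by rewrite -[X in measurable X]setTI; apply: measurable_lfm_restrict.
  have rhok n w : (k <= n)%N -> rho n (rho k (Xi w)) = rho n (Xi w).
    move=> kn; apply: lfm_restrict_comp => x /= + xk; apply.
    by rewrite (le_trans xk)// ler_nat.
  rewrite setTI; apply/seteqP; split => w Hw m _.
    have [n /= mn Bn] := Hw m Logic.I; have := mn; rewrite geq_max => /andP[kn mn'].
    by exists n => //=; move: Bn; rewrite /preimage/= rhok.
  have [n /= mn Bn] := Hw (maxn k m) Logic.I.
  have := mn; rewrite geq_max => /andP[kn mn'].
  by exists n => //=; rewrite rhok.
have : {ae P, forall w, forall n, Xi w = H n (rho n (Xi w))}.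
  apply/ae_foralln => n; apply: filterS (HF n) => w Hw.
  by rewrite {1}(lfm_restrict_split (ball n) (Xi w)) Hw.
apply: negligibleS => w /= Hw Hn; case: Hw => -[].
  move=> Ew; apply => m _; exists m => //=.
  by rewrite /B/= -Hn.
move=> Aw; apply; have [n _] := Aw 0%N Logic.I.
by rewrite /B/= -Hn.
Qed.

End Tail.

(** * Reduction to a pi-system of approximable sets *)

Section Criterion.
Context (R : realType) (disp : measure_display) (T : physicalSpaceType R disp)
  (dO : measure_display) (Omega : measurableType dO) (P : probability Omega R)
  (Xi : {mfun Omega >-> lfmeasure T}).

Definition approximable (D A : set T) : Prop :=
  exists (f : nat -> T -> R) (B : R),
  [/\ forall n, exists K, exists2 B' : R, bmeasurable K & bounded_mfun K B' (f n),
      forall n x, D x -> `|f n x| <= B,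
      forall x, D x -> f n x @[n --> \oo] --> (\1_A x : R) &
      forall n, variance_of P Xi (f n) <= 2^-1 ^+ n].

Lemma determined_by_outside_criterion (G : set (set T))
    (iota : T -> measurableTypeR R) (j : measurableTypeR R -> T)
    (D : set T) (mD : measurable D) :
  locally_square_integrable P Xi -> sbounded D ->
  @measurable _ T = <<s G >> -> setI_closed G -> G setT ->
  measurable_fun setT iota -> measurable_fun setT j -> cancel iota j ->
  (forall A, G A -> approximable D A) ->
  determined_by_outside P Xi mD.
Proof.
move=> Xi2 bD mG GI GT miota mj iotaK appr.
have detG b A : G A -> set_determined P Xi mD b A.
  move=> GA; have [f [B [fK fB fA fV]]] := appr A GA.
  apply: (@set_determined_approx _ _ _ _ _ _ _ Xi2 D mD (conj mD bD) b A f B) => //.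
  by rewrite mG; exact: sub_sigma_algebra.
apply: (reconstruction (conj mD bD) miota mj iotaK) => b A mA.
apply: (all_set_determined (conj mD bD) mG GI) => //.
  exact: detG.
by move=> A' /detG.
Qed.

End Criterion.

Lemma countable_bigcup_measurable d (T : measurableType d) (I : countType)
    (F : I -> set T) : (forall i, measurable (F i)) -> measurable (\bigcup_i F i).
Proof.
move=> mF; rewrite -[X in measurable X]setCK setC_bigcup; apply: measurableC.
by apply: countable_bigcap_measurable => i; exact: measurableC.
Qed.

(** * Borel sets and Lebesgue measure of R^d *)

Section RdBorel.
Context (R : realType) (d : nat).

Definition rational_box (c : 'rV[rat]_d * nat) : set (Rd R d) :=
  [set y | forall i, `|ratr (c.1 0 i) - (y : 'rV[R]_d) 0 i| < c.2.+1%:R^-1].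

(** Second countability with explicit rational cubes. It allows measurability of a map into R^d to
    be checked on coordinates, although the sigma-algebra is generated by the open sets of
    matrices. *)
Lemma open_rational_boxes (U : set 'rV[R]_d) : open U ->
  U = \bigcup_c (if `[< rational_box c `<=` U >] then rational_box c else set0).
Proof.
move=> oU; apply/seteqP; split => [x Ux|x [c _]]; last first.
  by case: asboolP => [H|_]; [exact: H|].
have /nbhs_ballP[e /= e0 xeU] : nbhs x U by exact: open_nbhs_nbhs.
have [N _ HN] := near_infty_natSinv_lt (PosNum (divr_gt0 e0 (ltr0n R 2))).
have {HN} Ne : N.+1%:R^-1 < e / 2 by exact: (HN N (leqnn _)).
have N0 : 0 < N.+1%:R^-1 :> R by rewrite invr_gt0.
have /choice[q Hq] : forall i : 'I_d, exists q : rat, `|ratr q - x 0 i| < N.+1%:R^-1.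
  move=> i; have [q /andP[q1 q2]] := rat_gt (x 0 i) N0; exists q.
  by rewrite ger0_norm ?subr_ge0 ?ltW// ltrBlDl.
exists (\row_i q i, N) => //; case: asboolP => [_|[]] /=.
  by move=> i; rewrite mxE.
move=> y Hy; apply: xeU; split => // i k; rewrite ord1.
have := Hy k; have := Hq k; rewrite /= mxE => h1 h2.
rewrite /ball/= (splitr e) (_ : x 0 k - y 0 k = - (ratr (q k) - x 0 k) + (ratr (q k) - y 0 k)).
  rewrite (le_lt_trans (ler_normD _ _))// normrN ltrD//; exact: lt_trans Ne.
by lra.
Qed.

Lemma measurable_coord (i : 'I_d) :
  measurable_fun setT (fun x : Rd R d => (x : 'rV[R]_d) 0 i).
Proof.
apply: (measurability _ (measurable_realfun.RGenOpens.measurableE R)).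
move=> _ [_ [a [b ->]] <-]; rewrite setTI; apply: sub_sigma_algebra.
have /continuousP := @coord_continuous R 1 d 0 i; apply.
exact: interval_open.
Qed.

Lemma measurable_fun_Rd dX (X : measurableType dX) (f : X -> Rd R d) :
  (forall i, measurable_fun setT (fun x => (f x : 'rV[R]_d) 0 i)) ->
  measurable_fun setT f.
Proof.
move=> mf; apply: (@measurability _ _ X (Rd R d) setT f (@open 'rV[R]_d)) => //.
move=> _ [U oU <-]; rewrite setTI (open_rational_boxes oU) preimage_bigcup.
apply: countable_bigcup_measurable => c; case: asboolP => _; last by rewrite preimage_set0.
rewrite (_ : f @^-1` _ = \bigcap_(i : 'I_d)
  [set x | `|ratr (c.1 0 i) - (f x : 'rV[R]_d) 0 i| < c.2.+1%:R^-1]); last first.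
  by apply/seteqP; split => x H i; [move=> _; exact: H|exact: (H i Logic.I)].
apply: countable_bigcap_measurable => i.
rewrite (_ : [set x | _] = (fun x => `|ratr (c.1 0 i) - (f x : 'rV[R]_d) 0 i|) @^-1`
  `]-oo, c.2.+1%:R^-1[); last by apply/seteqP; split => x /=; rewrite in_itv.
rewrite -[X in measurable X]setTI.
apply: (measurableT_comp (@normr_measurable _ setT)) => //.
exact: measurable_funB.
Qed.

(** A coordinate sent to [None] is unconstrained. This puts the whole space among the orthants, as
    complements in the Dynkin argument require. *)
Definition orthant (a : 'I_d -> option R) : set (Rd R d) :=
  [set x | forall i, if a i is Some c then (x : 'rV[R]_d) 0 i <= c else true].

Definition orthants : set (set (Rd R d)) := range orthant.

Lemma orthants_setI : setI_closed orthants.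
Proof.
move=> _ _ [a _ <-] [b _ <-].
exists (fun i => match a i, b i with
  | Some x, Some y => Some (Num.min x y) | Some x, None => Some x | None, o => o end) => //.
apply/seteqP; split => x /=.
  move=> H; split => i; have := H i; case: (a i) => [u|]; case: (b i) => [v|]//;
    by rewrite le_min => /andP[].
move=> [Ha Hb] i; have := Ha i; have := Hb i.
by case: (a i) => [u|]; case: (b i) => [v|]// h1 h2; rewrite le_min h1 h2.
Qed.

Lemma orthants_setT : orthants setT.
Proof. by exists (fun=> None) => //; apply/seteqP; split. Qed.

(** For the harder inclusion, the identity map from the sigma-algebra generated by the orthants to
    the Borel one is measurable because its coordinates are. *)
Lemma orthants_generate : @measurable _ (Rd R d) = <<s orthants >>.
Proof.
apply/seteqP; split; last first.
  apply: smallest_sub; first exact: sigma_algebra_measurable.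
  move=> _ [a _ <-].
  have -> : orthant a = \bigcap_(i : 'I_d)
      [set x | if a i is Some c then (x : 'rV[R]_d) 0 i <= c else true].
    apply/seteqP; split => x H i; first by move=> _; have := H i; rewrite /=; case: (a i).
    by have := H i Logic.I; rewrite /=; case: (a i).
  apply: countable_bigcap_measurable => i; case: (a i) => [c|]; last first.
    rewrite (_ : [set _ | _] = setT); first exact: measurableT.
    by apply/seteqP; split.
  rewrite (_ : [set x | _] = (fun x : Rd R d => (x : 'rV[R]_d) 0 i) @^-1` `]-oo, c]); last first.
    by apply/seteqP; split => x /=; rewrite in_itv.
  by rewrite -[X in measurable X]setTI; exact: measurable_coord.
move=> A mA.
have : measurable_fun setT (idfun : g_sigma_algebraType orthants -> Rd R d).
  apply: measurable_fun_Rd => i.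
  apply: (measurability _ (RGenOInfty.measurableE R)).
  move=> _ [_ [c ->] <-]; rewrite setTI.
  rewrite (_ : _ @^-1` _ = ~` [set x : Rd R d | (x : 'rV[R]_d) 0 i <= c]); last first.
    by apply/seteqP; split => x /=; rewrite in_itv/= andbT; [rewrite ltNge => /negP|move/negP; rewrite -ltNge].
  apply: measurableC; apply: sub_sigma_algebra => /=.
  exists (fun k => if k == i then Some c else None) => //.
  apply/seteqP; split => x /=.
    by move=> /(_ i); rewrite eqxx.
  by move=> xi k; case: eqP => // ->.
by move=> /(_ measurableT A mA); rewrite setTI.
Qed.

End RdBorel.

(** * Encoding a sequence of sets in one real function *)

Section Encoding.
Context (R : realType) (disp : measure_display) (T : measurableType disp)
  (C : (set T)^nat).
Hypothesis mC : forall n, measurable (C n).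
Local Notation TR := (measurableTypeR R).

(** The digit 2 of the Cantor set in position [n]. All later digits together contribute at most
    [3^-1 ^+ n.+1], half of [trit n], so a greedy reading never errs. *)
Definition trit (n : nat) : R := 2 * 3^-1 ^+ n.+1.

Definition digit_sum (x : T) (n : nat) : R := \sum_(k < n) trit k * \1_(C k) x.

Lemma trit_ge0 n : 0 <= trit n.
Proof. by rewrite mulr_ge0// exprn_ge0. Qed.

Lemma digit_sumB x m n : (n <= m)%N ->
  0 <= digit_sum x m - digit_sum x n <= 3^-1 ^+ n - 3^-1 ^+ m.
Proof.
move=> nm; rewrite -(subnK nm); elim: (m - n)%N => [|k IH].
  by rewrite add0n !subrr lexx.
have -> : digit_sum x (k.+1 + n) = digit_sum x (k + n) + trit (k + n) * \1_(C (k + n)%N) x.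
  by rewrite addSn /digit_sum big_ord_recr.
have t0 : 0 <= trit (k + n) * \1_(C (k + n)%N) x <= trit (k + n).
  by rewrite indicE; case: (_ \in _); rewrite ?mulr1 ?mulr0 trit_ge0 lexx.
move: IH t0; rewrite addSn /trit exprS; lra.
Qed.

Lemma digit_sum_cvg x : exists l : R, digit_sum x n @[n --> \oo] --> l.
Proof.
suff : cvgn (digit_sum x) by move=> h; exists (limn (digit_sum x)).
apply: nondecreasing_is_cvgn.
  apply/nondecreasing_seqP => n; have := digit_sumB x (leqnSn n).
  by rewrite subr_ge0 => /andP[].
exists 1 => _ [n _ <-]; have /andP[_] := digit_sumB x (leq0n n).
rewrite /digit_sum big_ord0 subr0 expr0 => /le_trans; apply.
by rewrite gerBl exprn_ge0.
Qed.

(* The greedy decoding of the ternary expansion [iota x = sum_n 2 [x in C n] / 3^(n+1)]. *)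
Fixpoint decoded_sum (n : nat) (y : R) : R :=
  if n is n'.+1 then
    decoded_sum n' y + (if trit n' <= y - decoded_sum n' y then trit n' else 0)
  else 0.

Definition decoded_digit (n : nat) : set TR := [set y | trit n <= y - decoded_sum n y].

Lemma measurable_decoded n : measurable_fun setT (decoded_sum n : TR -> R) /\
  measurable (decoded_digit n).
Proof.
have step k : measurable_fun setT (decoded_sum k : TR -> R) -> measurable (decoded_digit k).
  move=> mk; rewrite (_ : decoded_digit k = (fun y : TR => y - decoded_sum k y) @^-1` `[trit k, +oo[).
    rewrite -[X in measurable X]setTI; apply: measurable_funB => //.
  by apply/seteqP; split => y /=; rewrite in_itv/= andbT.
suff H : measurable_fun setT (decoded_sum n : TR -> R) by split => //; exact: step.
elim: n => [|n IH]; first exact: measurable_cst.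
rewrite (_ : decoded_sum n.+1 = fun y : TR => decoded_sum n y + trit n * \1_(decoded_digit n) y).
  apply: measurable_funD => //; apply: measurable_funM => //.
  by apply: measurable_indic; exact: step.
apply/funext => y /=; congr (_ + _); rewrite indicE.
have [h|h] := boolP (trit n <= y - decoded_sum n y).
  by rewrite mem_set ?mulr1.
by rewrite memNset ?mulr0//; exact/negP.
Qed.

Lemma encoding_exists : exists2 iota : T -> TR, measurable_fun setT iota &
  forall n x, decoded_digit n (iota x) <-> C n x.
Proof.
have /choice[iota Hiota] := digit_sum_cvg.
exists iota.
  apply: (@measurable_fun_cvg _ _ _ _ (fun n x => digit_sum x n)) => [n|x _].
    apply: measurable_sum => k; apply: measurable_funM => //.
  exact: Hiota.
have bnd x n : 0 <= iota x - digit_sum x n <= 3^-1 ^+ n.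
  have c1 : digit_sum x m - digit_sum x n @[m --> \oo] --> iota x - digit_sum x n.
    by apply: cvgB => //; exact: cvg_cst.
  apply/andP; split.
    apply: (cvgr_to_ge c1); near=> m; have nm : (n <= m)%N by near: m; exact: nbhs_infty_ge.
    by have /andP[] := digit_sumB x nm.
  apply: (cvgr_to_le c1); near=> m; have nm : (n <= m)%N by near: m; exact: nbhs_infty_ge.
  have /andP[_ /le_trans] := digit_sumB x nm; apply.
  by rewrite gerBl exprn_ge0.
have dig x n : decoded_sum n (iota x) = digit_sum x n /\ (decoded_digit n (iota x) <-> C n x).
  have step k : decoded_sum k (iota x) = digit_sum x k -> (decoded_digit k (iota x) <-> C k x).
    move=> E; rewrite /decoded_digit/= E.
    have /andP[h1 h2] := bnd x k.+1; move: h1 h2.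
    rewrite /digit_sum big_ord_recr/= -/(digit_sum x k) indicE.
    have p0 : 0 < 3^-1 ^+ k.+1 :> R by rewrite exprn_gt0.
    have [Ck|nCk] := pselect (C k x).
      by rewrite (mem_set Ck) mulr1 => h1 h2; split => // _; lra.
    rewrite (memNset nCk) mulr0 => h1 h2; split => // h; exfalso.
    by move: h; rewrite /trit; lra.
  elim: n => [|n [IH1 IH2]].
    by split; [rewrite /digit_sum big_ord0|apply: step; rewrite /digit_sum big_ord0].
  have E : decoded_sum n.+1 (iota x) = digit_sum x n.+1.
    rewrite /= /digit_sum big_ord_recr/= -/(digit_sum x n) IH1; congr (_ + _).
    rewrite indicE; move: IH2; rewrite /decoded_digit/= IH1.
    have [h|h] := boolP (trit n <= _).
      by move=> [H _]; rewrite mem_set ?mulr1//; exact: H.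
    by move=> [_ H]; rewrite memNset ?mulr0// => /H; exact/negP.
  by split => //; exact: step.
by move=> n x; case: (dig x n).
Unshelve. all: by end_near. Qed.

End Encoding.

(** The encoded sets are the half-spaces that bound one coordinate by a rational. A coordinate is
    the supremum of the rationals strictly below it, that is, of those whose half-space does not
    contain the point; the other rationals are switched off by the value [-oo]. *)
Lemma Rd_encoding (R : realType) (d : nat) :
  exists (iota : Rd R d -> measurableTypeR R) (j : measurableTypeR R -> Rd R d),
    [/\ measurable_fun setT iota, measurable_fun setT j & cancel iota j].
Proof.
pose C (n : nat) : set (Rd R d) := if choice.unpickle n is Some (i, q) then
  [set x | (x : 'rV[R]_d) 0 (i : 'I_d) <= ratr (q : rat)] else set0.
have mC n : measurable (C n).
  rewrite /C; case: choice.unpickle => [[i q]|]//.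
  rewrite (_ : [set x | _] = (fun x : Rd R d => (x : 'rV[R]_d) 0 i) @^-1` `]-oo, ratr q]).
    by rewrite -[X in measurable X]setTI; exact: measurable_coord.
  by apply/seteqP; split => x /=; rewrite in_itv.
have [iota miota Hiota] := encoding_exists R mC.
pose h (i : 'I_d) (q : rat) (y : measurableTypeR R) : \bar R :=
  if y \in decoded_digit (choice.pickle (i, q)) then -oo%E else (ratr q)%:E.
have mh i q : measurable_fun setT (h i q).
  rewrite /h; set E := decoded_digit _.
  have mE : measurable E by case: (@measurable_decoded R (choice.pickle (i, q))).
  apply: measurable_fun_ifT => //.
  apply: (@measurable_fun_bool _ _ _ _ true).
  rewrite setTI (_ : _ @^-1` _ = E)//.
  by apply/seteqP; split => y /= => [/set_mem|/mem_set].
have /choice[G HG] : forall i : 'I_d, exists G : measurableTypeR R -> R,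
    measurable_fun setT G /\ forall x : Rd R d, G (iota x) = (x : 'rV[R]_d) 0 i.
  move=> i; have [G mG HG] := measurable_ereal_supremum (mh i).
  exists G; split => // x; apply: HG => [q|e e0].
    rewrite /h; case: ifPn; rewrite ?leNye// => /negP nq; rewrite lee_fin.
    rewrite leNgt; apply/negP => xq; apply: nq; apply: mem_set.
    by apply/Hiota; rewrite /C choice.pickleK/= ltW.
  have xe : (x : 'rV[R]_d) 0 i - e < (x : 'rV[R]_d) 0 i by rewrite gtrBl.
  have [q] := rat_in_itvoo xe; rewrite in_itv/= => /andP[q1 q2].
  exists q; rewrite /h ifN ?lte_fin//; apply/negP => /set_mem/Hiota.
  by rewrite /C choice.pickleK/= leNgt q2.
exists iota, (fun y => \row_i G i y); split => //.
  apply: measurable_fun_Rd => i; under eq_fun do rewrite mxE.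
  by case: (HG i).
by move=> x; apply/rowP => i; rewrite mxE; case: (HG i).
Qed.

(** * Lebesgue measure as an iterated product *)

Section LebesgueRd.
Context (R : realType).
Local Notation leb := (@lebesgue_measure R).

Definition cons_Rd (d : nat) (z : measurableTypeR R * Rd R d) : Rd R d.+1 :=
  row_mx (z.1%:M : 'rV[R]_1) (z.2 : 'rV[R]_d) : 'rV[R]_(1 + d).

Lemma cons_Rd0 d z : (@cons_Rd d z : 'rV[R]_d.+1) 0 ord0 = z.1.
Proof.
have -> : ord0 = lshift d (ord0 : 'I_1) :> 'I_(1 + d) by apply: val_inj.
apply: etrans (row_mxEl (z.1%:M : 'rV[R]_1) (z.2 : 'rV[R]_d) 0 ord0) _.
by rewrite mxE eqxx mulr1n.
Qed.

Lemma cons_RdS d z i : (@cons_Rd d z : 'rV[R]_d.+1) 0 (lift ord0 i) = (z.2 : 'rV[R]_d) 0 i.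
Proof.
have -> : lift ord0 i = rshift 1 i :> 'I_(1 + d) by apply: val_inj.
exact: (row_mxEr (z.1%:M : 'rV[R]_1) (z.2 : 'rV[R]_d) 0 i).
Qed.

Lemma measurable_cons_Rd d : measurable_fun setT (@cons_Rd d).
Proof.
apply: measurable_fun_Rd => i; case: (unliftP ord0 i) => [k|] ->.
  under eq_fun do rewrite cons_RdS.
  apply: (measurableT_comp (measurable_coord k)); exact: measurable_snd.
under eq_fun do rewrite cons_Rd0.
exact: measurable_fst.
Qed.

Definition box (d : nat) (r : R) : set (Rd R d) :=
  [set x | forall i, `|(x : 'rV[R]_d) 0 i| <= r].

Lemma measurable_box d r : measurable (@box d r).
Proof.
rewrite (_ : @box d r = \bigcap_(i : 'I_d) [set x | `|(x : 'rV[R]_d) 0 i| <= r]); last first.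
  by apply/seteqP; split => x H i; [move=> _; exact: (H i)|exact: (H i Logic.I)].
apply: countable_bigcap_measurable => i.
rewrite (_ : [set x | _] = (fun x : Rd R d => (x : 'rV[R]_d) 0 i) @^-1` `[- r, r]); last first.
  by apply/seteqP; split => x /=; rewrite in_itv/= ler_norml.
by rewrite -[X in measurable X]setTI; exact: measurable_coord.
Qed.

Lemma box_cover d : \bigcup_n (@box d n%:R) = setT.
Proof.
apply/seteqP; split => // x _.
pose b (i : 'I_d) := Num.bound `|(x : 'rV[R]_d) 0 i|.
exists (\max_(i < d) b i)%N => //= i.
rewrite (le_trans (ltW (archi_boundP _)))// ler_nat.
exact: (@leq_bigmax _ b).
Qed.

(** [lebesgue_Rd] is a bare set function, and this ties it to a genuine measure. The volume of the
    cubes is recorded because it gives the sigma-finiteness that each product step of the induction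
    on [d] requires. *)
Definition is_lebesgue_Rd d (m : {sigma_finite_measure set (Rd R d) -> \bar R}) : Prop :=
  (forall A, measurable A -> m A = lebesgue_Rd A) /\
  (forall n : nat, m (box n%:R) = ((n%:R *+ 2) ^+ d)%:E).

Lemma box_sigma_finite d (m : {measure set (Rd R d) -> \bar R}) :
  (forall n : nat, m (box n%:R) = ((n%:R *+ 2) ^+ d)%:E) ->
  exists m' : {sigma_finite_measure set (Rd R d) -> \bar R}, m' = m :> (set (Rd R d) -> \bar R).
Proof.
case: m => mu c /= mb; pose m : {measure set (Rd R d) -> \bar R} := Measure.Pack c.
have sf : sigma_finite setT mu.
  exists (fun n => box n%:R); first by rewrite box_cover.
  by move=> n; split; [exact: measurable_box|rewrite mb ltry].
pose F := Measure_isSigmaFinite.Build _ _ _ (Measure.Pack c) sf.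
by exists (HB.pack mu c F : {sigma_finite_measure set (Rd R d) -> \bar R}).
Qed.

Lemma lebesgue_RdS d (m : {sigma_finite_measure set (Rd R d) -> \bar R}) (A : set (Rd R d.+1)) :
  (forall A, measurable A -> m A = lebesgue_Rd A) -> measurable A ->
  lebesgue_Rd A = (leb \x m)%E (@cons_Rd d @^-1` A).
Proof.
move=> mE mA; rewrite /= /product_measure1/=; apply: eq_integral => x _.
have mc : measurable_fun setT (fun y : Rd R d => cons_Rd (x, y)).
  apply: measurable_fun_Rd => i; case: (unliftP ord0 i) => [k|] ->.
    by under eq_fun do rewrite cons_RdS/=; exact: measurable_coord.
  by under eq_fun do rewrite cons_Rd0/=; exact: measurable_cst.
have mX : measurable ((fun y : Rd R d => cons_Rd (x, y)) @^-1` A).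
  by rewrite -[X in measurable X]setTI; exact: mc.
rewrite -[LHS](mE _ mX); congr (m _).
by rewrite xsectionE.
Qed.

(** Splitting off the first coordinate presents the measure as the image of a product under
    [cons_Rd]; in dimension 0 it is a unit mass. *)
Lemma lebesgue_Rd_exists d :
  exists m : {sigma_finite_measure set (Rd R d) -> \bar R}, is_lebesgue_Rd m.
Proof.
elim: d => [|d [m [mE mb]]].
  pose m0 := @dirac _ (Rd R 0) (0 : 'rV[R]_0) R.
  have mb n : m0 (box n%:R) = ((n%:R *+ 2) ^+ 0)%:E.
    by rewrite /m0 diracE mem_set// => -[].
  by have [m1 m1E] := box_sigma_finite mb; exists m1; split; rewrite m1E.
pose m' (A : set (Rd R d.+1)) : \bar R := (leb \x m)%E (@cons_Rd d @^-1` A).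
have mpre (A : set (Rd R d.+1)) : measurable A -> measurable (@cons_Rd d @^-1` A).
  by move=> mA; rewrite -[X in measurable X]setTI; exact: measurable_cons_Rd.
have m'0 : m' set0 = 0%E by rewrite /m' preimage_set0 measure0.
have m'ge0 A : (0 <= m' A)%E by exact: measure_ge0.
have m'sa : semi_sigma_additive m'.
  move=> F mF tF mU; rewrite /m' preimage_bigcup; apply: measure_semi_sigma_additive.
  - by move=> n; exact: mpre.
  - apply/trivIsetP => /= i j _ _ ij; rewrite -preimage_setI.
    by move/trivIsetP : tF => /(_ _ _ _ _ ij) ->//; rewrite preimage_set0.
  - by rewrite -preimage_bigcup; exact: mpre.
pose M := isMeasure.Build _ _ _ m' m'0 m'ge0 m'sa.
pose m1 : {measure set (Rd R d.+1) -> \bar R} := HB.pack m' M.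
have mb1 (n : nat) : m1 (box n%:R) = ((n%:R *+ 2) ^+ d.+1)%:E.
  rewrite /m1/= /m'.
  rewrite (_ : @cons_Rd d @^-1` box n%:R = `[- n%:R, n%:R] `*` box n%:R).
    rewrite product_measure1E//; last exact: measurable_box.
    have nn : - n%:R <= n%:R :> R by rewrite (@le_trans _ _ 0)// oppr_le0.
    rewrite [X in (X * _)%E](_ : _ = (n%:R *+ 2)%:E); last first.
      apply: (etrans (lebesgue_measure_itv _)); rewrite /= lte_fin.
      by case: ltP => h; rewrite -?EFinB ?opprK ?mulr2n//; congr EFin; lra.
    by rewrite [X in (_ * X)%E]mb -EFinM exprS.
  apply/seteqP; split => -[x y] /=.
    move=> H; split; first by have := H ord0; rewrite cons_Rd0/= in_itv/= ler_norml.
    by move=> i; have := H (lift ord0 i); rewrite cons_RdS.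
  move=> [+ H] i; rewrite in_itv/= -ler_norml.
  by case: (unliftP ord0 i) => [k|] ->; rewrite ?cons_Rd0 ?cons_RdS//= => _; exact: H.
have [m2 m2E] := box_sigma_finite mb1.
exists m2; split; rewrite m2E// => A mA.
by rewrite (lebesgue_RdS mE).
Qed.

End LebesgueRd.

Section IntegralRd.
Context (R : realType).
Local Notation leb := (@lebesgue_measure R).
Local Notation measRd d := {sigma_finite_measure set (Rd R d) -> \bar R}.

Definition uncons_Rd d (x : Rd R d.+1) : measurableTypeR R * Rd R d :=
  ((x : 'rV[R]_d.+1) 0 ord0, \row_i (x : 'rV[R]_d.+1) 0 (lift ord0 i)).

Lemma cons_uncons d (x : Rd R d.+1) : cons_Rd (uncons_Rd x) = x.
Proof.
apply/rowP => i; case: (unliftP ord0 i) => [k|] ->; last by rewrite cons_Rd0.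
by apply: (etrans (cons_RdS (uncons_Rd x) k)); rewrite mxE.
Qed.

Lemma uncons_cons d (z : measurableTypeR R * Rd R d) : uncons_Rd (cons_Rd z) = z.
Proof.
case: z => x y; congr pair; first exact: cons_Rd0.
by apply/rowP => i; rewrite mxE; apply: (etrans (cons_RdS (x, y) i)).
Qed.

Lemma lebesgue_Rd_integral d (m : measRd d) (D : set (Rd R d)) (f : Rd R d -> \bar R) :
  is_lebesgue_Rd m ->
  (\int[lebesgue_Rd (d:=d) : set (Rd R d) -> \bar R]_(x in D) f x = \int[m]_(x in D) f x)%E.
Proof.
move=> [mE _]; have mk (mu : set (Rd R d) -> \bar R) (g : Rd R d -> \bar R) :
    (\int[mu]_(x in D) g x = \int[mu]_x (g \_ D) x)%E.
  by rewrite /integral patch_setT.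
rewrite mk [RHS]mk; apply: (eq_set_function_integral (K := setT)) => [A mA _|x].
  exact/esym/mE.
by move=> /(_ Logic.I).
Qed.

Lemma cint_RdE d (m : measRd d) (D : set (Rd R d)) (f : Rd R d -> R[i]) : is_lebesgue_Rd m ->
  cint_Rd D f = (\int[m]_(x in D) Re (f x)) +i* (\int[m]_(x in D) Im (f x)).
Proof.
by move=> mP; rewrite /cint_Rd /cintegral /Rintegral !(lebesgue_Rd_integral _ _ mP).
Qed.

Lemma integrable_tensor d2 (T2 : measurableType d2) (m2 : {sigma_finite_measure set T2 -> \bar R})
    (a : R -> R) (b : T2 -> R) :
  leb.-integrable setT (EFin \o a) -> m2.-integrable setT (EFin \o b) ->
  (leb \x m2)%E.-integrable setT (fun z => (a z.1 * b z.2)%:E).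
Proof.
move=> ia ib.
have ma : measurable_fun setT a by case/integrableP : (ia) => /measurable_EFinP.
have mb : measurable_fun setT b by case/integrableP : (ib) => /measurable_EFinP.
apply/integrable12ltyP.
  apply/measurable_EFinP; apply: measurable_funM; apply: measurableT_comp => //.
have If : (\int[m2]_y `|(b y)%:E| < +oo)%E by case/integrableP : ib.
rewrite (_ : (fun x => _) = (fun x => `|(a x)%:E| * \int[m2]_y `|(b y)%:E|)%E); last first.
  apply/funext => x /=; rewrite -ge0_integralZl//=.
  - by apply: eq_integral => y _; rewrite normrM EFinM.
  - by apply/measurable_EFinP; exact: measurableT_comp.
have I0 : (0 <= \int[m2]_y `|(b y)%:E|)%E by apply: integral_ge0.
rewrite ge0_integralZr//=.
- have Ia : (\int[leb]_x `|(a x)%:E| < +oo)%E by case/integrableP : ia.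
  apply: lte_mul_pinfty => //; first exact: integral_ge0.
  by rewrite ge0_fin_numE//; exact: integral_ge0.
- by apply/measurable_EFinP; exact: measurableT_comp.
Qed.

Lemma Rd_fubini d (m : measRd d.+1) (m' : measRd d) (a : R -> R) (b : Rd R d -> R)
    (F : Rd R d.+1 -> R) :
  is_lebesgue_Rd m -> is_lebesgue_Rd m' ->
  leb.-integrable setT (EFin \o a) -> m'.-integrable setT (EFin \o b) ->
  (forall z, F (cons_Rd z) = a z.1 * b z.2) ->
  m.-integrable setT (EFin \o F) /\ \int[m]_x F x = (\int[leb]_x a x) * (\int[m']_x b x).
Proof.
move=> [mE _] [m'E _] ia ib Fab.
have ma : measurable_fun setT a by case/integrableP : (ia) => /measurable_EFinP.
have mb : measurable_fun setT b by case/integrableP : (ib) => /measurable_EFinP.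
have mF : measurable_fun setT F.
  rewrite (_ : F = fun x : Rd R d.+1 => a (uncons_Rd x).1 * b (uncons_Rd x).2); last first.
    by apply/funext => x; rewrite -[x in LHS]cons_uncons Fab.
  apply: measurable_funM; first exact: (measurableT_comp ma (measurable_coord ord0)).
  apply: (measurableT_comp mb).
  apply: measurable_fun_Rd => i; under eq_fun do rewrite mxE.
  exact: measurable_coord.
have mc := @measurable_cons_Rd R d.
have mp A : measurable A -> m A = pushforward (leb \x m')%E (@cons_Rd R d) A.
  by move=> mA; rewrite mE// (lebesgue_RdS m'E).
have Ec : (EFin \o F) \o (@cons_Rd R d) = (fun z => (a z.1 * b z.2)%:E).
  by apply/funext => z /=; rewrite Fab.
have iab := integrable_tensor ia ib.
have iF : (leb \x m')%E.-integrable (@cons_Rd R d @^-1` setT) ((EFin \o F) \o (@cons_Rd R d)).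
  by rewrite preimage_setT Ec.
have mEF : measurable_fun setT (EFin \o F) by exact/measurable_EFinP.
split.
  have /integrableP[_ h] := integrable_pushforward mc mEF iF measurableT.
  apply/integrableP; split; first exact/measurable_EFinP.
  rewrite (eq_measure_integral (pushforward (leb \x m')%E (@cons_Rd R d))); first exact: h.
  by move=> A mA _; exact: mp.
rewrite /Rintegral (eq_measure_integral (pushforward (leb \x m')%E (@cons_Rd R d))); last by move=> A mA _; exact: mp.
rewrite (integral_pushforward mc mEF iF measurableT) preimage_setT Ec.
rewrite -(integral12_prod_meas1 iab)/=.
rewrite [X in fine X = _](_ : _ = \int[leb]_x ((a x)%:E * \int[m']_y (b y)%:E))%E; last first.
  by apply: eq_integral => x _; rewrite /fubini_F/= -integralZl.
have If : (\int[m']_y (b y)%:E)%E \is a fin_num by exact: integrable_fin_num.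
rewrite -(fineK If) integralZr// fineM//; exact: integrable_fin_num.
Qed.

Definition cintegrable (h : R -> R[i]) : Prop :=
  leb.-integrable setT (fun x => (Re (h x))%:E) /\
  leb.-integrable setT (fun x => (Im (h x))%:E).

Definition cint (h : R -> R[i]) : R[i] :=
  (\int[leb]_x Re (h x)) +i* (\int[leb]_x Im (h x)).

Definition ctensor d (h : 'I_d -> R -> R[i]) (x : Rd R d) : R[i] :=
  \prod_i h i ((x : 'rV[R]_d) 0 i).

Lemma ctensor_integral d (m : measRd d) (h : 'I_d -> R -> R[i]) : is_lebesgue_Rd m ->
  (forall i, cintegrable (h i)) ->
  [/\ m.-integrable setT (fun x => (Re (ctensor h x))%:E),
     m.-integrable setT (fun x => (Im (ctensor h x))%:E) &
     (\int[m]_x Re (ctensor h x)) +i* (\int[m]_x Im (ctensor h x)) = \prod_i cint (h i)].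
Proof.
elim: d m h => [|d IH] m h mP ih.
  have mT : m setT = 1%E by case: mP => ->//= _; rewrite indicE mem_set.
  have E (x : Rd R 0) : ctensor h x = 1 by rewrite /ctensor big_ord0.
  have F (r : R) : m.-integrable setT (fun _ => r%:E).
    by apply/integrableP; split => //; rewrite integral_cst//= mT mule1 ltry.
  rewrite big_ord0 (_ : ctensor h = fun=> 1); last exact/funext.
  split; [exact: F|exact: F|].
  by rewrite !Rintegral_cst//= mT/= mul1r mul0r.
have [m' m'P] := lebesgue_Rd_exists R d.
have [i1 i2 E] := IH m' (fun i => h (lift ord0 i)) m'P (fun i => ih _).
have [j1 j2] := ih ord0.
set g := ctensor (fun i => h (lift ord0 i)) in i1 i2 E.
pose F (a : R -> R) (b : Rd R d -> R) (x : Rd R d.+1) := a (uncons_Rd x).1 * b (uncons_Rd x).2.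
have FP a b ia ib := @Rd_fubini d m m' a b (F a b) mP m'P ia ib
  (fun z => congr1 (fun y => a y.1 * b y.2) (uncons_cons z)).
have [irr err] := FP _ _ j1 i1. have [iii eii] := FP _ _ j2 i2.
have [iri eri] := FP _ _ j1 i2. have [iir eir] := FP _ _ j2 i1.
have -> : ctensor h = fun x =>
   (F (fun x => Re (h ord0 x)) (fun x => Re (g x)) x - F (fun x => Im (h ord0 x)) (fun x => Im (g x)) x) +i*
   (F (fun x => Re (h ord0 x)) (fun x => Im (g x)) x + F (fun x => Im (h ord0 x)) (fun x => Re (g x)) x).
  apply/funext => x; rewrite /F /ctensor big_ord_recl.
  have -> : \prod_(i < d) h (lift ord0 i) ((x : 'rV[R]_d.+1) 0 (lift ord0 i)) = g (uncons_Rd x).2.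
    by apply: eq_bigr => i _; rewrite mxE.
  by rewrite -[(x : 'rV[R]_d.+1) 0 ord0]/(uncons_Rd x).1; case: (h _ _) => ? ?; case: (g _).
rewrite big_ord_recl -E /cint; split => /=; [exact: (integrableB measurableT irr iii)|exact: (integrableD measurableT iri iir)|].
by rewrite RintegralB// RintegralD// err eii eri eir.
Qed.

Lemma cint_ctensor d (h : 'I_d -> R -> R[i]) : (forall i, cintegrable (h i)) ->
  cint_Rd setT (ctensor h) = \prod_i cint (h i).
Proof.
have [m mP] := lebesgue_Rd_exists R d.
by move=> ih; rewrite (cint_RdE _ _ mP); case: (ctensor_integral mP ih).
Qed.

Lemma normc_le_parts (z : R[i]) : normc z <= `|Re z| + `|Im z|.
Proof.
case: z => a b /=; rewrite -[X in _ <= X]ger0_norm ?addr_ge0//.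
rewrite -sqrtr_sqr ler_wsqrtr// sqrrD !real_normK ?num_real//.
by rewrite lerD2r lerDl mulrn_wge0// mulr_ge0.
Qed.

Lemma parts_le_normc (z : R[i]) : `|Re z| <= normc z /\ `|Im z| <= normc z.
Proof.
case: z => a b /=; rewrite -!sqrtr_sqr; split; rewrite ler_wsqrtr//.
  by rewrite lerDl sqr_ge0.
by rewrite lerDr sqr_ge0.
Qed.

Lemma measurable_normc d (T : measurableType d) (S : T -> R[i]) :
  measurable_fun setT (fun x => Re (S x)) -> measurable_fun setT (fun x => Im (S x)) ->
  measurable_fun setT (fun x => normc (S x)).
Proof.
move=> m1 m2; rewrite (_ : (fun x => _) = fun x => Num.sqrt (Re (S x) ^+ 2 + Im (S x) ^+ 2)).
  apply: (@measurableT_comp _ _ _ _ _ _ (@Num.sqrt R)).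
    apply: continuous_measurable_fun; exact: sqrt_continuous.
  by apply: measurable_funD; exact: measurable_funX.
by apply/funext => x; case: (S x).
Qed.

Lemma Rintegral_dominated d (T : measurableType d) (m : {measure set T -> \bar R}) (f g : T -> R) :
  measurable_fun setT f -> m.-integrable setT (EFin \o g) -> (forall x, `|f x| <= g x) ->
  m.-integrable setT (EFin \o f) /\ `|\int[m]_x f x| <= \int[m]_x g x.
Proof.
move=> mf ig fg; have jf : m.-integrable setT (EFin \o f).
  apply: le_integrable ig => //; first exact/measurable_EFinP.
  by move=> x _; rewrite /= lee_fin (le_trans (fg x))// ler_norm.
split => //; apply: le_trans (le_normr_Rintegral measurableT jf) _.
apply: le_Rintegral => //; exact: (integrable_norm jf).
Qed.

Lemma enorm_coord d (x : 'rV[R]_d) i : `|x 0 i| <= enorm x.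
Proof.
rewrite -sqrtr_sqr ler_wsqrtr// (bigD1 i)//= lerDl.
by apply: sumr_ge0 => j _; rewrite sqr_ge0.
Qed.

(** The majorant is [1 + normc (S x)] on [D], integrable because [S] is locally integrable and [D]
    bounded. The hypothesis on the product covers both ways of being small: through [S] near the
    origin, or through [F] elsewhere. The factor 2 in [C] accounts for the real and imaginary parts,
    and [C] depends neither on [F] nor on [E]. *)
Lemma cint_Rd_bound d (S : Rd R d -> R[i]) (D : set (Rd R d)) (r : R) : measurable D ->
  locally_integrable_Rd S -> (forall x, D x -> enorm x <= r) ->
  exists C : R, forall (F : Rd R d -> R) (e : R) (E : set (Rd R d)), measurable E ->
    measurable_fun setT F ->
    (forall x, E x -> ~ D x -> F x = 0) ->
    (forall x, D x -> normc (S x) * `|F x| <= e * (1 + normc (S x))) ->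
    normc (cint_Rd E (fun x => S x * (F x)%:C)) <= C * e.
Proof.
move=> mD [m1 m2 iS] Dr; have [m mP] := lebesgue_Rd_exists R d.
have mS := measurable_normc m1 m2.
pose w (x : Rd R d) : R := (1 + normc (S x)) * \1_D x.
have w0 x : 0 <= w x by rewrite mulr_ge0// addr_ge0//; case: (S x) => a b; rewrite sqrtr_ge0.
have mw : measurable_fun setT w.
  by apply: measurable_funM; [exact: measurable_funD|exact: measurable_indic].
pose K := [set x : Rd R d | enorm x <= r].
have mK : measurable K by exact: (@measurable_sball R _ (Rd R d) r).
have iw : m.-integrable setT (EFin \o w).
  apply/integrableP; split; first exact/measurable_EFinP.
  have mKoo : (m K < +oo)%E.
    pose n := Num.bound r.
    apply: (@le_lt_trans _ _ (m (box n%:R))); last by case: mP => _ ->; rewrite ltry.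
    apply: measure_mono => //; first exact: measurable_box.
    move=> x /= xr i; rewrite (le_trans (enorm_coord _ _))// (le_trans xr)//.
    rewrite /n; case: (leP 0 r) => [r0|/ltW r0]; first by rewrite ltW// archi_boundP.
    by rewrite (le_trans r0)//.
  have E : (\int[m]_(x in K) (normc (S x))%:E < +oo)%E.
    by have := iS r; rewrite (lebesgue_Rd_integral _ _ mP).
  have E2 : (\int[m]_(x in K) (1 + normc (S x))%:E < +oo)%E.
    rewrite (_ : (\int[m]_(x in K) _ = \int[m]_(x in K) (1%:E + (normc (S x))%:E))%E)//.
    rewrite ge0_integralD//=; last 2 first.
      by move=> x _; rewrite lee_fin; case: (S x) => ? ?; exact: sqrtr_ge0.
      by apply/measurable_EFinP; exact: measurable_funTS.
    by rewrite integral_cst// mul1e lte_add_pinfty.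
  apply: le_lt_trans E2; rewrite [leRHS]integral_mkcond.
  apply: ge0_le_integral => //.
  - by apply/measurable_EFinP; exact: measurableT_comp.
  - apply/(measurable_restrictT _ _).1 => //; apply: measurable_funTS.
    by apply/measurable_EFinP; exact: measurable_funD.
  - move=> x _; rewrite patchE /= ger0_norm// /w indicE.
    case: (boolP (x \in D)) => [/set_mem/Dr xr|_]; last first.
      rewrite mulr0; case: ifP => // _; rewrite ?lee_fin ?addr_ge0//.
      by case: (S x) => ? ?; exact: sqrtr_ge0.
    by rewrite mulr1 mem_set.
exists (2 * \int[m]_x w x) => F e E mE mF FE0 FD.
rewrite (cint_RdE _ _ mP); apply: le_trans (normc_le_parts _) _ => /=.
rewrite mulrDl mul1r mulrDl.
have ew : m.-integrable setT (fun x => (e * w x)%:E).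
  by have := integrableZl measurableT e iw.
have key (u : Rd R d -> R) : measurable_fun setT u -> (forall x, `|u x| <= normc (S x)) ->
    `|\int[m]_(x in E) (u x * F x)| <= (\int[m]_x w x) * e.
  move=> mu uS; rewrite Rintegral_mkcond [X in _ <= X]mulrC -RintegralZl//.
  apply: (Rintegral_dominated _ ew _).2.
    apply/(measurable_restrictT _ _).1 => //; apply: measurable_funTS; exact: measurable_funM.
  move=> x; rewrite patchE; case: ifPn => [/set_mem xE|_].
    case: (pselect (D x)) => xD.
      rewrite normrM (le_trans (ler_wpM2r _ (uS x)))// (le_trans (FD _ xD))//.
      by rewrite /w indicE mem_set// mulr1.
    by rewrite FE0// mulr0 normr0 /w indicE memNset// !mulr0.
  rewrite normr0 /w indicE; case: (boolP (x \in D)) => [/set_mem xD|_].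
    by rewrite mulr1; apply: le_trans (FD _ xD); rewrite mulr_ge0//; case: (S x) => ? ?; exact: sqrtr_ge0.
  by rewrite !mulr0.
have SF x : S x * (F x)%:C = (Re (S x) * F x) +i* (Im (S x) * F x).
  by case: (S x) => ? ?; rewrite /=; simpc.
under eq_Rintegral do rewrite SF/=.
under [X in _ + `|X| <= _]eq_Rintegral do rewrite SF/=.
by apply: lerD; apply: key => // x; case: (parts_le_normc (S x)).
Qed.

End IntegralRd.

(** * Tensor products of smooth functions *)

Section Jets.
Context (R : realType).
Local Notation leb := (@lebesgue_measure R).

(* [f n] is the [n]-th derivative of [f 0]; working with all the derivatives at once keeps them explicit. *)
Definition jet (f : nat -> R -> R) : Prop := forall n (x : R), is_derive x (1 : R) (f n) (f n.+1 x).

Lemma jet_continuous f n : jet f -> continuous (f n).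
Proof.
move=> jf x; have d : derivable (f n) x 1 by case: (jf n x).
exact/differentiable_continuous/derivable1_diffP.
Qed.

Lemma jetD f g : jet f -> jet g -> jet (fun n x => f n x + g n x).
Proof. by move=> jf jg n x; exact: is_deriveD. Qed.

Lemma jetZ a f : jet f -> jet (fun n x => a * f n x).
Proof. by move=> jf n x; exact: is_deriveZ. Qed.

Lemma jet0 : jet (fun _ _ => 0).
Proof. by move=> n x; exact: is_derive_cst. Qed.

Lemma jet_sum (I : Type) (s : seq I) (f : I -> nat -> R -> R) : (forall i, jet (f i)) ->
  jet (fun n x => \sum_(i <- s) f i n x).
Proof.
move=> jf; elim: s => [|i s IH].
  by under eq_fun do under eq_fun do rewrite big_nil; exact: jet0.
under eq_fun do under eq_fun do rewrite big_cons; exact: jetD.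
Qed.

Lemma jetS f : jet f -> jet (fun n => f n.+1).
Proof. by move=> jf n; exact: jf. Qed.

Lemma is_derive_affine (h : R -> R) (a b x l : R) : is_derive (a * x + b) (1 : R) h l ->
  is_derive x (1 : R) (fun y => h (a * y + b)) (a * l).
Proof.
move=> hl; have H : is_derive x (1 : R) (fun y : R => a * y + b) a.
  have := is_deriveD (is_deriveZ a (is_derive_id x (1 : R))) (is_derive_cst b x (1 : R)).
  by move=> /is_derive_eq; apply; rewrite addr0; exact: mulr1.
have := @is_derive1_comp _ h (fun y : R => a * y + b) x _ _ hl H.
by move=> /is_derive_eq; apply; rewrite mulrC.
Qed.

Lemma jet_affine a b f : jet f -> jet (fun n x => a ^+ n * f n (a * x + b)).
Proof.
move=> jf n x; have := is_deriveZ (a ^+ n) (is_derive_affine (jf n (a * x + b))).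
by move=> /is_derive_eq; apply; rewrite exprSr -[RHS]mulrA.
Qed.

Definition leibniz (f g : nat -> R -> R) (n : nat) (x : R) : R :=
  \sum_(k < n.+1) 'C(n, k)%:R * (f k x * g (n - k)%N x).

Lemma leibniz0 f g x : leibniz f g 0 x = f 0%N x * g 0%N x.
Proof. by rewrite /leibniz big_ord1 bin0 mul1r. Qed.

Lemma leibnizS f g n x :
  leibniz f g n.+1 x = leibniz (fun k => f k.+1) g n x + leibniz f (fun k => g k.+1) n x.
Proof.
rewrite /leibniz.
rewrite big_ord_recl [X in _ = _ + X]big_ord_recl !bin0 !subn0 [RHS]addrCA; congr (_ + _).
rewrite big_ord_recr [X in _ = X + _]big_ord_recr /= !binn !subnn addrAC; congr (_ + _).
rewrite -big_split/=; apply: eq_bigr => k _ /=.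
rewrite /bump /= !add1n binS natrD mulrDl addrC subSS; congr (_ + _).
by rewrite subnSK// ltn_ord.
Qed.

Lemma jet_leibniz f g : jet f -> jet g -> jet (leibniz f g).
Proof.
move=> + + n; elim: n f g => [|n IH] f g jf jg x.
  rewrite (_ : leibniz f g 0 = (f 0%N \* g 0%N)); last by apply/funext => y; rewrite leibniz0.
  apply: (is_derive_eq (is_deriveM (jf 0%N x) (jg 0%N x))).
  by rewrite leibnizS !leibniz0 addrC; congr (_ + _); exact: mulrC.
rewrite (_ : leibniz f g n.+1 = leibniz (fun k => f k.+1) g n \+ leibniz f (fun k => g k.+1) n); last first.
  by apply/funext => y; rewrite leibnizS.
rewrite leibnizS; apply: is_deriveD; apply: IH => //; exact: jetS.
Qed.

Definition tensor d (h : 'I_d -> R -> R) (x : Rd R d) : R :=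
  \prod_i h i ((x : 'rV[R]_d) 0 i).

Lemma is_derive_tensor d (h : 'I_d -> R -> R) (x : Rd R d) (i : 'I_d) (l : R) :
  is_derive ((x : 'rV[R]_d) 0 i) 1 (h i) l ->
  is_derive x (delta_mx 0 i : Rd R d) (tensor h)
    (l * \prod_(j | j != i) h j ((x : 'rV[R]_d) 0 j)).
Proof.
move=> [dh hl]; set c := \prod_(j | _) _.
have E : (fun t : R => t^-1 *: (tensor h (t *: (delta_mx 0 i : Rd R d) + x) - tensor h x)) =
    (fun t : R => (t^-1 *: (h i (t *: 1 + (x : 'rV[R]_d) 0 i) - h i ((x : 'rV[R]_d) 0 i))) * c).
  apply/funext => t; rewrite /tensor (bigD1 i)//= [X in _ *: (_ - X)](bigD1 i)//=.
  rewrite !mxE !eqxx /= -/c.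
  rewrite (_ : \prod_(j < d | j != i) _ = c); first by rewrite -mulrBl; exact: scalerAl.
  by apply: eq_bigr => j ji; rewrite !mxE (negbTE ji) andbF mulr0 add0r.
have cv : (fun t : R => t^-1 *: (tensor h (t *: (delta_mx 0 i : Rd R d) + x) - tensor h x)) @ 0^' --> l * c.
  rewrite E; apply: cvgMl; rewrite -hl; exact: dh.
apply: DeriveDef; first by apply/cvg_ex; exists (l * c).
exact: cvg_lim.
Qed.

(** Derivatives in different directions act on different factors, so only the multiplicity of each
    index in [s] counts. *)
Lemma pderiv_tensor d (h : 'I_d -> nat -> R -> R) (s : seq 'I_d) : (forall i, jet (h i)) ->
  pderiv s (tensor (fun i => h i 0%N)) = tensor (fun i => h i (count_mem i s)).
Proof.
move=> jh; elim: s => [|i s IH] //=; rewrite IH; apply/funext => x.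
have [_ ->] := @is_derive_tensor d (fun i => h i (count_mem i s)) x i _ (jh i (count_mem i s) ((x : 'rV[R]_d) 0 i)).
rewrite /tensor [RHS](bigD1 i)//= eqxx add1n; congr (_ * _).
by apply: eq_bigr => j ji; rewrite eq_sym (negbTE ji).
Qed.

Lemma tensor_continuous d (h : 'I_d -> R -> R) : (forall i, continuous (h i)) ->
  continuous (tensor h).
Proof.
move=> ch x; apply: continuous_big => [|i _ y]; first exact: mul_continuous.
apply: (@continuous_comp _ _ _ (fun y : 'rV[R]_d => y 0 i) (h i)); last exact: ch.
exact: coord_continuous.
Qed.

Lemma smooth_tensor d (h : 'I_d -> nat -> R -> R) : (forall i, jet (h i)) ->
  smooth (tensor (fun i => h i 0%N)).
Proof.
move=> jh s; rewrite pderiv_tensor//; split.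
  by apply: tensor_continuous => i; exact: jet_continuous.
by move=> i x; case: (@is_derive_tensor d (fun i => h i (count_mem i s)) x i _ (jh i (count_mem i s) ((x : 'rV[R]_d) 0 i))).
Qed.

Lemma pderiv0 d (s : seq 'I_d) : pderiv s (fun=> 0) = (fun=> 0) :> (Rd R d -> R).
Proof. by elim: s => [|i s IH]//=; rewrite IH; apply/funext => x; rewrite derive_cst. Qed.

Lemma csmooth_tensor d (h : 'I_d -> nat -> R -> R) : (forall i, jet (h i)) ->
  csmooth (fun x => (tensor (fun i => h i 0%N) x)%:C).
Proof.
move=> jh; split; first exact: smooth_tensor.
move=> s; rewrite (_ : (fun x => _) = fun=> 0) ?pderiv0//; split => [x|i x].
  exact: cst_continuous.
exact: derivable_cst.
Qed.

Lemma tensor_ctensor d (h : 'I_d -> R -> R) x :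
  (tensor h x)%:C = ctensor (fun i y => (h i y)%:C) x.
Proof. by rewrite /tensor /ctensor rmorph_prod. Qed.

Lemma measurable_tensor d (h : 'I_d -> R -> R) : (forall i, continuous (h i)) ->
  measurable_fun setT (tensor h).
Proof.
move=> ch; apply: measurable_prod => i _.
apply: (measurableT_comp (f := h i)); last exact: measurable_coord.
exact: continuous_measurable_fun.
Qed.

End Jets.

(** * The lattice *)

Section BinomialCosines.
Context (R : realType).

Lemma mean_value (f df : R -> R) : (forall x, is_derive x (1 : R) f (df x)) ->
  forall a b, exists c, `|c - a| <= `|b - a| /\ f b - f a = df c * (b - a).
Proof.
move=> df' a b; have cf : continuous f.
  move=> x; have d : derivable f x 1 by case: (df' x).
  exact/differentiable_continuous/derivable1_diffP.
have [ab|ba|->] := ltgtP a b.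
- have [c /[!in_itv]/= /andP[c1 c2] E] := MVT ab (fun x _ => df' x) (continuous_subspaceT cf).
  by exists c; split => //; rewrite !ger0_norm ?subr_ge0 ?(ltW ab) ?(ltW c1)// lerD2r ltW.
- have [c /[!in_itv]/= /andP[c1 c2] E] := MVT ba (fun x _ => df' x) (continuous_subspaceT cf).
  exists c; split; last by rewrite -opprB E -mulrN opprB.
  by rewrite !ler0_norm ?subr_le0 ?(ltW ba) ?(ltW c2)// !opprB lerD2l lerN2 ltW.
- by exists b; rewrite !subrr mulr0.
Qed.

Lemma cisD (a b : R) : cis (a + b) = cis a * cis b.
Proof. by rewrite /cis cosD sinD; simpc; rewrite [sin a * _ + _]addrC. Qed.

Lemma cis0 : cis 0 = 1 :> R[i].
Proof. by rewrite /cis cos0 sin0. Qed.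

Lemma cisX (a : R) n : cis a ^+ n = cis (n%:R * a).
Proof.
elim: n => [|n IH]; first by rewrite expr0 mul0r cis0.
by rewrite exprS IH -cisD -addn1 natrD mulrDl mul1r addrC.
Qed.

Lemma cis_sum (I : Type) (s : seq I) (a : I -> R) :
  cis (\sum_(i <- s) a i) = \prod_(i <- s) cis (a i).
Proof.
by elim/big_rec2: _ => [|i y1 y2 _ <-]; [rewrite cis0|rewrite cisD].
Qed.

(** With [j = l - n], this is up to the sign [(-1) ^ a] the derivative of order [2 a] of the
    function [(2 cos (k / 2)) ^ (2 n)]. *)
Definition bincos (a n : nat) (k : R) : R :=
  \sum_(0 <= l < n.*2.+1) (l%:R - n%:R) ^+ a.*2 * 'C(n.*2, l)%:R * cos ((l%:R - n%:R) * k).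

Lemma bincos0 n k : bincos 0 n k = 4 ^+ n * cos (k / 2) ^+ 2 ^+ n.
Proof.
have E : (cis (- (k / 2)) + cis (k / 2)) ^+ n.*2 =
    \sum_(l < n.*2.+1) (cis ((l%:R - n%:R) * k)) *+ 'C(n.*2, l).
  rewrite exprDn; apply: eq_bigr => l _; congr (_ *+ _).
  rewrite !cisX -cisD; congr cis.
  have ln : (l <= n.*2)%N by rewrite -ltnS.
  have n2 : n.*2%:R = n%:R * 2 :> R by rewrite -muln2 natrM.
  by rewrite natrB// n2; field.
have := congr1 (@complex.Re R) E.
rewrite raddf_sum /= => E2; rewrite /bincos big_mkord.
under eq_bigr do rewrite expr0 mul1r mulr_natl.
transitivity (\sum_(l < n.*2.+1) Re (cis ((l%:R - n%:R) * k) *+ 'C(n.*2, l))).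
  by apply: eq_bigr => l _; rewrite (raddfMn (@complex.Re R)).
rewrite -E2 /cis cosN sinN; simpc; rewrite addNr.
have -> : (cos (k / 2) + cos (k / 2))%R +i* 0 = (2 * cos (k / 2))%:C by rewrite mulrDl mul1r.
have -> : (2 * cos (k / 2))%:C ^+ n.*2 = ((2 * cos (k / 2)) ^+ n.*2)%:C by rewrite rmorphXn.
have e4 : (2 * cos (k / 2)) ^+ 2 = 4 * cos (k / 2) ^+ 2 by ring.
by rewrite /= -muln2 mulnC exprM e4 exprMn.
Qed.

(** With [j = l - n], this rests on the identity ((n + 1)^2 - j^2) C(2n + 2, n + 1 + j) = (2n + 2)
    (2n + 1) C(2n, n + j). It stands in for two differentiations of a power of the cosine. *)
Lemma bincosS a n k :
  bincos a.+1 n.+1 k = n.+1%:R ^+ 2 * bincos a n.+1 k - (n.+1.*2 * n.*2.+1)%:R * bincos a n k.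
Proof.
suff H : n.+1%:R ^+ 2 * bincos a n.+1 k - bincos a.+1 n.+1 k = (n.+1.*2 * n.*2.+1)%:R * bincos a n k.
  by rewrite -H opprB addrC subrK.
apply/esym; rewrite /bincos !mulr_sumr -sumrB.
rewrite doubleS [RHS]big_nat_recl// [X in _ = _ + X]big_nat_recr//=.
have n2 : n.*2%:R = 2 * n%:R :> R by rewrite -mul2n natrM.
(* The two extreme terms carry the factor (n + 1)^2 - j^2 with [j] equal to -(n + 1) and to n +
   1. *)
rewrite [X in _ = X + _](_ : _ = 0); last by rewrite mulr0n sub0r !exprSr; ring.
rewrite [X in _ = _ + (_ + X)](_ : _ = 0); last first.
  by rewrite (_ : n.*2.+2%:R = 2 * n.+1%:R :> R) ?exprSr; [ring|rewrite -!natr1 n2; ring].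
rewrite add0r addr0; apply: eq_big_nat => l /andP[_ ln].
have -> : l.+1%:R - n.+1%:R = l%:R - n%:R :> R by rewrite -!natr1; ring.
have C : (n.*2.+2 * n.*2.+1)%:R * 'C(n.*2, l)%:R =
   (n.+1%:R ^+ 2 - (l%:R - n%:R) ^+ 2) * 'C(n.*2.+2, l.+1)%:R :> R.
  have e1 := mul_bin_diag n.*2.+2 l. have e2 := mul_bin_down n.*2.+1 l.
  rewrite /= in e1 e2.
  have e3 : ((n.*2.+2 * n.*2.+1) * 'C(n.*2, l) = (n.*2.+1 - l) * l.+1 * 'C(n.*2.+2, l.+1))%N.
    by rewrite -mulnA e2 mulnCA e1 mulnA.
  rewrite -natrM e3 !natrM natrB; last by rewrite ltnW.
  by congr (_ * _); rewrite -!natr1 n2; ring.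
rewrite -[in LHS]mulrA [LHS]mulrCA [_%:R * (_ * _)]mulrA C !exprSr; ring.
Qed.

(** By [bincosS], raising [a] by one costs one factor [cos (k / 2) ^+ 2] and a polynomial factor in
    [n]. The two terms of the recursion receive equal bounds, whence the power of 2. *)
Lemma bincos_bound a n k : (a <= n)%N ->
  `|bincos a n k| <= 2 ^+ a * n%:R ^+ a.*2 * 4 ^+ n * cos (k / 2) ^+ 2 ^+ (n - a).
Proof.
have y0 : 0 <= cos (k / 2) ^+ 2 by rewrite sqr_ge0.
have y1 : cos (k / 2) ^+ 2 <= 1 by rewrite cos2sin2 gerBl sqr_ge0.
elim: a n => [|a IH] [|n] // an.
- by rewrite bincos0 subn0 !mul1r ger0_norm// mulr_ge0// exprn_ge0.
- by rewrite bincos0 subn0 !mul1r ger0_norm// mulr_ge0// exprn_ge0.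
rewrite bincosS; apply: le_trans (ler_normB _ _) _.
rewrite normrM [X in _ + X]normrM (ger0_norm (exprn_ge0 2 (ler0n _ _))) (ger0_norm (ler0n _ _)) subSS.
have h1 := IH n.+1 (leqW an). have h2 := IH n an.
set y := cos (k / 2) ^+ 2 in y0 y1 h1 h2 *.
have e1 : `|bincos a n.+1 k| <= 2 ^+ a * n.+1%:R ^+ a.*2 * 4 ^+ n.+1 * y ^+ (n - a).
  apply: le_trans h1 _; rewrite ler_wpM2l ?mulr_ge0 ?exprn_ge0//.
  by apply: ler_wiXn2l => //; rewrite leq_sub2r.
have e2 : `|bincos a n k| <= 2 ^+ a * n.+1%:R ^+ a.*2 * 4 ^+ n * y ^+ (n - a).
  apply: le_trans h2 _; apply: ler_wpM2r; first exact: exprn_ge0.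
  apply: ler_wpM2r; first exact: exprn_ge0.
  apply: ler_wpM2l; first exact: exprn_ge0.
  by rewrite lerXn2r ?nnegrE// ler_nat.
have e3 : (n.+1.*2 * n.*2.+1)%:R <= 4 * n.+1%:R ^+ 2 :> R.
  rewrite -natrX -natrM ler_nat; nia.
apply: (@le_trans _ _ (n.+1%:R ^+ 2 * (2 ^+ a * n.+1%:R ^+ a.*2 * 4 ^+ n.+1 * y ^+ (n - a)) +
    4 * n.+1%:R ^+ 2 * (2 ^+ a * n.+1%:R ^+ a.*2 * 4 ^+ n * y ^+ (n - a)))).
  by apply: lerD; [rewrite ler_wpM2l ?exprn_ge0|apply: ler_pM => //; rewrite ler0n].
by rewrite doubleS !exprS le_eqVlt; apply/orP; left; apply/eqP; ring.
Qed.

(** The central coefficient is the largest of the 2n + 1 coefficients whose sum is 4^n. Normalising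
    by it therefore costs only a factor polynomial in [n]. *)
Lemma central_binomial n : 4 ^+ n <= n.*2.+1%:R * 'C(n.*2, n)%:R :> R.
Proof.
rewrite -natrX -natrM ler_nat; elim: n => [|n IH] //.
rewrite expnS.
have e1 := mul_bin_diag n.*2.+2 n. have e2 := mul_bin_down n.*2.+1 n.
rewrite /= in e1 e2.
have e3 : (n.*2.+1 - n = n.+1)%N by lia.
rewrite e3 in e2.
have e4 : ((n.*2.+2 * n.*2.+1) * 'C(n.*2, n) = n.+1 * n.+1 * 'C(n.*2.+2, n.+1))%N.
  by rewrite -mulnA e2 mulnCA e1 mulnA.
rewrite doubleS.
suff : (n.+1 * n.+1 * (4 * 4 ^ n) <= n.+1 * n.+1 * (n.*2.+3 * 'C(n.*2.+2, n.+1)))%N.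
  by rewrite leq_pmul2l.
rewrite mulnCA [leqRHS]mulnCA -e4.
move: ('C(_, _)) IH => C; move: (4 ^ n)%N => X; rewrite -!muln2; nia.
Qed.

Definition binratio (n j : nat) : R := 'C(n.*2, n + j)%:R / 'C(n.*2, n)%:R.

Lemma central_gt0 n : 0 < 'C(n.*2, n)%:R :> R.
Proof. by rewrite ltr0n bin_gt0 -addnn leq_addr. Qed.

Lemma binratio0 n : binratio n 0 = 1.
Proof. by rewrite /binratio addn0 divff// gt_eqF// central_gt0. Qed.

Lemma binratioS n j : binratio n j.+1 = (n - j)%:R / (n + j).+1%:R * binratio n j.
Proof.
have := mul_bin_left n.*2 (n + j); rewrite -addnn subnDl => /(congr1 (fun x => x%:R : R)).
rewrite !natrM => E; rewrite /binratio addnS mulrA; congr (_ / _).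
rewrite -addnn; apply: (@mulfI _ (n + j).+1%:R); first by rewrite pnatr_eq0.
by rewrite E mulrA mulrCA divff ?mulr1 ?pnatr_eq0.
Qed.

Lemma binratio_bound n j : 0 <= binratio n j <= 1.
Proof.
have h j' : 0 <= binratio n j' by rewrite /binratio divr_ge0.
rewrite h/=; elim: j => [|j IH]; first by rewrite binratio0.
rewrite binratioS; apply: mulr_ile1 => //.
by rewrite ler_pdivrMr ?ltr0n// mul1r ler_nat; lia.
Qed.

Lemma binratio_cvg j : binratio n j @[n --> \oo] --> (1 : R).
Proof.
elim: j => [|j IH].
  rewrite (_ : (fun n => binratio n 0) = fun=> 1); first exact: cvg_cst.
  by apply/funext => n; rewrite binratio0.
rewrite (_ : (fun n => binratio n j.+1) =
    (fun n => (n - j)%:R / (n + j).+1%:R) \* (fun n => binratio n j)); last first.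
  by apply/funext => n; rewrite binratioS.
suff H : (n - j)%:R / (n + j).+1%:R @[n --> \oo] --> (1 : R).
  by have := cvgM H IH; rewrite mulr1; exact.
have E : (fun n : nat => 1 - (j.*2.+1)%:R * n.+1%:R^-1) @ \oo --> (1 : R).
  have h : (fun n : nat => j.*2.+1%:R * n.+1%:R^-1) @ \oo --> (j.*2.+1%:R * 0 : R).
    by apply: cvgM; [exact: cvg_cst|exact: cvg_harmonic].
  by rewrite mulr0 in h; rewrite -[X in _ --> X]subr0; apply: cvgB => //; exact: cvg_cst.
apply: (squeeze_cvgr _ E (cvg_cst _)).
near=> n; have jn : (j <= n)%N by near: n; exact: nbhs_infty_ge.
apply/andP; split; last by rewrite ler_pdivrMr ?ltr0n// mul1r ler_nat; lia.
rewrite ler_pdivlMr ?ltr0n// mulrBl mul1r lerBlDr -lerBlDl.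
rewrite (_ : _ - _ = j.*2.+1%:R); last first.
  by rewrite natrB// -!natr1 natrD -muln2 natrM; ring.
rewrite -mulrA ler_peMr// mulrC ler_pdivlMr ?ltr0n// mul1r ler_nat; lia.
Unshelve. all: by end_near.
Qed.

End BinomialCosines.

(** * Smallness of [S] times the lattice spectrum *)

Section TrigSmall.
Context (R : realType).

Lemma normr_sin_le (x : R) : `|sin x| <= `|x|.
Proof.
have [c [_ E]] := mean_value (fun x => is_derive_sin x) 0 x.
by rewrite sin0 !subr0 in E; rewrite E normrM ler_piMl// cos_max.
Qed.

Lemma cos_ge_quadratic (x : R) : 1 - x ^+ 2 / 2 <= cos x.
Proof.
have -> : cos x = 1 - 2 * sin (x / 2) ^+ 2.
  have -> : x = (x / 2) *+ 2 by rewrite mulr2n -splitr.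
  rewrite cos_mulr2n cos2sin2 mulr2n (_ : (x / 2 + x / 2) / 2 = x / 2); last by field.
  by ring.
have : sin (x / 2) ^+ 2 <= (x / 2) ^+ 2.
  by rewrite -real_normK ?num_real// -[leRHS]real_normK ?num_real// lerXn2r ?nnegrE// normr_sin_le.
rewrite exprMn; lra.
Qed.

Lemma sin_ge_half (x : R) : 0 <= x <= 1 -> x / 2 <= sin x.
Proof.
move=> /andP[x0 x1]; have [c [cx E]] := mean_value (fun x => is_derive_sin x) 0 x.
rewrite sin0 !subr0 in E cx; rewrite E mulrC ler_wpM2r//.
have := cos_ge_quadratic c.
have : c ^+ 2 <= 1.
  rewrite -real_normK ?num_real// exprn_ile1// (le_trans cx)// ger0_norm//.
lra.
Qed.

(** The 16 is the square of the 4 in the lower bound of [sin (eta / 2)] by [eta / 4], valid because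
    [eta / 2] is at most 1. *)
Lemma cos_half_le (eta k : R) : 0 <= eta <= 2 -> eta <= `|k| <= pi ->
  cos (k / 2) ^+ 2 <= 1 - eta ^+ 2 / 16.
Proof.
move=> /andP[e0 e2] /andP[ek kp].
have -> : cos (k / 2) = cos (`|k| / 2).
  by rewrite -cos_norm normrM [X in _ * X]ger0_norm// invr_ge0.
have h0 : 0 <= cos (`|k| / 2).
  apply: cos_ge0_pihalf; rewrite (@le_trans _ _ 0) ?oppr_le0 ?divr_ge0 ?pi_ge0//=.
  by rewrite ler_pM2r ?invr_gt0.
have h1 : cos (`|k| / 2) <= cos (eta / 2).
  move: ek; rewrite le_eqVlt => /predU1P[->//|ek]; apply/ltW.
  have p2 := @pi_ge2 R; rewrite ltr_cos ?in_itv/= ?ltr_pM2r ?invr_gt0//; lra.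
apply: (@le_trans _ _ (cos (eta / 2) ^+ 2)); first by rewrite lerXn2r ?nnegrE// (le_trans h0).
rewrite cos2sin2 lerB//.
have : eta / 2 / 2 <= sin (eta / 2) by apply: sin_ge_half; lra.
move=> h; have : (eta / 2 / 2) ^+ 2 <= sin (eta / 2) ^+ 2.
  by rewrite lerXn2r ?nnegrE ?divr_ge0// (le_trans _ h)// !divr_ge0.
by rewrite !exprMn; lra.
Qed.

(** The Fourier series of the weights [q.[j ^+ 2]] times C(2n, n + j) / C(2n, n), grouped by the
    coefficients of [q]; [trigf_cos] undoes the grouping. *)
Definition trigf (q : {poly R}) (n : nat) (k : R) : R :=
  \sum_(a < size q) q`_a * bincos a n k / 'C(n.*2, n)%:R.

(** The exponent [g.*2.+1] collects [2 g] powers of [n] from [bincos_bound] and one from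
    [central_binomial]; the 3 in the constant comes from 2n + 1 <= 3n. *)
Lemma trigf_bound (q : {poly R}) (g : nat) : (size q <= g.+1)%N ->
  exists K : R, 0 <= K /\ forall n k, (g <= n)%N -> (0 < n)%N ->
    `|trigf q n k| <= K * n%:R ^+ (g.*2.+1) * cos (k / 2) ^+ 2 ^+ (n - g).
Proof.
move=> qg; exists (\sum_(a < size q) 3 * `|q`_a| * 2 ^+ a); split.
  by apply: sumr_ge0 => a _; rewrite !mulr_ge0 ?exprn_ge0.
move=> n k gn n0; rewrite /trigf !mulr_suml; apply: le_trans (ler_norm_sum _ _ _) _.
have y0 : 0 <= cos (k / 2) ^+ 2 by rewrite sqr_ge0.
have y1 : cos (k / 2) ^+ 2 <= 1 by rewrite cos2sin2 gerBl sqr_ge0.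
apply: ler_sum => a _; have ag : (a <= g)%N by rewrite -ltnS (leq_trans _ qg).
have c0 := central_gt0 R n.
rewrite !normrM normfV [X in _ / X]ger0_norm// ler_pdivrMr//.
have B := bincos_bound k (leq_trans ag gn).
have C := central_binomial R n.
have n1 : 1 <= n%:R :> R by rewrite ler1n.
set y := cos (k / 2) ^+ 2 in y0 y1 B *; clearbody y.
have D : `|bincos a n k| <= 2 ^+ a * n%:R ^+ g.*2 * 4 ^+ n * y ^+ (n - g).
  apply: le_trans B _; apply: ler_pM; rewrite ?mulr_ge0 ?exprn_ge0//; last first.
    by apply: ler_wiXn2l => //; rewrite leq_sub2l.
  rewrite ler_wpM2r ?exprn_ge0// ler_wpM2l ?exprn_ge0//.
  by apply: ler_weXn2l => //; rewrite leq_double.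
set Y := y ^+ (n - g) in D *.
have Y0 : 0 <= Y by rewrite exprn_ge0.
apply: (@le_trans _ _ (`|q`_a| * (2 ^+ a * n%:R ^+ g.*2 * (3 * n%:R * 'C(n.*2, n)%:R) * Y))); last first.
  by rewrite exprSr le_eqVlt; apply/orP; left; apply/eqP; ring.
rewrite ler_wpM2l// (le_trans D)// ler_wpM2r// ler_wpM2l ?mulr_ge0 ?exprn_ge0//.
apply: (le_trans C); apply: ler_wpM2r; first exact: ltW.
by rewrite -natrM ler_nat; lia.
Qed.

(** The left-hand side is nonincreasing in [r]. It makes [(1 - x) ^+ r] decay at least like the
    inverse of [r * x]. *)
Lemma bernoulli_decay (x : R) (r : nat) : 0 <= x <= 1 -> (1 - x) ^+ r * (1 + r%:R * x) <= 1.
Proof.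
move=> /andP[x0 x1]; elim: r => [|r IH]; first by rewrite expr0 mul0r addr0 mul1r.
have h : (1 - x) * (1 + r.+1%:R * x) <= 1 + r%:R * x.
  have : 0 <= r%:R * x * x by rewrite !mulr_ge0.
  by rewrite -natr1; nra.
rewrite exprSr -mulrA (le_trans _ IH)// ler_wpM2l// exprn_ge0// subr_ge0//.
Qed.

Lemma enorm_le_coord d (x : 'rV[R]_d) (rho : R) : 0 <= rho -> (forall i, `|x 0 i| <= rho) ->
  enorm x <= d%:R * rho.
Proof.
move=> r0 H; rewrite -[leRHS]ger0_norm ?mulr_ge0// -sqrtr_sqr ler_wsqrtr//.
apply: (@le_trans _ _ (\sum_(i < d) rho ^+ 2)).
  by apply: ler_sum => i _; rewrite -real_normK ?num_real// lerXn2r ?nnegrE// H.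
have -> : \sum_(i < d) rho ^+ 2 = d%:R * rho ^+ 2 by rewrite sumr_const card_ord [RHS]mulr_natl.
have -> : (d%:R * rho) ^+ 2 = (d%:R * d%:R) * rho ^+ 2 by ring.
apply: ler_wpM2r; first exact: sqr_ge0.
by rewrite -natrM ler_nat; case: (d) => // d'; rewrite leq_pmulr.
Qed.

Lemma trigf_small d (q : 'I_d -> {poly R}) (S : Rd R d -> R[i]) : (0 < d)%N ->
  vanishes_faster_than_polynomials S ->
  exists (g L : nat) (K : R), (0 < L)%N /\ forall N (x : Rd R d), (0 < N)%N ->
    (forall i, `|(x : 'rV[R]_d) 0 i| <= pi) ->
    normc (S x) * `|tensor (fun i k => trigf (q i) (g + L * N ^ 4) k ^+ 2) x| <=
    K / N%:R * (1 + normc (S x)).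
Proof.
move=> d0 vS; pose g := (\max_(i < d) size (q i))%N.
have /choice[K HK] i : exists K : R, 0 <= K /\ forall n k, (g <= n)%N -> (0 < n)%N ->
    `|trigf (q i) n k| <= K * n%:R ^+ (g.*2.+1) * cos (k / 2) ^+ 2 ^+ (n - g).
  by apply: trigf_bound; rewrite leqW// (@leq_bigmax _ (fun i => size (q i))).
(* [P] is the power of [n] in the product over [d] coordinates of the squared bounds. As [n] is of
   order [N ^ 4], the growth is of order [N ^ (4 P)]; it is compensated by vanishing of order
   [4 P + 1] near 0, and elsewhere by [L = 2 P + 1] factors of order [N ^ (-2)]. *)
pose p := g.*2.+1; pose P := (p * 2 * d)%N; pose L := P.*2.+1.
have LP : (2 * L = 4 * P + 2)%N by rewrite /L -[P.*2]mul2n; move: (P) => P'; lia.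
have [C [eps [C0 eps0 HS]]] := vS (4 * P).+1 isT.
pose K0 := \prod_i (K i ^+ 2); have K00 : 0 <= K0 by apply: prodr_ge0 => i _; rewrite sqr_ge0.
pose K1 := K0 * (g + L)%:R ^+ P; have K10 : 0 <= K1 by rewrite mulr_ge0// exprn_ge0.
pose e1 := Num.min eps 1.
have e10 : 0 < e1 by rewrite lt_min eps0 ltr01.
have e11 : e1 <= 1 by rewrite ge_min lexx orbT.
pose c := (e1 / d%:R) ^+ 2 / 16.
have dR : 0 < d%:R :> R by rewrite ltr0n.
have c0 : 0 < c by rewrite divr_gt0// exprn_gt0// divr_gt0.
(* For [n = g + L * N ^ 4]: if [|x| <= e1 / N], the order of vanishing of [S] beats the growth in [n];
   otherwise some [cos (x_i / 2) ^ 2] is at most [1 - c / N ^ 2] and its power beats it. *)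
exists g, L, (C * K1 + K1 * c^-1 ^+ L); split => // N x N0 xpi.
set n := (g + L * N ^ 4)%N.
have n0 : (0 < n)%N by rewrite addn_gt0 muln_gt0 expn_gt0 N0 orbT.
have gn : (g <= n)%N by rewrite leq_addr.
have NR : 0 < N%:R :> R by rewrite ltr0n.
have N1 : 1 <= N%:R :> R by rewrite ler1n.
pose Y i := cos ((x : 'rV[R]_d) 0 i / 2) ^+ 2.
have Y0 i : 0 <= Y i by rewrite sqr_ge0.
have Y1 i : Y i <= 1 by rewrite /Y cos2sin2 gerBl sqr_ge0.
have nP : n%:R ^+ P <= (g + L)%:R ^+ P * N%:R ^+ (4 * P) :> R.
  rewrite exprM -exprMn lerXn2r ?nnegrE ?mulr_ge0 ?exprn_ge0// -natrX -natrM ler_nat.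
  by rewrite mulnDl leq_add2r leq_pmulr// expn_gt0 N0.
have Yp i : 0 <= Y i ^+ (n - g) ^+ 2 <= 1.
  have h : 0 <= Y i ^+ (n - g) by rewrite exprn_ge0.
  by rewrite sqr_ge0/=; apply: exprn_ile1 => //; apply: exprn_ile1.
have F1 : `|tensor (fun i k => trigf (q i) n k ^+ 2) x| <=
    K1 * N%:R ^+ (4 * P) * \prod_i (Y i ^+ (n - g) ^+ 2).
  rewrite /tensor normr_prod.
  apply: (@le_trans _ _ (\prod_i (K i * n%:R ^+ p * Y i ^+ (n - g)) ^+ 2)).
    apply: ler_prod => i _; rewrite normr_ge0/= normrX lerXn2r ?nnegrE//.
      by case: (HK i) => Ki _; rewrite !mulr_ge0// exprn_ge0.
    by case: (HK i) => _; apply.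
  under eq_bigr do rewrite exprMn. rewrite big_split/= ler_wpM2r//.
    by apply: prodr_ge0 => i _; rewrite sqr_ge0.
  under eq_bigr do rewrite exprMn. rewrite big_split/= -/K0 -mulrA ler_wpM2l//.
  by rewrite prodr_const card_ord -!exprM mulnA.
apply: (@le_trans _ _ (normc (S x) * (K1 * N%:R ^+ (4 * P) * \prod_i (Y i ^+ (n - g) ^+ 2)))).
  by rewrite ler_wpM2l//; case: (S x) => ? ?; exact: sqrtr_ge0.
set s := normc (S x).
have s0 : 0 <= s by rewrite /s; case: (S x) => ? ?; exact: sqrtr_ge0.
have [small|big] := leP (enorm (x : 'rV[R]_d)) (e1 / N%:R).
  have PY : \prod_i (Y i ^+ (n - g) ^+ 2) <= 1.
    by apply: prodr_ile1 => i.
  have : s <= C * (N%:R^-1) ^+ (4 * P).+1.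
    apply: le_trans (HS x _) _.
      by rewrite (le_trans small)// ler_pdivrMr// (@le_trans _ _ eps) ?ge_min ?lexx// ler_peMr// ltW.
    apply: ler_wpM2l; first exact: ltW.
    rewrite lerXn2r ?nnegrE ?sqrtr_ge0 ?invr_ge0//.
    by rewrite (le_trans small)// -[leRHS]mul1r ler_wpM2r// invr_ge0.
  move=> sC; apply: (@le_trans _ _ (C * (N%:R^-1) ^+ (4 * P).+1 * (K1 * N%:R ^+ (4 * P) * 1))).
    apply: ler_pM => //; first by rewrite !mulr_ge0 ?exprn_ge0//; apply: prodr_ge0 => i _; rewrite sqr_ge0.
    by rewrite ler_wpM2l// mulr_ge0// exprn_ge0.
  have -> : C * (N%:R^-1) ^+ (4 * P).+1 * (K1 * N%:R ^+ (4 * P) * 1) = C * K1 / N%:R.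
    by rewrite exprS exprVn; field; rewrite expf_neq0 gt_eqF.
  rewrite -[leLHS]mulr1; apply: ler_pM; rewrite ?lerDl// ?divr_ge0 ?mulr_ge0 ?(ltW C0)//.
  by rewrite ler_wpM2r ?invr_ge0// lerDl mulr_ge0// exprn_ge0// invr_ge0 ltW.
have [j xj] : exists j, e1 / d%:R / N%:R < `|(x : 'rV[R]_d) 0 j|.
  apply: contrapT => /forallNP H; move: big; rewrite ltNge => /negP; apply.
  apply: le_trans (@enorm_le_coord _ x (e1 / d%:R / N%:R) _ _) _.
  - by rewrite !divr_ge0// ltW.
  - by move=> i; rewrite leNgt; apply/negP; exact: H.
  - by rewrite le_eqVlt; apply/orP; left; apply/eqP; field; rewrite !gt_eqF.
pose t := c / N%:R ^+ 2.
have t0 : 0 <= t by rewrite divr_ge0 ?(ltW c0)// sqr_ge0.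
have Yt : Y j <= 1 - t.
  have -> : t = (e1 / d%:R / N%:R) ^+ 2 / 16 by rewrite /t /c; field; rewrite !gt_eqF.
  apply: cos_half_le; last by rewrite (ltW xj) xpi.
  rewrite !divr_ge0 ?(ltW e10)//= (@le_trans _ _ 1)// ?ler1n//.
  rewrite -mulrA -invfM ler_pdivrMr; last by rewrite mulr_gt0.
  rewrite mul1r (le_trans e11)//.
  by rewrite -natrM ler1n muln_gt0 d0 N0.
have t1 : t <= 1 by rewrite -subr_ge0 (le_trans _ Yt).
have cN : 0 < c * N%:R ^+ 2 by apply: mulr_gt0 => //; exact: exprn_gt0.
have YN : Y j ^+ (N ^ 4) <= c^-1 / N%:R ^+ 2.
  apply: (@le_trans _ _ ((1 - t) ^+ (N ^ 4))).
    by rewrite lerXn2r ?nnegrE ?subr_ge0.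
  have := @bernoulli_decay t (N ^ 4); rewrite t0 t1 => /(_ isT).
  have p0 : 0 <= (1 - t) ^+ (N ^ 4) by rewrite exprn_ge0// subr_ge0.
  rewrite natrX => h.
  rewrite -[leRHS]mul1r -[c^-1 / _]invrK invfM !invrK ler_pdivlMr//.
  apply: le_trans h; rewrite ler_wpM2l//.
  have -> : N%:R ^+ 4 * t = c * N%:R ^+ 2 by rewrite /t; field; rewrite gt_eqF.
  by rewrite lerDr.
have PY : \prod_i (Y i ^+ (n - g) ^+ 2) <= (c^-1 / N%:R ^+ 2) ^+ L.
  rewrite (bigD1 j)//= -[leRHS]mulr1; apply: ler_pM => //.
  - by rewrite sqr_ge0.
  - by apply: prodr_ge0 => i _; rewrite sqr_ge0.
  - rewrite /n addKn mulnC exprM.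
    have h' : 0 <= Y j ^+ (N ^ 4) by rewrite exprn_ge0.
    have h1 : Y j ^+ (N ^ 4) ^+ L <= 1 by apply: exprn_ile1 => //; apply: exprn_ile1.
    have h2 : 0 <= Y j ^+ (N ^ 4) ^+ L := exprn_ge0 L h'.
    apply: (@le_trans _ _ (Y j ^+ (N ^ 4) ^+ L)); first by rewrite expr2; apply: ler_piMl.
    by rewrite lerXn2r ?nnegrE ?(le_trans h' YN).
  - by apply: prodr_ile1 => i.
apply: (@le_trans _ _ (s * (K1 * c^-1 ^+ L / N%:R))).
  rewrite ler_wpM2l// (le_trans (ler_wpM2l _ PY)) ?mulr_ge0 ?exprn_ge0//.
  have E : N%:R ^+ (4 * P) * (c^-1 / N%:R ^+ 2) ^+ L = c^-1 ^+ L / N%:R ^+ 2.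
    rewrite exprMn mulrCA; congr (_ * _).
    rewrite exprVn -exprM LP.
    by rewrite exprD invfM mulrA divff ?mul1r// expf_neq0// gt_eqF.
  have -> : K1 * N%:R ^+ (4 * P) * (c^-1 / N%:R ^+ 2) ^+ L = K1 * c^-1 ^+ L / N%:R ^+ 2.
    by rewrite -[LHS]mulrA E [LHS]mulrA.
  apply: ler_wpM2l; first by apply: mulr_ge0 => //; rewrite exprn_ge0// invr_ge0 ltW.
  by rewrite lef_pV2 ?posrE ?exprn_gt0// expr2 ler_peMr// ltW.
rewrite mulrC -[leLHS]mulr1; apply: (@le_trans _ _ (K1 * c^-1 ^+ L / N%:R * (1 + s))).
  by rewrite mulr1 ler_wpM2l ?lerDr// divr_ge0 ?mulr_ge0 ?exprn_ge0 ?invr_ge0 ?(ltW c0).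
by rewrite ler_wpM2r ?addr_ge0// ler_wpM2r ?invr_ge0// lerDr mulr_ge0// ltW.
Qed.

End TrigSmall.

(** * Waves and Fourier coefficients on the torus *)

Section TorusFourier.
Context (R : realType) (d : nat).
Local Notation leb := (@lebesgue_measure R).

(** Each derivative advances the phase by [pi / 2]. The phase [theta = 0] gives the cosine and
    [theta = - (pi / 2)] the sine, so that one jet serves for both. *)
Definition cosjet (theta : R) (n : nat) (y : R) : R := cos (y + (theta + n%:R * (pi / 2))).

Lemma jet_cosjet theta : jet (cosjet theta).
Proof.
move=> n x; have H : is_derive x (1 : R) (fun y : R => y + (theta + n%:R * (pi / 2))) 1.
  have := is_deriveD (is_derive_id x (1 : R)) (is_derive_cst (theta + n%:R * (pi / 2)) x (1 : R)).
  by move=> /is_derive_eq; apply; rewrite addr0.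
have := @is_derive1_comp _ (@cos R) _ x _ _ (is_derive_cos _) H.
move=> /is_derive_eq; apply; rewrite mulr1 -cosDpihalf; congr cos.
by rewrite -natr1; ring.
Qed.

Lemma is_derive_line (F : Rd R d -> R) (h : R -> R) (v x : Rd R d) (l : R) :
  (forall t : R, F (t *: v + x) = h t) -> is_derive (0 : R) (1 : R) h l -> is_derive x v F l.
Proof.
move=> Fh [dh hl].
have E : (fun t : R => t^-1 *: (F (t *: v + x) - F x)) =
    (fun t : R => t^-1 *: (h (t *: 1 + 0) - h 0)).
  apply/funext => t; rewrite Fh -(Fh 0) scale0r add0r; congr (_ *: (h _ - _)).
  by rewrite addr0; exact/esym/mulr1.
have cv : (fun t : R => t^-1 *: (F (t *: v + x) - F x)) @ 0^' --> l.
  by rewrite E -hl; exact: dh.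
by apply: DeriveDef; [apply/cvg_ex; exists l|exact: cvg_lim].
Qed.

Lemma dotpDl (x y z : 'rV[R]_d) : dotp (x + y) z = dotp x z + dotp y z.
Proof. by rewrite /dotp -big_split; apply: eq_bigr => i _; rewrite mxE mulrDl. Qed.

Lemma dotpZl a (x y : 'rV[R]_d) : dotp (a *: x) y = a * dotp x y.
Proof. by rewrite /dotp mulr_sumr; apply: eq_bigr => i _; rewrite mxE mulrA. Qed.

Lemma dotp_delta i (y : 'rV[R]_d) : dotp (delta_mx 0 i) y = y 0 i.
Proof.
rewrite /dotp (bigD1 i)//= mxE !eqxx mul1r big1 ?addr0// => j ji.
by rewrite mxE (negbTE ji) andbF mul0r.
Qed.

Lemma is_derive_plane_wave theta n (x k : Rd R d) i :
  is_derive k (delta_mx 0 i : Rd R d) (fun k : Rd R d => cosjet theta n (dotp k x))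
    (x 0 i * cosjet theta n.+1 (dotp k x)).
Proof.
apply: (@is_derive_line _ (fun t => cosjet theta n (x 0 i * t + dotp k x))).
  by move=> t; rewrite dotpDl dotpZl dotp_delta mulrC.
have := @is_derive_affine _ (cosjet theta n) (x 0 i) (dotp k x) 0 (cosjet theta n.+1 (dotp k x)).
by rewrite mulr0 add0r; apply; exact: jet_cosjet.
Qed.

Lemma pderiv_plane_wave theta (x : Rd R d) (s : seq 'I_d) :
  pderiv s (fun k : Rd R d => cosjet theta 0 (dotp k x)) =
  fun k => (\prod_(i <- s) x 0 i) * cosjet theta (size s) (dotp k x).
Proof.
elim: s => [|i s IH]; first by apply/funext => k; rewrite big_nil mul1r.
rewrite /= IH; apply/funext => k.
have [D1 D2] := is_deriveZ (\prod_(i <- s) x 0 i) (is_derive_plane_wave theta (size s) x k i).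
apply: (etrans D2); rewrite big_cons; set p := \prod_(_ <- _) _; set c := cosjet _ _ _.
by rewrite [RHS]mulrAC -[RHS]mulrC; congr (_ * _); rewrite mulrC.
Qed.

Lemma smooth_plane_wave theta (x : Rd R d) :
  smooth (fun k : Rd R d => cosjet theta 0 (dotp k x)).
Proof.
move=> s; rewrite pderiv_plane_wave; split; last first.
  by move=> i k; have [] := is_deriveZ (\prod_(i <- s) x 0 i) (is_derive_plane_wave theta (size s) x k i).
have cd : continuous (fun k : Rd R d => dotp k x).
  move=> k; apply: continuous_big => [|i _ y]; first exact: add_continuous.
  apply: (@continuous_comp _ _ _ (fun y : 'rV[R]_d => y 0 i) (fun t => t * x 0 i)).
    exact: coord_continuous.
  exact: mulrr_continuous.
move=> k; apply: (@continuous_comp _ _ _ (fun k : Rd R d => dotp k x)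
  (fun y => (\prod_(i <- s) x 0 i) * cosjet theta (size s) y)); first exact: cd.
apply: (jet_continuous (f := fun n y => (\prod_(i <- s) x 0 i) * cosjet theta n y)).
by apply: jetZ; exact: jet_cosjet.
Qed.

Lemma csmooth_plane_wave (x : Rd R d) : csmooth (fun k : Rd R d => cis (dotp k x)).
Proof.
split.
  rewrite (_ : (fun k => _) = fun k => cosjet 0 0 (dotp k x)); first exact: smooth_plane_wave.
  by apply/funext => k; rewrite /cosjet mul0r !addr0.
rewrite (_ : (fun k => _) = fun k => cosjet (- (pi / 2)) 0 (dotp k x)); first exact: smooth_plane_wave.
by apply/funext => k; rewrite /cosjet mul0r addr0 cosBpihalf.
Qed.

Lemma Rintegral_derive (F f : R -> R) (a b : R) : a < b -> continuous f ->
  (forall x, is_derive x (1 : R) F (f x)) ->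
  \int[leb]_(x in `[a, b]) f x = F b - F a.
Proof.
move=> ab cf dF; have cF : continuous F.
  move=> x; have dd : derivable F x 1 by case: (dF x).
  exact/differentiable_continuous/derivable1_diffP.
rewrite /Rintegral (@continuous_FTC2 _ f F)//.
- exact: continuous_subspaceT.
- split => [x _||]; first by case: (dF x).
  + exact/cvg_at_right_filter/cF.
  + exact/cvg_at_left_filter/cF.
- by move=> x _; rewrite derive1E; case: (dF x).
Qed.

Lemma sin_natpi n : sin (n%:R * pi) = 0 :> R.
Proof.
elim: n => [|n IH]; first by rewrite mul0r sin0.
by rewrite -natr1 mulrDl mul1r sinDpi IH oppr0.
Qed.

Lemma sin_intpi (n : int) : sin (n%:~R * pi) = 0 :> R.
Proof.
case: n => n; first exact: sin_natpi.
by rewrite NegzE mulrNz mulNr sinN sin_natpi oppr0.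
Qed.

Lemma cis_2pi_nat (n : nat) : cis (n%:R * (2 * pi)) = 1 :> R[i].
Proof. by rewrite -cisX mulrC mulr_natr /cis cos2pi sin2pi expr1n. Qed.

Lemma cis_2pi_int (n : int) : cis (n%:~R * (2 * pi)) = 1 :> R[i].
Proof.
case: n => n; first exact: cis_2pi_nat.
have := cis_2pi_nat n.+1; rewrite /cis NegzE mulrNz mulNr cosN sinN => -[-> ->].
by rewrite oppr0.
Qed.

Definition period_cell : set R := `[- pi, pi[%classic.

Definition cell_wave (n : int) (y : R) : R[i] := (\1_period_cell y)%:C * cis (y * n%:~R).

Lemma cell_wave_integral (f : R -> R) : continuous f ->
  leb.-integrable setT (fun y => (\1_period_cell y * f y)%:E) /\
  \int[leb]_y (\1_period_cell y * f y) = \int[leb]_(y in `[- pi, pi]) f y.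
Proof.
move=> cf; have ic : leb.-integrable `[- pi, pi] (EFin \o f).
  by apply: continuous_compact_integrable; [exact: segment_compact|exact: continuous_subspaceT].
have E : (fun y => \1_period_cell y * f y) = f \_ period_cell.
  apply/funext => y; rewrite patchE indicE; case: ifP; rewrite ?mul1r ?mul0r//.
have icc : leb.-integrable period_cell (EFin \o f).
  apply: integrableS ic => //; first exact: measurable_itv.
  by move=> y; rewrite /period_cell/= !in_itv/= => /andP[-> /ltW].
split.
  rewrite (_ : (fun y => _) = (EFin \o f) \_ period_cell).
    by apply/(integrable_mkcond _ _).1; [exact: measurable_itv|].
  by rewrite restrict_EFin -E.
rewrite E -Rintegral_mkcond; apply: Rintegral_itv_bndo_bndc.
exact: icc.
Qed.

Lemma Re_cell_wave n y : Re (cell_wave n y) = \1_period_cell y * cos (n%:~R * y + 0).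
Proof. by rewrite /cell_wave /cis addr0 [_ * y]mulrC; simpc. Qed.

Lemma Im_cell_wave n y : Im (cell_wave n y) = \1_period_cell y * cos (n%:~R * y - pi / 2).
Proof. by rewrite /cell_wave /cis cosBpihalf [_ * y]mulrC; simpc. Qed.

Lemma continuous_phase (a b : R) : continuous (fun y => cos (a * y + b)).
Proof.
move=> y; apply: (@continuous_comp _ _ _ (fun y => a * y + b) (@cos R)); last exact: continuous_cos.
by apply: cvgD; [apply: cvgM; [exact: cvg_cst|exact: cvg_id]|exact: cvg_cst].
Qed.

Lemma cell_wave_integrable n : cintegrable (cell_wave n).
Proof.
split.
  have := (cell_wave_integral (@continuous_phase n%:~R 0)).1.
  by congr (_.-integrable _ _); apply/funext => y; rewrite Re_cell_wave.
have := (cell_wave_integral (@continuous_phase n%:~R (- (pi / 2)))).1.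
by congr (_.-integrable _ _); apply/funext => y; rewrite Im_cell_wave.
Qed.

Lemma cint_cell_wave n : cint (cell_wave n) = if n == 0 then (2 * pi)%:C else 0.
Proof.
rewrite /cint; under eq_Rintegral do rewrite Re_cell_wave.
under [X in _ +i* X]eq_Rintegral do rewrite Im_cell_wave.
rewrite (cell_wave_integral (@continuous_phase n%:~R 0)).2 (cell_wave_integral (@continuous_phase n%:~R (- (pi / 2)))).2.
have pp : - pi < pi :> R by rewrite gtrN// pi_gt0.
case: eqP => [->|/eqP n0].
  under eq_Rintegral do rewrite mul0r addr0 cos0.
  under [X in _ +i* X]eq_Rintegral do rewrite mul0r add0r cosN cos_pihalf.
  rewrite !Rintegral_cst//= mul0r mul1r lebesgue_measure_itv/= lte_fin pp /=.
  by congr (_ +i* _); ring.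
have nR : n%:~R != 0 :> R by rewrite intr_eq0.
have J theta x : is_derive x (1 : R) (fun y => n%:~R^-1 * cos (n%:~R * y + (theta - pi / 2))) (cos (n%:~R * x + theta)).
  have H := is_deriveZ (n%:~R^-1 : R) (is_derive_affine (is_derive_cos (n%:~R * x + (theta - pi / 2)))).
  apply: (is_derive_eq H); rewrite addrA sinBpihalf opprK.
  by rewrite -[LHS]/(n%:~R^-1 * (n%:~R * _)) mulrA mulVf// mul1r.
have sp (x : R) : sin (- x) = - sin x by exact: sinN.
rewrite (Rintegral_derive pp (@continuous_phase _ _) (J 0)).
rewrite (Rintegral_derive pp (@continuous_phase _ _) (J (- (pi / 2)))).
rewrite add0r !cosBpihalf mulrN sinN sin_intpi oppr0 mulr0 subr0.
rewrite -opprD -splitr !cosB !cospi !sinpi cosN !mulr0 !addr0 subrr //.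
Qed.

Lemma cint_mkcond (D : set (Rd R d)) (f : Rd R d -> R[i]) :
  cint_Rd D f = cint_Rd setT (fun k => (\1_D k)%:C * f k).
Proof.
have [m mP] := lebesgue_Rd_exists R d.
rewrite !(cint_RdE _ _ mP) [X in X +i* _]Rintegral_mkcond [X in _ +i* X]Rintegral_mkcond.
by congr (_ +i* _); apply: eq_Rintegral => k _; rewrite patchE indicE;
  case: ifP; case: (f k) => ? ?; simpc; rewrite ?mul1r ?mul0r.
Qed.

Lemma indic_torus_cell (k : Rd R d) :
  \1_(@torus_cell R d) k = \prod_i \1_period_cell ((k : 'rV[R]_d) 0 i) :> R.
Proof.
rewrite indicE; case: (boolP (k \in _)) => [/set_mem H|/negP H].
  rewrite big1// => i _; rewrite indicE mem_set//= /period_cell/= in_itv/=; exact: H.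
have [i Hi] : exists i, ~ period_cell ((k : 'rV[R]_d) 0 i).
  apply: contrapT => /forallNP Hn; apply: H; apply: mem_set => i.
  by move: (contrapT (Hn i)); rewrite /period_cell/= in_itv.
by rewrite (bigD1 i)//= indicE memNset// mul0r.
Qed.

Lemma Zd_Rd_coord (x : Zd R d) i : (Zd_Rd x : 'rV[R]_d) 0 i = ((x : 'rV[int]_d) 0 i)%:~R.
Proof. by rewrite mxE. Qed.

Lemma fourier_torus_wave (x0 x : Zd R d) :
  fourier_torus (fun k => cis (dotp k (Zd_Rd x0))) x = if x == x0 then (2 * pi)%:C ^+ d else 0.
Proof.
rewrite /fourier_torus cint_mkcond.
rewrite (_ : (fun k => _) = ctensor (fun i => cell_wave ((x0 : 'rV[int]_d) 0 i - (x : 'rV[int]_d) 0 i))).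
  rewrite cint_ctensor => [|i]; last exact: cell_wave_integrable.
  under eq_bigr do rewrite cint_cell_wave subr_eq0.
  case: eqP => [->|/eqP xx0].
    by under eq_bigr do rewrite eqxx; rewrite prodr_const card_ord.
  have [i xi] : exists i, (x0 : 'rV[int]_d) 0 i != (x : 'rV[int]_d) 0 i.
    apply: contrapT => /forallNP H; move/eqP: xx0; apply; apply/rowP => i.
    by have /negP := H i; rewrite negbK => /eqP.
  by rewrite (bigD1 i)//= (negbTE xi) mul0r.
apply/funext => k; rewrite /ctensor /cell_wave big_split/= indic_torus_cell rmorph_prod; congr (_ * _).
rewrite -cisD -cis_sum; congr cis; rewrite /dotp -sumrN -big_split/=.
by apply: eq_bigr => i _; rewrite !Zd_Rd_coord intrD mulrDr mulrNz mulrN.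
Qed.

Lemma torus_periodic_wave (x0 : Zd R d) : torus_periodic (fun k => cis (dotp k (Zd_Rd x0))).
Proof.
move=> k n; rewrite dotpDl dotpZl cisD.
have -> : dotp (Zd_Rd n) (Zd_Rd x0) = (\sum_i (n : 'rV[int]_d) 0 i * (x0 : 'rV[int]_d) 0 i)%:~R.
  by rewrite /dotp rmorph_sum; apply: eq_bigr => i _; rewrite !Zd_Rd_coord rmorphM.
by rewrite [_ * _%:~R]mulrC cis_2pi_int mulr1.
Qed.

(** The wave attached to [x0] has Fourier coefficients that vanish except at [x0], so the sums over
    balls are constant once the ball contains [x0]. *)
Lemma covariance_wave (beta : Zd R d -> R[i]) (S : Rd R d -> R[i]) (x0 : Zd R d) :
  structure_function_Zd beta S ->
  beta x0 * (2 * pi)%:C ^+ d =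
  cint_Rd (@torus_cell R d) (fun k => S k * cis (dotp k (Zd_Rd x0))).
Proof.
move=> [_ _ /(_ _ (csmooth_plane_wave (Zd_Rd x0)) (torus_periodic_wave x0))].
set u := fun n => _; set L := cint_Rd _ _ => -[c1 c2].
pose N := Num.bound (enorm (Zd_Rd x0)).
have uE n : (N <= n)%N -> u n = beta x0 * (2 * pi)%:C ^+ d.
  move=> Nn; rewrite /u -(fsbig_widen [set x0]); first by rewrite fsbig_set1 fourier_torus_wave eqxx.
  - move=> _ ->/=; rewrite (le_trans (ltW (archi_boundP _)))// ?ler_nat// sqrtr_ge0//.
  - by move=> x [_ /eqP/negbTE xx0] /=; rewrite fourier_torus_wave xx0 mulr0.
set l := beta x0 * _ in uE *.
have e1 : Re l = Re L.
  apply: (cvg_unique _ _ c1) => //; apply: cvg_near_cst.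
  by near=> n; rewrite uE//; near: n; exact: nbhs_infty_ge.
have e2 : Im l = Im L.
  apply: (cvg_unique _ _ c2) => //; apply: cvg_near_cst.
  by near=> n; rewrite uE//; near: n; exact: nbhs_infty_ge.
by case: l L e1 e2 {c1 c2 uE} => ? ? [? ?] /= -> ->.
Unshelve. all: by end_near.
Qed.

End TorusFourier.

Section SumIntegral.
Context (R : realType) (d : nat).

Lemma cint_Rd_sum (S : Rd R d -> R[i]) (D : set (Rd R d)) (r : R) (I : Type) (s : seq I)
    (c : I -> R) (u : I -> Rd R d -> R[i]) :
  locally_integrable_Rd S -> measurable D -> (forall x, D x -> enorm x <= r) ->
  (forall i, measurable_fun setT (fun x => Re (u i x))) ->
  (forall i, measurable_fun setT (fun x => Im (u i x))) ->
  (forall i x, normc (u i x) <= 1) ->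
  cint_Rd D (fun x => S x * \sum_(i <- s) (c i)%:C * u i x) =
  \sum_(i <- s) (c i)%:C * cint_Rd D (fun x => S x * u i x).
Proof.
move=> [m1 m2 iS] mD Dr mu1 mu2 u1; have [m mP] := lebesgue_Rd_exists R d.
have mS := measurable_normc m1 m2.
have iSD : m.-integrable D (EFin \o (fun x => normc (S x))).
  pose K := [set x : Rd R d | enorm x <= r].
  have mK : measurable K by exact: (@measurable_sball R _ (Rd R d) r).
  apply: (integrableS mK mD); first exact: Dr.
  apply/integrableP; split; first by apply/measurable_EFinP; exact: measurable_funTS.
  have := iS r; rewrite (lebesgue_Rd_integral _ _ mP); apply: le_lt_trans.
  apply: ge0_le_integral => //.
  - by apply/measurable_EFinP; apply: measurable_funTS; exact: measurableT_comp.
  - by apply/measurable_EFinP; exact: measurable_funTS.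
  - by move=> x _; rewrite /= ger0_norm//; case: (S x) => ? ?; exact: sqrtr_ge0.
have iu i : m.-integrable D (EFin \o (fun x => Re (S x * u i x))) /\
    m.-integrable D (EFin \o (fun x => Im (S x * u i x))).
  have b x : normc (S x * u i x) <= normc (S x).
    rewrite normcM -[leRHS]mulr1 ler_wpM2l//; by case: (S x) => ? ?; exact: sqrtr_ge0.
  have b' (x : Rd R d) (y : R) : `|y| <= normc (S x * u i x) -> (`|y%:E| <= `|(normc (S x))%:E|)%E.
    move=> yb; rewrite /= lee_fin [leRHS]ger0_norm ?(le_trans yb (b x))//.
    by case: (S x) => ? ?; exact: sqrtr_ge0.
  have [p1 p2] : (forall x, `|Re (S x * u i x)| <= normc (S x * u i x)) /\
      (forall x, `|Im (S x * u i x)| <= normc (S x * u i x)).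
    by split => x; case: (parts_le_normc (S x * u i x)).
  split; (apply: le_integrable iSD; [exact: mD| |by move=> x _; apply: b'; rewrite (p1,p2)]).
  - apply/measurable_EFinP; apply: measurable_funTS.
    rewrite (_ : (fun x => _) = (fun x => Re (S x) * Re (u i x) - Im (S x) * Im (u i x))).
      by apply: measurable_funB; exact: measurable_funM.
    by apply/funext => x; case: (S x); case: (u i x).
  - apply/measurable_EFinP; apply: measurable_funTS.
    rewrite (_ : (fun x => _) = (fun x => Re (S x) * Im (u i x) + Im (S x) * Re (u i x))).
      by apply: measurable_funD; exact: measurable_funM.
    by apply/funext => x; case: (S x); case: (u i x).
(* The integrability of the partial sums is carried along in the induction, since additivity of the
   integral requires it at each step. *)
have [_ _ ->] : [/\
  m.-integrable D (EFin \o (fun x => Re (S x * \sum_(i <- s) (c i)%:C * u i x))),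
  m.-integrable D (EFin \o (fun x => Im (S x * \sum_(i <- s) (c i)%:C * u i x))) &
  cint_Rd D (fun x => S x * \sum_(i <- s) (c i)%:C * u i x) =
  \sum_(i <- s) (c i)%:C * cint_Rd D (fun x => S x * u i x)]; last by [].
elim: s => [|i s [j1 j2 IH]].
  have E : (fun x : Rd R d => S x * \sum_(i <- [::]) (c i)%:C * u i x) = fun=> 0.
    by apply/funext => x; rewrite big_nil mulr0.
  have Z (f : Rd R d -> R) : (forall x, f x = 0) -> m.-integrable D (EFin \o f).
    move=> f0; rewrite (_ : EFin \o f = cst 0%E); first exact: integrable0.
    by apply/funext => x; rewrite /= f0.
  split; [by apply: Z => x; rewrite (congr1 (fun f => f x) E)|by apply: Z => x; rewrite (congr1 (fun f => f x) E)|].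
  rewrite E big_nil; by rewrite (cint_RdE _ _ mP)/= !Rintegral_cst// !mul0r.
have [i1 i2] := iu i.
have E1 : (fun x => Re (S x * \sum_(i <- i :: s) (c i)%:C * u i x)) = (fun x =>
    c i * Re (S x * u i x) + Re (S x * \sum_(i <- s) (c i)%:C * u i x)).
  apply/funext => x; rewrite big_cons mulrDr raddfD/=; congr (_ + _).
  by case: (S x) => ? ?; case: (u i x) => ? ?; simpc => /=; ring.
have E2 : (fun x => Im (S x * \sum_(i <- i :: s) (c i)%:C * u i x)) = (fun x =>
    c i * Im (S x * u i x) + Im (S x * \sum_(i <- s) (c i)%:C * u i x)).
  apply/funext => x; rewrite big_cons mulrDr raddfD/=; congr (_ + _).
  by case: (S x) => ? ?; case: (u i x) => ? ?; simpc => /=; ring.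
have k1 := integrableZl mD (c i) i1; have k2 := integrableZl mD (c i) i2.
rewrite E1 E2; split; [exact: (integrableD mD k1 j1)|exact: (integrableD mD k2 j2)|].
rewrite big_cons -IH !(cint_RdE _ _ mP).
under eq_Rintegral => x _ do rewrite (congr1 (fun f => f x) E1).
under [X in _ +i* X = _]eq_Rintegral => x _ do rewrite (congr1 (fun f => f x) E2).
rewrite (RintegralD mD k1 j1) (RintegralD mD k2 j2) (RintegralZl _ mD i1) (RintegralZl _ mD i2).
by simpc.
Qed.

End SumIntegral.

(** * Variance of a weighted sum over the lattice *)

Section LatticeVariance.
Context (R : realType) (d : nat).

Definition lattice_weight (q : {poly R}) (n l : nat) : R :=
  q.[(l%:R - n%:R) ^+ 2] * 'C(n.*2, l)%:R / 'C(n.*2, n)%:R.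

Lemma trigf_cos (q : {poly R}) n k :
  trigf q n k = \sum_(l < n.*2.+1) lattice_weight q n l * cos (k * (l%:R - n%:R)).
Proof.
rewrite /trigf /bincos; under eq_bigr do rewrite big_mkord mulr_sumr mulr_suml.
rewrite exchange_big; apply: eq_bigr => l _ /=; rewrite /lattice_weight horner_coef !mulr_suml.
by apply: eq_bigr => a _; rewrite -exprM mul2n [k * _]mulrC; ring.
Qed.

Lemma trigf_continuous (q : {poly R}) n : continuous (trigf q n).
Proof.
rewrite (_ : trigf q n = fun k => \sum_(l < n.*2.+1) lattice_weight q n l *
    ((l%:R - n%:R) ^+ 0 * cosjet 0 0 ((l%:R - n%:R) * k + 0))); last first.
  apply/funext => k; rewrite trigf_cos; apply: eq_bigr => l _.
  by rewrite expr0 mul1r /cosjet mul0r !addr0 mulrC [k * _]mulrC mulrC.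
apply: (jet_continuous (f := fun m k => \sum_(l < n.*2.+1) lattice_weight q n l *
    ((l%:R - n%:R) ^+ m * cosjet 0 m ((l%:R - n%:R) * k + 0))) (n := 0%N)).
apply: jet_sum => l; apply: jetZ; apply: jet_affine; exact: jet_cosjet.
Qed.

(** Reflecting [l] to [2 n - l] preserves the weights and reverses the sines, so the imaginary part
    cancels. *)
Lemma trigf_wave (q : {poly R}) n k :
  \sum_(l < n.*2.+1) (lattice_weight q n l)%:C * cis (k * (l%:R - n%:R)) = (trigf q n k)%:C.
Proof.
have O : \sum_(l < n.*2.+1) lattice_weight q n l * sin (k * (l%:R - n%:R)) = 0.
  set s := \sum_(l < _) _; suff : s = - s by move=> h; lra.
  rewrite {1}/s (reindex_inj rev_ord_inj)/= -sumrN; apply: eq_bigr => l _.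
  have ln : (l <= n.*2)%N by rewrite -ltnS.
  have n2 : n.*2%:R = 2 * n%:R :> R by rewrite -mul2n natrM.
  have nl : (n.*2 - l)%:R - n%:R = - (l%:R - n%:R) :> R by rewrite natrB// n2; ring.
  rewrite subSS nl.
  rewrite mulrN sinN mulrN; congr (- (_ * _)).
  by rewrite /lattice_weight nl bin_sub// sqrrN.
rewrite trigf_cos rmorph_sum/=.
transitivity ((\sum_(l < n.*2.+1) lattice_weight q n l * cos (k * (l%:R - n%:R))) +i*
  (\sum_(l < n.*2.+1) lattice_weight q n l * sin (k * (l%:R - n%:R)))).
  elim/big_rec3: _ => //= l y1 y2 y3 _ ->; rewrite /cis; by simpc.
by rewrite O; elim/big_rec2: _ => //= l y1 y2 _ <-; simpc.
Qed.

(** The weight of index [l = z + c], whose offset from the centre of the binomial is [z + c - n];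
    the family is thus shifted by [c - n]. It vanishes for negative [l] by definition, and for
    [l > 2 n] through the binomial coefficient. *)
Definition int_weight (q : {poly R}) (n c : nat) (z : int) : R :=
  if z + c%:Z is Posz l then lattice_weight q n l else 0.

Lemma int_weight_out q n c z : ~ (exists2 l : nat, (l <= n.*2)%N & z = l%:Z - c%:Z) ->
  int_weight q n c z = 0.
Proof.
move=> H; rewrite /int_weight; case E : (z + c%:Z) => [l|l]//.
rewrite /lattice_weight bin_small ?mulr0 ?mul0r// ltnNge; apply/negP => ln; apply: H.
by exists l => //; rewrite -E addrK.
Qed.

Definition lattice_point (n c : nat) (f : {ffun 'I_d -> 'I_(n.*2.+1)}) : Zd R d :=
  \row_i ((f i : nat)%:Z - c%:Z).
Arguments lattice_point : clear implicits.

Lemma lattice_point_inj n c : injective (lattice_point n c).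
Proof.
move=> f g /rowP H; apply/ffunP => i; have := H i; rewrite !mxE => /addIr [E].
exact: val_inj.
Qed.

Definition Zd_tensor (h : 'I_d -> int -> R) (x : Zd R d) : R :=
  \prod_i h i ((x : 'rV[int]_d) 0 i).

Lemma Zd_tensor_out (q : 'I_d -> {poly R}) n c x : ~ range (lattice_point n c) x ->
  Zd_tensor (fun i => int_weight (q i) n c) x = 0.
Proof.
move=> H; have [i Hi] : exists i, ~ (exists2 l : nat, (l <= n.*2)%N & (x : 'rV[int]_d) 0 i = l%:Z - c%:Z).
  apply: contrapT => /forallNP Hn; apply: H.
  have /choice[l Hl] i : exists l : nat, (l <= n.*2)%N /\ (x : 'rV[int]_d) 0 i = l%:Z - c%:Z.
    by have [l] := contrapT (Hn i); exists l.
  exists [ffun i => inord (l i)] => //; apply/rowP => i.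
  by rewrite mxE ffunE inordK ?ltnS; case: (Hl i) => // _ ->.
by rewrite /Zd_tensor (bigD1 i)//= int_weight_out// mul0r.
Qed.

Lemma Zd_tensor_point (q : 'I_d -> {poly R}) n c f :
  Zd_tensor (fun i => int_weight (q i) n c) (lattice_point n c f) =
  \prod_i lattice_weight (q i) n (f i).
Proof.
by apply: eq_bigr => i _; rewrite mxE /int_weight subrK.
Qed.

Lemma fsum_lattice n c (G : Zd R d -> R[i]) : (forall x, ~ range (lattice_point n c) x -> G x = 0) ->
  \sum_(x \in [set: Zd R d]) G x = \sum_f G (lattice_point n c f).
Proof.
move=> G0; pose r := [seq lattice_point n c f | f <- index_enum _].
transitivity (\sum_(x <- r) G x); last by rewrite big_map.
have ur : uniq r.
  by apply: (etrans (@map_inj_uniq _ (Zd R d) _ (@lattice_point_inj n c) _)); exact: index_enum_uniq.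
rewrite (@fsbig_seq _ _ _ _ _ _ ur).
apply/esym; apply: fsbig_widen => // x [_ xr] /=; apply: G0 => -[f _ fx]; apply: xr.
by apply/mapP; exists f; rewrite ?mem_index_enum.
Qed.

Context (dO : measure_display) (Omega : measurableType dO) (P : probability Omega R)
  (Xi : {mfun Omega >-> lfmeasure (Zd R d)}) (beta : Zd R d -> R[i]) (S : Rd R d -> R[i]).
Hypotheses (cov : covariance_functional_Zd P Xi beta) (str : structure_function_Zd beta S).

Lemma torus_cell_box : @measurable _ (Rd R d) (@torus_cell R d) /\
  forall x, @torus_cell R d x -> enorm (x : 'rV[R]_d) <= d%:R * pi.
Proof.
split.
  rewrite (_ : @torus_cell R d = \bigcap_(i : 'I_d) (fun x : Rd R d => (x : 'rV[R]_d) 0 i) @^-1` `[- pi, pi[%classic).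
    apply: countable_bigcap_measurable => i.
    by rewrite -[X in measurable X]setTI; exact: measurable_coord.
  apply/seteqP; split => x H i; first by move=> _ /=; rewrite in_itv; exact: H.
  by have := H i Logic.I; rewrite /= in_itv.
move=> x H; apply: enorm_le_coord => [|i]; first exact: pi_ge0.
by have /andP[h1 /ltW h2] := H i; rewrite ler_norml h1.
Qed.

(** Writing [beta] as the integral of [S] against waves turns the double sum into the squared
    modulus of a trigonometric sum. The latter factors over the coordinates, and the phases produced
    by the shift [c - n] have modulus 1. *)
Lemma lattice_variance (q : 'I_d -> {poly R}) n c :
  (2 * pi) ^+ d * variance_of P Xi (Zd_tensor (fun i => int_weight (q i) n c)) =
  Re (cint_Rd (@torus_cell R d)
    (fun k => S k * (tensor (fun i y => trigf (q i) n y ^+ 2) k)%:C)).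
Proof.
set phi := Zd_tensor _.
have phi0 x : ~ range (lattice_point n c) x -> phi x = 0 by exact: Zd_tensor_out.
have fin : finite_set [set s | (phi s)%:C != 0].
  apply: (@sub_finite_set _ _ (range (lattice_point n c))); last exact: finite_image.
  by move=> x /= /eqP H; apply: contrapT => /phi0 E; apply: H; rewrite E.
rewrite /variance_of (cov fin fin).
pose w (f : {ffun 'I_d -> 'I_(n.*2.+1)}) := \prod_i lattice_weight (q i) n (f i).
have -> : \sum_(s \in [set: Zd R d]) \sum_(t \in [set: Zd R d])
      (phi s)%:C * conjc (phi t)%:C * beta (s - t : Zd R d) =
    \sum_p (w p.1 * w p.2)%:C * beta (lattice_point n c p.1 - lattice_point n c p.2 : Zd R d).
  rewrite (@fsum_lattice n c); last first.
    by move=> x /phi0 ->; rewrite fsbig1// => y _; rewrite !mul0r.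
  rewrite -(pair_bigA _ (fun f g => (w f * w g)%:C * beta (lattice_point n c f - lattice_point n c g : Zd R d)))/=.
  apply: eq_bigr => f _; rewrite (@fsum_lattice n c); last first.
    by move=> x /phi0 ->; rewrite oppr0 mulr0 mul0r.
  apply: eq_bigr => g _; rewrite /phi !Zd_tensor_point rmorphM /= -!/(w _); congr (_ * _ * _).
  by rewrite /conjc oppr0.
have [_ lS _] := str; have [mC bC] := torus_cell_box.
have pc z : (2 * pi) ^+ d * Re z = Re (((2 * pi) ^+ d)%:C * z).
  by case: z => a b; simpc.
have mwave (x : Zd R d) : measurable_fun setT (fun k : Rd R d => Re (cis (dotp k (Zd_Rd x)))) /\
    measurable_fun setT (fun k : Rd R d => Im (cis (dotp k (Zd_Rd x)))).
  have md : measurable_fun setT (fun k : Rd R d => dotp k (Zd_Rd x)).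
    by apply: measurable_sum => i; apply: measurable_funM => //; exact: measurable_coord.
  split; [apply: (measurableT_comp (f := @cos R)) => //|apply: (measurableT_comp (f := @sin R)) => //];
    apply: continuous_measurable_fun; [exact: continuous_cos|exact: continuous_sin].
rewrite pc mulr_sumr; congr Re.
under eq_bigr => p _ do rewrite mulrCA [X in _ * X]mulrC rmorphXn /= (covariance_wave _ str).
apply: (etrans (esym (@cint_Rd_sum _ _ S _ _ _ _ (fun p => w p.1 * w p.2) (fun p k =>
  cis (dotp k (Zd_Rd (lattice_point n c p.1 - lattice_point n c p.2 : Zd R d)))) lS mC bC
  (fun p => (mwave _).1) (fun p => (mwave _).2) _))).
  by move=> p k; rewrite /cis/= cos2Dsin2 sqrtr1.
congr (cint_Rd _ _); apply/funext => k; congr (_ * _).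
have conj_cis (a t : R) : conjc (a%:C * cis t) = a%:C * cis (- t).
  by rewrite /cis cosN sinN; simpc.
pose z := \sum_f (w f)%:C * cis (dotp k (Zd_Rd (lattice_point n c f))).
transitivity (z * conjc z).
  have -> : conjc z = \sum_f (w f)%:C * cis (- dotp k (Zd_Rd (lattice_point n c f))).
    by rewrite /z raddf_sum; apply: eq_bigr => f _; exact: conj_cis.
  rewrite /z big_distrlr/= pair_bigA/=; apply: eq_bigr => -[f g] _ /=.
  rewrite rmorphM /=.
  rewrite mulrACA; congr (_ * _); rewrite -cisD; congr cis.
  rewrite /dotp -sumrN -big_split/=; apply: eq_bigr => i _.
  rewrite -mulrBr; congr (_ * _); rewrite !Zd_Rd_coord -intrB; congr (_%:~R).
  by apply: (etrans (mxE _ _ _ _)); congr (_ + _); exact: (etrans (mxE _ _ _ _)).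
have -> : z = \prod_i (cis ((k : 'rV[R]_d) 0 i * (n%:R - c%:R)) * (trigf (q i) n ((k : 'rV[R]_d) 0 i))%:C).
  under eq_bigr do rewrite -trigf_wave mulr_sumr.
  rewrite bigA_distr_bigA; apply: eq_bigr => f _; rewrite /w rmorph_prod /dotp cis_sum -big_split/=.
  apply: eq_bigr => i _; rewrite mulrCA -cisD; congr (_ * cis _).
  by rewrite Zd_Rd_coord mxE intrB; ring.
rewrite rmorph_prod -big_split /tensor rmorph_prod; apply: eq_bigr => i _.
set t := _ * (n%:R - _); set a := trigf _ _ _.
rewrite -[LHS]/((cis t * a%:C) * conjc (cis t * a%:C)).
rewrite [cis t * _]mulrC conj_cis mulrACA -cisD subrr cis0 mulr1.
by rewrite expr2 rmorphM.
Qed.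

End LatticeVariance.

(** * Determination on the lattice *)

Section LatticeCase.
Context (R : realType).

(** Newton interpolation: at a new node the value is corrected by a multiple of the product that
    vanishes at the earlier nodes. *)
Lemma interpolation (s : seq R) (v : R -> R) : exists q : {poly R}, forall y, y \in s -> q.[y] = v y.
Proof.
elim: s => [|a s [q Hq]]; first by exists 0.
have [sa|sa] := boolP (a \in s).
  by exists q => y; rewrite inE => /predU1P[->|]; exact: Hq.
pose w := \prod_(b <- s) ('X - b%:P).
have wa : w.[a] != 0.
  rewrite horner_prod prodf_seq_neq0; apply/allP => b bs /=.
  by rewrite hornerXsubC subr_eq0; apply: contraNneq sa => ->.
exists (q + ((v a - q.[a]) / w.[a]) *: w) => y; rewrite hornerD hornerZ inE => /predU1P[->|ys].
  by rewrite divfK// addrC subrK.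
suff -> : w.[y] = 0 by rewrite mulr0 addr0 Hq.
by apply/eqP; rewrite -rootE root_prod_XsubC.
Qed.

Context (d : nat).

Lemma cvg_prod_ord (f : 'I_d -> nat -> R) (l : 'I_d -> R) :
  (forall i, f i n @[n --> \oo] --> l i) ->
  \prod_i f i n @[n --> \oo] --> \prod_i l i.
Proof. by move=> fl; apply: cvg_big => [|i _]; [exact: mul_continuous|exact: fl]. Qed.

Definition lattice_product : set (set (Zd R d)) :=
  [set A | exists a : 'I_d -> set int, A = [set x | forall i, a i ((x : 'rV[int]_d) 0 i)]].

Lemma lattice_product_setI : setI_closed lattice_product.
Proof.
move=> _ _ [a ->] [b ->]; exists (fun i => a i `&` b i).
by apply/seteqP; split => x /=; [move=> [h1 h2] i; split|move=> h; split => i; case: (h i)].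
Qed.

Lemma lattice_product_setT : lattice_product setT.
Proof. by exists (fun=> setT); apply/seteqP; split. Qed.

Lemma lattice_product_generate : @measurable _ (Zd R d) = <<s lattice_product >>.
Proof.
apply/seteqP; split => // A _.
rewrite (_ : A = \bigcup_n [set x | A x /\ choice.unpickle n = Some (x : 'rV[int]_d)]); last first.
  apply/seteqP; split => [x Ax|x [n _ []]//].
  by exists (choice.pickle (x : 'rV[int]_d)) => //; split => //; exact: choice.pickleK.
apply: (@bigcupT_measurable _ (g_sigma_algebraType lattice_product)) => n.
case E : (choice.unpickle n) => [y|]; last first.
  by rewrite (_ : [set _ | _] = set0); [exact: measurable0|apply/seteqP; split => x // -[]].
have [Ay|Ay] := pselect (A y); last first.
  rewrite (_ : [set _ | _] = set0); first exact: measurable0.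
  by apply/seteqP; split => x // [Ax [yx]]; apply: Ay; rewrite yx.
apply: sub_sigma_algebra; exists (fun i => [set (y : 'rV[int]_d) 0 i]).
apply/seteqP; split => [x /= [_ [->]]//|x /= H].
have -> : x = y by apply/rowP => i; exact: H.
by [].
Qed.

Lemma Zd_encoding : exists (iota : Zd R d -> measurableTypeR R) (j : measurableTypeR R -> Zd R d),
  [/\ measurable_fun setT iota, measurable_fun setT j & cancel iota j].
Proof.
pose iota (x : Zd R d) : measurableTypeR R := (choice.pickle (x : 'rV[int]_d))%:R.
pose j (y : measurableTypeR R) : Zd R d :=
  if choice.unpickle (Num.truncn (y : R)) is Some x then x : 'rV[int]_d else 0.
have iotaK : cancel iota j by move=> x; rewrite /j /iota natrK choice.pickleK.
have mi : measurable_fun setT iota by move=> _ A mA; exact: (@Zd_measurable R d).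
exists iota, j; split => //.
move=> _ A _; rewrite setTI.
rewrite (_ : j @^-1` A = \bigcup_n (if `[< A (if choice.unpickle n is Some x then x : 'rV[int]_d else 0) >]
   then [set y : measurableTypeR R | Num.truncn (y : R) = n] else set0)); last first.
  apply/seteqP; split => y.
    by move=> /= Ay; exists (Num.truncn (y : R)) => //; case: asboolP.
  by move=> [n _]; case: asboolP => // An /= yn; rewrite /j yn.
apply: bigcupT_measurable => n; case: asboolP => _ //.
have m1 k : measurable ([set y : measurableTypeR R | (Num.truncn (y : R) <= k)%N]).
  rewrite (_ : [set _ | _] = `]-oo, k.+1%:R[%classic); first exact: measurable_itv.
  by apply/seteqP; split => y /=; rewrite in_itv/= truncn_le_nat.
rewrite (_ : [set y | _] = [set y : measurableTypeR R | (Num.truncn (y : R) <= n)%N] `\`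
    (if n is k.+1 then [set y : measurableTypeR R | (Num.truncn (y : R) <= k)%N] else set0)).
  by apply: measurableD => //; case: (n).
apply/seteqP; split => y /=; case: n => [|n].
- by move=> ->; split => // -[].
- by move=> E; split; rewrite /= E ?ltnn.
- by rewrite leqn0 => -[/eqP].
- by move=> [h1 /= /negP]; rewrite -ltnNge => h2; apply/eqP; rewrite eqn_leq h1.
Qed.

Context (dO : measure_display) (Omega : measurableType dO) (P : probability Omega R)
  (Xi : {mfun Omega >-> lfmeasure (Zd R d)}) (beta : Zd R d -> R[i]) (S : Rd R d -> R[i]).
Hypotheses (cov : covariance_functional_Zd P Xi beta) (str : structure_function_Zd beta S)
  (vS : vanishes_faster_than_polynomials S) (d0 : (0 < d)%N).

Lemma lattice_approximable (D A : set (Zd R d)) : finite_set D -> lattice_product A ->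
  approximable P Xi D A.
Proof.
move=> /finite_seqP[r Dr] [a ->].
pose co (x : Zd R d) i : int := (x : 'rV[int]_d) 0%R i.
have [B [B0 DB]] : exists B : nat, (0 < B)%N /\ forall x, D x -> forall i, (`|co x i| <= B)%N.
  exists (\max_(x <- r) (\max_(i < d) `|co x i|)%N).+1; split => // x; rewrite Dr /= => xr i.
  apply: leqW; apply: (@leq_trans (\max_(i < d) `|co x i|)%N).
    exact: (@leq_bigmax _ (fun i => `|co x i|)%N).
  exact: (@leq_bigmax_seq (Zd R d) r xpredT (fun x => (\max_(i < d) `|co x i|)%N) x xr isT).
(* The shift by [2 * B] sends the coordinates of the points of [D] into the integers from [B] to
   [3 * B], where squaring is injective. An arbitrary indicator is therefore a polynomial in the
   square. *)
have /choice[q Hq] (i : 'I_d) : exists q : {poly R}, forall z : int, (`|z| <= B)%N ->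
    q.[(absz (z + (2 * B)%N%:Z))%:R ^+ 2] = \1_(a i) z.
  pose s := [seq ((l : nat)%:R ^+ 2 : R) | l <- iota 0 (4 * B).+1].
  pose v (y : R) : R := \1_(a i) ((Num.truncn (Num.sqrt y))%:Z - (2 * B)%N%:Z).
  have [p Hp] := interpolation s v; exists p => z zB; rewrite Hp.
    rewrite /v sqrtr_sqr ger0_norm ?ler0n// natrK.
    by congr (\1_(a i) _); lia.
  by apply/mapP; exists (absz (z + (2 * B)%N%:Z)) => //; rewrite mem_iota; lia.
have [g [L [K [L0 HK]]]] := trigf_small q d0 vS.
have [mC bC] := torus_cell_box R d.
have [_ lS _] := str.
have [C HC] := cint_Rd_bound mC lS bC.
pose n N := (g + L * N ^ 4)%N.
pose phi N := Zd_tensor (R := R) (fun i => int_weight (q i) (n N) (n N + 2 * B)).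
have V N : (0 < N)%N -> (2 * pi) ^+ d * variance_of P Xi (phi N) <= C * (K / N%:R).
  move=> N0; rewrite (lattice_variance cov str).
  apply: le_trans (ler_norm _) _; apply: le_trans (parts_le_normc _).1 _.
  apply: HC => //.
  - apply: measurable_tensor => i y.
    apply: (@continuous_comp _ _ _ (trigf (q i) (n N)) (fun t => t ^+ 2)).
      exact: trigf_continuous.
    exact: exprn_continuous.
  - by move=> x xC; apply: HK => // i; have /andP[h1 /ltW h2] := xC i; rewrite ler_norml h1.
(* The first summand brings [C * K / N m] below [2^-1 ^+ m]; the second makes [N m] positive and
   unbounded. *)
pose N m := (Num.bound (`|C * K| * 2 ^+ m)%R + m.+1)%N.
have N0 m : (0 < N m)%N by rewrite /N addnS.
have wD m x i : D x -> int_weight (q i) (n (N m)) (n (N m) + 2 * B) (co x i) =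
    \1_(a i) (co x i) * binratio R (n (N m)) (absz (co x i + (2 * B)%N%:Z)).
  move=> /DB/(_ i) xB; rewrite /int_weight.
  have -> : co x i + (n (N m) + 2 * B)%N%:Z = (n (N m) + absz (co x i + (2 * B)%N%:Z)%R)%N%:Z by lia.
  by rewrite /lattice_weight natrD addrAC subrr add0r Hq// -mulrA.
exists (fun m => phi (N m)), 1; split.
- move=> m; pose pt := @lattice_point R d (n (N m)) (n (N m) + 2 * B).
  exists (range pt), (\sum_f `|phi (N m) (pt f)|).
    split; first exact: Zd_measurable.
    exists (\sum_f snorm (pt f : Zd R d)) => _ [f _ <-]; rewrite (bigD1 f)//= lerDl.
    by apply: sumr_ge0 => f' _; exact: sqrtr_ge0.
  split; [by move=> _ E mE; exact: Logic.I| |exact: Zd_tensor_out].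
  move=> x; case: (pselect (range pt x)) => [[f _ <-]|/Zd_tensor_out]; last first.
    by rewrite /phi => ->; rewrite normr0 sumr_ge0.
  by rewrite (bigD1 f)//= lerDl sumr_ge0.
- move=> m x Dx; rewrite /phi /Zd_tensor normr_prod; apply: prodr_ile1 => i _.
  rewrite normr_ge0/= wD// normrM mulr_ile1//.
    by rewrite indicE; case: (_ \in _); rewrite ?normr1 ?normr0.
  by have /andP[h0 h1] := binratio_bound R (n (N m)) (absz (co x i + (2 * B)%N%:Z)); rewrite ger0_norm.
- move=> x Dx.
  rewrite (_ : (fun m => _) = fun m => \prod_i (\1_(a i) (co x i) *
     binratio R (n (N m)) (absz (co x i + (2 * B)%N%:Z)))); last first.
    by apply/funext => m; apply: eq_bigr => i _; rewrite -wD.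
  rewrite (_ : \1_ _ x = \prod_i (\1_(a i) (co x i) * 1)).
    apply: cvg_prod_ord => i; apply: cvgM; first exact: cvg_cst.
    suff nN : n (N m) @[m --> \oo] --> \oo.
      exact: (@cvg_comp _ _ _ (fun m => n (N m)) (fun k => binratio R k (absz (co x i + (2 * B)%N%:Z)))
        _ _ _ nN (@binratio_cvg R _)).
    apply/cvgnyPge => k; near=> m.
    have mk : (k <= m)%N by near: m; exact: nbhs_infty_ge.
    have h1 : (m <= N m)%N by rewrite /N; lia.
    have h2 : (N m <= N m ^ 4)%N by rewrite -{1}[N m]expn1 leq_pexp2l.
    by rewrite /n (leq_trans mk)// (leq_trans h1)// (leq_trans h2)// (leq_trans (leq_pmull _ L0))// leq_addl.
  case: (pselect (forall i, a i (co x i))) => H.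
    by rewrite indicE mem_set// big1// => i _; rewrite indicE mem_set ?mulr1.
  rewrite indicE memNset//; move/existsNP: H => [i Hi].
  by rewrite (bigD1 i)//= indicE memNset// !mul0r.
- move=> m; have := V _ (N0 m).
  have NR : 0 < (N m)%:R :> R by rewrite ltr0n.
  have h : C * (K / (N m)%:R) <= 2^-1 ^+ m.
    rewrite mulrA ler_pdivrMr// exprVn ler_pdivlMl ?exprn_gt0// mulrC.
    apply: (@le_trans _ _ (`|C * K| * 2 ^+ m)); first by rewrite ler_wpM2r ?exprn_ge0// ler_norm.
    rewrite (le_trans (ltW (archi_boundP _))) ?mulr_ge0 ?exprn_ge0//.
    by rewrite ler_nat leq_addr.
  set v := variance_of _ _ _ => /le_trans/(_ h) vh; case: (leP 0 v) => v0; last first.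
    by rewrite (le_trans (ltW v0)) ?exprn_ge0.
  apply: le_trans vh; rewrite ler_peMl// exprn_ege1// mulr_ege1 ?ler1n//.
  by rewrite (le_trans _ (pi_ge2 R)) ?ler1n.
Unshelve. all: by end_near.
Qed.

Lemma lattice_determined (D : set (Zd R d)) (mD : measurable D) :
  locally_square_integrable P Xi -> finite_set D -> determined_by_outside P Xi mD.
Proof.
move=> Xi2 finD; have [iota [j [mi mj ij]]] := Zd_encoding.
have bD : sbounded D.
  have [r Dr] := (finite_seqP D).1 finD.
  exists (\sum_(x <- undup r) snorm (x : Zd R d)) => x; rewrite Dr /= => xr.
  rewrite (bigD1_seq x) ?mem_undup ?undup_uniq//= lerDl.
  by apply: sumr_ge0 => y _; exact: sqrtr_ge0.
apply: (determined_by_outside_criterion mD Xi2 bD lattice_product_generate lattice_product_setI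
  lattice_product_setT mi mj ij) => A GA.
exact: lattice_approximable.
Qed.

End LatticeCase.

(** * The Euclidean space *)

Section RealIntegrals.
Context (R : realType).
Local Notation leb := (@lebesgue_measure R).
Local Notation integrableR f := (leb.-integrable setT (EFin \o f)).

Local Notation TR := (measurableTypeR R).

Lemma Rintegral_preserving (phi : TR -> TR) (f : TR -> R) : measurable_fun setT phi ->
  (forall A, measurable A -> leb (phi @^-1` A) = leb A) ->
  integrableR f -> integrableR (f \o phi) /\ \int[leb]_x f (phi x) = \int[leb]_x f x.
Proof.
move=> mphi phiE intf; have mf : measurable_fun setT (EFin \o f) by case/integrableP : intf.
have mp A : measurable A -> pushforward leb phi A = leb A by exact: phiE.
have i1 : integrableR (f \o phi).
  apply/integrableP; split.
    by apply/measurable_EFinP; apply: measurableT_comp => //; exact/measurable_EFinP.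
  have /integrableP[_] := intf; apply: le_lt_trans.
  have E := @eq_measure_integral _ _ _ setT (pushforward leb phi) leb (fun x => `|(f x)%:E|%E)
    (fun A mA _ => esym (mp A mA)).
  by rewrite [leRHS]E ge0_integral_pushforward//; exact: measurableT_comp.
have E := @eq_measure_integral _ _ _ setT (pushforward leb phi) leb (EFin \o f) (fun A mA _ => esym (mp A mA)).
by split => //; rewrite /Rintegral [RHS](congr1 fine (E mphi)) integral_pushforward.
Qed.

Lemma itv_len (a b : R) : a <= b -> leb `]a, b]%classic = (b - a)%:E /\ leb `[a, b[%classic = (b - a)%:E.
Proof.
move=> ab; rewrite !lebesgue_measure_itv/= lte_fin; case: ltP => // ba.
by have -> : a = b; [by apply/eqP; rewrite eq_le ab|rewrite subrr].
Qed.

Lemma Rintegral_translate (f : R -> R) (a : R) : integrableR f ->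
  integrableR (fun x => f (x + a)) /\ \int[leb]_x f (x + a) = \int[leb]_x f x.
Proof.
have mt : measurable_fun setT (fun x : TR => (x : R) + a : TR) by exact: measurable_funD.
apply: (Rintegral_preserving mt) => // A mA; apply/esym.
apply: (@lebesgue_measure_unique R (pushforward leb (fun x : TR => (x : R) + a : TR))) => // _ [[b c]/= _ <-].
rewrite /pushforward (_ : _ @^-1` _ = `]b - a, c - a]%classic).
  case: (leP b c) => bc; last by rewrite !set_itv_ge// bnd_simp -leNgt ?lerD2r ltW.
  by rewrite (itv_len bc).1 (itv_len (lerB bc (lexx a))).1; congr EFin; ring.
by apply/seteqP; split => x /=; rewrite !in_itv/= lerBrDr ltrBlDr.
Qed.

Lemma Rintegral_opp (f : R -> R) : integrableR f ->
  integrableR (fun x => f (- x)) /\ \int[leb]_x f (- x) = \int[leb]_x f x.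
Proof.
have mt : measurable_fun setT (fun x : TR => - (x : R) : TR) by exact: measurable_funN.
apply: (Rintegral_preserving mt) => // A mA; apply/esym.
apply: (@lebesgue_measure_unique R (pushforward leb (fun x : TR => - (x : R) : TR))) => // _ [[b c]/= _ <-].
rewrite /pushforward (_ : _ @^-1` _ = `[- c, - b[%classic).
  case: (leP b c) => bc; last by rewrite !set_itv_ge// bnd_simp -leNgt ?lerN2 ltW.
  by rewrite (itv_len bc).1; have bc' := bc; rewrite -lerN2 in bc'; rewrite (itv_len bc').2; congr EFin; ring.
by apply/seteqP; split => x /=; rewrite !in_itv/= lerNl ltrNr andbC.
Qed.

Lemma integrable_continuous (f g : R -> R) : continuous f -> integrableR g ->
  (forall x, `|f x| <= g x) -> integrableR f /\ `|\int[leb]_x f x| <= \int[leb]_x g x.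
Proof.
move=> cf ig fg; apply: Rintegral_dominated => //; exact: continuous_measurable_fun.
Qed.

Definition cauchy (x : R) : R := (1 + x ^+ 2)^-1.

Lemma cauchy_gt0 x : 0 < cauchy x.
Proof. by rewrite invr_gt0 ltr_wpDr ?sqr_ge0. Qed.

Lemma cauchy_continuous : continuous cauchy.
Proof. exact: continuous_oneDsqrV. Qed.

Lemma cauchy_integrable : integrableR cauchy.
Proof.
have mc : measurable_fun setT cauchy by apply: continuous_measurable_fun; exact: cauchy_continuous.
pose g x : R := cauchy x * \1_(`[0, +oo[%classic : set R) x.
have gp x : 0 <= g x by rewrite mulr_ge0 ?(ltW (cauchy_gt0 x)).
have ig : integrableR g.
  apply/integrableP; split.
    by apply/measurable_EFinP; apply: measurable_funM => //; exact: measurable_indic.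
  apply: (@le_lt_trans _ _ (pi / 2)%:E); last exact: ltry.
  rewrite -integral0y_oneDsqr [leRHS]integral_mkcond le_eqVlt; apply/orP; left; apply/eqP.
  apply: eq_integral => x _; rewrite patchE /= ger0_norm// /g indicE.
  by case: ifP => _; rewrite ?mulr1 ?mulr0.
have [ig' _] := Rintegral_opp ig.
have := integrableD measurableT ig ig'.
apply: le_integrable => //; first exact/measurable_EFinP.
move=> x _ /=; rewrite lee_fin !ger0_norm ?addr_ge0 ?(ltW (cauchy_gt0 _))//.
have cN : cauchy (- x) = cauchy x by rewrite /cauchy sqrrN.
rewrite /g cN -mulrDr ler_peMr ?(ltW (cauchy_gt0 _))// !indicE.
case: (leP 0 x) => x0; first by rewrite mem_set ?lerDl//= in_itv/= andbT.
have -> : - x \in (`[0, +oo[%classic : set R) by apply: mem_set; rewrite /= in_itv/= andbT oppr_ge0 ltW.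
by rewrite lerDr.
Qed.

Definition cauchy_mass : R := \int[leb]_x cauchy x.

Lemma cauchy_mass_ge0 : 0 <= cauchy_mass.
Proof. by apply: Rintegral_ge0 => x _; exact: ltW (cauchy_gt0 x). Qed.

Lemma decay_integrable (f : R -> R) (B : R) : continuous f ->
  (forall x, (1 + x ^+ 2) * `|f x| <= B) -> integrableR f /\ `|\int[leb]_x f x| <= B * cauchy_mass.
Proof.
move=> cf fB; have iB := integrableZl measurableT B cauchy_integrable.
have := @integrable_continuous f (fun x => B * cauchy x) cf iB.
rewrite RintegralZl//; last exact: cauchy_integrable.
by apply=> x; rewrite ler_pdivlMr ?ltr_wpDr ?sqr_ge0// mulrC.
Qed.

(** A remainder bounded by [h ^+ 2 * b t] makes the error of the difference quotient at most [|h|]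
    times the integral of [b]. Differentiation under the integral sign is thus reduced to a Taylor
    bound on the integrand. *)
Lemma is_derive_integral (G G1 : R -> R -> R) (b : R -> R) (x : R) :
  (forall y, integrableR (G y)) -> integrableR (G1 x) -> integrableR b ->
  (forall h t, `|G (x + h) t - G x t - h * G1 x t| <= h ^+ 2 * b t) ->
  is_derive x (1 : R) (fun y => \int[leb]_t G y t) (\int[leb]_t G1 x t).
Proof.
move=> iG iG1 ib Gb; set l := \int[leb]_t G1 x t; set F := fun y => _.
have key h : h != 0 -> `|h^-1 *: (F (h *: 1 + x) - F x) - l| <= `|h| * \int[leb]_t b t.
  move=> h0; have e : (h *: 1 + x : R) = x + h by rewrite addrC; congr (_ + _); exact: mulr1.
  rewrite e -[X in _ - X](mulKf h0) -[_ *: _]/(_ * _) -mulrBr.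
  have -> : F (x + h) - F x - h * l = \int[leb]_t (G (x + h) t - G x t - h * G1 x t).
    have iB := integrableB measurableT (iG (x + h)) (iG x).
    have iZ := integrableZl measurableT h iG1.
    rewrite (RintegralB measurableT iB iZ) (RintegralB measurableT (iG (x + h)) (iG x)).
    by rewrite (RintegralZl _ measurableT iG1).
  rewrite normrM normfV ler_pdivrMl ?normr_gt0// mulrA -expr2 real_normK ?num_real//.
  rewrite -(RintegralZl _ measurableT ib).
  have ihb := integrableZl measurableT (h ^+ 2) ib.
  apply: (Rintegral_dominated _ ihb _).2 => //.
  have iB := integrableB measurableT (iG (x + h)) (iG x).
  have iZ := integrableZl measurableT h iG1.
  by have /integrableP[/measurable_EFinP + _] := integrableB measurableT iB iZ.
have cv : (fun h : R => h^-1 *: (F (h *: 1 + x) - F x)) @ 0^' --> l.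
  apply/cvgrPdist_le => /= e e0; set I := \int[leb]_t b t in key.
  have I0 : 0 < `|I| + 1 by rewrite ltr_wpDl.
  near=> h; rewrite distrC; apply: le_trans (key h _) _; first by near: h; exact: nbhs_dnbhs_neq.
  apply: (@le_trans _ _ (`|h| * (`|I| + 1))).
    by rewrite ler_wpM2l// (le_trans (ler_norm _))// lerDl.
  rewrite -ler_pdivlMr//; near: h; apply: dnbhs0_le; exact: divr_gt0.
by apply: DeriveDef; [apply/cvg_ex; exists l|exact: cvg_lim].
Unshelve. all: by end_near.
Qed.

Lemma jet_taylor (f : nat -> R -> R) (B x h : R) : jet f -> (forall y, `|f 2 y| <= B) ->
  `|f 0%N (x + h) - f 0%N x - h * f 1%N x| <= h ^+ 2 * B.
Proof.
move=> jf fB; have [c [cx E]] := mean_value (jf 0%N) x (x + h).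
have [c' [_ E']] := mean_value (jf 1%N) x c.
have xh : x + h - x = h by rewrite addrC addKr.
rewrite E xh [h * _]mulrC -mulrBl E' !normrM -[h ^+ 2]real_normK ?num_real//.
rewrite xh in cx; rewrite mulrC expr2 -mulrA ler_wpM2l// mulrC.
by apply: ler_pM.
Qed.

End RealIntegrals.

(** * Cosine transforms of compactly supported functions *)

Section CosineTransform.
Context (R : realType).
Local Notation leb := (@lebesgue_measure R).
Local Notation integrableR f := (leb.-integrable setT (EFin \o f)).

Definition rapid (f : R -> R) : Prop :=
  continuous f /\ forall N : nat, exists B : R, forall x, (1 + `|x|) ^+ N * `|f x| <= B.

Definition schwartz_jet (f : nat -> R -> R) : Prop := jet f /\ forall n, rapid (f n).

Lemma weight_ge1 (x : R) : 1 <= 1 + `|x|.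
Proof. by rewrite lerDl. Qed.

Lemma weight_gt0 (x : R) : 0 < 1 + `|x|.
Proof. exact: lt_le_trans ltr01 (weight_ge1 x). Qed.

Lemma sqr_le_weight (x : R) : 1 + x ^+ 2 <= (1 + `|x|) ^+ 2.
Proof. by rewrite -[x ^+ 2]real_normK ?num_real// sqrrD expr1n lerD2r lerDl mulrn_wge0// mul1r. Qed.

Lemma rapid_integrable f : rapid f -> integrableR f.
Proof.
move=> [cf /(_ 2%N)[B fB]]; apply: (@decay_integrable _ f B cf _).1 => x.
by apply: le_trans (fB x); rewrite ler_wpM2r// sqr_le_weight.
Qed.

Lemma rapid_mul (f g : R -> R) (M : R) (n : nat) : rapid f -> continuous g ->
  (forall x, `|g x| <= M * (1 + `|x|) ^+ n) -> rapid (fun x => g x * f x).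
Proof.
move=> [cf fr] cg gM; split; first by move=> x; apply: cvgM; [exact: cg|exact: cf].
move=> N; have [B fB] := fr (N + n)%N; exists (`|M| * B) => x.
have w0 := weight_gt0 x.
rewrite normrM mulrCA (le_trans (ler_wpM2r _ (gM x))) ?mulr_ge0 ?exprn_ge0 ?(ltW w0)//.
rewrite -mulrA mulrA; apply: (@le_trans _ _ (`|M| * ((1 + `|x|) ^+ (N + n) * `|f x|))).
  rewrite exprD -mulrA -!mulrA; set A := _ ^+ n; set C := _ ^+ N.
  rewrite (_ : A * (C * `|f x|) = C * (A * `|f x|)); last by rewrite mulrCA.
  by rewrite ler_wpM2r ?mulr_ge0 ?exprn_ge0 ?(ltW w0)// ler_norm.
by rewrite ler_wpM2l.
Qed.

Lemma continuous_pow n : continuous (fun x : R => x ^+ n).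
Proof. exact: exprn_continuous. Qed.

Lemma rapid_pow f n : rapid f -> rapid (fun x => x ^+ n * f x).
Proof.
move=> rf; apply: (@rapid_mul _ _ 1 n rf (@continuous_pow n)) => x.
by rewrite mul1r normrX lerXn2r ?nnegrE ?addr_ge0// lerDr.
Qed.

Lemma rapid_abs f : rapid f -> rapid (fun x => `|f x|).
Proof.
move=> [cf fr]; split; first by move=> x; apply: (@continuous_comp _ _ _ f Num.norm); [exact: cf|exact: norm_continuous].
by move=> N; have [B fB] := fr N; exists B => x; rewrite normr_id.
Qed.

Lemma cosjet_le1 theta n (x : R) : `|cosjet theta n x| <= 1.
Proof. exact: cos_max. Qed.

Lemma cosjet_line_continuous theta n (x : R) : continuous (fun k : R => cosjet theta n (k * x)).
Proof.
rewrite (_ : (fun k => _) = fun k => cos (x * k + (theta + n%:R * (pi / 2)))).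
  by move=> k; exact: continuous_phase.
by apply/funext => k; rewrite mulrC.
Qed.

Lemma rapid_cosjet f theta n x : rapid f -> rapid (fun k => f k * cosjet theta n (k * x)).
Proof.
move=> rf; rewrite (_ : (fun k => _) = fun k => cosjet theta n (k * x) * f k); last first.
  by apply/funext => k; rewrite mulrC.
apply: (@rapid_mul _ _ 1 0 rf (@cosjet_line_continuous theta n x)) => k.
by rewrite mul1r expr0 cosjet_le1.
Qed.

Definition transform (theta : R) (w : R -> R) (n : nat) (x : R) : R :=
  \int[leb]_k (k ^+ n * w k * cosjet theta n (k * x)).

Lemma transform_bound theta w n x : rapid w ->
  `|transform theta w n x| <= \int[leb]_k `|k ^+ n * w k|.
Proof.
move=> rw; have rn := rapid_pow n rw.
apply: (integrable_continuous _ (rapid_integrable (rapid_abs rn)) _).2.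
  by case: (rapid_cosjet theta n x rn).
by move=> k; rewrite normrM ler_piMr// cosjet_le1.
Qed.

Lemma jet_transform theta w : rapid w -> jet (transform theta w).
Proof.
move=> rw n x; pose b k : R := `|k ^+ n.+2 * w k|.
apply: (@is_derive_integral _ (fun y k => k ^+ n * w k * cosjet theta n (k * y))
  (fun y k => k ^+ n.+1 * w k * cosjet theta n.+1 (k * y)) b).
- by move=> y; apply: rapid_integrable; apply: rapid_cosjet; exact: rapid_pow.
- by apply: rapid_integrable; apply: rapid_cosjet; exact: rapid_pow.
- by apply: rapid_integrable; apply: rapid_abs; exact: rapid_pow.
- move=> h k; have jc : jet (fun m => cosjet theta (n + m)).
    by move=> m y; rewrite addnS; exact: jet_cosjet.
  have := @jet_taylor _ _ 1 (k * x) (k * h) jc (fun y => cosjet_le1 _ _ _).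
  rewrite addn0 addn1 mulr1 -mulrDr => T.
  rewrite (_ : _ - _ - _ = k ^+ n * w k * (cosjet theta n (k * (x + h)) - cosjet theta n (k * x) -
    k * h * cosjet theta n.+1 (k * x))); last by rewrite exprS; ring.
  have -> : b k = k ^+ 2 * `|k ^+ n * w k|.
    by rewrite /b -addn2 exprD [_ * k ^+ 2]mulrC -mulrA normrM ger0_norm ?sqr_ge0.
  rewrite normrM (le_trans (ler_wpM2l (normr_ge0 _) T))//.
  by rewrite le_eqVlt; apply/orP; left; apply/eqP; ring.
Qed.

Definition compact_jet (a : R) (w : nat -> R -> R) : Prop :=
  jet w /\ forall n x, a <= `|x| -> w n x = 0.

Lemma compact_jetS a w : compact_jet a w -> compact_jet a (fun n => w n.+1).
Proof. by move=> [jw w0]; split; [exact: jetS|move=> n; exact: w0]. Qed.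

Lemma compact_jet_leibniz a f w : jet f -> compact_jet a w -> compact_jet a (leibniz f w).
Proof.
move=> jf [jw w0]; split; first exact: jet_leibniz.
by move=> n x ax; rewrite /leibniz big1// => k _; rewrite w0// !mulr0.
Qed.

Lemma compact_support_bounded (a : R) (f : R -> R) : continuous f -> (forall x, a <= `|x| -> f x = 0) ->
  exists B : R, forall x, `|f x| <= B.
Proof.
move=> cf f0; have [a0|a0] := leP a 0.
  by exists 0 => x; rewrite f0 ?normr0// (le_trans a0).
have cab : compact (f @` `[- a, a]).
  apply: continuous_compact; last exact: segment_compact.
  exact: continuous_subspaceT.
have [M [_ MB]] := compact_bounded cab.
exists (Num.max 0 (M + 1)) => x; have [ax|xa] := leP a `|x|.
  by rewrite f0// normr0 le_max lexx.
rewrite le_max; apply/orP; right; apply: (MB (M + 1)); first by rewrite ltrDl.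
by exists x => //=; rewrite in_itv/= -ler_norml ltW.
Qed.

Lemma compact_rapid (a : R) (f : R -> R) : continuous f -> (forall x, a <= `|x| -> f x = 0) -> rapid f.
Proof.
move=> cf f0; split => // N; have [B fB] := compact_support_bounded cf f0.
exists ((1 + `|a|) ^+ N * B) => x; have [ax|xa] := leP a `|x|.
  rewrite f0// normr0 mulr0 mulr_ge0 ?exprn_ge0 ?(ltW (weight_gt0 _))//.
  exact: le_trans (fB 0).
have wx := ltW (weight_gt0 x).
have h : (1 + `|x|) ^+ N <= (1 + `|a|) ^+ N.
  by rewrite lerXn2r ?nnegrE ?(ltW (weight_gt0 _))// lerD2l (le_trans (ltW xa))// ler_norm.
by apply: ler_pM => //; exact: exprn_ge0.
Qed.

Lemma compact_jet_rapid a w n : compact_jet a w -> rapid (w n).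
Proof. by move=> [jw w0]; apply: compact_rapid (w0 n); exact: jet_continuous. Qed.

Lemma compact_Rintegral (a : R) (f : R -> R) : (forall x, a <= `|x| -> f x = 0) ->
  \int[leb]_x f x = \int[leb]_(x in `[- a, a]) f x.
Proof.
move=> f0; rewrite [RHS]Rintegral_mkcond; apply: eq_Rintegral => x _; rewrite patchE.
case: ifPn => // /negP xa; rewrite f0// leNgt; apply/negP => ax; apply: xa.
by apply: mem_set; rewrite /= in_itv/= -ler_norml ltW.
Qed.

Lemma transform_by_parts a w theta m x : 0 < a -> compact_jet a w ->
  \int[leb]_k (w 1%N k * cosjet theta m (k * x)) = - (x * \int[leb]_k (w 0%N k * cosjet theta m.+1 (k * x))).
Proof.
move=> a0 cw; have [jw w0] := cw.
have r1 := rapid_integrable (rapid_cosjet theta m x (compact_jet_rapid 1 cw)).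
have r0 := rapid_integrable (rapid_cosjet theta m.+1 x (compact_jet_rapid 0 cw)).
have r0x := integrableZl measurableT x r0.
apply/eqP; rewrite -addr_eq0 -(RintegralZl _ measurableT r0) -(RintegralD measurableT r1 r0x).
rewrite (@compact_Rintegral a); last by move=> k ak; rewrite !w0// !mul0r mulr0 addr0.
pose F k := w 0%N k * cosjet theta m (k * x).
have dF (k : R) : is_derive k (1 : R) F (w 1%N k * cosjet theta m (k * x) + x * (w 0%N k * cosjet theta m.+1 (k * x))).
  have H := @is_derive_affine _ (cosjet theta m) x 0 k (cosjet theta m.+1 (x * k + 0)) (jet_cosjet theta m _).
  have E : (fun y => cosjet theta m (x * y + 0)) = (fun y => cosjet theta m (y * x)).
    by apply/funext => y; rewrite addr0 mulrC.
  rewrite E in H; have := is_deriveM (jw 0%N k) H.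
  move=> /is_derive_eq; apply; rewrite addr0 -[_ *: _]/(_ * _) -[X in _ + X]/(_ * _) [x * k]mulrC.
  by ring.
rewrite (Rintegral_derive _ _ dF).
- by rewrite /F !w0 ?mul0r ?subr0// ?normrN ger0_norm// ltW.
- by rewrite gtrN.
- have [c1 _] := rapid_cosjet theta m x (compact_jet_rapid 1 cw).
  have [c0 _] := rapid_cosjet theta m.+1 x (compact_jet_rapid 0 cw).
  move=> k; apply: cvgD; first exact: c1.
  by apply: cvgM; [exact: cvg_cst|exact: c0].
Qed.

Lemma cosjet2 theta m (y : R) : cosjet theta m.+2 y = - cosjet theta m y.
Proof.
rewrite /cosjet -cosDpi; congr cos.
have -> : m.+2%:R = m%:R + 2 :> R by rewrite -natrD addn2.
set h := pi / 2; have ph : pi = h + h by rewrite /h -splitr.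
by rewrite [X in _ = _ + X]ph; ring.
Qed.

Lemma transform_even_parts a w theta m x N : 0 < a -> compact_jet a w ->
  \int[leb]_k (w N.*2 k * cosjet theta m (k * x)) =
  (-1) ^+ N * x ^+ N.*2 * \int[leb]_k (w 0%N k * cosjet theta m (k * x)).
Proof.
move=> a0; elim: N w => [|N IH] w cw; first by rewrite !expr0 !mul1r.
have c2 := compact_jetS (compact_jetS cw).
rewrite doubleS (IH (fun n => w n.+2) c2) (@transform_by_parts a (fun n => w n.+1))//; last exact: compact_jetS.
rewrite (@transform_by_parts a w)//.
have -> : \int[leb]_k (w 0%N k * cosjet theta m.+2 (k * x)) = - \int[leb]_k (w 0%N k * cosjet theta m (k * x)).
  under eq_Rintegral do rewrite cosjet2 mulrN -mulN1r.
  rewrite RintegralZl ?mulN1r//; apply: rapid_integrable; apply: rapid_cosjet.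
  exact: compact_jet_rapid cw.
by rewrite !exprS; ring.
Qed.

Definition id_jet (n : nat) (x : R) : R := if n is n'.+1 then (n' == 0%N)%:R else x.

Lemma jet_id_jet : jet id_jet.
Proof. by case=> [|[|n]] x /=; [exact: is_derive_id|exact: is_derive_cst|exact: is_derive_cst]. Qed.

(** The jet of [x ^+ n * w 0 x]. Differentiating a transform [n] times inserts this power, and
    integrating by parts afterwards calls for the derivatives of the product. *)
Fixpoint pow_jet (n : nat) (w : nat -> R -> R) : nat -> R -> R :=
  if n is n'.+1 then leibniz id_jet (pow_jet n' w) else w.

Lemma pow_jet0 n w x : pow_jet n w 0 x = x ^+ n * w 0%N x.
Proof.
elim: n => [|n IH]; first by rewrite expr0 mul1r.
by rewrite /= leibniz0 IH exprS mulrA.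
Qed.

Lemma compact_pow_jet a n w : compact_jet a w -> compact_jet a (pow_jet n w).
Proof. by move=> cw; elim: n => //= n; exact: compact_jet_leibniz jet_id_jet. Qed.

(** Decay comes from [2 N] integrations by parts applied to [pow_jet n w], which bound [x ^ (2 N)]
    times the [n]-th derivative; an even number of them returns to the same phase up to sign. *)
Lemma transform_schwartz a w theta : 0 < a -> compact_jet a w -> schwartz_jet (transform theta (w 0%N)).
Proof.
move=> a0 cw; have jT := jet_transform theta (compact_jet_rapid 0 cw).
split => // n; split; first exact: jet_continuous.
move=> N; have cW := compact_pow_jet n cw.
have B0 := transform_bound theta n _ (compact_jet_rapid 0 cw).
set C0 := \int[leb]_k _ in B0.
pose C1 := \int[leb]_k `|pow_jet n w N.*2 k|.
exists (2 ^+ N * (C0 + C1)) => x.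
have B1 : `|x| ^+ N.*2 * `|transform theta (w 0%N) n x| <= C1.
  have := @transform_even_parts a (pow_jet n w) theta n x N a0 cW.
  rewrite (_ : \int[leb]_k (pow_jet n w 0%N k * _) = transform theta (w 0%N) n x); last first.
    by apply: eq_Rintegral => k _; rewrite pow_jet0.
  move=> /(congr1 Num.norm); rewrite !normrM normrX normrN1 expr1n mul1r normrX => <-.
  have r := compact_jet_rapid N.*2 cW.
  apply: (integrable_continuous _ (rapid_integrable (rapid_abs r)) _).2.
    by case: (rapid_cosjet theta n x r).
  by move=> k; rewrite normrM ler_piMr// cosjet_le1.
have W : (1 + `|x|) ^+ N <= 2 ^+ N * (1 + `|x| ^+ N.*2).
  have [x1|x1] := leP `|x| 1.
    rewrite -[leLHS]mulr1; apply: ler_pM => //; rewrite ?exprn_ge0 ?(ltW (weight_gt0 _))//.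
      by rewrite lerXn2r ?nnegrE ?(ltW (weight_gt0 _))//; lra.
    by rewrite lerDl exprn_ge0.
  apply: (@le_trans _ _ ((2 * `|x|) ^+ N)).
    by rewrite lerXn2r ?nnegrE ?(ltW (weight_gt0 _))// ?mulr_ge0//; lra.
  rewrite exprMn ler_wpM2l ?exprn_ge0//.
  apply: (@le_trans _ _ (`|x| ^+ N.*2)); last by rewrite lerDr.
  by rewrite ler_eXn2l ?leq_addr// -addnn leq_addr.
apply: le_trans (ler_wpM2r _ W) _ => //.
by rewrite -mulrA ler_wpM2l ?exprn_ge0// mulrDl mul1r lerD.
Qed.

End CosineTransform.

(** * A smooth bump with explicit derivatives *)

Section Bump.
Context (R : realType).

Lemma poly_exp_bound (p : {poly R}) : exists C : R, forall y, 0 <= y -> `|p.[y]| * expR (- y) <= C.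
Proof.
exists (\sum_(i < size p) `|p`_i| * i`!%:R) => y y0.
rewrite horner_coef; apply: (@le_trans _ _ (\sum_(i < size p) `|p`_i| * (y ^+ i * expR (- y)))).
  have -> : \sum_(i < size p) `|p`_i| * (y ^+ i * expR (- y)) = (\sum_(i < size p) `|p`_i| * y ^+ i) * expR (- y).
    by rewrite mulr_suml; apply: eq_bigr => i _; rewrite mulrA.
  rewrite ler_wpM2r ?expR_ge0// (le_trans (ler_norm_sum _ _ _))// ler_sum// => i _.
  by rewrite normrM normrX (ger0_norm y0).
apply: ler_sum => i _; apply: ler_wpM2l => //; rewrite expRN ler_pdivrMr ?expR_gt0//.
case: (i : nat) => [|k]; first by rewrite expr0 fact0 mul1r -expR0 ler_expR.
have f0 : 0 < k.+1`!%:R :> R by rewrite ltr0n fact_gt0.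
by rewrite -ler_pdivrMl// mulrC (le_trans _ (expR_ge1Dxn k y0))// lerDr.
Qed.

(** As [q] varies, these functions form a class closed under differentiation, which yields all the
    derivatives of [exp (- 1 / x)] extended by 0. *)
Definition flat (q : {poly R}) (x : R) : R := if 0 < x then q.[x^-1] * expR (- x^-1) else 0.

Lemma flat_le0 q x : x <= 0 -> flat q x = 0.
Proof. by rewrite /flat ltNge => ->. Qed.

Definition flat_deriv (q : {poly R}) : {poly R} := 'X^2 * (q - q^`()).

Lemma is_derive_flat q x : is_derive x (1 : R) (flat q) (flat (flat_deriv q) x).
Proof.
have [x0|x0|->] := ltgtP x 0.
- rewrite (flat_le0 _ (ltW x0)).
  apply: (@near_eq_is_derive _ _ _ (cst 0)) => //.
  near=> y; have y0 : y <= 0 by apply/ltW; near: y; exact: lt_nbhsl.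
  by rewrite /= flat_le0.
- rewrite {2}/flat x0.
  apply: (@near_eq_is_derive _ _ _ (fun y : R => q.[y^-1] * expR (- y^-1) : R^o)) => //.
    near=> y; have y0 : 0 < y by near: y; exact: lt_nbhsr.
    by rewrite /flat y0.
  have xN : x != 0 by rewrite gt_eqF.
  have dV : is_derive x (1 : R) (fun y => y^-1) (- x ^- 2).
    have := is_deriveV xN (is_derive_id x (1 : R)).
    by move=> /is_derive_eq; apply; rewrite -[_ *: _]/(_ * _) mulr1.
  have dp (z : R) : is_derive z (1 : R) (horner q) q^`().[z].
    by apply: DeriveDef; [exact: derivable_horner|rewrite derivE derive1E].
  have dq := @is_derive1_comp _ (horner q) (fun y : R => y^-1) x _ _ (dp _) dV.
  have dN : is_derive x (1 : R) (fun y : R => - y^-1) (x ^- 2).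
    by have := is_deriveN dV; move=> /is_derive_eq; apply; rewrite opprK.
  have de := @is_derive1_comp _ (@expR R) (fun y => - y^-1) x _ _ (is_derive_expR _) dN.
  have := is_deriveM dq de; move=> /is_derive_eq; apply.
  rewrite -[_ *: _]/(_ * _) -[X in _ + X]/(_ * _) /flat_deriv hornerM hornerXn hornerD hornerN exprVn /=.
  by set a := x ^- 2; ring.
- rewrite (flat_le0 _ (lexx 0)).
  (* Bounding the polynomial ['X^2 * q] instead of [q] gives a bound of order [h ^ 2] for
     [flat q h], so the derivative at the origin is 0. *)
  have [C HC] := poly_exp_bound ('X^2 * q).
  have fb h : `|flat q h| <= C * h ^+ 2.
    rewrite /flat; case: ltP => h0; last first.
      rewrite normr0 mulr_ge0 ?sqr_ge0//; apply: le_trans (HC 0 (lexx 0)).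
      by rewrite mulr_ge0// expR_ge0.
    have := HC h^-1; rewrite invr_ge0 (ltW h0) => /(_ isT).
    rewrite hornerM hornerXn normrM exprVn normfV (ger0_norm (sqr_ge0 h)) -mulrA.
    by rewrite ler_pdivrMl ?exprn_gt0// normrM (ger0_norm (expR_ge0 _)) [C * _]mulrC.
  have cv : (fun h : R => h^-1 *: (flat q (h *: 1 + 0) - flat q 0)) @ 0^' --> (0 : R).
    apply/cvgrPdist_le => /= e e0; near=> h.
    have h0 : h != 0 by near: h; exact: nbhs_dnbhs_neq.
    have eh : (h *: 1 + 0 : R) = h by rewrite addr0; exact: mulr1.
    rewrite sub0r normrN eh (flat_le0 _ (lexx 0)) subr0 -[_ *: _]/(_ * _) normrM normfV.
    rewrite ler_pdivrMl ?normr_gt0// (le_trans (fb h))// -real_normK ?num_real//.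
    rewrite expr2 mulrA [C * _]mulrC -mulrA ler_wpM2l//.
    apply: (@le_trans _ _ ((`|C| + 1) * `|h|)).
      by rewrite ler_wpM2r// (le_trans (ler_norm _))// lerDl.
    rewrite mulrC -ler_pdivlMr ?ltr_wpDl//; near: h; apply: dnbhs0_le.
    by rewrite divr_gt0// ltr_wpDl.
  by apply: DeriveDef; [apply/cvg_ex; exists 0|exact: cvg_lim].
Unshelve. all: by end_near.
Qed.

Fixpoint flat_poly (n : nat) : {poly R} := if n is k.+1 then flat_deriv (flat_poly k) else 1.

Definition bump_jet : nat -> R -> R :=
  leibniz (fun n x => 1 ^+ n * flat (flat_poly n) (1 * x + 1))
          (fun n x => (-1) ^+ n * flat (flat_poly n) (-1 * x + 1)).

Lemma compact_bump_jet : compact_jet 1 bump_jet.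
Proof.
have jf : jet (fun n => flat (flat_poly n)) by move=> n x; exact: is_derive_flat.
split; first by apply: jet_leibniz; exact: (jet_affine _ _ jf).
move=> n x; rewrite /bump_jet /leibniz => x1; rewrite big1// => k _.
have [x0|x0] := leP 0 x.
  by rewrite ger0_norm// in x1; rewrite (@flat_le0 _ (-1 * x + 1)) ?mulr0//; lra.
rewrite ltr0_norm// in x1; rewrite (@flat_le0 _ (1 * x + 1)) ?(mulr0,mul0r)//; lra.
Qed.

Lemma bump_jet0E x : bump_jet 0 x = flat 1 (1 + x) * flat 1 (1 - x).
Proof. by rewrite /bump_jet leibniz0 !expr0 !mul1r mulN1r ![_ + 1]addrC. Qed.

Lemma flat1_ge0 x : 0 <= flat 1 x.
Proof. by rewrite /flat; case: ifP => // _; rewrite hornerC mul1r expR_ge0. Qed.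

Lemma bump_jet_ge0 x : 0 <= bump_jet 0 x.
Proof. by rewrite bump_jet0E mulr_ge0// flat1_ge0. Qed.

Lemma bump_jet_even x : bump_jet 0 (- x) = bump_jet 0 x.
Proof. by rewrite !bump_jet0E opprK mulrC. Qed.

(** An explicit bound on half of the support; the bump rescaled to width [delta] then has mass at
    least of order [delta]. *)
Lemma bump_jet_lower x : `|x| <= 1 / 2 -> expR (- 2) * expR (- 2) <= bump_jet 0 x.
Proof.
rewrite ler_norml => /andP[h1 h2].
have key y : 1 / 2 <= y -> expR (- 2) <= flat 1 y.
  move=> hy; have y0 : 0 < y by lra.
  rewrite /flat y0 hornerC mul1r ler_expR lerN2 -[leRHS]invrK lef_pV2 ?posrE//; lra.
by rewrite bump_jet0E; apply: ler_pM; rewrite ?expR_ge0//; apply: key; lra.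
Qed.

Lemma jet_parity (f : nat -> R -> R) : jet f -> (forall x, f 0%N (- x) = f 0%N x) ->
  forall n x, f n (- x) = (-1) ^+ n * f n x.
Proof.
move=> jf fe; elim=> [|n IH] x; first by rewrite fe mul1r.
have d1 := @is_derive_affine _ (f n) (-1) 0 x (f n.+1 (-1 * x + 0)) (jf n _).
have d2 := is_deriveZ ((-1) ^+ n) (jf n x).
have E : (fun y => f n (-1 * y + 0)) = (-1) ^+ n \*: f n.
  by apply/funext => y; rewrite addr0 mulN1r IH.
rewrite E in d1; have [_ e1] := d1; have [_ e2] := d2.
have : -1 * f n.+1 (-1 * x + 0) = (-1) ^+ n * f n.+1 x by rewrite -e1 e2.
by rewrite addr0 mulN1r mulN1r exprS mulN1r => /eqP; rewrite eqr_oppLR -mulNr => /eqP.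
Qed.

End Bump.

(** * Spectral windows of width [delta] *)

Section Window.
Context (R : realType).
Local Notation leb := (@lebesgue_measure R).
Local Notation integrableR f := (leb.-integrable setT (EFin \o f)).

Lemma Rintegral_lower (f : R -> R) (a b c : R) : a <= b -> 0 <= c -> integrableR f ->
  (forall x, 0 <= f x) -> (forall x, a <= x <= b -> c <= f x) -> c * (b - a) <= \int[leb]_x f x.
Proof.
move=> ab c0 intf f0 fc; pose I := `[a, b]%classic : set R.
have mI : measurable I by exact: measurable_itv.
have ic : leb.-integrable I (EFin \o cst c).
  by apply: continuous_compact_integrable; [exact: segment_compact|move=> x; exact: cvg_cst].
have ic' : integrableR (cst c \_ I) by rewrite -restrict_EFin -integrable_mkcond.
have : \int[leb]_(x in I) c <= \int[leb]_x f x.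
  rewrite Rintegral_mkcond; apply: le_Rintegral => // x _; rewrite patchE; case: ifPn => // xI.
  by apply: fc; move: (set_mem xI); rewrite /I /= in_itv.
have lI : leb I = (b - a)%:E.
  rewrite lebesgue_measure_itv/= lte_fin; case: ltP => // ba.
  by rewrite (_ : b - a = 0)//; apply/eqP; rewrite subr_eq0 eq_le ab ba.
have -> : \int[leb]_(_ in I) c = c * fine (leb I) by exact: Rintegral_cst.
by rewrite lI.
Qed.

(** The [+ 0] in the argument matches the form that [jet_affine] produces. *)
Definition window_mass (delta : R) : R := \int[leb]_k bump_jet 0 (delta^-1 * k + 0).

Definition window (delta : R) (n : nat) (k : R) : R :=
  (window_mass delta)^-1 * (delta^-1 ^+ n * bump_jet n (delta^-1 * k + 0)).

Lemma compact_scaled_bump (delta : R) : 0 < delta ->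
  compact_jet delta (fun n k => delta^-1 ^+ n * bump_jet n (delta^-1 * k + 0)).
Proof.
move=> d0; have [jb b0] := compact_bump_jet R; split; first exact: jet_affine.
move=> n x dx; rewrite b0 ?mulr0// addr0 normrM gtr0_norm ?invr_gt0// mulrC.
by rewrite ler_pdivlMr// mul1r.
Qed.

Lemma compact_window delta : 0 < delta -> compact_jet delta (window delta).
Proof.
move=> d0; have [j b0] := compact_scaled_bump d0; split; first exact: jetZ.
by move=> n x dx; rewrite /window b0// mulr0.
Qed.

Lemma window_mass_lower delta : 0 < delta -> delta * (expR (- 2) * expR (- 2)) <= window_mass delta.
Proof.
move=> d0; have r := compact_jet_rapid 0 (compact_scaled_bump d0).
have E : (fun k : R => delta^-1 ^+ 0 * bump_jet 0 (delta^-1 * k + 0)) = (fun k => bump_jet 0 (delta^-1 * k + 0)).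
  by apply/funext => k; rewrite expr0 mul1r.
rewrite E in r.
have := @Rintegral_lower _ (- (delta / 2)) (delta / 2) (expR (- 2) * expR (- 2)) _ _ (rapid_integrable r).
rewrite opprK -splitr [_ * _ * delta]mulrC; apply.
- lra.
- by rewrite mulr_ge0 ?expR_ge0.
- by move=> x; exact: bump_jet_ge0.
- move=> x; rewrite -ler_norml => xd; apply: bump_jet_lower.
  rewrite addr0 normrM gtr0_norm ?invr_gt0// ler_pdivrMl//; lra.
Qed.

Lemma window_mass_gt0 delta : 0 < delta -> 0 < window_mass delta.
Proof. by move=> d0; apply: lt_le_trans (window_mass_lower d0); rewrite !mulr_gt0 ?expR_gt0. Qed.

Lemma window0_ge0 delta k : 0 < delta -> 0 <= window delta 0 k.
Proof.
by move=> d0; rewrite /window expr0 mul1r mulr_ge0 ?invr_ge0 ?(ltW (window_mass_gt0 d0))// bump_jet_ge0.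
Qed.

Lemma window_even delta k : window delta 0 (- k) = window delta 0 k.
Proof. by rewrite /window !addr0 mulrN bump_jet_even. Qed.

Lemma window_rapid delta n : 0 < delta -> rapid (window delta n).
Proof. by move=> d0; exact: compact_jet_rapid (compact_window d0). Qed.

Lemma window_integral delta : 0 < delta -> \int[leb]_k window delta 0 k = 1.
Proof.
move=> d0; have r := rapid_integrable (compact_jet_rapid 0 (compact_scaled_bump d0)).
rewrite /window (RintegralZl _ measurableT r).
rewrite (_ : \int[leb]_k _ = window_mass delta) ?mulVf ?gt_eqF ?window_mass_gt0//.
by apply: eq_Rintegral => k _; rewrite expr0 mul1r.
Qed.

(** Each derivative costs a factor [delta^-1], and so does the normalisation, by
    [window_mass_lower]. *)
Lemma window_bound n : exists2 C : R, 0 <= C & forall delta : R, 0 < delta -> forall k,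
  `|window delta n k| <= C * delta^-1 ^+ n.+1.
Proof.
have [jb b0] := compact_bump_jet R.
have [B bB] := compact_support_bounded (jet_continuous jb) (b0 n).
have B0 : 0 <= B := le_trans (normr_ge0 _) (bB 0).
have c0 : 0 < expR (- 2) * expR (- 2) :> R by rewrite mulr_gt0 ?expR_gt0.
exists ((expR (- 2) * expR (- 2))^-1 * B); first by rewrite mulr_ge0 ?invr_ge0// ltW.
move=> delta d0 k; have m0 := window_mass_gt0 d0.
rewrite /window !normrM normfV (gtr0_norm m0) normrX (ger0_norm (ltW _)) ?invr_gt0//.
rewrite exprSr -!mulrA.
apply: (@le_trans _ _ ((delta * (expR (- 2) * expR (- 2)))^-1 * (delta^-1 ^+ n * B))).
  apply: ler_pM; rewrite ?mulr_ge0 ?invr_ge0 ?exprn_ge0 ?invr_ge0 ?(ltW m0) ?(ltW d0)//.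
    by rewrite lef_pV2 ?posrE ?mulr_gt0 ?expR_gt0// window_mass_lower.
  by rewrite ler_wpM2l ?exprn_ge0 ?invr_ge0 ?(ltW d0).
set c := expR _ * _; rewrite invfM.
by rewrite (_ : delta^-1 / c * (delta^-1 ^+ n * B) = c^-1 * (B * (delta^-1 ^+ n / delta)))//; ring.
Qed.

Definition kappa (delta y : R) : R := \int[leb]_k (window delta 0 k * cosjet 0 0 (k * y)).

Lemma cosjet00 (x : R) : cosjet 0 0 x = cos x.
Proof. by rewrite /cosjet mul0r !addr0. Qed.

Lemma kappa_le1 delta y : 0 < delta -> `|kappa delta y| <= 1.
Proof.
move=> d0; rewrite -(window_integral d0); have r := window_rapid 0 d0.
apply: (integrable_continuous _ (rapid_integrable r) _).2.
  by case: (rapid_cosjet 0 0 y r).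
by move=> k; rewrite normrM (ger0_norm (window0_ge0 k d0)) ler_piMr ?window0_ge0// cosjet_le1.
Qed.

(** The cosine is 1-Lipschitz, and the window has mass 1 and vanishes for [|k| >= delta]. *)
Lemma kappa_near1 delta y : 0 < delta -> `|kappa delta y - 1| <= delta * `|y|.
Proof.
move=> d0; have r := window_rapid 0 d0; have i := rapid_integrable r.
have ic := rapid_integrable (rapid_cosjet 0 0 y r).
rewrite -(window_integral d0) -(RintegralB measurableT ic i).
have E : delta * `|y| = \int[leb]_k (delta * `|y| * window delta 0 k).
  by rewrite (RintegralZl _ measurableT i) window_integral// mulr1.
rewrite E; apply: (integrable_continuous _ (integrableZl measurableT _ i) _).2.
  have [c1 _] := rapid_cosjet 0 0 y r; have [c2 _] := r.
  by move=> k; apply: cvgB; [exact: c1|exact: c2].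
move=> k; have w0 := window0_ge0 k d0.
rewrite -[X in _ - X]mulr1 -mulrBr normrM (ger0_norm w0) mulrC.
have [dk|kd] := leP delta `|k|.
  by have [_ ->] := compact_window d0; rewrite ?mulr0.
rewrite ler_wpM2r//; have [c [_ H]] := mean_value (fun x => jet_cosjet 0 0 x) 0 (k * y).
have : cosjet 0 0 (k * y) - 1 = cosjet 0 1 c * (k * y).
  by have := H; rewrite [cosjet 0 0 0]cosjet00 cos0 subr0.
move=> ->; rewrite normrM -[leRHS]mul1r; apply: ler_pM => //; first exact: cosjet_le1.
by rewrite normrM ler_wpM2r// ltW.
Qed.

End Window.

(** * Polynomial profiles and their spectra *)

Section Profile.
Context (R : realType).
Local Notation leb := (@lebesgue_measure R).
Local Notation integrableR f := (leb.-integrable setT (EFin \o f)).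

(** The [n]-th derivative of the operator [p (- d^2 / dk^2)] applied to the window. Its terms have
    even order, which keeps the window even and turns it, by [profile_poly], into multiplication by
    [p.[y ^+ 2]] after the cosine transform. *)
Definition spectrum (p : {poly R}) (delta : R) (n : nat) (k : R) : R :=
  \sum_(a < size p) (p`_a * (-1) ^+ a) * window delta (a.*2 + n) k.

Lemma compact_spectrum p delta : 0 < delta -> compact_jet delta (spectrum p delta).
Proof.
move=> d0; have [jw w0] := compact_window d0; split.
  apply: (@jet_sum R _ _ (fun a n k => (p`_(a : 'I__) * (-1) ^+ (a : 'I__)) * window delta ((a : 'I__).*2 + n) k)) => a.
  by apply: jetZ => n x; rewrite addnS; exact: jw.
by move=> n x dx; rewrite /spectrum big1// => a _; rewrite w0// mulr0.
Qed.

Lemma spectrum_even p delta k : 0 < delta -> spectrum p delta 0 (- k) = spectrum p delta 0 k.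
Proof.
move=> d0; have [jw _] := compact_window d0.
apply: eq_bigr => a _; rewrite (jet_parity jw (window_even delta)).
by rewrite addn0 -mul2n exprM sqrrN expr1n expr1n mul1r.
Qed.

Lemma spectrum_bound p n : exists2 C : R, 0 <= C & forall delta : R, 0 < delta -> delta <= 1 -> forall k,
  `|spectrum p delta n k| <= C * delta^-1 ^+ ((size p).*2 + n).+1.
Proof.
have H (a : nat) := window_bound R (a.*2 + n).
pose C a := projT1 (cid2 (H a)).
have C0 a : 0 <= C a by rewrite /C; case: cid2.
have CP a delta : 0 < delta -> forall k, `|window delta (a.*2 + n) k| <= C a * delta^-1 ^+ (a.*2 + n).+1.
  by rewrite /C; case: cid2 => c _ /=; exact.
exists (\sum_(a < size p) `|p`_a| * C a).
  by apply: sumr_ge0 => a _; rewrite mulr_ge0.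
move=> delta d0 d1 k; rewrite mulr_suml (le_trans (ler_norm_sum _ _ _))// ler_sum// => a _.
rewrite normrM normrM normrX normrN1 expr1n mulr1 -mulrA; apply: ler_wpM2l => //.
apply: le_trans (CP a _ d0 k) _; apply: ler_wpM2l => //.
by rewrite ler_weXn2l ?invf_ge1// ltnS leq_add2r leq_double ltnW.
Qed.

Definition profile (p : {poly R}) (delta : R) : nat -> R -> R := transform 0 (spectrum p delta 0).

Lemma profile_schwartz p delta : 0 < delta -> schwartz_jet (profile p delta).
Proof. by move=> d0; exact: transform_schwartz d0 (compact_spectrum p d0). Qed.

Lemma profile0E p delta y :
  profile p delta 0 y = \int[leb]_k (spectrum p delta 0 k * cosjet 0 0 (k * y)).
Proof. by apply: eq_Rintegral => k _; rewrite expr0 mul1r. Qed.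

Lemma profile_even p delta y : profile p delta 0 (- y) = profile p delta 0 y.
Proof. by rewrite !profile0E; apply: eq_Rintegral => k _; rewrite !cosjet00 mulrN cosN. Qed.

Lemma Rintegral_sum_ord (N : nat) (f : 'I_N -> R -> R) : (forall i, integrableR (f i)) ->
  \int[leb]_x (\sum_i f i x) = \sum_i \int[leb]_x f i x.
Proof.
elim: N f => [|N IH] f intf.
  by rewrite big_ord0; under eq_Rintegral do rewrite big_ord0; rewrite Rintegral_cst// mul0r.
rewrite big_ord_recl -IH// -RintegralD//.
  by apply: eq_Rintegral => x _; rewrite big_ord_recl.
rewrite (_ : EFin \o _ = fun x => \sum_i (f (lift ord0 i) x)%:E); last first.
  by apply/funext => x; rewrite /= sumEFin.
by apply: integrable_sum => // i _; exact: intf.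
Qed.

Lemma profile_poly p delta y : 0 < delta -> profile p delta 0 y = p.[y ^+ 2] * kappa delta y.
Proof.
move=> d0; rewrite profile0E horner_coef mulr_suml.
have i a := rapid_integrable (rapid_cosjet 0 0 y (window_rapid a d0)).
transitivity (\int[leb]_k (\sum_(a < size p) (p`_a * (-1) ^+ a) * (window delta a.*2 k * cosjet 0 0 (k * y)))).
  apply: eq_Rintegral => k _; rewrite /spectrum mulr_suml; apply: eq_bigr => a _.
  by rewrite addn0 [RHS]mulrA.
rewrite Rintegral_sum_ord => [|a]; last exact: (integrableZl measurableT _ (i _)).
apply: eq_bigr => a _; rewrite (RintegralZl _ measurableT (i _)).
rewrite (transform_even_parts _ _ _ _ d0 (compact_window d0)) -exprM mul2n.
by rewrite -/(kappa delta y) !mulrA -[_ * (-1) ^+ a * (-1) ^+ a]mulrA -expr2 sqrr_sign mulr1.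
Qed.

(** The profile and its product with [y ^ 2] are, up to sign, cosine transforms of the spectrum and
    of its second derivative, both bounded by a power of [delta^-1]. Together they bound [1 + y ^ 2]
    times the profile, hence its integral. *)
Lemma profile_mass p : exists2 C : R, 0 <= C & forall delta : R, 0 < delta -> delta <= 1 ->
  \int[leb]_x `|profile p delta 0 x| <= C * delta^-1 ^+ ((size p).*2 + 2).+1.
Proof.
have [C0 C00 S0] := spectrum_bound p 0; have [C2 C20 S2] := spectrum_bound p 2.
set P := ((size p).*2 + 2).+1 in S2 *; set m := cauchy_mass R; have m0 : 0 <= m := cauchy_mass_ge0 R.
exists (2 * (C0 + C2) * m * m); first by rewrite !mulr_ge0// addr_ge0.
move=> delta d0 d1; set dP := delta^-1 ^+ P.
have dP0 : 0 <= dP by rewrite exprn_ge0// invr_ge0 ltW.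
have cs := compact_spectrum p d0.
have key n C : 0 <= C -> (forall k, `|spectrum p delta n k| <= C * dP) ->
    forall y, `|\int[leb]_k (spectrum p delta n k * cosjet 0 0 (k * y))| <= (2 * (C * dP)) * m.
  move=> C0' sC y; apply: (decay_integrable _ _).2.
    by case: (rapid_cosjet 0 0 y (compact_jet_rapid n cs)).
  move=> k; have [dk|kd] := leP delta `|k|.
    by have [_ ->] := cs; rewrite ?mul0r ?normr0 ?mulr0// !mulr_ge0.
  have k1 : 1 + k ^+ 2 <= 2.
    rewrite -[k ^+ 2]real_normK ?num_real// (_ : (2 : R) = 1 + 1)// lerD2l expr_le1//.
    by rewrite (le_trans (ltW kd)).
  apply: ler_pM => //; first by rewrite addr_ge0// sqr_ge0.
  by rewrite normrM -[leRHS]mulr1; apply: ler_pM => //; exact: cosjet_le1.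
have b2 := key 2%N C2 C20 (S2 _ d0 d1).
have h0 k : `|spectrum p delta 0 k| <= C0 * dP.
  by apply: le_trans (S0 _ d0 d1 k) _; rewrite ler_wpM2l// ler_weXn2l ?invf_ge1// ltnS leq_add2l.
have b0 := key 0%N C0 C00 h0.
have cr := (rapid_abs ((profile_schwartz p d0).2 0%N)).1.
apply: le_trans (ler_norm _) _.
rewrite (_ : 2 * (C0 + C2) * m * m * dP = (2 * (C0 * dP) * m + 2 * (C2 * dP) * m) * m); last ring.
apply: (decay_integrable cr _).2 => y; rewrite normr_id mulrDl mul1r; apply: lerD.
  by rewrite profile0E b0.
have := transform_even_parts 0 0 y 1 d0 cs.
rewrite -profile0E expr1 mulN1r mulNr => /(congr1 Num.norm).
by rewrite normrN normrM (ger0_norm (sqr_ge0 _)) => <-; exact: b2.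
Qed.

End Profile.

(** * Autocorrelations and their truncation *)

Section Correlation.
Context (R : realType).
Local Notation leb := (@lebesgue_measure R).
Local Notation integrableR f := (leb.-integrable setT (EFin \o f)).

Lemma uniform_bound (Y : Type) (F : nat -> Y -> R) :
  (forall n, exists B, forall y, F n y <= B) ->
  forall N, exists2 B, 0 <= B & forall n y, (n <= N)%N -> F n y <= B.
Proof.
move=> FB; elim=> [|N [B B0 HB]].
  have [B HB] := FB 0%N; exists `|B| => // n y; rewrite leqn0 => /eqP ->.
  exact: le_trans (HB y) (ler_norm _).
have [C HC] := FB N.+1; exists (B + `|C|); first by rewrite addr_ge0.
move=> n y; rewrite leq_eqVlt ltnS => /predU1P[->|nN].
  by rewrite (le_trans (HC y))// (le_trans (ler_norm _))// lerDr.
by rewrite (le_trans (HB n y nN))// lerDl.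
Qed.

(** One-dimensional counterpart of the seminorm in [tempered_distribution]: the same [N] bounds the
    order of the derivatives and is the exponent of the weight. *)
Definition snorm_le (N : nat) (f : nat -> R -> R) (B : R) : Prop :=
  forall n x, (n <= N)%N -> (1 + `|x|) ^+ N * `|f n x| <= B.

Lemma schwartz_snorm f N : schwartz_jet f -> exists2 B, 0 <= B & snorm_le N f B.
Proof.
move=> [_ rf]; apply: (@uniform_bound _ (fun n x => (1 + `|x|) ^+ N * `|f n x|)) => n.
by have [_] := rf n; exact.
Qed.

Lemma snorm_schwartz f : jet f -> (forall N, exists B, snorm_le N f B) -> schwartz_jet f.
Proof.
move=> jf fB; split => // n; split; first exact: jet_continuous.
move=> N; have [B HB] := fB (maxn n N); exists B => x; apply: le_trans (HB n x (leq_maxl _ _)).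
by rewrite ler_wpM2r// ler_weXn2l ?weight_ge1// leq_maxr.
Qed.

Lemma compact_schwartz (a : R) f : compact_jet a f -> schwartz_jet f.
Proof. by move=> cf; split; [exact: cf.1|move=> n; exact: compact_jet_rapid cf]. Qed.

Lemma snorm_ge0 N f B : snorm_le N f B -> 0 <= B.
Proof.
move=> h; apply: le_trans (h 0%N 0 (leq0n _)).
by rewrite mulr_ge0// exprn_ge0// ltW// weight_gt0.
Qed.

Lemma snorm_leW N N' f B : (N' <= N)%N -> snorm_le N f B -> snorm_le N' f B.
Proof.
move=> NN h n x nN; apply: le_trans (h n x (leq_trans nN NN)).
by rewrite ler_wpM2r// ler_weXn2l ?weight_ge1.
Qed.

Definition corr (f : nat -> R -> R) (g : R -> R) (n : nat) (x : R) : R :=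
  \int[leb]_t (f n (x + t) * g t).

Lemma continuous_shift (f : R -> R) x : continuous f -> continuous (fun t => f (x + t)).
Proof.
move=> cf t; apply: (@continuous_comp _ _ _ (fun t => x + t) f); last exact: cf.
by apply: cvgD; [exact: cvg_cst|exact: cvg_id].
Qed.

Lemma rapid_shift_mul (f g : R -> R) x : rapid f -> rapid g -> rapid (fun t => f (x + t) * g t).
Proof.
move=> [cf fB] rg; have [B HB] := fB 0%N.
have fxB t : `|f (x + t)| <= B * (1 + `|t|) ^+ 0 by have := HB (x + t); rewrite expr0 mul1r mulr1.
exact: (@rapid_mul R g (fun t => f (x + t)) B 0 rg (continuous_shift cf) fxB).
Qed.

Lemma jet_corr f g : schwartz_jet f -> rapid g -> jet (corr f g).
Proof.
move=> [jf rf] rg n x; have [B HB] : exists B, forall y, `|f n.+2 y| <= B.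
  by have [_ /(_ 0%N)[B HB]] := rf n.+2; exists B => y; have := HB y; rewrite expr0 mul1r.
apply: (@is_derive_integral R (fun y t => f n (y + t) * g t) (fun y t => f n.+1 (y + t) * g t) (fun t => B * `|g t|)).
- by move=> y; apply: rapid_integrable; exact: rapid_shift_mul.
- by apply: rapid_integrable; exact: rapid_shift_mul.
- exact: (integrableZl measurableT B (rapid_integrable (rapid_abs rg))).
- move=> h t; have jn : jet (fun m => f (n + m)%N) by move=> m y; rewrite addnS; exact: jf.
  have := @jet_taylor R _ B (x + t) h jn; rewrite addn0 addn1 addn2 => /(_ HB) T.
  rewrite (_ : _ - _ - _ = (f n (x + t + h) - f n (x + t) - h * f n.+1 (x + t)) * g t); last first.
    by rewrite [x + h + t]addrAC; ring.
  by rewrite normrM mulrA ler_wpM2r.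
Qed.

Lemma weight_shift (x t : R) : 1 + `|x| <= (1 + `|x + t|) * (1 + `|t|).
Proof.
have h : `|x| <= `|x + t| + `|t| by rewrite -{1}[x](addrK t) ler_normB.
have : 0 <= `|x + t| * `|t| by rewrite mulr_ge0.
by rewrite mulrDl mul1r mulrDr mulr1; lra.
Qed.

(** By [weight_shift], the weight of [x] is at most the product of those of [x + t] and of [t]; the
    two extra powers asked of [g] make the integral in [t] converge. *)
Lemma corr_bound N f g B C : (forall n, continuous (f n)) -> continuous g ->
  snorm_le N f B -> (forall t, (1 + `|t|) ^+ N.+2 * `|g t| <= C) -> snorm_le N (corr f g) (B * C * cauchy_mass R).
Proof.
move=> cf cg fB gC n x nN; have B0 := snorm_ge0 fB.
have wN0 (y : R) (k : nat) : 0 <= (1 + `|y|) ^+ k by rewrite exprn_ge0// ltW// weight_gt0.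
have -> : (1 + `|x|) ^+ N * `|corr f g n x| = `|(1 + `|x|) ^+ N * corr f g n x|.
  by rewrite normrM (ger0_norm (wN0 _ _)).
have ch : continuous (fun t => f n (x + t) * g t).
  by move=> t; apply: cvgM; [exact: continuous_shift|exact: cg].
have key t : (1 + t ^+ 2) * `|(1 + `|x|) ^+ N * (f n (x + t) * g t)| <= B * C.
  rewrite !normrM (ger0_norm (wN0 _ _)).
  apply: (@le_trans _ _ (((1 + `|x + t|) ^+ N * `|f n (x + t)|) * ((1 + `|t|) ^+ N.+2 * `|g t|))); last first.
    by apply: ler_pM; [exact: mulr_ge0|exact: mulr_ge0|exact: fB|exact: gC].
  have h1 : (1 + `|x|) ^+ N <= (1 + `|x + t|) ^+ N * (1 + `|t|) ^+ N.
    by rewrite -exprMn lerXn2r ?nnegrE ?mulr_ge0 ?(ltW (weight_gt0 _))// weight_shift.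
  have h2 := sqr_le_weight t.
  have -> : (1 + `|t|) ^+ N.+2 = (1 + `|t|) ^+ N * (1 + `|t|) ^+ 2 by rewrite -exprD addn2.
  set F := `|f n _|; set G := `|g t|.
  set W := (1 + `|x|) ^+ N in h1 *; set U := (1 + `|x + t|) ^+ N in h1 *; set V := (1 + `|t|) ^+ N in h1 *.
  set Z := (1 + `|t|) ^+ 2 in h2 *; set q := 1 + t ^+ 2 in h2 *.
  have q0 : 0 <= q by rewrite addr_ge0// sqr_ge0.
  have W0 : 0 <= W by exact: wN0.
  rewrite (_ : q * (W * (F * G)) = (q * W) * (F * G)); last exact: mulrA.
  rewrite (_ : U * F * (V * Z * G) = (Z * (U * V)) * (F * G)); last by ring.
  by apply: ler_wpM2r; [exact: mulr_ge0 (normr_ge0 _) (normr_ge0 _)|exact: ler_pM].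
have ch' : continuous (fun t => (1 + `|x|) ^+ N * (f n (x + t) * g t)).
  by move=> t; apply: cvgM; [exact: cvg_cst|exact: ch].
have [_] := decay_integrable ch' key.
have ih : integrableR (fun t => f n (x + t) * g t).
  apply: (@decay_integrable R _ (B * C) ch _).1 => t; apply: le_trans (key t).
  apply: ler_wpM2l; first by rewrite addr_ge0// sqr_ge0.
  rewrite [leRHS]normrM (ger0_norm (wN0 _ _)).
  by rewrite ler_peMl// exprn_ege1// weight_ge1.
by rewrite (RintegralZl _ measurableT ih).
Qed.

Lemma schwartz_corr f g : schwartz_jet f -> rapid g -> schwartz_jet (corr f g).
Proof.
move=> sf rg; apply: snorm_schwartz; first exact: jet_corr.
move=> N; have [B _ HB] := schwartz_snorm N sf; have [cg /(_ N.+2)[C HC]] := rg.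
exists (B * C * cauchy_mass R); apply: corr_bound => // n; exact: jet_continuous sf.1.
Qed.

Lemma leibniz_bound N f e B E : snorm_le N.+1 f B -> 0 <= E ->
  (forall n x, (n <= N)%N -> `|e n x| <= E * (1 + `|x|)) -> snorm_le N (leibniz f e) (2 ^+ N * (B * E)).
Proof.
move=> fB E0 eE n x nN; have B0 := snorm_ge0 fB.
have w0 : 0 <= 1 + `|x| := ltW (weight_gt0 x).
have wN0 : 0 <= (1 + `|x|) ^+ N by exact: exprn_ge0.
apply: (@le_trans _ _ (\sum_(k < n.+1) 'C(n, k)%:R * (B * E))).
  rewrite /leibniz -[X in X * _](ger0_norm wN0) -normrM mulr_sumr (le_trans (ler_norm_sum _ _ _))// ler_sum// => k _.
  rewrite mulrCA normrM (ger0_norm (ler0n _ _)); apply: ler_wpM2l => //.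
  rewrite !normrM (ger0_norm wN0).
  have hk : (k <= N.+1)%N by rewrite (leq_trans _ (leqW nN))// -ltnS.
  have h1 := fB k x hk.
  have h2 := eE (n - k)%N x (leq_trans (leq_subr _ _) nN).
  apply: (@le_trans _ _ ((1 + `|x|) ^+ N * (`|f k x| * (E * (1 + `|x|))))).
    by apply: ler_wpM2l => //; apply: ler_wpM2l.
  rewrite exprSr in h1.
  rewrite (_ : _ * (_ * _) = ((1 + `|x|) ^+ N * (1 + `|x|) * `|f k x|) * E); last by ring.
  exact: ler_wpM2r.
rewrite -mulr_suml ler_wpM2r ?mulr_ge0// -natr_sum.
have -> : \sum_(k < n.+1) 'C(n, k) = (2 ^ n)%N.
  by have := expnDn 1 1 n; rewrite addn1 => ->; apply: eq_bigr => k _; rewrite !exp1n !muln1.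
by rewrite natrX ler_weXn2l// ler1n.
Qed.

(** Normalised to be 1 at 0, but not constant near 0: its deviation from 1 is of order
    [(1 + |x|) / M], which costs one power of the weight in the estimates. *)
Definition cutoff (M : R) (n : nat) (x : R) : R :=
  (bump_jet 0 0)^-1 * (M^-1 ^+ n * bump_jet n (M^-1 * x + 0)).

Lemma bump_jet00_gt0 : 0 < bump_jet 0 0 :> R.
Proof.
apply: (@lt_le_trans _ _ (expR (- 2) * expR (- 2))); first by rewrite mulr_gt0 ?expR_gt0.
by apply: bump_jet_lower; rewrite normr0; lra.
Qed.

Lemma compact_cutoff M : 0 < M -> compact_jet M (cutoff M).
Proof.
move=> M0; have [j b0] := compact_scaled_bump M0; split; first exact: jetZ.
by move=> n x dx; rewrite /cutoff b0// mulr0.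
Qed.

Definition cutoff_defect (M : R) (n : nat) (x : R) : R := cutoff M n x - (n == 0%N)%:R.

Lemma jet_cutoff_defect M : 0 < M -> jet (cutoff_defect M).
Proof.
move=> M0 n x; have := is_deriveB ((compact_cutoff M0).1 n x) (is_derive_cst ((n == 0%N)%:R : R) x (1 : R)).
by move=> /is_derive_eq; apply; rewrite /cutoff_defect.
Qed.

Lemma cutoff_defect_bound N : exists2 E : R, 0 <= E & forall M, 1 <= M ->
  forall n x, (n <= N)%N -> `|cutoff_defect M n x| <= E / M * (1 + `|x|).
Proof.
have [jb b0] := compact_bump_jet R; set c := bump_jet 0 (0 : R).
have c0 : 0 < c := bump_jet00_gt0.
have [E E0 HE] : exists2 E : R, 0 <= E & forall n x, (n <= N.+1)%N -> `|bump_jet n x| <= E.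
  by apply: (@uniform_bound R (fun n x => `|bump_jet n x|)) => n; exact: compact_support_bounded (jet_continuous jb) (b0 n).
exists (c^-1 * E); first by rewrite mulr_ge0 ?invr_ge0// ltW.
move=> M M1 n x nN; have M0 : 0 < M by exact: lt_le_trans ltr01 M1.
have w1 := weight_ge1 x.
rewrite -!mulrA; case: n nN => [_|n nN].
  rewrite /cutoff_defect /cutoff expr0 mul1r -/c addr0.
  have -> : c^-1 * bump_jet 0 (M^-1 * x) - 1 = c^-1 * (bump_jet 0 (M^-1 * x) - c).
    by rewrite mulrBr mulVf// gt_eqF.
  rewrite normrM (gtr0_norm (_ : 0 < c^-1)) ?invr_gt0//; apply: ler_wpM2l; first by rewrite invr_ge0 ltW.
  have [z [_ ->]] := mean_value (jb 0%N) 0 (M^-1 * x).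
  rewrite subr0 !normrM (gtr0_norm (_ : 0 < M^-1)) ?invr_gt0//; apply: ler_pM; rewrite ?mulr_ge0 ?invr_ge0 ?(ltW M0)//.
    exact: HE.
  by apply: ler_wpM2l; rewrite ?invr_ge0 ?(ltW M0)// lerDr.
rewrite /cutoff_defect subr0 /cutoff -/c normrM (gtr0_norm (_ : 0 < c^-1)) ?invr_gt0//.
apply: ler_wpM2l; first by rewrite invr_ge0 ltW.
rewrite normrM normrX (gtr0_norm (_ : 0 < M^-1)) ?invr_gt0// mulrC; apply: ler_pM; rewrite ?exprn_ge0 ?invr_ge0 ?(ltW M0)//.
  by apply: HE; exact: leqW.
rewrite -[leLHS]mulr1; apply: ler_pM; rewrite ?exprn_ge0 ?invr_ge0 ?(ltW M0)//.
by rewrite exprS ger_pMr ?invr_gt0// exprn_ile1 ?invr_ge0 ?(ltW M0)// invf_le1.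
Qed.

Definition truncate (M : R) (f : nat -> R -> R) : nat -> R -> R := leibniz f (cutoff M).

Lemma compact_truncate M f : 0 < M -> jet f -> compact_jet M (truncate M f).
Proof. by move=> M0 jf; exact: compact_jet_leibniz jf (compact_cutoff M0). Qed.

Lemma truncateE M f n x : truncate M f n x = f n x + leibniz f (cutoff_defect M) n x.
Proof.
rewrite /truncate /leibniz; apply/eqP; rewrite -subr_eq -sumrB big_ord_recr/= binn subnn mul1r.
rewrite big1 => [|k _]; last first.
  by rewrite /cutoff_defect subn_eq0 leqNgt ltn_ord/= subr0 subrr.
by have -> : cutoff_defect M 0 x = cutoff M 0 x - 1; [|apply/eqP; ring].
Qed.

(** Bilinearity splits the difference of the two autocorrelations into two correlations, each having
    the truncation error as one argument, and this error has seminorms of order [1 / M]. The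
    constant [K] is chosen before [M]. *)
Lemma truncation_limit f N : schwartz_jet f -> exists2 K : R, 0 <= K & forall M, 1 <= M ->
  [/\ snorm_le N (corr f (f 0%N)) K, snorm_le N (corr (truncate M f) (truncate M f 0%N)) K &
    snorm_le N (fun n x => corr (truncate M f) (truncate M f 0%N) n x - corr f (f 0%N) n x) (K / M)].
Proof.
(* Of the three extra orders, two are used by [corr_bound] and one is lost in [leibniz_bound]. *)
move=> sf; have [F F0 HF] := schwartz_snorm N.+3 sf.
have [E E0 HE] := cutoff_defect_bound N.+2.
set m := cauchy_mass R; have m0 : 0 <= m := cauchy_mass_ge0 R.
pose G := 2 ^+ N.+2 * (F * E); have G0 : 0 <= G by apply: mulr_ge0; [exact: exprn_ge0|exact: mulr_ge0].
exists ((F + G) * (F + G) * m); first by rewrite !mulr_ge0// addr_ge0.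
move=> M M1; have M0 : 0 < M := lt_le_trans ltr01 M1.
pose ep := leibniz f (cutoff_defect M).
have HG : snorm_le N.+2 ep (G / M).
  rewrite (_ : G / M = 2 ^+ N.+2 * (F * (E / M))); last by rewrite /G !mulrA.
  apply: leibniz_bound HF _ _; first by rewrite divr_ge0// ltW.
  exact: HE.
have HGM : G / M <= G by rewrite ler_pdivrMr// ler_peMr.
have HF2 : snorm_le N.+2 f F by exact: snorm_leW HF.
have HT : snorm_le N.+2 (truncate M f) (F + G).
  move=> n x nN; rewrite truncateE.
  apply: (@le_trans _ _ ((1 + `|x|) ^+ N.+2 * (`|f n x| + `|ep n x|))).
    by apply: ler_wpM2l; [exact/exprn_ge0/ltW/weight_gt0|exact: ler_normD].
  by rewrite mulrDr; apply: lerD; [exact: HF2|exact: le_trans (HG n x nN) HGM].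
have jep : jet ep by exact: jet_leibniz sf.1 (jet_cutoff_defect M0).
have cT n : continuous (truncate M f n) by exact: jet_continuous (compact_truncate M0 sf.1).1.
have cf n : continuous (f n) by exact: jet_continuous sf.1.
have cep n : continuous (ep n) by exact: jet_continuous.
have lN : (N <= N.+2)%N by rewrite -addn2 leq_addr.
have Bff := corr_bound cf (cf 0%N) (snorm_leW lN HF2) (fun t => HF2 0%N t (leq0n _)).
have BTT := corr_bound cT (cT 0%N) (snorm_leW lN HT) (fun t => HT 0%N t (leq0n _)).
have BeT := corr_bound cep (cT 0%N) (snorm_leW lN HG) (fun t => HT 0%N t (leq0n _)).
have Bfe := corr_bound cf (cep 0%N) (snorm_leW lN HF2) (fun t => HG 0%N t (leq0n _)).
rewrite -/m in Bff BTT BeT Bfe.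
split.
- move=> n x nN; apply: le_trans (Bff n x nN) _.
  by rewrite ler_wpM2r//; apply: ler_pM => //; rewrite lerDl.
- exact: BTT.
- have sep : schwartz_jet ep.
    apply: snorm_schwartz jep _ => N'; have [F' _ HF'] := schwartz_snorm N'.+1 sf.
    have [E' E'0 HE'] := cutoff_defect_bound N'; exists (2 ^+ N' * (F' * (E' / M))).
    by apply: leibniz_bound HF' _ (HE' M M1); rewrite divr_ge0// ltW.
  have sT : schwartz_jet (truncate M f) := compact_schwartz (compact_truncate M0 sf.1).
  move=> n x nN.
  have i1 := rapid_integrable (rapid_shift_mul x (sT.2 n) (sT.2 0%N)).
  have i2 := rapid_integrable (rapid_shift_mul x (sf.2 n) (sf.2 0%N)).
  have i3 := rapid_integrable (rapid_shift_mul x (sep.2 n) (sT.2 0%N)).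
  have i4 := rapid_integrable (rapid_shift_mul x (sf.2 n) (sep.2 0%N)).
  have -> : corr (truncate M f) (truncate M f 0%N) n x - corr f (f 0%N) n x =
      corr ep (truncate M f 0%N) n x + corr f (ep 0%N) n x.
    rewrite /corr -(RintegralB measurableT i1 i2) -(RintegralD measurableT i3 i4).
    by apply: eq_Rintegral => t _; rewrite !truncateE -/ep; ring.
  apply: (@le_trans _ _ ((1 + `|x|) ^+ N * (`|corr ep (truncate M f 0%N) n x| + `|corr f (ep 0%N) n x|))).
    by apply: ler_wpM2l; [exact/exprn_ge0/ltW/weight_gt0|exact: ler_normD].
  rewrite mulrDr; apply: le_trans (lerD (BeT n x nN) (Bfe n x nN)) _.
  rewrite (_ : _ + _ = (F + (F + G)) * G * m / M); last by field; exact: lt0r_neq0.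
  rewrite ler_wpM2r ?invr_ge0 ?(ltW M0)// ler_wpM2r//.
  have FG : 0 <= F * G by rewrite mulr_ge0.
  have := sqr_ge0 F; rewrite expr2; nra.
Qed.

End Correlation.

(** * The autocorrelation as a cosine transform *)

Section SpectralIdentity.
Context (R : realType).
Local Notation leb := (@lebesgue_measure R).
Local Notation integrableR f := (leb.-integrable setT (EFin \o f)).
Local Notation TR := (measurableTypeR R).

Lemma Rintegral_swap (F : R -> R -> R) (a b : R -> R) :
  measurable_fun setT (fun z : TR * TR => F z.1 z.2) -> integrableR a -> integrableR b ->
  (forall k t, `|F k t| <= a k * b t) ->
  \int[leb]_t \int[leb]_k F k t = \int[leb]_k \int[leb]_t F k t.
Proof.
move=> mF ia ib Fab.
have iF : (leb \x leb)%E.-integrable setT (fun z : TR * TR => (F z.1 z.2)%:E).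
  apply: le_integrable (integrable_tensor ia ib) => //; first exact/measurable_EFinP.
  by move=> z _ /=; rewrite lee_fin (le_trans (Fab _ _))// ler_norm.
have m1 (k : TR) : measurable_fun setT (fun t : TR => F k t).
  exact: (measurable_fun_pair2 k mF).
have m2 (t : TR) : measurable_fun setT (fun k : TR => F k t).
  exact: (measurable_fun_pair1 t mF).
have i1 (k : TR) : (\int[leb]_t (F k t)%:E)%E \is a fin_num.
  apply: integrable_fin_num => //.
  exact: (Rintegral_dominated (m1 k) (integrableZl measurableT (a k) ib) (Fab k)).1.
have i2 (t : TR) : (\int[leb]_k (F k t)%:E)%E \is a fin_num.
  apply: integrable_fin_num => //.
  apply: (Rintegral_dominated (m2 t) (integrableZl measurableT (b t) ia) _).1 => k.
  by rewrite mulrC.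
rewrite /Rintegral; congr fine.
have E1 : (\int[leb]_t (\int[leb]_k F k t)%:E = \int[leb]_t \int[leb]_k (F k t)%:E)%E.
  by apply: eq_integral => t _; rewrite fineK.
have E2 : (\int[leb]_k (\int[leb]_t F k t)%:E = \int[leb]_k \int[leb]_t (F k t)%:E)%E.
  by apply: eq_integral => k _; rewrite fineK.
by rewrite E1 E2; exact: (esym (Fubini iF)).
Qed.

Lemma Rintegral_odd (f : R -> R) : integrableR f -> (forall x, f (- x) = - f x) -> \int[leb]_x f x = 0.
Proof.
move=> intf fo; have [_] := Rintegral_opp intf.
under eq_Rintegral do rewrite fo -mulN1r.
by rewrite RintegralZl// mulN1r => /eqP; rewrite eq_sym -addr_eq0 -mulr2n mulrn_eq0/= => /eqP.
Qed.

Lemma cosjet01 (x : R) : cosjet 0 1 x = - sin x.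
Proof. by rewrite /cosjet mul1r add0r cosDpihalf. Qed.

(* This form of the autocorrelation as a cosine transform avoids Fourier inversion. *)
Lemma corr_transform (v : R -> R) (f : nat -> R -> R) x : rapid v -> f = transform 0 v ->
  (forall n, rapid (f n)) -> (forall y, f 0%N (- y) = f 0%N y) ->
  corr f (f 0%N) 0 x = \int[leb]_k (transform 0 (f 0%N) 0 k * v k * cosjet 0 0 (k * x)).
Proof.
move=> rv fE rf fe; have r0 := rf 0%N.
have f0E y : f 0%N y = \int[leb]_k (v k * cosjet 0 0 (k * y)).
  by rewrite fE; apply: eq_Rintegral => k _; rewrite expr0 mul1r.
have iv y := rapid_integrable (rapid_cosjet 0 0 y rv).
have it0 k := rapid_integrable (rapid_cosjet 0 0 k r0).
have it1 k := rapid_integrable (rapid_cosjet 0 1 k r0).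
transitivity (\int[leb]_t \int[leb]_k (v k * f 0%N t * cosjet 0 0 (k * (x + t)))).
  apply: eq_Rintegral => t _; rewrite f0E mulrC -(RintegralZl _ measurableT (iv _)).
  by apply: eq_Rintegral => k _; rewrite mulrCA mulrA.
have iav := rapid_integrable (rapid_abs rv); have iaf := rapid_integrable (rapid_abs r0).
rewrite (@Rintegral_swap (fun k t => v k * f 0%N t * cosjet 0 0 (k * (x + t))) _ _ _ iav iaf).
- apply: eq_Rintegral => k _.
  (* The addition formula for the cosine of [k * (x + t)]: the sine term is odd in [t], because
     [f 0] is even, and integrates to 0. *)
  transitivity (\int[leb]_t (v k * cosjet 0 0 (k * x) * (f 0%N t * cosjet 0 0 (t * k)) +
      v k * cosjet 0 1 (k * x) * - (f 0%N t * cosjet 0 1 (t * k)))).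
    apply: eq_Rintegral => t _; rewrite !cosjet00 !cosjet01 mulrDr cosD [t * k]mulrC; ring.
  have iN := integrableN (it1 k).
  have odd0 : \int[leb]_t - (f 0%N t * cosjet 0 1 (t * k)) = 0.
    apply: Rintegral_odd => // t; rewrite fe !cosjet01 mulNr sinN; ring.
  rewrite (RintegralD measurableT (integrableZl measurableT _ (it0 k)) (integrableZl measurableT _ iN)).
  rewrite (RintegralZl _ measurableT iN) odd0 mulr0 addr0 (RintegralZl _ measurableT (it0 k)).
  rewrite (_ : \int[leb]_t _ = transform 0 (f 0%N) 0 k); first by ring.
  by apply: eq_Rintegral => t _; rewrite expr0 mul1r.
- have mv : measurable_fun setT v by apply: continuous_measurable_fun; exact: rv.1.
  have mf : measurable_fun setT (f 0%N) by apply: continuous_measurable_fun; exact: r0.1.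
  have mc : measurable_fun setT (cosjet 0 0 : R -> R).
    by apply: continuous_measurable_fun; apply: jet_continuous; exact: jet_cosjet.
  apply: measurable_funM; first apply: measurable_funM.
  + exact: (measurableT_comp mv).
  + exact: (measurableT_comp mf).
  + apply: (measurableT_comp mc); apply: measurable_funM => //; exact: measurable_funD.
- by move=> k t; rewrite !normrM ler_piMr ?cosjet_le1// mulr_ge0.
Qed.

End SpectralIdentity.

(** * Tempered distributions on tensor products *)

Section TensorDistribution.
Context (R : realType) (d : nat).
Local Notation leb := (@lebesgue_measure R).

(** Telescoping: the factors are exchanged one at a time. *)
Lemma prod_dist (I : Type) (s : seq I) (a b : I -> R) (K e : R) : 1 <= K -> 0 <= e ->
  (forall i, `|a i| <= K) -> (forall i, `|b i| <= K) -> (forall i, `|a i - b i| <= e) ->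
  `|\prod_(i <- s) a i - \prod_(i <- s) b i| <= (size s)%:R * K ^+ size s * e.
Proof.
move=> K1 e0 aK bK abe; have K0 : 0 <= K := le_trans ler01 K1.
elim: s => [|i s IH]; first by rewrite !big_nil subrr normr0 !mul0r.
rewrite !big_cons; set A := \prod_(j <- s) a j in IH *; set B := \prod_(j <- s) b j in IH *.
have AK : `|A| <= K ^+ size s.
  rewrite /A normr_prod; elim: (s) => [|j t IH']; first by rewrite big_nil.
  by rewrite big_cons exprS; apply: ler_pM => //; exact: prodr_ge0.
rewrite (_ : _ - _ = (a i - b i) * A + b i * (A - B)); last by ring.
apply: le_trans (ler_normD _ _) _; rewrite !normrM /= -natr1 exprS.
have h1 : `|a i - b i| * `|A| <= e * K ^+ size s by apply: ler_pM.
have h2 : `|b i| * `|A - B| <= K * ((size s)%:R * K ^+ size s * e) by apply: ler_pM.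
have h3 : e * K ^+ size s <= K * (e * K ^+ size s) by rewrite ler_peMl// mulr_ge0// exprn_ge0.
apply: le_trans (lerD h1 h2) _; apply: le_trans (lerD h3 (lexx _)) _.
by rewrite le_eqVlt; apply/orP; left; apply/eqP; ring.
Qed.

(** The Euclidean norm is at most the sum of the absolute values of the coordinates, and the product
    expands to at least 1 plus that sum. Weighted bounds on tensors thus reduce to one
    coordinate. *)
Lemma enorm_weight N (x : 'rV[R]_d) : (1 + enorm x) ^+ N <= \prod_i (1 + `|x 0 i|) ^+ N.
Proof.
rewrite prodrXl; apply: lerXn2r; rewrite ?nnegrE ?addr_ge0 ?sqrtr_ge0//.
  by apply: prodr_ge0 => i _; exact: ltW (weight_gt0 _).
suff [h1 h2 h3] : [/\ 0 <= \sum_i `|x 0 i|, \sum_i x 0 i ^+ 2 <= (\sum_i `|x 0 i|) ^+ 2 &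
    1 + \sum_i `|x 0 i| <= \prod_i (1 + `|x 0 i|)].
  apply: le_trans h3; rewrite lerD2l -[leRHS]ger0_norm// -sqrtr_sqr.
  exact: ler_wsqrtr.
elim: (index_enum _) => [|i s [h1 h2 h3]]; first by rewrite !big_nil expr0n addr0.
rewrite !big_cons; set S := \sum_(j <- s) `|_| in h1 h2 h3 *; set P := \prod_(j <- s) _ in h3 *.
set Q := \sum_(j <- s) _ ^+ 2 in h2 *; set c := x 0 i.
have c0 := normr_ge0 c; have cS : 0 <= `|c| * S by exact: mulr_ge0.
split; first exact: addr_ge0.
- rewrite -[c ^+ 2]real_normK ?num_real//.
  rewrite (_ : (`|c| + S) ^+ 2 = `|c| ^+ 2 + S ^+ 2 + (`|c| * S + `|c| * S)); last by ring.
  by move: (`|c| ^+ 2) (S ^+ 2) (`|c| * S) h2 cS => *; lra.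
- apply: le_trans (ler_wpM2l _ h3); last by rewrite addr_ge0.
  by rewrite (_ : _ * _ = 1 + (`|c| + S) + `|c| * S) ?lerDl//; ring.
Qed.

Lemma cpderiv_real (h : Rd R d -> R) s x : cpderiv s (fun x => (h x)%:C) x = (pderiv s h x)%:C.
Proof. by rewrite /cpderiv /= pderiv0. Qed.

Lemma csmooth_real (h : Rd R d -> R) : smooth h -> csmooth (fun x => (h x)%:C).
Proof.
move=> sh; split => // s; rewrite (_ : (fun x : Rd R d => complex.Im (h x)%:C) = fun=> 0)//.
rewrite pderiv0; split => [x|i x]; [exact: cst_continuous|exact: derivable_cst].
Qed.

Lemma normc_real (r : R) : normc r%:C = `|r|.
Proof. by rewrite /= expr0n addr0 sqrtr_sqr. Qed.

Lemma pderivB (f g : Rd R d -> R) s : smooth f -> smooth g ->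
  pderiv s (fun x => f x - g x) = (fun x => pderiv s f x - pderiv s g x).
Proof.
move=> sf sg; elim: s => //= i s ->; apply/funext => x.
exact: (deriveB ((sf s).2 i x) ((sg s).2 i x)).
Qed.

Lemma smoothB (f g : Rd R d -> R) : smooth f -> smooth g -> smooth (fun x => f x - g x).
Proof.
move=> sf sg s; rewrite pderivB//; split => [x|i x].
  by apply: (@cvgB R R^o _ (nbhs x) (nbhs_filter x) (pderiv s f) (pderiv s g)); [exact: (sf s).1|exact: (sg s).1].
exact: (derivableB ((sf s).2 i x) ((sg s).2 i x)).
Qed.

Lemma tensor_decay (h : 'I_d -> nat -> R -> R) N B s x : (forall i, snorm_le N (h i) B) ->
  (size s <= N)%N -> `|\prod_i ((1 + `|(x : 'rV[R]_d) 0 i|) ^+ N * h i (count_mem i s) ((x : 'rV[R]_d) 0 i))| <= B ^+ d.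
Proof.
move=> hB sN; rewrite normr_prod -[d in X in _ <= X]card_ord -prodr_const.
apply: ler_prod => i _; rewrite normr_ge0/= normrM ger0_norm; last by rewrite exprn_ge0// ltW// weight_gt0.
by apply: hB; rewrite (leq_trans (count_size _ _)).
Qed.

Lemma schwartz_tensor (h : 'I_d -> nat -> R -> R) : (forall i, schwartz_jet (h i)) ->
  schwartz_function (fun x => (tensor (fun i => h i 0%N) x)%:C).
Proof.
move=> sh; have jh i := (sh i).1; split; first exact: csmooth_tensor.
move=> N s; pose N' := maxn N (size s).
have hB i := schwartz_snorm N' (sh i).
pose B i := projT1 (cid2 (hB i)).
have BP i : 0 <= B i /\ snorm_le N' (h i) (B i) by rewrite /B; case: cid2.
have Bs i : B i <= \sum_j B j by rewrite (bigD1 i)//= lerDl; apply: sumr_ge0 => j _; case: (BP j).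
exists ((\sum_i B i) ^+ d) => x; rewrite cpderiv_real normc_real pderiv_tensor//.
have e1 : 1 <= 1 + enorm (x : 'rV[R]_d) by rewrite lerDl sqrtr_ge0.
apply: (@le_trans _ _ ((1 + enorm (x : 'rV[R]_d)) ^+ N' * `|tensor (fun i => h i (count_mem i s)) x|)).
  by rewrite ler_wpM2r// ler_weXn2l// leq_maxl.
apply: le_trans (@tensor_decay h N' _ s x (fun i => _) (leq_maxr _ _)).
  rewrite big_split normrM/= [X in _ <= X * _]ger0_norm; first by apply: ler_wpM2r => //; exact: enorm_weight.
  by apply: prodr_ge0 => i _; rewrite exprn_ge0// ltW// weight_gt0.
by move=> i n y nN; apply: le_trans ((BP i).2 n y nN) (Bs i).
Qed.

Lemma tensor_out (a : R) (h : 'I_d -> R -> R) x : 0 <= a -> (forall i y, a <= `|y| -> h i y = 0) ->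
  d%:R * a < enorm (x : 'rV[R]_d) -> tensor h x = 0.
Proof.
move=> a0 h0 xa; have [i xi] : exists i, a <= `|(x : 'rV[R]_d) 0 i|.
  apply: contrapT => H; move: xa; rewrite ltNge => /negP; apply; apply: enorm_le_coord => // i.
  by rewrite leNgt; apply/negP => /ltW ai; apply: H; exists i.
by rewrite /tensor (bigD1 i)//= h0// mul0r.
Qed.

Lemma test_tensor (a : R) (h : 'I_d -> nat -> R -> R) : 0 <= a -> (forall i, compact_jet a (h i)) ->
  test_function (fun x => (tensor (fun i => h i 0%N) x)%:C).
Proof.
move=> a0 ch; split; first by apply: csmooth_tensor => i; exact: (ch i).1.
exists (d%:R * a) => x xa; rewrite (@tensor_out a)// => i y; exact: (ch i).2.
Qed.

(** The continuity bound of [beta] is applied to the difference of the two tensors, whose seminorms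
    are estimated by [prod_dist]. With [K] fixed and [e] of order [1 / M], it controls the effect of
    truncating the profiles. *)
Lemma tempered_tensor (beta : (Rd R d -> R[i]) -> R[i]) : tempered_distribution beta ->
  exists N (C : R), forall (A A' : 'I_d -> nat -> R -> R) (K e : R),
    1 <= K -> 0 <= e -> (forall i, schwartz_jet (A i)) -> (forall i, schwartz_jet (A' i)) ->
    (forall i, snorm_le N (A i) K) -> (forall i, snorm_le N (A' i) K) ->
    (forall i, snorm_le N (fun n x => A i n x - A' i n x) e) ->
    normc (beta (fun x => (tensor (fun i => A i 0%N) x)%:C) -
           beta (fun x => (tensor (fun i => A' i 0%N) x)%:C)) <= C * (K ^+ d * e).
Proof.
move=> [blin [C [N bC]]]; exists N, (`|C| * d%:R) => A A' K e K1 e0 sA sA' AK A'K AA.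
set f := fun x => (tensor (fun i => A i 0%N) x)%:C; set g := fun x => (tensor (fun i => A' i 0%N) x)%:C.
have sf : schwartz_function f by exact: schwartz_tensor.
have sg : schwartz_function g by exact: schwartz_tensor.
have -> : beta f - beta g = beta (fun x => -1 * g x + f x) by rewrite blin// mulN1r addrC.
have smf : smooth (tensor (fun i => A i 0%N)) by apply: smooth_tensor => i; exact: (sA i).1.
have smg : smooth (tensor (fun i => A' i 0%N)) by apply: smooth_tensor => i; exact: (sA' i).1.
pose D x := tensor (fun i => A i 0%N) x - tensor (fun i => A' i 0%N) x.
have -> : (fun x => -1 * g x + f x) = (fun x => (D x)%:C).
  by apply/funext => x; rewrite /D rmorphB mulN1r addrC.
have smD : smooth D by exact: smoothB.
have pD s x : pderiv s D x = tensor (fun i => A i (count_mem i s)) x - tensor (fun i => A' i (count_mem i s)) x.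
  by rewrite pderivB// !pderiv_tensor// => i; [exact: (sA' i).1|exact: (sA i).1].
have w0 n (y : R) : 0 <= (1 + `|y|) ^+ n by rewrite exprn_ge0// ltW// weight_gt0.
have bound s x : (size s <= N)%N -> (1 + enorm (x : 'rV[R]_d)) ^+ N * normc (cpderiv s (fun x => (D x)%:C) x) <=
    d%:R * K ^+ d * e.
  move=> sN; rewrite cpderiv_real normc_real pD.
  apply: (@le_trans _ _ (\prod_i (1 + `|(x : 'rV[R]_d) 0 i|) ^+ N *
     `|tensor (fun i => A i (count_mem i s)) x - tensor (fun i => A' i (count_mem i s)) x|)).
    by apply: ler_wpM2r => //; exact: enorm_weight.
  rewrite -[X in X * _]ger0_norm ?prodr_ge0// -normrM mulrBr -!big_split/=.
  have cs i : (count_mem i s <= N)%N by rewrite (leq_trans (count_size _ _)).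
  have := @prod_dist _ (index_enum 'I_d)
    (fun i => (1 + `|(x : 'rV[R]_d) 0 i|) ^+ N * A i (count_mem i s) ((x : 'rV[R]_d) 0 i))
    (fun i => (1 + `|(x : 'rV[R]_d) 0 i|) ^+ N * A' i (count_mem i s) ((x : 'rV[R]_d) 0 i)) K e K1 e0.
  rewrite /index_enum -enumT size_enum_ord; apply=> i.
  - by rewrite normrM (ger0_norm (w0 _ _)) AK.
  - by rewrite normrM (ger0_norm (w0 _ _)) A'K.
  - by rewrite -mulrBr normrM (ger0_norm (w0 _ _)) AA.
have sD : schwartz_function (fun x => (D x)%:C).
  split; first exact: csmooth_real.
  move=> M s; have [B1 HB1] := sf.2 M s; have [B2 HB2] := sg.2 M s; exists (B1 + B2) => x.
  have := lerD (HB1 x) (HB2 x); rewrite !cpderiv_real !normc_real pD !pderiv_tensor; first last.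
  - by move=> i; exact: (sA i).1.
  - by move=> i; exact: (sA' i).1.
  rewrite -mulrDr; apply: le_trans; apply: ler_wpM2l; last exact: ler_normB.
  by rewrite exprn_ge0// addr_ge0// sqrtr_ge0.
apply: le_trans (bC _ _ sD bound) _.
rewrite -[leRHS]mulrA [d%:R * (_ * _)]mulrA; apply: ler_wpM2r; last exact: ler_norm.
by rewrite !mulr_ge0// exprn_ge0// (le_trans ler01).
Qed.

Lemma cint_real (f : R -> R) : cint (fun y => (f y)%:C) = (\int[leb]_y f y)%:C.
Proof. by rewrite /cint /= Rintegral_cst// mul0r. Qed.

Lemma cintegrable_real (f : R -> R) : rapid f -> cintegrable (fun y => (f y)%:C).
Proof.
move=> rf; split; first exact: rapid_integrable.
by rewrite /=; exact: integrable0.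
Qed.

(** The transform factors over the coordinates, and evenness of each factor removes its sine
    part. *)
Lemma fourier_tensor (a : R) (G : 'I_d -> nat -> R -> R) : (forall i, compact_jet a (G i)) ->
  (forall i k, G i 0%N (- k) = G i 0%N k) ->
  fourier_Rd (fun k => (tensor (fun i => G i 0%N) k)%:C) =
  (fun x => (tensor (fun i y => \int[leb]_k (G i 0%N k * cosjet 0 0 (k * y))) x)%:C).
Proof.
move=> cG eG; apply/funext => x; rewrite /fourier_Rd.
pose h i y := (G i 0%N y)%:C * cis (- (y * (x : 'rV[R]_d) 0 i)).
rewrite (_ : (fun k => _) = ctensor h); last first.
  apply/funext => k; rewrite tensor_ctensor /ctensor /dotp -sumrN cis_sum -big_split/=.
  by apply: eq_bigr => i _; rewrite [_ * (k : 'rV[R]_d) 0 i]mulrC.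
have r i m := rapid_cosjet 0 m ((x : 'rV[R]_d) 0 i) (compact_jet_rapid 0 (cG i)).
have hE i : h i = fun y => (G i 0%N y * cosjet 0 0 (y * (x : 'rV[R]_d) 0 i)) +i*
    (G i 0%N y * cosjet 0 1 (y * (x : 'rV[R]_d) 0 i)).
  by apply/funext => y; rewrite /h /cis cosN sinN cosjet00 cosjet01; simpc.
rewrite cint_ctensor => [|i]; last by rewrite hE; split; [exact: rapid_integrable (r i 0%N)|exact: rapid_integrable (r i 1%N)].
rewrite /tensor rmorph_prod; apply: eq_bigr => i _; rewrite hE /cint /=.
rewrite [X in _ +i* X]Rintegral_odd//; first exact: rapid_integrable (r i 1%N).
by move=> y; rewrite eG !cosjet01 mulNr sinN; ring.
Qed.

End TensorDistribution.

(** * Small variance of truncated profiles *)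

Section SmallVariance.
Context (R : realType) (d : nat).
Local Notation leb := (@lebesgue_measure R).
Context (dO : measure_display) (Omega : measurableType dO) (P : probability Omega R)
  (Xi : {mfun Omega >-> lfmeasure (Rd R d)}) (beta : (Rd R d -> R[i]) -> R[i]) (S : Rd R d -> R[i]).
Hypotheses (cov : covariance_functional_Rd P Xi beta) (str : structure_function_Rd beta S)
  (vS : vanishes_faster_than_polynomials S).

(** Translating a function leaves its autocorrelation unchanged, so [c] disappears on the right. *)
Lemma variance_tensor (a c : R) (h : 'I_d -> nat -> R -> R) : 0 <= a -> (forall i, compact_jet a (h i)) ->
  variance_of P Xi (tensor (fun i y => h i 0%N (y + c))) =
  Re (beta (fun x => (tensor (fun i => corr (h i) (h i 0%N) 0) x)%:C)).
Proof.
move=> a0 ch; pose g i n y := 1 ^+ n * h i n (1 * y + c).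
have cg i : compact_jet (a + `|c|) (g i).
  split; first exact: jet_affine (ch i).1.
  move=> n x ax; rewrite /g mul1r (ch i).2 ?mulr0//.
  have := ler_normB (x + c) c; rewrite addrK; move: (`|x + c|) => u; lra.
have gE : (fun x => (tensor (fun i y => h i 0%N (y + c)) x)%:C) = (fun x => (tensor (fun i => g i 0%N) x)%:C).
  by apply/funext => x; congr (_%:C); apply: eq_bigr => i _; rewrite /g expr0 !mul1r.
have tg := test_tensor (addr_ge0 a0 (normr_ge0 c)) cg.
rewrite /variance_of gE (cov.2 _ _ tg tg); congr (Re (beta _)); apply/funext => x.
have rg i := compact_jet_rapid 0 (cg i).
rewrite (_ : (fun t => _) = ctensor (fun i y => (g i 0%N ((x : 'rV[R]_d) 0 i + y) * g i 0%N y)%:C)); last first.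
  apply/funext => t; rewrite /conjc /= oppr0 -/(real_complex _) -rmorphM -tensor_ctensor; congr (_%:C).
  rewrite /tensor -big_split/=; apply: eq_bigr => i _.
  by congr (g i 0%N _ * _); exact: mxE.
have rr i := rapid_shift_mul ((x : 'rV[R]_d) 0 i) (rg i) (rg i).
rewrite cint_ctensor => [|i]; last exact: cintegrable_real.
rewrite /tensor rmorph_prod; apply: eq_bigr => i _; rewrite cint_real; congr (_%:C).
have rh := compact_jet_rapid 0 (ch i).
have [_ E] := Rintegral_translate c (rapid_integrable (rapid_shift_mul ((x : 'rV[R]_d) 0 i) rh rh)).
rewrite /corr -E.
by apply: eq_Rintegral => y _; rewrite /g !expr0 !mul1r addrA.
Qed.

Variable p : 'I_d -> {poly R}.

(** By Fourier inversion, the function of index 0 is a constant multiple of the squared spectrum. It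
    is kept as a product because [corr_transform] delivers this form; the second factor gives the
    compact support. *)
Definition energy_density (delta : R) (i : 'I_d) : nat -> R -> R :=
  leibniz (transform 0 (profile (p i) delta 0)) (spectrum (p i) delta).

Lemma compact_energy_density delta i : 0 < delta -> compact_jet delta (energy_density delta i).
Proof.
move=> d0; apply: compact_jet_leibniz; last exact: compact_spectrum.
by apply: jet_transform; exact: (profile_schwartz (p i) d0).2.
Qed.

(** The transform of the profile is at most the integral of its absolute value, which [profile_mass]
    bounds, and [spectrum_bound] bounds the other factor. The exponent [Q] depends on the size of
    [p i] only, not on [delta]. *)
Lemma energy_density_bound i : exists2 C : R, 0 <= C & exists Q, forall delta, 0 < delta -> delta <= 1 ->
  forall k, `|energy_density delta i 0 k| <= C * delta^-1 ^+ Q.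
Proof.
have [C1 C10 H1] := profile_mass (p i); have [C2 C20 H2] := spectrum_bound (p i) 0.
exists (C1 * C2); first exact: mulr_ge0.
exists (((size (p i)).*2 + 2).+1 + ((size (p i)).*2 + 0).+1)%N => delta d0 d1 k.
rewrite /energy_density leibniz0 normrM exprD.
rewrite (_ : C1 * C2 * _ = C1 * delta^-1 ^+ ((size (p i)).*2 + 2).+1 * (C2 * delta^-1 ^+ ((size (p i)).*2 + 0).+1)); last by rewrite mulrACA.
apply: ler_pM => //; last exact: H2.
apply: le_trans (transform_bound 0 0 k ((profile_schwartz (p i) d0).2 0%N)) _.
by apply: le_trans (H1 _ d0 d1); under eq_Rintegral do rewrite expr0 mul1r.
Qed.

Lemma energy_transform delta : 0 < delta ->
  fourier_Rd (fun k => (tensor (fun i => energy_density delta i 0%N) k)%:C) =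
  (fun x => (tensor (fun i => corr (profile (p i) delta) (profile (p i) delta 0%N) 0) x)%:C).
Proof.
move=> d0; have even_transform i k : transform 0 (profile (p i) delta 0) 0 (- k) =
    transform 0 (profile (p i) delta 0) 0 k.
  by apply: eq_Rintegral => t _; rewrite !cosjet00 mulrN cosN.
rewrite (@fourier_tensor R d delta (energy_density delta)); last 2 first.
- by move=> i; exact: compact_energy_density.
- by move=> i k; rewrite /energy_density !leibniz0 even_transform spectrum_even.
apply/funext => x; congr (_%:C); apply: eq_bigr => i _.
have [js rs] := profile_schwartz (p i) d0.
rewrite (@corr_transform R (spectrum (p i) delta 0) (profile (p i) delta)) //.
- by apply: eq_Rintegral => k _; rewrite /energy_density leibniz0.
- exact: compact_jet_rapid (compact_spectrum (p i) d0).
- exact: profile_even.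
Qed.

(** By [energy_transform], the value of [beta] is the integral of [S] against a density of order
    [delta^-1 ^+ Qs] supported where [enorm x <= d%:R * delta]. Vanishing of [S] to order [Qs + 1]
    leaves one factor [delta]. *)
Lemma energy_small e : 0 < e -> exists2 delta0 : R, 0 < delta0 & forall delta, 0 < delta -> delta <= delta0 ->
  normc (beta (fun x => (tensor (fun i => corr (profile (p i) delta) (profile (p i) delta 0%N) 0) x)%:C)) <= e.
Proof.
move=> e0; have [lS sS] := str.
pose C i := projT1 (cid2 (energy_density_bound i)).
have CP i : exists Q, forall delta, 0 < delta -> delta <= 1 ->
    forall k, `|energy_density delta i 0 k| <= C i * delta^-1 ^+ Q.
  by rewrite /C; case: cid2.
have C0 i : 0 <= C i by rewrite /C; case: cid2.
pose Q i := projT1 (cid (CP i)).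
have QP i : forall delta, 0 < delta -> delta <= 1 -> forall k, `|energy_density delta i 0 k| <= C i * delta^-1 ^+ Q i.
  by rewrite /Q; case: cid.
set Qs := (\sum_i Q i)%N; set Cs := \prod_i C i; have Cs0 : 0 <= Cs by apply: prodr_ge0.
have [K [eps [K0 eps0 SK]]] := vS (ltn0Sn Qs).
pose D := [set x : Rd R d | enorm (x : 'rV[R]_d) <= eps].
have mD : measurable D by exact: (@measurable_sball R _ (Rd R d) eps).
have [B HB] := @cint_Rd_bound R d S D eps mD lS (fun x Dx => Dx).
pose W : R := `|B| * (K * d%:R ^+ Qs.+1 * Cs) + 1.
have W0 : 0 < W by rewrite ltr_wpDl// mulr_ge0// !mulr_ge0 ?exprn_ge0// ltW.
have d1_gt0 : 0 < d%:R + 1 :> R by rewrite ltr_wpDl.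
exists (Num.min 1 (Num.min (eps / (d%:R + 1)) (e / W))).
  by rewrite !lt_min ltr01 !divr_gt0.
move=> delta d0; rewrite !le_min => /andP[dl1 /andP[dleps dlW]].
rewrite -energy_transform//; have cG i := compact_energy_density i d0.
rewrite (sS _ (test_tensor (ltW d0) cG)).
set F := tensor (fun i => energy_density delta i 0%N).
have ddelta : d%:R * delta <= eps.
  rewrite ler_pdivlMr// in dleps; apply: le_trans dleps.
  by rewrite mulrDr mulr1 mulrC lerDl ltW.
have FB x : `|F x| <= Cs * delta^-1 ^+ Qs.
  rewrite /F /tensor normr_prod /Cs /Qs -prodrXr -big_split/=.
  by apply: ler_prod => i _; rewrite normr_ge0/=; exact: QP.
have F0 x : d%:R * delta < enorm (x : 'rV[R]_d) -> F x = 0.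
  by apply: tensor_out (ltW d0) _ => i y; exact: (cG i).2.
pose e1 := K * d%:R ^+ Qs.+1 * Cs * delta.
have e10 : 0 <= e1 by rewrite !mulr_ge0 ?exprn_ge0// ltW.
have nS x : 0 <= normc (S x) by case: (S x) => ? ?; exact: sqrtr_ge0.
have mF : measurable_fun setT F.
  by apply: measurable_tensor => i; exact: jet_continuous (cG i).1.
have := HB F e1 setT measurableT mF _ _.
move=> H; apply: le_trans (H _ _) _.
- by move=> x _ Dx; apply: F0; apply: le_lt_trans ddelta _; rewrite ltNge; apply/negP.
- move=> x Dx; apply: (@le_trans _ _ e1); last by rewrite ler_peMr// lerDl.
  have [xd|xd] := ltP (d%:R * delta) (enorm (x : 'rV[R]_d)); first by rewrite F0// normr0 mulr0.
  apply: (@le_trans _ _ (K * (d%:R * delta) ^+ Qs.+1 * (Cs * delta^-1 ^+ Qs))).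
    apply: ler_pM => //; apply: le_trans (SK x Dx) _; apply: ler_wpM2l; first exact: ltW.
    by apply: lerXn2r; rewrite ?nnegrE ?sqrtr_ge0// mulr_ge0// ltW.
  rewrite le_eqVlt; apply/orP; left; apply/eqP; rewrite /e1 exprMn exprVn [delta ^+ Qs.+1]exprS.
  have z0 : delta ^+ Qs != 0 by rewrite expf_neq0// gt_eqF.
  move: (delta ^+ Qs) (d%:R ^+ Qs.+1) z0 => z u z0.
  have -> : K * (u * (delta * z)) * (Cs / z) = K * u * Cs * delta * (z / z) by ring.
  by rewrite divff// mulr1.
- apply: (@le_trans _ _ (W * delta)).
    rewrite /e1 mulrA; apply: ler_wpM2r; first exact: ltW.
    apply: le_trans (_ : `|B| * (K * d%:R ^+ Qs.+1 * Cs) <= _); last by rewrite lerDl.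
    by apply: ler_wpM2r; [rewrite !mulr_ge0 ?exprn_ge0// ltW|exact: ler_norm].
  by rewrite mulrC -ler_pdivlMr.
Qed.

(* Small [delta] kills the energy of the untruncated profiles; then a large [M] makes the truncation harmless. *)
Lemma small_variance (c e : R) : 0 < e -> forall delta1 M1 : R, 0 < delta1 -> exists delta M : R,
  [/\ 0 < delta, delta <= delta1, 1 <= M, M1 <= M &
    variance_of P Xi (tensor (fun i y => truncate M (profile (p i) delta) 0 (y + c))) <= e].
Proof.
move=> e0 delta1 M1 d10; have e20 : 0 < e / 2 by rewrite divr_gt0.
have [delta0 d00 Hd] := energy_small e20; pose delta := Num.min delta0 delta1.
have dp : 0 < delta by rewrite lt_min d00.
have sp i := profile_schwartz (p i) dp.
have [N [C HC]] := tempered_tensor cov.1.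
have tl i := truncation_limit N (sp i).
pose K i := projT1 (cid2 (tl i)).
have K0 i : 0 <= K i by rewrite /K; case: cid2.
have KP i : forall M, 1 <= M ->
  [/\ snorm_le N (corr (profile (p i) delta) (profile (p i) delta 0%N)) (K i),
      snorm_le N (corr (truncate M (profile (p i) delta)) (truncate M (profile (p i) delta) 0%N)) (K i) &
      snorm_le N (fun n x => corr (truncate M (profile (p i) delta)) (truncate M (profile (p i) delta) 0%N) n x -
         corr (profile (p i) delta) (profile (p i) delta 0%N) n x) (K i / M)].
  by rewrite /K; case: cid2.
pose Ks := 1 + \sum_i K i.
have Ki i : K i <= Ks.
  rewrite /Ks (bigD1 i)//= addrCA lerDl addr_ge0//; exact: sumr_ge0.
have Ks1 : 1 <= Ks by rewrite lerDl sumr_ge0.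
have Ks0 : 0 <= Ks := le_trans ler01 Ks1.
pose W : R := `|C| * Ks ^+ d.+1; have W0 : 0 <= W by rewrite mulr_ge0// exprn_ge0.
(* The last argument brings the truncation error, at most [W / M], below [e / 2]. *)
pose M := Num.max 1 (Num.max M1 (2 * W / e)).
have M1' : 1 <= M by rewrite le_max lexx.
have M0 : 0 < M := lt_le_trans ltr01 M1'.
have MW : 2 * W / e <= M by rewrite !le_max lexx !orbT.
exists delta, M; split => //; first by rewrite ge_min lexx orbT.
  by rewrite !le_max lexx orbT.
have cT i : compact_jet M (truncate M (profile (p i) delta)) := compact_truncate M0 (sp i).1.
rewrite (variance_tensor c (ltW M0) cT).
have sA i : schwartz_jet (corr (profile (p i) delta) (profile (p i) delta 0%N)).
  by apply: schwartz_corr => //; exact: (sp i).2.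
have sT i := compact_schwartz (cT i).
have sA' i : schwartz_jet (corr (truncate M (profile (p i) delta)) (truncate M (profile (p i) delta) 0%N)).
  by apply: schwartz_corr => //; exact: (sT i).2.
have lW f B i : snorm_le N f B -> B <= K i -> snorm_le N f Ks.
  by move=> fB BK n x nN; apply: le_trans (fB n x nN) (le_trans BK (Ki i)).
have := HC _ _ Ks (Ks / M) Ks1 _ sA' sA
  (fun i => lW _ _ i (let: And3 _ h _ := KP i M M1' in h) (lexx _))
  (fun i => lW _ _ i (let: And3 h _ _ := KP i M M1' in h) (lexx _)) _.
set b' := beta _; set b := beta _ => H.
have nb : normc b <= e / 2 by apply: Hd => //; rewrite ge_min lexx.
have nd : normc (b' - b) <= e / 2.
  apply: le_trans (H _ _) _; first by rewrite divr_ge0// ltW.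
    move=> i n x nN; have [_ _ h] := KP i M M1'; apply: le_trans (h n x nN) _.
    by rewrite ler_wpM2r// invr_ge0 ltW.
  apply: (@le_trans _ _ (W / M)).
    rewrite /W exprSr !mulrA; apply: ler_wpM2r; first by rewrite invr_ge0 ltW.
    by do 2 apply: ler_wpM2r => //; [exact: exprn_ge0|exact: ler_norm].
  rewrite ler_pdivrMr//; have : 2 * W <= M * e by rewrite -ler_pdivrMr.
  by move: (W) (M) => w m; lra.
have [h1 _] := parts_le_normc b; have [h2 _] := parts_le_normc (b' - b).
have -> : Re b' = Re b + Re (b' - b) by case: (b') => ? ?; case: (b) => ? ? /=; ring.
have := ler_norm (Re b); have := ler_norm (Re (b' - b)); lra.
Qed.

End SmallVariance.

(** * Determination in Euclidean space *)

Section EuclideanCase.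
Context (R : realType).

(** A variant of the polynomials [(1 - z ^ n) ^ (2 ^ n)], which tend to 1 below 1/2 and to 0 above,
    but to [exp (-1)] at 1/2. The extra [n] in the inner exponent makes the limit 1 at 1/2 as well,
    as the closed orthants require. *)
Definition step_value (z : R) (n : nat) : R := (1 - z ^+ (n * n + n)) ^+ (2 ^ (n * n)).

Lemma step_value_bound z n : 0 <= z <= 1 -> 0 <= step_value z n <= 1.
Proof.
move=> /andP[z0 z1]; have h0 : 0 <= z ^+ (n * n + n) by exact: exprn_ge0.
have h1 : z ^+ (n * n + n) <= 1 by exact: exprn_ile1.
by rewrite /step_value exprn_ge0 ?subr_ge0//= exprn_ile1 ?subr_ge0// gerBl.
Qed.

(* With [m = 2 ^ (n ^ 2)] and [N = n ^ 2 + n], [m * z ^ N] is at most [2 ^ (- n)] when [z <= 1 / 2], and equals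
   [((2 * z) ^ n.+1 / 2) ^ n] in general. *)
Lemma step_value_cvg z : 0 <= z <= 1 -> step_value z n @[n --> \oo] --> ((z <= 2^-1)%R%:R : R).
Proof.
move=> z01; have /andP[z0 z1] := z01.
have h2 : (fun n => 2^-1 ^+ n : R) @ \oo --> (0 : R).
  by apply: cvg_expr; rewrite ger0_norm ?invr_ge0// invf_lt1// ltr1n.
suff key : \forall n \near \oo, `|step_value z n - (z <= 2^-1)%R%:R| <= 2^-1 ^+ n.
  apply/cvgrPdist_le => e e0; near=> n; rewrite distrC.
  apply: (le_trans (_ : _ <= 2^-1 ^+ n)); first by near: n.
  apply: le_trans (ler_norm _) _; near: n.
  by move/cvgr0Pnorm_le : h2; apply.
have mz n : (2 ^ (n * n))%:R * z ^+ (n * n + n) = (2 * z) ^+ (n * n + n) * 2^-1 ^+ n.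
  by rewrite natrX exprMn exprVn [2 ^+ (n * n + n)]exprD mulrAC mulfK ?expf_neq0.
case: leP => zh.
  near=> n; have /andP[s0 s1] := step_value_bound n z01.
  rewrite distrC ger0_norm ?subr_ge0// lerBlDr -lerBlDl.
  apply: (@le_trans _ _ (1 - (2 ^ (n * n))%:R * z ^+ (n * n + n))).
    rewrite lerD2l lerN2 mz ler_piMl ?exprn_ge0// exprn_ile1 ?mulr_ge0//.
    by rewrite -ler_pdivlMl// mulr1.
  have h1 : 0 <= z ^+ (n * n + n) <= 1 by rewrite exprn_ge0//= exprn_ile1.
  rewrite /step_value; move: (z ^+ _) (2 ^ _)%N h1 => y m /andP[y0 y1].
  elim: m => [|m IH]; first by rewrite mul0r subr0.
  rewrite exprS -natr1; have y1' : 0 <= 1 - y by rewrite subr_ge0.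
  have := ler_wpM2l y1' IH; have : 0 <= m%:R * y * y by rewrite !mulr_ge0.
  by set q := _ * (1 - y) ^+ m; lra.
have zp : 0 < z by apply: lt_trans zh; rewrite invr_gt0.
have t1 : `|(2 * z)^-1| < 1.
  by rewrite ger0_norm ?invr_ge0 ?mulr_ge0// invf_lt1 ?mulr_gt0//; lra.
have ht : (fun n => (2 * z)^-1 ^+ n) @ \oo --> (0 : R) by exact: cvg_expr.
near=> n; have /andP[s0 s1] := step_value_bound n z01.
rewrite subr0 ger0_norm//.
have t4 : (2 * z)^-1 ^+ n.+1 <= 4^-1.
  apply: (@le_trans _ _ ((2 * z)^-1 ^+ n)).
    by rewrite ler_wiXn2l ?invr_ge0 ?mulr_ge0// invf_le1 ?mulr_gt0//; lra.
  apply: le_trans (ler_norm _) _; near: n.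
  by move/cvgr0Pnorm_le : ht; apply; rewrite invr_gt0.
have t4' : 4 <= (2 * z) ^+ n.+1.
  by rewrite -lef_pV2 ?posrE ?exprn_gt0 ?mulr_gt0// -exprVn.
have h1 : 0 <= z ^+ (n * n + n) <= 1 by rewrite exprn_ge0//= exprn_ile1.
have := bernoulli_decay (2 ^ (n * n)) h1; rewrite -/(step_value z n) mz.
have -> : (n * n + n)%N = (n.+1 * n)%N by rewrite mulSn addnC.
rewrite exprM -exprMn => H.
have h3 : 2 ^+ n <= ((2 * z) ^+ n.+1 / 2) ^+ n.
  by apply: lerXn2r; rewrite ?nnegrE// ?divr_ge0 ?exprn_ge0 ?mulr_ge0//; lra.
rewrite exprVn -[leRHS]mul1r ler_pdivlMr ?exprn_gt0//; apply: le_trans H.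
by apply: ler_wpM2l => //; rewrite (le_trans h3)// lerDr.
Unshelve. all: by end_near.
Qed.

Definition below (o : option R) (x : R) : bool := if o is Some c then x <= c else true.

(* The squared distance to the far point [- 6 * B] rescales [`[- B, B]] into [`[0, 1]], sending [c] to [1 / 2]. *)
Lemma step_polynomial (o : option R) (B : R) : 0 < B -> exists q : nat -> {poly R},
  (forall n (x : R), `|x| <= B -> `|(q n).[(x + 6 * B) ^+ 2]| <= 1) /\
  (forall x : R, `|x| <= B -> (q n).[(x + 6 * B) ^+ 2] @[n --> \oo] -->
    ((below o x)%:R : R)).
Proof.
move=> B0; have cst_case (b : bool) : (forall x : R, `|x| <= B -> below o x = b) ->
    exists q : nat -> {poly R}, (forall n (x : R), `|x| <= B -> `|(q n).[(x + 6 * B) ^+ 2]| <= 1) /\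
  (forall x : R, `|x| <= B -> (q n).[(x + 6 * B) ^+ 2] @[n --> \oo] -->
    ((below o x)%:R : R)).
  move=> ob; exists (fun=> b%:R%:P); split => [n x _|x xB].
    by rewrite hornerC; case: (b); rewrite ?normr1 ?normr0.
  by rewrite ob//; under eq_cvg do rewrite hornerC; exact: cvg_cst.
case: o cst_case => [c|] cst_case; last exact: (cst_case true).
have [Bc|cB] := leP B c.
  by apply: (cst_case true) => x; rewrite ler_norml => /andP[_ xB]; rewrite /below (le_trans xB).
have [cB'|Bc] := ltP c (- B).
  by apply: (cst_case false) => x; rewrite ler_norml => /andP[xB _]; apply/negbTE; rewrite -ltNge (lt_le_trans cB').
pose L := c + 6 * B; have L0 : 0 < L by rewrite /L; lra.
pose al : R := (2 * L ^+ 2)^-1; have al0 : 0 < al by rewrite invr_gt0 mulr_gt0// exprn_gt0.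
have z01 x : `|x| <= B -> 0 <= al * (x + 6 * B) ^+ 2 <= 1.
  rewrite ler_norml => /andP[x1 x2]; rewrite mulr_ge0 ?(ltW al0) ?sqr_ge0//=.
  rewrite ler_pdivrMl ?mulr_gt0 ?exprn_gt0// mulr1.
  (* Since [x <= B] and [c >= - B], the rescaled square is at most 1 as soon as 7^2 <= 2 times 5^2,
     that is 49 <= 50; this is the origin of the constant 6. *)
  apply: (@le_trans _ _ ((7 * B) ^+ 2)).
    by apply: lerXn2r; rewrite ?nnegrE; lra.
  apply: (@le_trans _ _ (2 * (5 * B) ^+ 2)).
    have -> : (7 * B) ^+ 2 = 49 * B ^+ 2 by ring.
    have -> : (5 * B) ^+ 2 = 25 * B ^+ 2 by ring.
    by have := sqr_ge0 B; move: (B ^+ 2) => b b_ge0; lra.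
  rewrite ler_pM2l//; apply: lerXn2r; rewrite ?nnegrE /L; lra.
exists (fun n => (1 - (al *: 'X) ^+ (n * n + n)) ^+ (2 ^ (n * n))).
have qE n x : ((1 - (al *: 'X) ^+ (n * n + n)) ^+ (2 ^ (n * n))).[x] = step_value (al * x) n.
  by rewrite horner_exp hornerD hornerN horner_exp hornerZ hornerX hornerC.
split => [n x xB|x xB].
  by rewrite qE; have /andP[h1 h2] := step_value_bound n (z01 x xB); rewrite ger0_norm.
under eq_cvg do rewrite qE.
rewrite /below.
have -> : (x <= c) = (al * (x + 6 * B) ^+ 2 <= 2^-1).
  have x0 : 0 <= x + 6 * B by move: xB; rewrite ler_norml => /andP[xB _]; lra.
  rewrite ler_pdivrMl ?mulr_gt0 ?exprn_gt0// mulrAC divff// mul1r.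
  by rewrite ler_pXn2r ?nnegrE ?(ltW L0)// lerD2r.
exact: step_value_cvg (z01 x xB).
Qed.

Context (d : nat) (dO : measure_display) (Omega : measurableType dO) (P : probability Omega R)
  (Xi : {mfun Omega >-> lfmeasure (Rd R d)}) (beta : (Rd R d -> R[i]) -> R[i]) (S : Rd R d -> R[i]).
Hypotheses (cov : covariance_functional_Rd P Xi beta) (str : structure_function_Rd beta S)
  (vS : vanishes_faster_than_polynomials S).

Lemma orthant_approximable (D : set (Rd R d)) (a : 'I_d -> option R) : sbounded D ->
  approximable P Xi D (orthant a).
Proof.
move=> [r Dr]; pose co (x : Rd R d) i : R := (x : 'rV[R]_d) 0 i.
pose B := `|r| + 1; have B0 : 0 < B by rewrite ltr_wpDl.
have DB x i : D x -> `|co x i| <= B.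
  move=> /Dr xr; apply: le_trans (enorm_coord (x : 'rV[R]_d) i) _.
  by apply: (le_trans xr); rewrite (le_trans (ler_norm _))// lerDl.
have /choice[q Hq] := fun i => step_polynomial (a i) B0.
have V0 (u : R) : 0 < u -> 0 < u^-1 by rewrite invr_gt0.
(* The constraints [delta <= 1 / (n + 1)] and [M >= n + 1] make [kappa] and the cutoff tend to 1 at
   each point of [D]. *)
have H n := @small_variance R d dO Omega P Xi beta S cov str vS (fun i => q i n) (6 * B) (2^-1 ^+ n)
  (exprn_gt0 n (V0 2 (ltr0n R 2))) n.+1%:R^-1 n.+1%:R (V0 _ (ltr0Sn R n)).
have /choice[dM HdM] : forall n, exists dM : R * R, [/\ 0 < dM.1, dM.1 <= n.+1%:R^-1, 1 <= dM.2, n.+1%:R <= dM.2 &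
    variance_of P Xi (tensor (fun i y => truncate dM.2 (profile (q i n) dM.1) 0 (y + 6 * B))) <= 2^-1 ^+ n].
  by move=> n; have [delta [M h]] := H n; exists (delta, M).
pose delta n := (dM n).1; pose M n := (dM n).2.
have delta0 n : 0 < delta n by case: (HdM n).
have M1 n : 1 <= M n by case: (HdM n).
have M0 n : 0 < M n by exact: lt_le_trans ltr01 (M1 n).
have fE n i y : truncate (M n) (profile (q i n) (delta n)) 0 y = (q i n).[y ^+ 2] * kappa (delta n) y * cutoff (M n) 0 y.
  by rewrite /truncate leibniz0 profile_poly.
have [E E0 HE] := cutoff_defect_bound R 0.
have [jb b0] := compact_bump_jet R.
have [C HC] := compact_support_bounded (jet_continuous jb) (b0 0%N).
have cutB n y : `|cutoff (M n) 0 y| <= (bump_jet 0 0)^-1 * C.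
  rewrite /cutoff expr0 mul1r normrM ger0_norm ?invr_ge0 ?(ltW (bump_jet00_gt0 R))//.
  by rewrite ler_wpM2l ?invr_ge0 ?(ltW (bump_jet00_gt0 R)).
exists (fun n => tensor (fun i y => truncate (M n) (profile (q i n) (delta n)) 0 (y + 6 * B))),
  (((bump_jet 0 0)^-1 * C) ^+ d); split.
- move=> n; have cT i := compact_truncate (M0 n) (profile_schwartz (q i n) (delta0 n)).1.
  have cc i : continuous (truncate (M n) (profile (q i n) (delta n)) 0%N) by exact: jet_continuous (cT i).1.
  have TB i := compact_support_bounded (cc i) ((cT i).2 0%N).
  pose b i := projT1 (cid (TB i)).
  have bP i y : `|truncate (M n) (profile (q i n) (delta n)) 0 y| <= b i by rewrite /b; case: cid.
  pose s : R := d%:R * (M n + 6 * B).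
  exists [set x : Rd R d | enorm (x : 'rV[R]_d) <= s], (\prod_i b i).
    by split; [exact: (@measurable_sball R _ (Rd R d) s)|exists s].
  split.
  + apply: measurable_tensor => i y.
    apply: (@continuous_comp _ _ _ (fun y => y + 6 * B) (truncate (M n) (profile (q i n) (delta n)) 0%N)); last exact: cc.
    by apply: cvgD; [exact: cvg_id|exact: cvg_cst].
  + by move=> x; rewrite /tensor normr_prod; apply: ler_prod => i _; rewrite normr_ge0/=.
  + move=> x /negP; rewrite -ltNge => xs; apply: (@tensor_out R d (M n + 6 * B)) xs.
      by rewrite addr_ge0 ?(ltW (M0 n))// mulr_ge0// ltW.
    move=> i y yM; apply: (cT i).2; have := ler_normB (y + 6 * B) (6 * B).
    rewrite addrK (ger0_norm (_ : 0 <= 6 * B)); last by rewrite mulr_ge0// ltW.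
    by move: (`|y + 6 * B|) yM => u; lra.
- move=> n x Dx; rewrite /tensor normr_prod -[d in X in _ <= X]card_ord -prodr_const.
  apply: ler_prod => i _; rewrite normr_ge0/= fE normrM -[leRHS]mul1r; apply: ler_pM => //.
  rewrite normrM mulr_ile1 ?kappa_le1//; exact: (Hq i).1 _ _ (DB x i Dx).
- move=> x Dx.
  have -> : \1_(orthant a) x = \prod_i ((below (a i) (co x i))%:R * 1 * 1) :> R.
    rewrite indicE; case: (boolP (x \in orthant a)) => [/set_mem xa|xa].
      rewrite big1// => i _; rewrite (_ : below (a i) (co x i) = true) ?mulr1//.
      by have := xa i; rewrite /below; case: (a i).
    have [i Hi] : exists i, ~~ below (a i) (co x i).
      apply: contrapT => h; move/negP: xa; apply; apply: mem_set => i.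
      have := h; rewrite /below; case E' : (a i) => [c|]// h'; apply: contrapT => /negP h2.
      by apply: h'; exists i; rewrite E'.
    by rewrite (bigD1 i)//= (negbTE Hi) !mul0r.
  rewrite /tensor; apply: cvg_prod_ord => i; set y := co x i + 6 * B.
  rewrite (_ : (fun n => _) = fun n => (q i n).[y ^+ 2] * kappa (delta n) y * cutoff (M n) 0 y); last first.
    by apply/funext => n; rewrite fE.
  have hq : (fun n => (q i n).[y ^+ 2]) @ \oo --> ((below (a i) (co x i))%:R : R).
    exact: (Hq i).2 _ (DB x i Dx).
  have harm (A : R) (u : nat -> R) : (forall n, `|u n - 1| <= n.+1%:R^-1 * A) -> u @ \oo --> (1 : R).
    move=> uA; apply/cvgrPdist_le => e e0.
    have A0 : 0 < e / (`|A| + 1) by rewrite divr_gt0// ltr_wpDl.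
    near=> n; rewrite distrC; apply: le_trans (uA n) _.
    apply: (@le_trans _ _ (n.+1%:R^-1 * (`|A| + 1))).
      by rewrite ler_wpM2l ?invr_ge0// (le_trans (ler_norm _))// lerDl.
    rewrite -ler_pdivlMr ?ltr_wpDl//; apply: ltW; near: n.
    exact: (near_infty_natSinv_lt (PosNum A0)).
  have hk : (fun n => kappa (delta n) y) @ \oo --> (1 : R).
    apply: (harm `|y|) => n; apply: le_trans (kappa_near1 y (delta0 n)) _.
    by rewrite ler_wpM2r//; case: (HdM n).
  have hc : (fun n => cutoff (M n) 0 y) @ \oo --> (1 : R).
    apply: (harm (E * (1 + `|y|))) => n; apply: le_trans (HE _ (M1 n) 0%N y (leqnn _)) _.
    rewrite mulrAC mulrC; apply: ler_wpM2r; first by rewrite mulr_ge0// addr_ge0.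
    by rewrite lef_pV2 ?posrE//; case: (HdM n).
  have hqk : (fun n => (q i n).[y ^+ 2] * kappa (delta n) y) @ \oo --> ((below (a i) (co x i))%:R * 1 : R).
    exact: cvgM.
  exact: cvgM.
- by move=> n; case: (HdM n).
Unshelve. all: by end_near.
Qed.

Lemma Rd_determined (D : set (Rd R d)) (mD : measurable D) :
  locally_square_integrable P Xi -> sbounded D -> determined_by_outside P Xi mD.
Proof.
move=> Xi2 bD; have [iota [j [mi mj ij]]] := Rd_encoding R d.
apply: (determined_by_outside_criterion mD Xi2 bD (orthants_generate R d) (@orthants_setI R d)
  (orthants_setT R d) mi mj ij) => _ [a _ <-].
exact: orthant_approximable.
Qed.

End EuclideanCase.

Lemma Zd_ball_finite (R : realType) (d n : nat) : finite_set [set x : Zd R d | snorm x <= n%:R :> R].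
Proof.
have fin : finite_set (range (@lattice_point R d n n)) by exact: finite_image.
apply: sub_finite_set fin => x /= xn.
have xi i : (absz ((x : 'rV[int]_d) 0%R i) <= n)%N.
  have := le_trans (enorm_coord (Zd_Rd x : 'rV[R]_d) i) xn.
  by rewrite Zd_Rd_coord -intr_norm (_ : n%:R = n%:Z%:~R)// ler_int -abszE lez_nat.
have h i : (absz ((x : 'rV[int]_d) 0 i + n%:Z)%R < n.*2.+1)%N by have := xi i; lia.
exists [ffun i => Ordinal (h i)] => //; apply/rowP => i; rewrite !mxE ffunE /=; have := xi i; lia.
Qed.

Theorem theorem1p6 (R : realType) (d : nat) (d_gt0 : (0 < d)%N)
    (dO : measure_display) (Omega : measurableType dO)
    (P : probability Omega R) :
  (forall (Xi : {mfun Omega >-> lfmeasure (Rd R d)})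
          (beta : (Rd R d -> complex R) -> complex R)
          (S : Rd R d -> complex R),
     locally_square_integrable P Xi ->
     translation_invariant P Xi ->
     covariance_functional_Rd P Xi beta ->
     structure_function_Rd beta S ->
     vanishes_faster_than_polynomials S ->
     (forall (D : set (Rd R d)) (mD : measurable D),
        sbounded D -> determined_by_outside P Xi mD) /\
     determined_by_tail P Xi) /\
  (forall (Xi : {mfun Omega >-> lfmeasure (Zd R d)})
          (beta : Zd R d -> complex R)
          (S : Rd R d -> complex R),
     locally_square_integrable P Xi ->
     translation_invariant P Xi ->
     covariance_functional_Zd P Xi beta ->
     structure_function_Zd beta S ->
     vanishes_faster_than_polynomials S ->
     (forall D : set (Zd R d),
        finite_set D -> determined_by_outside P Xi (Zd_measurable D)) /\
     determined_by_tail P Xi).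
Proof.
split => Xi beta S Xi2 _ cov str vS.
  have det (D : set (Rd R d)) (mD : measurable D) : sbounded D -> determined_by_outside P Xi mD.
    exact: Rd_determined cov str vS _ mD Xi2.
  by split => //; apply: determined_by_outside_tail => n; apply: det; exists n%:R.
have det (D : set (Zd R d)) (mD : measurable D) : finite_set D -> determined_by_outside P Xi mD.
  exact: lattice_determined cov str vS d_gt0 _ mD Xi2.
split => [D|]; first exact: det.
by apply: determined_by_outside_tail => n; apply: det; exact: Zd_ball_finite.
Qed.
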